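(* Let $s\in(0,1)$, $0<\lambda\le\Lambda$, $L\in\mathcal L_s(\lambda,\Lambda;1)$, and $\alpha\in(0,s)\cap(0,1-s)$. Let $u_0\in C^{0,1}_{loc}(\mathbb R^n)\cap C^{2s+\varepsilon}_{loc}(\mathbb R^n)$ (for some $\varepsilon>0$) be such that $u_0\ge0$ in $\mathbb R^n$, and, for some constant $c>0$, $$\|\nabla u_0\|_{L^\infty(B_R)}\le cR^{s+\alpha}\quad\text{for all }R\ge1,$$ $$L\left(\frac{u_0(\cdot+h)-u_0(\cdot)}{|h|}\right)(x)\ge0\quad\text{for all }x\in\{u_0>0\}\text{ and all }h\in\mathbb R^n\setminus\{0\}.$$ Then $u_0$ is convex in $\mathbb R^n$. In particular, if in addition the kernel $K$ of $L$ is homogeneous, i.e. $K(y)=|y|^{-n-2s}K(y/|y|)$ for all $y\ne0$, $0\in\partial\{u_0>0\}$, and $u_0\in C^1(\{u_0>0\})$ solves in the viscosity sense $L(\nabla u_0)=0$ in $\{u_0>0\}$, then $u_0(x)=\kappa(x\cdot\nu)_+^{1+s}$ for some $\nu\in\mathbb S^{n-1}$ and $\kappa\ge0$.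
   Context: $B_R$ is the open ball of radius $R$ centered at $0$ in $\mathbb R^n$; $t_+=\max\{t,0\}$. Operators: $Lu(x)=\mathrm{p.v.}\int_{\mathbb R^n}(u(x)-u(y))K(x-y)\,dy$ with $K:\mathbb R^n\to[0,\infty]$ symmetric, $K(y)=K(-y)$. One writes $L\in\mathcal L_s(\lambda,\Lambda;1)$ if for all $y\neq0$: $\lambda|y|^{-n-2s}\le K(y)\le\Lambda|y|^{-n-2s}$ and $|\nabla K(y)|\le\Lambda|y|^{-1}K(y)$. $L(\nabla u_0)=0$ means $L(\partial_eu_0)=0$ for every $e\in\mathbb S^{n-1}$. *)

(* Defs.v *)
From HB Require Import structures.
From mathcomp Require Import all_boot all_order all_algebra.
From mathcomp Require Import all_classical all_reals all_analysis.

Set Implicit Arguments.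
Unset Strict Implicit.
Unset Printing Implicit Defensive.
Import Order.TTheory GRing.Theory Num.Theory.
Import numFieldNormedType.Exports.

Local Open Scope classical_set_scope.
Local Open Scope ring_scope.

(* R^n is 'rV[R]_n. Its library norm `|x| is the sup norm: the topology is the
   usual one, but Euclidean lengths have to be written with enorm. *)

Section Euclidean.
Context {R : realType} {n : nat}.
Implicit Types x y : 'rV[R]_n.

Definition edot x y : R := \sum_(i < n) x 0 i * y 0 i.

Definition enorm x : R := Num.sqrt (edot x x).

Definition eball (r : R) : set 'rV[R]_n := [set x | enorm x < r].

Definition boundary (A : set 'rV[R]_n) : set 'rV[R]_n := closure A `\` A°.

End Euclidean.

(* The product sigma-algebra on R^n, as the library does for n-tuples; since R
   is second countable it is the Borel sigma-algebra. *)
Section MeasurableRowVector.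
Context {R : realType} {n : nat}.

Let coord (i : 'I_n) (v : 'rV[R]_n) : measurableTypeR R := v 0 i.

Let rV_set0 : g_sigma_preimage coord set0.
Proof. exact: sigma_algebra0. Qed.

Let rV_setC A : g_sigma_preimage coord A -> g_sigma_preimage coord (~` A).
Proof. exact: sigma_algebraC. Qed.

Let rV_bigcup (F : (set 'rV[R]_n)^nat) :
  (forall i, g_sigma_preimage coord (F i)) ->
  g_sigma_preimage coord (\bigcup_i (F i)).
Proof. exact: sigma_algebra_bigcup. Qed.

HB.instance Definition _ :=
  @isMeasurable.Build default_measure_display 'rV[R]_n
    (g_sigma_preimage coord) rV_set0 rV_setC rV_bigcup.

Lemma measurable_coord (i : 'I_n) :
  measurable_fun [set: 'rV[R]_n] (fun v => v 0 i : measurableTypeR R).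
Proof.
move=> _ Y mY; rewrite setTI; apply: sub_sigma_algebra.
rewrite -bigcup_seq/=; exists i => /=; first by rewrite mem_index_enum.
by exists Y => //; rewrite setTI.
Qed.

Lemma measurable_fun_rV d (T : measurableType d) (f : T -> 'rV[R]_n) :
  (forall i, measurable_fun [set: T] (fun t => f t 0 i : measurableTypeR R)) ->
  measurable_fun [set: T] f.
Proof.
move=> mf.
pose G := \big[setU/set0]_(i < n) preimage_set_system setT (coord i) measurable.
apply: (@measurability _ _ _ _ setT f G) => // _ [B + <-].
rewrite /G -bigcup_seq => -[i /= _ [A mA <-]].
by have := mf i measurableT _ mA; rewrite !setTI.
Qed.

End MeasurableRowVector.

Section Lebesgue.
Context {R : realType}.

Definition consrV n (p : measurableTypeR R * 'rV[R]_n) : 'rV[R]_n.+1 :=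
  row_mx (p.1)%:M p.2.

Lemma measurable_consrV n : measurable_fun setT (@consrV n).
Proof.
apply: measurable_fun_rV => i; case: (@split_ordP 1 n i) => j ->.
- rewrite (_ : (fun _ => _) = fst) //; apply/funext => p.
  by rewrite /consrV [LHS](row_mxEl (p.1)%:M p.2) mxE !ord1 eqxx mulr1n.
- rewrite (_ : (fun _ => _) = (fun v : 'rV[R]_n => v 0 j) \o snd).
    by apply: measurableT_comp => //; exact: measurable_coord.
  by apply/funext => p; rewrite /consrV [LHS](row_mxEr (p.1)%:M p.2).
Qed.

HB.instance Definition _ n :=
  @isMeasurableFun.Build _ _ _ _ (@consrV n) (@measurable_consrV n).

Section step.
Context {n : nat} (mu : {sigma_finite_measure set 'rV[R]_n -> \bar R}).

Definition lebesgue_step : set 'rV[R]_n.+1 -> \bar R :=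
  pushforward (lebesgue_measure \x mu)%E (@consrV n).

Let step0 : lebesgue_step set0 = 0%E.
Proof. exact: measure0. Qed.

Let step_ge0 A : (0 <= lebesgue_step A)%E.
Proof. exact: measure_ge0. Qed.

Let step_sigma_additive : semi_sigma_additive lebesgue_step.
Proof. exact: measure_semi_sigma_additive. Qed.

HB.instance Definition _ :=
  isMeasure.Build _ _ _ lebesgue_step step0 step_ge0 step_sigma_additive.

Let unconsrV (v : 'rV[R]_n.+1) : measurableTypeR R * 'rV[R]_n :=
  (v 0 ord0, \row_j v 0 (lift ord0 j)).

Let measurable_unconsrV : measurable_fun setT unconsrV.
Proof.
apply/measurable_fun_pair => /=; first exact: measurable_coord.
apply: measurable_fun_rV => i; under eq_fun do rewrite mxE.
exact: measurable_coord.
Qed.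

Let consrVK : cancel (@consrV n) unconsrV.
Proof.
move=> [x v]; congr (_, _).
  have -> : ord0 = @lshift 1 n ord0 by apply/val_inj.
  by rewrite /consrV [LHS](row_mxEl x%:M v) mxE eqxx mulr1n.
apply/rowP => j; rewrite mxE.
have -> : lift ord0 j = @rshift 1 n j by apply/val_inj.
by rewrite /consrV [LHS](row_mxEr x%:M v).
Qed.

Let step_sigma_finite : sigma_finite setT lebesgue_step.
Proof.
have /sigma_finiteP[F [TF ndF Foo]] := @sigma_finiteT _ _ R lebesgue_measure.
have /sigma_finiteP[G [TG ndG Goo]] := sigma_finiteT mu.
exists (fun k => unconsrV @^-1` (F k `*` G k)).
  rewrite -preimage_bigcup (_ : \bigcup_k _ = setT) ?preimage_setT//.
  rewrite -setXTT TF TG predeqE => -[x v]; split.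
    by move=> [k _ [/= ? ?]]; split; exists k.
  move=> [/= [k _ Fkx] [l _ Glv]]; exists (maxn k l) => //; split.
    by move: x Fkx; exact/subsetPset/ndF/leq_maxl.
  by move: v Glv; exact/subsetPset/ndG/leq_maxr.
move=> k; have [mF Fk] := Foo k; have [mG Gk] := Goo k; split.
  rewrite -[X in measurable X]setTI; apply: measurable_unconsrV => //.
  exact: measurableX.
rewrite /lebesgue_step /pushforward -comp_preimage.
rewrite (_ : unconsrV \o @consrV n = id) ?preimage_id; last exact/funext/consrVK.
by rewrite product_measure1E// lte_mul_pinfty// ge0_fin_numE.
Qed.

HB.instance Definition _ :=
  Measure_isSigmaFinite.Build _ _ _ lebesgue_step step_sigma_finite.

End step.

(* n-dimensional Lebesgue measure: the n-fold product of lebesgue_measure. *)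
Fixpoint lebn (n : nat) : {sigma_finite_measure set 'rV[R]_n -> \bar R} :=
  if n is n'.+1 then lebesgue_step (lebn n') else \d_ (0 : 'rV[R]_0).

End Lebesgue.
Arguments lebn {R} n.

Section Regularity.
Context {R : realType} {n : nat}.
Implicit Types (u : 'rV[R]_n -> R) (A : set 'rV[R]_n).

Definition evec (i : 'I_n) : 'rV[R]_n := delta_mx 0 i.

(* 'D_v u x is a default value where the derivative does not exist; for locally
   Lipschitz u this only concerns a Lebesgue-null set of points x. *)
Definition grad u (x : 'rV[R]_n) : 'rV[R]_n := \row_i 'D_(evec i) u x.

Definition pderivs (l : seq 'I_n) u : 'rV[R]_n -> R :=
  foldr (fun i (g : 'rV[R]_n -> R) x => 'D_(evec i) g x) u l.

(* u is of class C^k in the open set A *)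
Definition Ck A (k : nat) u :=
  forall l : seq 'I_n, (size l <= k)%N -> forall x, A x ->
    {for x, continuous (pderivs l u)} /\
    ((size l < k)%N -> forall i, derivable (pderivs l u) x (evec i)).

(* C^{k,g}_loc(R^n); as 0 `^ 0 = 1, C^{k,0}_loc is C^k *)
Definition Ck_holder_loc (k : nat) (g : R) u :=
  Ck setT k u /\
  forall l : seq 'I_n, size l = k -> forall r : R, 0 < r ->
    exists C : R, forall x y, eball r x -> eball r y ->
      `|pderivs l u x - pderivs l u y| <= C * enorm (x - y) `^ g.

(* C^b_loc(R^n) with real exponent b >= 0 *)
Definition holder_loc (b : R) u :=
  Ck_holder_loc (Num.truncn b) (b - (Num.truncn b)%:R) u.

Definition Linfty_norm A u : \bar R :=
  'N[lebn n]_+oo [(EFin \o u) \_ A].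

End Regularity.

Section Operator.
Context {R : realType} {n : nat}.
Implicit Types (K : 'rV[R]_n -> \bar R) (u v : 'rV[R]_n -> R).

(* Lu(x) = p.v. int (u(x) - u(y)) K(x - y) dy, as the limit for r -> 0+ of the
   integrals over |x - y| > r; lim is a default value if there is no limit. *)
Definition nonlocal K u (x : 'rV[R]_n) : \bar R :=
  lim ((fun r : R =>
    \int[lebn n]_(y in [set y | (r < enorm (x - y))%R])
      ((u x - u y)%:E * K (x - y)%R))%E @ 0^'+).

Record kernel_class (s lam Lam : R) K : Prop := {
  kernel_ge0 : forall y, (0 <= K y)%E ;
  kernel_sym : forall y, K y = K (- y) ;
  kernel_lower : forall y, y != 0 ->
    ((lam * enorm y `^ (- n%:R - 2 * s))%:E <= K y)%E ;
  kernel_upper : forall y, y != 0 ->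
    (K y <= (Lam * enorm y `^ (- n%:R - 2 * s))%:E)%E ;
  kernel_diff : forall y, y != 0 -> differentiable (fine \o K) y ;
  kernel_grad : forall y, y != 0 ->
    ((enorm (grad (fine \o K) y))%:E <= (Lam * (enorm y)^-1)%:E * K y)%E }.

Definition homogeneous_kernel (s : R) K := forall y, y != 0 ->
  K y = ((enorm y `^ (- n%:R - 2 * s))%:E * K ((enorm y)^-1 *: y))%E.

(* The weighted space L^1(R^n, (1 + |y|)^{-n-2s} dy) *)
Definition L1_tail (s : R) u :=
  (lebn n).-integrable setT
    (fun y => (u y * (1 + enorm y) `^ (- n%:R - 2 * s))%:E).

(* Viscosity solutions of Lv = 0 in the open set A: test functions phi are C^2
   near x, touch v at x and stay on one side of v in the whole space. Changing
   v on a null set outside A does not affect these notions, since phi may be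
   changed there as well. *)
Definition viscosity_subsolution (s : R) K (A : set 'rV[R]_n) v :=
  forall x (N : set 'rV[R]_n) (phi : 'rV[R]_n -> R),
    open_nbhs x N -> N `<=` A -> L1_tail s phi -> Ck N 2 phi ->
    phi x = v x -> (forall y, v y <= phi y) ->
    (nonlocal K phi x <= 0)%E.

Definition viscosity_supersolution (s : R) K (A : set 'rV[R]_n) v :=
  forall x (N : set 'rV[R]_n) (phi : 'rV[R]_n -> R),
    open_nbhs x N -> N `<=` A -> L1_tail s phi -> Ck N 2 phi ->
    phi x = v x -> (forall y, phi y <= v y) ->
    (0 <= nonlocal K phi x)%E.

Definition viscosity_solution (s : R) K (A : set 'rV[R]_n) v :=
  [/\ forall x, A x -> {for x, continuous v},
      L1_tail s v,
      viscosity_subsolution s K A v &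
      viscosity_supersolution s K A v].

End Operator.

(* Main.v *)
Require Import Defs.
From HB Require Import structures.
From mathcomp Require Import all_boot all_order all_algebra.
From mathcomp Require Import all_classical all_reals all_analysis.
From mathcomp Require Import measurable_realfun.
From mathcomp Require Import ring lra.

Set Implicit Arguments.
Unset Strict Implicit.
Unset Printing Implicit Defensive.
Import Order.TTheory GRing.Theory Num.Theory.
Import numFieldNormedType.Exports.

Local Open Scope classical_set_scope.
Local Open Scope ring_scope.

(* Convexity. The second differences D_h u = u(. + h) + u(. - h) - 2 u satisfy L(D_h u) >= 0 where
   u > 0 and D_h u >= 0 where u = 0. A doubling argument in h turns this into the bound
   D_h u >= - C |h|^(1+b) on the unit scale for some b > s + alpha; applied to u(R x), whose Lipschitz
   constant grows like R^(1+s+alpha), it gives D_h u >= 0 as R tends to infinity.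

   Classification. Let G be the convex cone of directions along which the convex function u is
   nondecreasing. If G lies in a hyperplane, then {u = 0} is thin at large scales; the doubling
   argument for averages of - u then shows that u grows less than R^(1+s+alpha), hence vanishes. If G
   has interior, {u > 0} contains a ball of comparable size at every large scale, and the boundary
   Harnack inequality for forward and backward increments of u shows that C e - v lies in G whenever
   e is in G but - e is not, and v is in G. So G is a half-space and u(x) = phi(x . nu). Finally
   L((x . nu)_+^s) = 0 in {x . nu > 0}, by an explicit cancellation under the inversion z -> 1/z, and
   the boundary Harnack inequality at all scales forces the infimum and the supremum of
   phi'(t) / t^s to coincide. *)

(** * Lebesgue measure on row vectors *)

(** All information on [L] is one-sided. The inequality for the increment [- h], shifted by [h],
    becomes the opposite inequality for the increment [h] at every [x] with [u (x + h) > 0]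
    ([Lle_incr]). Thus in {u > 0} forward increments are supersolutions, backward increments are
    subsolutions, and increments with both ends inside are both.

    Contact functions are combinations of increments, weights, paraboloids and indicators, for which
    a principal value need not exist. Hence the upper limits [Lle]: they are subadditive, and at a
    global maximum they still bound the whole integral ([touching]).

    The exponent [gam] lies strictly between [s + alpha] and [2 s]: weights of growth [gam] beat the
    increments of [u] at infinity, so that extrema are attained, while tails stay integrable. The
    exponent [bet] lies strictly between [s + alpha] and 1: above the former rescaling wins, below
    the latter doubling wins. The constants see the kernel only through [s], [gam], [l], [m], which
    rescaling preserves, so each estimate is available at all scales. *)

Section PointwiseContinuity.
Context {R : realType} {T : topologicalType}.
Implicit Types f g : T -> R.

Lemma cont_cst (c : R) : continuous (fun _ : T => c).
Proof. by move=> x; exact: cst_continuous. Qed.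

Lemma cont_add f g : continuous f -> continuous g -> continuous (fun x => f x + g x).
Proof. by move=> cf cg x; apply: (@cvgD R R^o _ _ _ f g); [exact: cf|exact: cg]. Qed.

Lemma cont_opp f : continuous f -> continuous (fun x => - f x).
Proof. by move=> cf x; apply: (@cvgN R R^o _ _ _ f); exact: cf. Qed.

Lemma cont_sub f g : continuous f -> continuous g -> continuous (fun x => f x - g x).
Proof. by move=> cf cg; apply: cont_add => //; apply: cont_opp. Qed.

Lemma cont_mul f g : continuous f -> continuous g -> continuous (fun x => f x * g x).
Proof. by move=> cf cg x; apply: (@cvgM R _ _ _ f g); [exact: cf|exact: cg]. Qed.

Lemma cont_comp (U : topologicalType) (h : U -> T) f :
  continuous h -> continuous f -> continuous (fun x => f (h x)).
Proof. by move=> ch cf x; apply: (@continuous_comp U T R h f); [exact: ch|exact: cf]. Qed.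

Lemma cont_min f g : continuous f -> continuous g -> continuous (fun x => Num.min (f x) (g x)).
Proof. by move=> cf cg x; apply: (@continuous_min R T f g); [exact: cf|exact: cg]. Qed.

Lemma cont_max f g : continuous f -> continuous g -> continuous (fun x => Num.max (f x) (g x)).
Proof. by move=> cf cg x; apply: (@continuous_max R T f g); [exact: cf|exact: cg]. Qed.

Lemma cont_sum (I : finType) (F : I -> T -> R) :
  (forall i, continuous (F i)) -> continuous (fun x => \sum_i F i x).
Proof.
move=> cF; rewrite (_ : (fun _ => _) = \sum_i F i); last by apply/funext => x; rewrite fct_sumE.
elim/big_rec : _ => [|i f _ cf]; first by apply: cont_cst.
exact: cont_add.
Qed.

End PointwiseContinuity.

Section RowVectorBasics.
Context {R : realType} {n : nat}.
Implicit Types x y : 'rV[R]_n.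

Lemma coord_le_norm x i : `|x 0 i| <= `|x|.
Proof.
rewrite /Num.norm/= mx_normrE.
rewrite -[X in X <= _]/((fun ij : 'I_1 * 'I_n => `|x ij.1 ij.2|) (0, i)); exact: le_bigmax.
Qed.

Lemma rV_norm_le x (r : R) : 0 <= r -> (forall i, `|x 0 i| <= r) -> `|x| <= r.
Proof.
move=> r0 H; rewrite /Num.norm/= mx_normrE.
by apply: bigmax_le => // -[i j] _ /=; rewrite ord1; apply: H.
Qed.

Lemma rV_norm_lt x (r : R) : 0 < r -> (forall i, `|x 0 i| < r) -> `|x| < r.
Proof.
move=> r0 H; rewrite /Num.norm/= mx_normrE.
by apply: bigmax_lt => // -[i j] _ /=; rewrite ord1; apply: H.
Qed.

Lemma measurable_box (c : 'rV[R]_n) (r : R) : 0 < r ->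
  measurable [set v : 'rV[R]_n | `|v - c| < r].
Proof.
move=> r0.
rewrite (_ : mkset _ = \big[setI/setT]_(i < n)
   ((fun v : 'rV[R]_n => v 0 i : measurableTypeR R) @^-1`
      [set t : R | `|t - c 0 i| < r])); last first.
  apply/seteqP; split=> v.
    move=> /= vr; rewrite -bigcap_seq => i _ /=.
    apply: le_lt_trans vr; have := coord_le_norm (v - c) i.
    by rewrite !mxE.
  rewrite -bigcap_seq => /= H; apply: rV_norm_lt => // i.
  by rewrite !mxE; apply: (H i) => /=; rewrite mem_index_enum.
apply: bigsetI_measurable => i _.
rewrite -[X in measurable X]setTI; apply: measurable_coord => //.
rewrite (_ : mkset _ = ball (c 0 i) r); first exact: measurable_realfun.measurable_ball.
by apply/seteqP; split=> t; rewrite -ball_normE/= distrC.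
Qed.

(** The measurable structure is the product one, so openness has to be unfolded: an open set is the
    countable union of the sup-norm boxes with rational centre and radius [1 / (k + 1)] that it
    contains. *)
Lemma measurable_open_rV (A : set 'rV[R]_n) : open A -> measurable A.
Proof.
move=> oA.
pose F (q : 'rV[rat]_n * nat) : set 'rV[R]_n :=
  let B := [set v : 'rV[R]_n | `|v - map_mx ratr q.1| < q.2.+1%:R^-1] in
  if `[< B `<=` A >] then B else set0.
rewrite (_ : A = \bigcup_q F q); last first.
  apply/seteqP; split=> x; last first.
    by move=> [q _]; rewrite /F; case: asboolP => // BA; exact: BA.
  move=> Ax; have /nbhs_ballP[e /= e0 eA] : nbhs x A by apply: open_nbhs_nbhs.
  have [k ke] : exists k : nat, k.+1%:R^-1 < e / 2.
    have : 0 < e / 2 by rewrite divr_gt0.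
    move=> /(@ltr_add_invr R 0)[k]; rewrite add0r => ?; by exists k.
  have [c Hc] : exists c : 'rV[rat]_n, forall i, `|x 0 i - ratr (c 0 i)| < k.+1%:R^-1.
    have H i : exists q : rat, `|x 0 i - ratr q| < k.+1%:R^-1.
      have [q] : exists q, ratr q \in `](x 0 i - k.+1%:R^-1), (x 0 i + k.+1%:R^-1)[.
        by apply: rat_in_itvoo; rewrite ltrD2l gtrN// invr_gt0.
      rewrite in_itv/= => /andP[q1 q2]; exists q.
      rewrite ltr_norml; move: q1 q2; set d := _^-1; set r := ratr q => q1 q2.
      by apply/andP; split; lra.
    exists (\row_i sval (cid (H i))) => i; rewrite mxE.
    by case: cid.
  exists (c, k) => //; rewrite /F; case: asboolP => /= [_|].
    apply: rV_norm_lt; first by rewrite invr_gt0.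
    by move=> i; rewrite !mxE.
  move=> [] v /= vk; apply: eA; rewrite -ball_normE/=.
  apply: rV_norm_lt => // i; rewrite !mxE.
  have h1 := Hc i.
  have h2 : `|v 0 i - ratr (c 0 i)| < k.+1%:R^-1.
    by apply: le_lt_trans vk; have := coord_le_norm (v - map_mx ratr c) i; rewrite !mxE.
  rewrite (_ : x 0 i - v 0 i = (x 0 i - ratr (c 0 i)) - (v 0 i - ratr (c 0 i))); last by ring.
  apply: le_lt_trans (ler_normB _ _) _.
  by move: ke h1 h2; set d := _^-1 => ke h1 h2; lra.
apply: countable_bigcupT_measurable => //.
move=> q; rewrite /F; case: asboolP => // _.
by apply: measurable_box; rewrite invr_gt0.
Qed.

Lemma continuous_measurable_rV (f : 'rV[R]_n -> R) :
  continuous f -> measurable_fun setT (f : 'rV[R]_n -> measurableTypeR R).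
Proof.
move=> /continuousP cf; apply: (measurability _ (RGenOInfty.measurableE R)).
move=> _ [_ [a ->] <-]; rewrite setTI; apply: measurable_open_rV.
exact/cf/interval_open.
Qed.

Lemma measurable_affine_rV (c : R) (h : 'rV[R]_n) :
  measurable_fun setT (fun x : 'rV[R]_n => c *: x + h).
Proof.
apply: measurable_fun_rV => i.
rewrite (_ : (fun _ => _) = (fun x : 'rV[R]_n => c * x 0 i + h 0 i)).
  apply: continuous_measurable_rV.
  apply: cont_add; last exact: cont_cst.
  by apply: cont_mul; [exact: cont_cst|exact: coord_continuous].
by apply/funext => x; rewrite !mxE.
Qed.

End RowVectorBasics.

Section AffineChange.
Context {R : realType}.

(** Lebesgue measure is determined by its values on intervals []a, b]], where the claim is explicit.
    A negative [c] turns such an interval into one closed on the left, hence the two cases. *)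
Lemma lebesgue_measure_affine (c h : R) (A : set (measurableTypeR R)) :
  c != 0 -> measurable A ->
  (lebesgue_measure [set x : R | A (c * x + h)%R] = (`|c|^-1)%:E * lebesgue_measure A)%E.
Proof.
move=> c0 mA.
have mphi : measurable_fun setT (fun x : measurableTypeR R => (c * x + h)%R : measurableTypeR R).
  apply: (@continuous_measurable_fun R (fun x => c * x + h)).
  apply: cont_add; last exact: cont_cst.
  by apply: cont_mul; [exact: cont_cst|by move=> x; exact: cvg_id].
have cn : 0 <= `|c| by [].
pose mu : {measure set (measurableTypeR R) -> \bar R} := mscale (NngNum cn)
  (measure_function_pushforward__canonical__measure_function_Measure lebesgue_measure mphi).
have H : forall A, measurable A -> lebesgue_measure A = mu A.
  apply: lebesgue_measure_unique => _ [[a b]] _ <-.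
  rewrite /mu/= /mscale/= /pushforward/=.
  have [c_gt0|c_lt0|/eqP c_eq0] := ltgtP 0 c; last by rewrite eq_sym in c_eq0; rewrite (negbTE c0) in c_eq0.
    rewrite (_ : _ @^-1` _ = `]((a - h) / c), ((b - h) / c)]%classic); last first.
      apply/seteqP; split=> x /=; rewrite !in_itv/= ltr_pdivrMr// ler_pdivlMr// ltrBlDr lerBrDr mulrC//.
    rewrite !lebesgue_measure_itv/= !lte_fin ltr_pM2r ?invr_gt0// ltrD2r.
    case: ifPn => _; last by rewrite mule0.
    rewrite -!EFinB -EFinM gtr0_norm//; congr EFin; field.
    by rewrite gt_eqF.
  rewrite (_ : _ @^-1` _ = `[((b - h) / c), ((a - h) / c)[%classic); last first.
    apply/seteqP; split=> x /=; rewrite !in_itv/= ltr_ndivlMr// ler_ndivrMr// ltrBlDr lerBrDr mulrC andbC//.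
  rewrite !lebesgue_measure_itv/= !lte_fin ltr_nM2r ?invr_lt0// ltrD2r.
  case: ifPn => _; last by rewrite mule0.
  rewrite -!EFinB -EFinM ltr0_norm//; congr EFin; field.
  by rewrite lt_eqF.
rewrite [in RHS]H// /mu/= /mscale/= muleA -EFinM mulVf ?normr_eq0// mul1e.
by [].
Qed.

Lemma ge0_integral_affine1 (c h : R) (f : measurableTypeR R -> \bar R) : c != 0 ->
  measurable_fun setT f -> (forall x, 0 <= f x)%E ->
  (\int[lebesgue_measure]_x f (c * x + h)%R = (`|c|^-1)%:E * \int[lebesgue_measure]_x f x)%E.
Proof.
move=> c0 mf f0.
have mphi : measurable_fun setT (fun x : measurableTypeR R => (c * x + h)%R : measurableTypeR R).
  apply: (@continuous_measurable_fun R (fun x => c * x + h)).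
  apply: cont_add; last exact: cont_cst.
  by apply: cont_mul; [exact: cont_cst|by move=> x; exact: cvg_id].
have cn : 0 <= `|c|^-1 by rewrite invr_ge0.
have := @ge0_integral_pushforward _ _ _ _ R _ mphi lebesgue_measure setT f measurableT mf.
rewrite preimage_setT => /(_ (fun y _ => f0 y)) <-.
rewrite -(@ge0_integral_mscale _ _ _ lebesgue_measure setT measurableT (NngNum cn) f)//.
apply: eq_measure_integral => A mA _.
by rewrite /= /mscale/= -(@lebesgue_measure_affine c h).
Qed.

Lemma consrV_affine n (c t : R) (y : 'rV[R]_n) (h : 'rV[R]_n.+1) :
  c *: consrV (t, y) + h =
  consrV ((c * t + h 0 ord0)%R, c *: y + \row_j h 0 (lift ord0 j)).
Proof.
apply/rowP => i; rewrite /consrV/=; case: (@split_ordP 1 n i) => j ->; rewrite !mxE.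
  rewrite -[lshift n j]/(unsplit (inl j)) unsplitK/= !mxE ord1 /= !mulr1n.
  by congr (_ + h _ _); apply/val_inj.
rewrite -[rshift 1 j]/(unsplit (inr j)) unsplitK/= !mxE.
by congr (_ + h _ _); apply/val_inj.
Qed.

(** Induction on the dimension: sections of the preimage are affine preimages of sections, and the
    remaining integral in the first coordinate is one-dimensional. *)
Lemma lebn_affine n (c : R) (h : 'rV[R]_n) (A : set 'rV[R]_n) :
  c != 0 -> measurable A ->
  (lebn n [set x | A (c *: x + h)%R] = (`|c|^-1 ^+ n)%:E * lebn n A)%E.
Proof.
move=> c0; elim: n h A => [|n IH] h A mA.
  rewrite expr0 mul1e /=; congr (\d_ _ _).
  by apply/seteqP; split=> x /=; rewrite (_ : c *: x + h = x)//; apply/rowP; case.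
have c1 : 0 <= `|c|^-1 by rewrite invr_ge0.
pose hd : R := h 0 ord0; pose tl : 'rV[R]_n := \row_j h 0 (lift ord0 j).
rewrite [LHS]/(lebn n.+1 _) /= /lebesgue_step /pushforward.
pose B : set (measurableTypeR R * 'rV[R]_n) := @consrV R n @^-1` A.
have mB : measurable B.
  by rewrite -[X in measurable X]setTI; apply: measurable_consrV.
pose F (t : R) := lebn n (xsection B t).
have mF : measurable_fun setT (F : measurableTypeR R -> _) by exact: measurable_fun_xsection.
have F0 t : (0 <= F t)%E by exact: measure_ge0.
transitivity (\int[lebesgue_measure]_t ((`|c|^-1 ^+ n)%:E * F (c * t + hd)%R))%E.
  apply: eq_integral => t _ /=.
  rewrite -(IH tl); last exact: measurable_xsection.
  congr (lebn n _); apply/seteqP; split=> y; rewrite /xsection/= !inE /B/=;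
  by rewrite consrV_affine.
rewrite ge0_integralZl//.
- rewrite (@ge0_integral_affine1 c hd F c0 mF F0) exprSr EFinM muleA.
  by rewrite /F/= /B.
- have : measurable_fun setT (F \o (fun t : measurableTypeR R => c * t + hd : measurableTypeR R)).
    apply: measurableT_comp => //; apply: (@continuous_measurable_fun R (fun x => c * x + hd)).
    apply: cont_add; last exact: cont_cst.
    by apply: cont_mul; [exact: cont_cst|by move=> x; exact: cvg_id].
  by [].
Qed.

Lemma ge0_integral_affine n (c : R) (h : 'rV[R]_n) (f : 'rV[R]_n -> \bar R) : c != 0 ->
  measurable_fun setT f -> (forall x, 0 <= f x)%E ->
  (\int[lebn n]_x f (c *: x + h)%R = (`|c|^-1 ^+ n)%:E * \int[lebn n]_x f x)%E.
Proof.
move=> c0 mf f0.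
have mphi := measurable_affine_rV c h.
have cn : 0 <= `|c|^-1 ^+ n by rewrite exprn_ge0// invr_ge0.
have := @ge0_integral_pushforward _ _ _ _ R _ mphi (lebn n) setT f measurableT mf.
rewrite preimage_setT => /(_ (fun y _ => f0 y)) <-.
rewrite -(@ge0_integral_mscale _ _ _ (lebn n) setT measurableT (NngNum cn) f)//.
apply: eq_measure_integral => A mA _.
by rewrite /= /mscale/= -(@lebn_affine n c h).
Qed.

Lemma integral_affine n (c : R) (h : 'rV[R]_n) (f : 'rV[R]_n -> \bar R) : `|c| = 1 ->
  measurable_fun setT f ->
  (\int[lebn n]_x f (c *: x + h)%R = \int[lebn n]_x f x)%E.
Proof.
move=> c1 mf; have c0 : c != 0 by rewrite -normr_eq0 c1 oner_eq0.
rewrite integralE [RHS]integralE.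
have H g : measurable_fun setT g -> (forall x, 0 <= g x)%E ->
  (\int[lebn n]_x g (c *: x + h)%R = \int[lebn n]_x g x)%E.
  by move=> mg g0; rewrite ge0_integral_affine// c1 invr1 expr1n mul1e.
congr (_ - _)%E.
  rewrite -(H (f^\+)%E)//; last exact: measurable_funepos.
  by apply: eq_integral => x _; rewrite !funeposE.
rewrite -(H (f^\-)%E)//; last exact: measurable_funeneg.
by apply: eq_integral => x _; rewrite !funenegE.
Qed.

Lemma lebn_box n (c : 'rV[R]_n) (r : R) : 0 < r ->
  (lebn n [set x | (`|x - c| < r)%R] = ((2 * r) ^+ n)%:E)%E.
Proof.
move=> r0; elim: n c => [|n IH] c.
  rewrite expr0 /= diracE mem_set//= sub0r normrN.
  by rewrite (_ : c = 0) ?normr0//; apply/rowP; case.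
rewrite [LHS]/(lebn n.+1 _) /= /lebesgue_step /pushforward.
pose tl : 'rV[R]_n := \row_j c 0 (lift ord0 j).
have E : consrV (n:=n) @^-1` [set x | `|x - c| < r] =
   ball (c 0 ord0) r `*` [set y | `|y - tl| < r].
  apply/seteqP; split=> -[t y] /=.
    move=> H; split.
      rewrite -ball_normE/= distrC; apply: le_lt_trans H.
      have := coord_le_norm (consrV (t, y) - c) (@lshift 1 n ord0).
      have := consrV_affine 1 t y (- c); rewrite scale1r => ->.
      rewrite /consrV !mxE/= -[lshift n ord0]/(unsplit (inl ord0)) unsplitK/= !mxE mul1r mulr1n.
      by congr (`|_ - c _ _| <= _); apply/val_inj.
    apply: rV_norm_lt => // i; apply: le_lt_trans H.
    have := coord_le_norm (consrV (t, y) - c) (rshift 1 i).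
    have := consrV_affine 1 t y (- c); rewrite scale1r => ->.
    rewrite /consrV !mxE/= -[rshift 1 i]/(unsplit (inr i)) unsplitK/= !mxE mul1r.
    by congr (`|_ - c _ _| <= _); apply/val_inj.
  rewrite -ball_normE/= distrC => -[H1 H2].
  have := consrV_affine 1 t y (- c); rewrite scale1r => ->.
  apply: rV_norm_lt => // i; case: (@split_ordP 1 n i) => j ->.
    rewrite /consrV !mxE/= -[lshift n j]/(unsplit (inl j)) unsplitK/= !mxE ord1 mul1r mulr1n.
    by move: H1; congr (`|_ - c _ _| < _); apply/val_inj.
  rewrite /consrV !mxE/= -[rshift 1 j]/(unsplit (inr j)) unsplitK/= !mxE mul1r.
  apply: le_lt_trans H2; have := coord_le_norm (y - tl) j.
  rewrite !mxE; congr (`|_ - c _ _| <= _); exact/val_inj.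
rewrite E product_measure1E//; last 2 first.
- exact: measurable_realfun.measurable_ball.
- exact: measurable_box.
transitivity ((r *+ 2)%:E * ((2 * r) ^+ n)%:E)%E.
  congr (_ * _)%E; last exact: IH.
  exact: (lebesgue_measure_ball (c 0 ord0) (ltW r0)).
by rewrite -EFinM exprS mulr_natl.
Qed.

End AffineChange.

(** * Real powers and the integrability of powers of the norm *)

Section PowerMonotonicity.
Context {R : realType}.
Implicit Types x y q : R.

Lemma powR_one q : 1 `^ q = 1 :> R.
Proof. by rewrite powR1. Qed.

Lemma powR_le q x y : 0 <= q -> 0 <= x -> x <= y -> x `^ q <= y `^ q.
Proof. by move=> q0 x0 xy; apply: ge0_ler_powR => //; rewrite nnegrE// (le_trans x0). Qed.

Lemma powR_lt q x y : 0 < q -> 0 <= x -> x < y -> x `^ q < y `^ q.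
Proof. by move=> q0 x0 xy; apply: gt0_ltr_powR => //; rewrite nnegrE// (le_trans x0)// ltW. Qed.

Lemma powR_anti q x y : q <= 0 -> 0 < x -> x <= y -> y `^ q <= x `^ q.
Proof.
move=> q0 x0 xy; rewrite -[q]opprK powRN [leRHS]powRN.
rewrite lef_pV2 ?posrE ?powR_gt0// ?(lt_le_trans x0)//.
by apply: powR_le => //; [rewrite oppr_ge0|exact: ltW].
Qed.

Lemma powR_add q1 q2 x : 0 < x -> x `^ (q1 + q2) = x `^ q1 * x `^ q2.
Proof. by move=> x0; rewrite powRD// (gt_eqF x0) implybT. Qed.

Lemma powR2 x : 0 <= x -> x `^ 2 = x ^+ 2.
Proof. by move=> x0; rewrite (powR_mulrn 2 x0). Qed.

End PowerMonotonicity.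

Section Powers.
Context {R : realType} {n : nat}.
Implicit Types (f g : 'rV[R]_n -> R) (A : set 'rV[R]_n).
Local Notation mu := (@lebn R n).

Lemma int_indic A f : measurable A ->
  (\int[mu]_(y in A) (f y)%:E = \int[mu]_y (f y * \1_A y)%:E)%E.
Proof.
move=> mA; rewrite integral_mkcond; apply: eq_integral => y _.
by rewrite epatch_indic /= EFinM.
Qed.

Lemma ge0_integral_scale (c : R) (f : 'rV[R]_n -> \bar R) : 0 < c ->
  measurable_fun setT f -> (forall x, 0 <= f x)%E ->
  (\int[mu]_x f (c *: x)%R = (c^-1 ^+ n)%:E * \int[mu]_x f x)%E.
Proof.
move=> c0 mf f0; have := @ge0_integral_affine R n c 0 f _ mf f0.
rewrite gtr0_norm// => <-; last by rewrite gt_eqF.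
by apply: eq_integral => x _; rewrite addr0.
Qed.

Lemma integral_shift (h : 'rV[R]_n) (f : 'rV[R]_n -> \bar R) :
  measurable_fun setT f -> (\int[mu]_x f (x + h)%R = \int[mu]_x f x)%E.
Proof.
move=> mf; rewrite -(@integral_affine R n 1 h f)// ?normr1//.
by apply: eq_integral => x _; rewrite scale1r.
Qed.

Lemma integral_reflect (f : 'rV[R]_n -> \bar R) :
  measurable_fun setT f -> (\int[mu]_x f (- x)%R = \int[mu]_x f x)%E.
Proof.
move=> mf; rewrite -(@integral_affine R n (-1) 0 f)// ?normrN1//.
by apply: eq_integral => x _; rewrite scaleN1r addr0.
Qed.

Lemma cont_norm : continuous (fun x : 'rV[R]_n => `|x|).
Proof. by move=> x; exact: norm_continuous. Qed.

Lemma measurable_norm_rV : measurable_fun setT (fun x : 'rV[R]_n => `|x| : measurableTypeR R).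
Proof. by apply: continuous_measurable_rV; exact: cont_norm. Qed.

Lemma measurable_pw (q : R) : measurable_fun setT (fun y : 'rV[R]_n => `|y| `^ q : measurableTypeR R).
Proof.
exact: (measurableT_comp (@measurable_powR R q) measurable_norm_rV).
Qed.

Lemma measurable_norm_le (r : R) : measurable [set y : 'rV[R]_n | `|y| <= r].
Proof.
rewrite -[X in measurable X]setTI; rewrite (_ : mkset _ = (fun x : 'rV[R]_n => `|x|) @^-1` `]-oo, r]%classic).
  exact: measurable_norm_rV.
by apply/seteqP; split => y /=; rewrite in_itv/=.
Qed.

Lemma measurable_norm_gt (r : R) : measurable [set y : 'rV[R]_n | r < `|y|].
Proof.
rewrite (_ : mkset _ = ~` [set y : 'rV[R]_n | `|y| <= r]).
  by apply: measurableC; exact: measurable_norm_le.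
by apply/seteqP; split => y /=; [rewrite ltNge => /negP|move=> /negP; rewrite -ltNge].
Qed.

Lemma lebn_norm_le_fin (r : R) : 0 < r -> (mu [set y | (`|y| <= r)%R] <= ((4 * r) ^+ n)%:E)%E.
Proof.
move=> r0; have r20 : 0 < 2 * r by rewrite mulr_gt0.
rewrite (_ : 4 * r = 2 * (2 * r)); last by ring.
rewrite -(lebn_box 0 r20); apply: le_measure; rewrite ?inE.
- exact: measurable_norm_le.
- exact: measurable_box.
- by move=> y /= yr; rewrite subr0; apply: le_lt_trans yr _; lra.
Qed.

(** Covering the set of index [N + 1] by the first set and by the copy of the [N]-th one dilated by
    [c] gives the recursion [I (N + 1) <= A1 + th * I N] with [th = c^(n + q) < 1]; the bound is its
    fixed point. Both ends are served: [c = 1/2] near the origin and [c = 2] at infinity. *)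
Lemma shell_bound (c q : R) (S : nat -> set 'rV[R]_n) (A1 : R) :
  0 < c -> c `^ (n%:R + q) < 1 -> (forall N, measurable (S N)) ->
  (forall N, S N.+1 `<=` S 1%N `|` [set y | S N (c^-1 *: y)]) -> S 0%N = set0 ->
  (\int[mu]_(y in S 1%N) (`|y| `^ q)%:E <= A1%:E)%E ->
  forall N, (\int[mu]_(y in S N) (`|y| `^ q)%:E <= (A1 / (1 - c `^ (n%:R + q)))%:E)%E.
Proof.
move=> c0 th1 mS SS S0 HA1.
set th := c `^ _ in th1 *.
have th0 : 0 <= th by exact: powR_ge0.
have A10 : 0 <= A1.
  by rewrite -lee_fin; apply: le_trans HA1; apply: integral_ge0 => y _; rewrite lee_fin powR_ge0.
have mI N : measurable_fun setT (fun y : 'rV[R]_n => (`|y| `^ q * \1_(S N) y)%:E).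
  apply/measurable_EFinP; apply: measurable_funM; first exact: measurable_pw.
  exact: measurable_indic.
have I0 N (y : 'rV[R]_n) : (0 <= (`|y| `^ q * \1_(S N) y)%:E)%E.
  by rewrite lee_fin mulr_ge0// powR_ge0.
elim=> [|N IH].
  by rewrite S0 integral_set0 lee_fin divr_ge0// subr_ge0 ltW.
rewrite int_indic//.
have -> : A1 / (1 - th) = A1 + th * (A1 / (1 - th)).
  by field; rewrite subr_eq0 eq_sym lt_eqF.
apply: (@le_trans _ _ (\int[mu]_y ((`|y| `^ q * \1_(S 1%N) y)%:E +
   (c `^ q)%:E * (`|c^-1 *: y| `^ q * \1_(S N) (c^-1 *: y))%:E))%E).
  apply: ge0_le_integral => //.
  - apply: emeasurable_funD => //.
    apply: measurable_funeM.
    have := measurableT_comp (mI N) (measurable_affine_rV c^-1 0).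
    by apply: eq_measurable_fun => y _ /=; rewrite addr0.
  - move=> y _; rewrite -EFinM -EFinD lee_fin mulrA normrZ gtr0_norm ?invr_gt0//.
    rewrite -powRM ?mulr_ge0 ?invr_ge0 ?(ltW c0)// mulrA mulfV ?gt_eqF// mul1r.
    rewrite -mulrDr; apply: ler_wpM2l; first exact: powR_ge0.
    rewrite !indicE; case: (boolP (y \in S N.+1)) => [|_]; last by rewrite addr_ge0.
    rewrite inE => /SS[yS1|yS]; first by rewrite (mem_set yS1)/= lerDl.
    by rewrite (mem_set (yS : S N (c^-1 *: y))) lerDr.
rewrite ge0_integralD//; first last.
- apply: measurable_funeM.
  have := measurableT_comp (mI N) (measurable_affine_rV c^-1 0).
  by apply: eq_measurable_fun => y _ /=; rewrite addr0.
- by move=> y _; rewrite mule_ge0// ?lee_fin ?powR_ge0// mulr_ge0// powR_ge0.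
rewrite EFinD; apply: leeD; first by rewrite -int_indic.
rewrite ge0_integralZl ?lee_fin ?powR_ge0//; first last.
  have := measurableT_comp (mI N) (measurable_affine_rV c^-1 0).
  by apply: eq_measurable_fun => y _ /=; rewrite addr0.
rewrite (ge0_integral_scale _ (mI N) (I0 N)) ?invr_gt0// invrK muleA -EFinM -int_indic//.
rewrite [leRHS]EFinM; have -> : c `^ q * c ^+ n = th.
  rewrite /th -powR_mulrn ?(ltW c0)// -powRD ?(gt_eqF c0) ?implybT//.
  by rewrite addrC.
by apply: lee_wpmul2l => //; rewrite lee_fin.
Qed.

Lemma exhaust_le (S : nat -> set 'rV[R]_n) (f : 'rV[R]_n -> \bar R) (C : \bar R) :
  (forall i j, (i <= j)%N -> S i `<=` S j) -> (forall N, measurable (S N)) ->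
  measurable_fun setT f -> (forall y, 0 <= f y)%E ->
  (forall N, \int[mu]_(y in S N) f y <= C)%E ->
  (\int[mu]_(y in \bigcup_N S N) f y <= C)%E.
Proof.
move=> ndS mS mf f0 H.
have cv : (\int[mu]_(y in S i) f y)%E @[i --> \oo] --> (\int[mu]_(y in \bigcup_i S i) f y)%E.
  apply: ge0_nondecreasing_set_cvg_integral => //.
  - by move=> i j ij; apply/subsetPset; exact: ndS.
  - by move=> i; exact: measurable_funTS.
rewrite -(cvg_lim _ cv)//.
apply: lime_le; first by apply/cvg_ex; eexists; exact: cv.
by apply: nearW => i; exact: H.
Qed.

Lemma powR_near_integral (a p : R) : 0 < a - (p - n%:R) ->
  (\int[mu]_(y in [set y | (0 < `|y|)%R /\ (`|y| <= 1)%R]) (`|y| `^ (a - p))%:E < +oo)%E.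
Proof.
move=> ap.
pose S N : set 'rV[R]_n := [set y | 2^-1 ^+ N < `|y| /\ `|y| <= 1].
have mS N : measurable (S N).
  apply: measurableI; [exact: measurable_norm_gt|exact: measurable_norm_le].
have U : [set y : 'rV[R]_n | 0 < `|y| /\ `|y| <= 1] = \bigcup_N S N.
  apply/seteqP; split => y /=; last first.
    by move=> [N _ [yN y1]]; split => //; apply: le_lt_trans yN; rewrite exprn_ge0.
  move=> [y0 y1]; have [N HN] : exists N, `|y|^-1 < N%:R.
    exists (Num.truncn `|y|^-1).+1; exact: truncnS_gt.
  exists N => //; split=> //; rewrite exprVn invf_plt ?posrE ?exprn_gt0//.
  apply: (lt_trans HN); rewrite -natrX ltr_nat; exact: ltn_expl.
have [A1 HA1] : exists A1 : R, (\int[mu]_(y in S 1%N) (`|y| `^ (a - p))%:E <= A1%:E)%E.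
  pose M := Num.max 1 (2^-1 `^ (a - p)).
  exists (M * (4 * 1) ^+ n).
  apply: (@le_trans _ _ (\int[mu]_(y in S 1%N) M%:E)%E).
    apply: ge0_le_integral => //.
    - by apply/measurable_EFinP; apply: measurable_funTS; exact: measurable_pw.
    - move=> y [yl yu]; rewrite lee_fin /M le_max.
      rewrite expr1 in yl.
      have [q0|q0] := leP 0 (a - p).
        by rewrite -[X in _ <= X](powR_one (a - p)) (powR_le q0).
      by rewrite (powR_anti _ _ (ltW yl)) ?orbT// ltW.
  rewrite integral_cst// EFinM; apply: lee_wpmul2l; first by rewrite lee_fin le_max ler01.
  apply: le_trans (lebn_norm_le_fin ltr01); apply: le_measure; rewrite ?inE//.
    exact: measurable_norm_le.
  by move=> y [].
have th1 : (2^-1 : R) `^ (n%:R + (a - p)) < 1.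
  have e0 : 0 < n%:R + (a - p) by lra.
  rewrite -[ltRHS](powR_one (n%:R + (a - p))).
  by apply: powR_lt => //; lra.
rewrite U; apply: (@le_lt_trans _ _ ((A1 / (1 - 2^-1 `^ (n%:R + (a - p))))%:E)); last by rewrite ltry.
apply: exhaust_le => //.
- move=> i j ij y [h1 h2]; split=> //; apply: le_lt_trans h1.
  by rewrite !exprVn lef_pV2 ?posrE ?exprn_gt0// ler_weXn2l// ler1n.
- by apply/measurable_EFinP; exact: measurable_pw.
apply: shell_bound => //.
- move=> N y [h1 h2]; have [h|h] := ltP 2^-1 `|y|.
    by left; split => //; rewrite expr1.
  right; rewrite /= /S /= invrK normrZ ger0_norm//; split; last lra.
  by move: h1; rewrite exprS; lra.
- by apply/seteqP; split=> // y [] /=; rewrite expr0 => h1 h2; have := lt_le_trans h1 h2; rewrite ltxx.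
Qed.

Lemma powR_far_integral (b p : R) : b - (p - n%:R) < 0 ->
  (\int[mu]_(y in [set y | (1 < `|y|)%R]) (`|y| `^ (b - p))%:E < +oo)%E.
Proof.
move=> bp.
pose S N : set 'rV[R]_n := [set y | 1 < `|y| /\ `|y| <= 2 ^+ N].
have mS N : measurable (S N).
  apply: measurableI; [exact: measurable_norm_gt|exact: measurable_norm_le].
have U : [set y : 'rV[R]_n | 1 < `|y|] = \bigcup_N S N.
  apply/seteqP; split => y /=; last by move=> [N _ []].
  move=> y1; have [N HN] : exists N, `|y| < N%:R.
    exists (Num.truncn `|y|).+1; exact: truncnS_gt.
  exists N => //; split=> //; apply: ltW.
  apply: (lt_trans HN); rewrite -natrX ltr_nat; exact: ltn_expl.
have [A1 HA1] : exists A1 : R, (\int[mu]_(y in S 1%N) (`|y| `^ (b - p))%:E <= A1%:E)%E.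
  pose M := Num.max 1 (2 `^ (b - p)).
  exists (M * (4 * 2) ^+ n).
  apply: (@le_trans _ _ (\int[mu]_(y in S 1%N) M%:E)%E).
    apply: ge0_le_integral => //.
    - by apply/measurable_EFinP; apply: measurable_funTS; exact: measurable_pw.
    - move=> y [yl yu]; rewrite lee_fin /M le_max.
      rewrite expr1 in yu.
      have [q0|q0] := leP 0 (b - p).
        by rewrite (powR_le q0 _ yu) ?orbT.
      by rewrite -[X in _ <= X](powR_one (b - p)) (powR_anti (ltW q0) _ (ltW yl)).
  rewrite integral_cst// EFinM; apply: lee_wpmul2l; first by rewrite lee_fin le_max ler01.
  apply: le_trans (lebn_norm_le_fin (ltr0n R 2)); apply: le_measure; rewrite ?inE//.
    exact: measurable_norm_le.
  by move=> y [_] /=; rewrite expr1.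
have th1 : (2 : R) `^ (n%:R + (b - p)) < 1.
  have e0 : 0 < - (n%:R + (b - p)) by lra.
  rewrite -[n%:R + (b - p)]opprK powRN invf_lt1 ?powR_gt0//.
  rewrite -[ltLHS](powR_one (- (n%:R + (b - p)))).
  by apply: powR_lt => //; lra.
rewrite U; apply: (@le_lt_trans _ _ ((A1 / (1 - 2 `^ (n%:R + (b - p))))%:E)); last by rewrite ltry.
apply: exhaust_le => //.
- move=> i j ij y [h1 h2]; split=> //; apply: (le_trans h2).
  by rewrite ler_weXn2l// ler1n.
- by apply/measurable_EFinP; exact: measurable_pw.
apply: shell_bound => //.
- move=> N y [h1 h2]; have [h|h] := leP `|y| 2.
    by left; split => //; rewrite expr1.
  right; rewrite /= /S /= normrZ ger0_norm ?invr_ge0//; split; first lra.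
  by move: h2; rewrite exprS; lra.
- by apply/seteqP; split=> // y [] /=; rewrite expr0 => h1 h2; have := lt_le_trans h1 h2; rewrite ltxx.
Qed.

End Powers.

(** * Truncated operators and one-sided limits *)

Section EuclideanNorm.
Context {R : realType} {n : nat}.
Implicit Types x y : 'rV[R]_n.

Lemma edot_ge0 x : 0 <= edot x x.
Proof. by apply: sumr_ge0 => i _; rewrite -expr2 sqr_ge0. Qed.

Lemma edotC x y : edot x y = edot y x.
Proof. by apply: eq_bigr => i _; rewrite mulrC. Qed.

Lemma edotDl x y z : edot (x + y) z = edot x z + edot y z.
Proof. by rewrite /edot -big_split; apply: eq_bigr => i _; rewrite mxE mulrDl. Qed.

Lemma edotDr x y z : edot x (y + z) = edot x y + edot x z.
Proof. by rewrite edotC edotDl !(edotC x). Qed.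

Lemma edotZl c x y : edot (c *: x) y = c * edot x y.
Proof. by rewrite /edot mulr_sumr; apply: eq_bigr => i _; rewrite mxE mulrA. Qed.

Lemma edotZr c x y : edot x (c *: y) = c * edot x y.
Proof. by rewrite edotC edotZl edotC. Qed.

Lemma edotNl x y : edot (- x) y = - edot x y.
Proof. by rewrite -scaleN1r edotZl mulN1r. Qed.

Lemma edotNr x y : edot x (- y) = - edot x y.
Proof. by rewrite edotC edotNl edotC. Qed.

Lemma norm_sq_le_edot x : `|x| ^+ 2 <= edot x x.
Proof.
have [n0|n0] := eqVneq `|x| 0; first by rewrite n0 expr0n edot_ge0.
have /mx_norm_neq0[[i j] /= Hij] : mx_norm x != 0 by exact: n0.
have {}Hij : `|x| = `|x 0 j| by rewrite [LHS]Hij ord1.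
rewrite Hij real_normK ?num_real// /edot (bigD1 j)//= -expr2 lerDl.
by apply: sumr_ge0 => k _; rewrite -expr2 sqr_ge0.
Qed.

Lemma edot_le_norm_sq x : edot x x <= n%:R * `|x| ^+ 2.
Proof.
rewrite /edot -{7}(card_ord n) mulr_natl -sumr_const; apply: ler_sum => i _.
by rewrite -expr2 -[X in X <= _]real_normK ?num_real// ler_sqr ?nnegrE// coord_le_norm.
Qed.

Lemma norm_le_enorm x : `|x| <= enorm x.
Proof.
rewrite /enorm -(@ger0_norm _ `|x|)// -sqrtr_sqr ler_sqrt ?norm_sq_le_edot//.
exact: edot_ge0.
Qed.

(** The factor [n + 1] is generous so that it is positive in every dimension and can be divided
    by. *)
Lemma enorm_le_norm x : enorm x <= n.+1%:R * `|x|.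
Proof.
rewrite /enorm -(@ger0_norm _ (n.+1%:R * `|x|)) ?mulr_ge0// -sqrtr_sqr ler_sqrt ?sqr_ge0//.
apply: le_trans (edot_le_norm_sq x) _; rewrite exprMn; apply: ler_wpM2r; first exact: sqr_ge0.
by rewrite -natrX ler_nat; apply: (leq_trans (leqnSn n)); rewrite -mulnn leq_pmulr.
Qed.

Lemma enormN x : enorm (- x) = enorm x.
Proof. by rewrite /enorm edotNl edotNr opprK. Qed.

Lemma enorm_ge0 x : 0 <= enorm x.
Proof. exact: sqrtr_ge0. Qed.

Lemma enorm_sq x : enorm x ^+ 2 = edot x x.
Proof. by rewrite sqr_sqrtr// edot_ge0. Qed.

Lemma enormZ c x : enorm (c *: x) = `|c| * enorm x.
Proof.
rewrite /enorm edotZl edotZr mulrA -expr2 sqrtrM ?sqr_ge0//.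
by rewrite sqrtr_sqr.
Qed.

Lemma enorm_gt0 x : x != 0 -> 0 < enorm x.
Proof. by move=> x0; apply: lt_le_trans (norm_le_enorm x); rewrite normr_gt0. Qed.

Lemma cont_coord i : continuous (fun x : 'rV[R]_n => x 0 i).
Proof. by move=> x; exact: coord_continuous. Qed.

Lemma cont_edot : continuous (fun x : 'rV[R]_n => edot x x).
Proof.
apply: (@cont_sum R _ _ (fun (i : 'I_n) (x : 'rV[R]_n) => x 0 i * x 0 i)) => i.
by apply: cont_mul; exact: cont_coord.
Qed.

Lemma cont_edotl y : continuous (fun x : 'rV[R]_n => edot x y).
Proof.
apply: (@cont_sum R _ _ (fun (i : 'I_n) (x : 'rV[R]_n) => x 0 i * y 0 i)) => i.
by apply: cont_mul; [exact: cont_coord|exact: cont_cst].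
Qed.

Lemma cont_enorm : continuous (fun x : 'rV[R]_n => enorm x).
Proof.
by apply: (@cont_comp R _ _ _ (@Num.sqrt R)); [exact: cont_edot|exact: sqrt_continuous].
Qed.

Lemma cont_shift (h : 'rV[R]_n) : continuous (fun x : 'rV[R]_n => x + h).
Proof.
move=> x; have c1 : {for x, continuous (fun z : 'rV[R]_n => z)} by exact: cvg_id.
exact: (@continuousD R 'rV[R]_n 'rV[R]_n _ _ x c1 (@cst_continuous _ _ h x)).
Qed.

Lemma cont_scale (c : R) : continuous (fun x : 'rV[R]_n => c *: x).
Proof. by move=> x; exact: scaler_continuous. Qed.

End EuclideanNorm.

Section Kernel.
Context {R : realType} {n : nat}.
Local Notation mu := (@lebn R n).
Local Notation V := 'rV[R]_n.

(** The kernel as a real function, with bounds in the sup norm, whose balls are boxes of explicit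
    measure. The value 0 at the origin lets integrals run over the whole space without removing a
    point. *)
Record stable_kernel (s l m : R) (k : V -> R) : Prop := {
  sk_meas : measurable_fun setT (k : V -> measurableTypeR R) ;
  sk_zero : k 0 = 0 ;
  sk_sym : forall y, k (- y) = k y ;
  sk_lower : forall y, y != 0 -> l * `|y| `^ (- (n%:R + 2 * s)) <= k y ;
  sk_upper : forall y, y != 0 -> k y <= m * `|y| `^ (- (n%:R + 2 * s)) }.

(** [gam] is the growth allowed to test functions; [gam < 2 * s] makes [(1 + |y|)^gam * k y]
    integrable at infinity. *)
Record kernel_setting (s gam l m : R) (k : V -> R) : Prop := {
  ks_s0 : 0 < s ;
  ks_s1 : s < 1 ;
  ks_gam0 : 0 < gam ;
  ks_gam2 : gam < 2 * s ;
  ks_l0 : 0 < l ;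
  ks_m0 : 0 < m ;
  ks_kernel : stable_kernel s l m k }.

Definition outside (r : R) : set V := [set y | r < enorm y].

(** Written in the displacement [y], so that neither the kernel nor the cut-off moves with [x]. *)
Definition trunc_op (k : V -> R) (r : R) (w : V -> R) (x : V) : R :=
  \int[mu]_(y in outside r) ((w x - w (x + y)) * k y).

Definition growth_adm (gam : R) (w : V -> R) : Prop :=
  measurable_fun setT (w : V -> measurableTypeR R) /\
  exists2 C : R, 0 <= C & forall x, `|w x| <= C * (1 + `|x|) `^ gam.

(* [Lle k w x a] says that the upper limit of the truncated operators at [x] is at most [a]; the
   principal value need not exist. *)
Definition Lle (k : V -> R) (w : V -> R) (x : V) (a : R) : Prop :=
  forall e : R, 0 < e -> exists2 r0 : R, 0 < r0 &
    forall r, 0 < r -> r < r0 -> trunc_op k r w x <= a + e.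

Definition Lge (k : V -> R) (w : V -> R) (x : V) (a : R) : Prop :=
  Lle k (fun z => - w z) x (- a).

Lemma measurable_outside r : measurable (outside r).
Proof.
apply: measurable_open_rV.
rewrite (_ : outside r = (fun x : V => enorm x) @^-1` `]r, +oo[%classic).
  by move/continuousP : (@cont_enorm R n); apply; exact: interval_open.
by apply/seteqP; split => y /=; rewrite in_itv/= andbT.
Qed.

Lemma growth_submul (gam : R) (x y : V) : 0 <= gam ->
  (1 + `|x + y|) `^ gam <= (1 + `|x|) `^ gam * (1 + `|y|) `^ gam.
Proof.
move=> g0; rewrite -powRM ?addr_ge0//; apply: powR_le; rewrite ?addr_ge0//.
apply: (@le_trans _ _ (1 + (`|x| + `|y|))); first by rewrite lerD2l ler_normD.
by have := mulr_ge0 (normr_ge0 x) (normr_ge0 y); lra.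
Qed.

Section Fixed.
Variables (s gam l m : R) (k : V -> R).
Hypothesis HK : kernel_setting s gam l m k.
Let s_gt0 : 0 < s. Proof. exact: (ks_s0 HK). Qed.
Let s_lt1 : s < 1. Proof. exact: (ks_s1 HK). Qed.
Let gam_gt0 : 0 < gam. Proof. exact: (ks_gam0 HK). Qed.
Let gam_lt : gam < 2 * s. Proof. exact: (ks_gam2 HK). Qed.
Let l_gt0 : 0 < l. Proof. exact: (ks_l0 HK). Qed.
Let m_gt0 : 0 < m. Proof. exact: (ks_m0 HK). Qed.
Let Hk : stable_kernel s l m k. Proof. exact: (ks_kernel HK). Qed.
Let p := n%:R + 2 * s.
Implicit Types w : V -> R.

Lemma kernel_nneg y : 0 <= k y.
Proof.
have [->|y0] := eqVneq y 0; first by rewrite (sk_zero Hk).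
apply: le_trans (sk_lower Hk y0); rewrite mulr_ge0 ?powR_ge0//; exact: ltW.
Qed.

Lemma kernel_le y : k y <= m * `|y| `^ (- p).
Proof.
have [->|y0] := eqVneq y 0; last exact: (sk_upper Hk y0).
by rewrite (sk_zero Hk) mulr_ge0 ?powR_ge0// ltW.
Qed.

Lemma adm_measurable w : growth_adm gam w -> measurable_fun setT (w : V -> measurableTypeR R).
Proof. by case. Qed.

Lemma adm_add w1 w2 : growth_adm gam w1 -> growth_adm gam w2 ->
  growth_adm gam (fun x => w1 x + w2 x).
Proof.
move=> [m1 [C1 C10 H1]] [m2 [C2 C20 H2]]; split; first exact: measurable_funD.
exists (C1 + C2); first exact: addr_ge0.
by move=> x; rewrite mulrDl (le_trans (ler_normD _ _))// lerD.
Qed.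

Lemma adm_scale c w : growth_adm gam w -> growth_adm gam (fun x => c * w x).
Proof.
move=> [mw [C C0 H]]; split; first by apply: measurable_funM => //; exact: measurable_cst.
exists (`|c| * C); first exact: mulr_ge0.
by move=> x; rewrite normrM -mulrA ler_wpM2l.
Qed.

Lemma adm_opp w : growth_adm gam w -> growth_adm gam (fun x => - w x).
Proof.
move=> /(adm_scale (-1)); by under eq_fun do rewrite mulN1r.
Qed.

Lemma measurable_shift w (a : V) : measurable_fun setT (w : V -> measurableTypeR R) ->
  measurable_fun setT ((fun x => w (x + a)) : V -> measurableTypeR R).
Proof.
move=> mw; have := measurableT_comp mw (@measurable_affine_rV R n 1 a).
by apply: eq_measurable_fun => x _ /=; rewrite scale1r.
Qed.

Lemma adm_shift w (a : V) : growth_adm gam w -> growth_adm gam (fun x => w (x + a)).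
Proof.
move=> [mw [C C0 H]]; split; first exact: measurable_shift.
exists (C * (1 + `|a|) `^ gam); first by rewrite mulr_ge0// powR_ge0.
move=> x; apply: le_trans (H _) _; rewrite -mulrA ler_wpM2l// mulrC.
by apply: growth_submul; exact: ltW.
Qed.

Lemma growth_ge1 (x : V) : 1 <= (1 + `|x|) `^ gam.
Proof. by rewrite -[X in X <= _](powR_one gam); apply: powR_le => //; rewrite ?lerDl// ltW. Qed.

Lemma adm_cst c : growth_adm gam (fun=> c).
Proof.
split; first exact: measurable_cst.
exists `|c| => // x; rewrite -[leLHS]mulr1 ler_wpM2l//.
exact: growth_ge1.
Qed.

Lemma growth_kernel_integrable r : 0 < r ->
  mu.-integrable (outside r) (fun y => ((1 + `|y|) `^ gam * k y)%:E).
Proof.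
(* [d] converts the Euclidean cut-off: [r < enorm y] forces [d < |y|], so the kernel is bounded on
   the part with [|y| <= 1]. *)
move=> r0; pose d := r / n.+1%:R; have d0 : 0 < d by rewrite divr_gt0.
have mG : measurable_fun setT (fun y : V => (1 + `|y|) `^ gam : measurableTypeR R).
  apply: (measurableT_comp (@measurable_powR R gam)).
  by apply: measurable_funD; [exact: measurable_cst|exact: measurable_norm_rV].
have mf : measurable_fun setT (fun y : V => ((1 + `|y|) `^ gam * k y)%:E).
  by apply/measurable_EFinP; apply: measurable_funM => //; exact: (sk_meas Hk).
apply/integrableP; split; first exact: measurable_funTS.
pose C1 := 2 `^ gam * (m * d `^ (- p)); pose C2 := 2 `^ gam * m.
have C10 : 0 <= C1 by rewrite !mulr_ge0 ?powR_ge0// ltW.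
have C20 : 0 <= C2 by rewrite !mulr_ge0 ?powR_ge0// ltW.
pose A := [set y : V | `|y| <= 1]; pose B := [set y : V | 1 < `|y|].
have mA : measurable A by exact: measurable_norm_le.
have mB : measurable B by exact: measurable_norm_gt.
have mP : measurable_fun setT (fun y : V => (`|y| `^ (gam - p) * \1_B y)%:E).
  apply/measurable_EFinP; apply: measurable_funM; first exact: measurable_pw.
  exact: measurable_indic.
have P0 (y : V) : (0 <= (`|y| `^ (gam - p) * \1_B y)%:E)%E.
  by rewrite lee_fin mulr_ge0 ?powR_ge0.
have m1A : measurable_fun setT (fun y : V => (\1_A y : R)%:E).
  by apply/(measurable_EFinP (R := R)); exact: measurable_indic.
apply: (@le_lt_trans _ _ (\int[mu]_y (C1%:E * (\1_A y)%:E + C2%:E * (`|y| `^ (gam - p) * \1_B y)%:E))%E).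
  rewrite integral_mkcond; apply: ge0_le_integral => //.
  - by move=> y _; rewrite patchE; case: ifP => _ //; exact: abse_ge0.
  - apply/(measurable_restrictT _ (measurable_outside r)).
    by apply: measurableT_comp => //; exact: measurable_funTS.
  - by apply: emeasurable_funD; apply: measurable_funeM.
  - move=> y _; rewrite patchE -!EFinM -EFinD; case: ifPn; last first.
      by move=> _; rewrite lee_fin addr_ge0// mulr_ge0// ?indicE// mulr_ge0// powR_ge0.
    rewrite inE /outside/= => yr.
    have dy : d < `|y|.
      by rewrite /d ltr_pdivrMr// mulrC; apply: lt_le_trans (enorm_le_norm y).
    have y0 : 0 < `|y| by exact: lt_trans dy.
    rewrite lee_fin ger0_norm ?mulr_ge0 ?powR_ge0 ?kernel_nneg//.
    have [y1|y1] := leP `|y| 1.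
      rewrite indicE mem_set// mulr1.
      apply: (@le_trans _ _ C1); last by rewrite lerDl mulr_ge0 // mulr_ge0// powR_ge0.
      apply: ler_pM; rewrite ?powR_ge0 ?kernel_nneg//.
        by apply: powR_le; [exact: ltW|rewrite addr_ge0|lra].
      apply: le_trans (kernel_le y) _; rewrite ler_wpM2l ?(ltW m_gt0)//.
      by apply: powR_anti => //; rewrite ?oppr_le0 ?addr_ge0 ?mulr_ge0// ltW.
    rewrite !indicE (@memNset _ A) ?(@mem_set _ B)//=; last by move=> /le_lt_trans /(_ y1); rewrite ltxx.
    rewrite mulr0 add0r mulr1 /C2 -mulrA.
    apply: (@le_trans _ _ ((2 * `|y|) `^ gam * (m * `|y| `^ (- p)))).
      apply: ler_pM; rewrite ?powR_ge0 ?kernel_nneg ?kernel_le//.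
      by apply: powR_le; [exact: ltW|rewrite addr_ge0|lra].
    rewrite powRM// powR_add// mulrA [X in X <= _]mulrC !mulrA.
    by rewrite le_eqVlt; apply/orP; left; apply/eqP; ring.
rewrite ge0_integralD//; first last.
- exact: measurable_funeM.
- by move=> y _; rewrite mule_ge0.
- exact: measurable_funeM.
- by move=> y _; rewrite mule_ge0// lee_fin.
rewrite !ge0_integralZl ?lee_fin// -int_indic// integral_indic// setIT.
apply: lte_add_pinfty.
  by apply: lte_mul_pinfty => //; apply: le_lt_trans (lebn_norm_le_fin ltr01) _; rewrite ltry.
apply: lte_mul_pinfty => //; apply: powR_far_integral.
by rewrite /p; move: gam_lt; lra.
Qed.

Lemma trunc_integrable r w x : 0 < r -> growth_adm gam w ->
  mu.-integrable (outside r) (EFin \o (fun y => (w x - w (x + y)) * k y)).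
Proof.
move=> r0 [mw [C C0 H]].
pose D := C * (1 + `|x|) `^ gam * 2.
apply: (@le_integrable _ _ _ _ _ (measurable_outside r) _
   (fun y => D%:E * ((1 + `|y|) `^ gam * k y)%:E)%E).
- apply: measurable_funTS; apply/measurable_EFinP; apply: measurable_funM; last exact: (sk_meas Hk).
  apply: measurable_funB; first exact: measurable_cst.
  have := measurable_shift x mw.
  by apply: eq_measurable_fun => y _; rewrite addrC.
- move=> y _; rewrite -EFinM /= lee_fin !normrM.
  rewrite (ger0_norm (kernel_nneg y)) !(@ger0_norm _ (_ `^ _)) ?powR_ge0//.
  rewrite mulrA ler_wpM2r ?kernel_nneg//.
  rewrite (ger0_norm C0) (@ger0_norm _ 2)//.
  apply: le_trans (ler_normB _ _) _.
  apply: (@le_trans _ _ (C * (1 + `|x|) `^ gam * (1 + `|y|) `^ gam + C * (1 + `|x|) `^ gam * (1 + `|y|) `^ gam)); last first.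
    by rewrite /D; rewrite le_eqVlt; apply/orP; left; apply/eqP; ring.
  apply: lerD.
    by apply: le_trans (H x) _; rewrite ler_peMr ?growth_ge1// mulr_ge0// powR_ge0.
  apply: le_trans (H _) _; rewrite -mulrA ler_wpM2l// growth_submul// ltW//.
- exact: (integrableZl (measurable_outside r) D (growth_kernel_integrable r0)).
Qed.

Lemma trunc_opD r w1 w2 x : 0 < r -> growth_adm gam w1 -> growth_adm gam w2 ->
  trunc_op k r (fun z => w1 z + w2 z) x = trunc_op k r w1 x + trunc_op k r w2 x.
Proof.
move=> r0 h1 h2; rewrite /trunc_op -RintegralD//; first last.
- exact: trunc_integrable.
- exact: trunc_integrable.
- exact: measurable_outside.
by apply: eq_Rintegral => y _; ring.
Qed.

Lemma trunc_opZ r c w x : 0 < r -> growth_adm gam w ->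
  trunc_op k r (fun z => c * w z) x = c * trunc_op k r w x.
Proof.
move=> r0 h1; rewrite /trunc_op -RintegralZl//; first last.
- exact: trunc_integrable.
- exact: measurable_outside.
by apply: eq_Rintegral => y _; ring.
Qed.

Lemma trunc_op_shift r w x a :
  trunc_op k r (fun z => w (z + a)) x = trunc_op k r w (x + a).
Proof. by rewrite /trunc_op; apply: eq_Rintegral => y _; rewrite addrAC. Qed.

Lemma Lle_add w1 w2 x a1 a2 : growth_adm gam w1 -> growth_adm gam w2 ->
  Lle k w1 x a1 -> Lle k w2 x a2 -> Lle k (fun z => w1 z + w2 z) x (a1 + a2).
Proof.
move=> h1 h2 L1 L2 e e0.
have [r1 r10 H1] := L1 (e / 2) (divr_gt0 e0 (ltr0n R 2)).
have [r2 r20 H2] := L2 (e / 2) (divr_gt0 e0 (ltr0n R 2)).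
exists (Num.min r1 r2); first by rewrite lt_min r10 r20.
move=> r r0; rewrite lt_min => /andP[rr1 rr2]; rewrite trunc_opD//.
by have := H1 r r0 rr1; have := H2 r r0 rr2; lra.
Qed.

Lemma Lle_scale c w x a : 0 <= c -> growth_adm gam w ->
  Lle k w x a -> Lle k (fun z => c * w z) x (c * a).
Proof.
move=> c0 h L e e0.
have c1 : 0 < c + 1 by rewrite ltr_wpDl.
have [r1 r10 H1] := L (e / (c + 1)) (divr_gt0 e0 c1).
exists r1 => // r r0 rr; rewrite trunc_opZ//.
have := H1 r r0 rr; move=> /(ler_wpM2l c0) /le_trans; apply.
rewrite mulrDr lerD2l mulrA ler_pdivrMr// mulrC ler_pM2l//.
by rewrite lerDl.
Qed.

Lemma Lle_mono w x a b : a <= b -> Lle k w x a -> Lle k w x b.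
Proof.
move=> ab L e e0; have [r0 r00 H] := L e e0; exists r0 => // r rp rr.
by apply: le_trans (H r rp rr) _; rewrite lerD2r.
Qed.

Lemma Lle_shift w x h a : Lle k w (x + h) a <-> Lle k (fun z => w (z + h)) x a.
Proof.
by split=> L e e0; have [r0 r00 H] := L e e0; exists r0 => // r rp rr;
  have := H r rp rr; rewrite trunc_op_shift.
Qed.

Lemma Lle_cst c x : Lle k (fun=> c) x 0.
Proof.
move=> e e0; exists 1 => // r r0 _; rewrite /trunc_op.
rewrite (_ : (fun _ => _) = cst 0); last by apply/funext => y; rewrite subrr mul0r.
by rewrite /Rintegral integral0 /= add0r ltW.
Qed.

Lemma int_outside_refl r (g : V -> R) : measurable_fun setT (g : V -> measurableTypeR R) ->
  (\int[mu]_(y in outside r) (g (- y))%:E = \int[mu]_(y in outside r) (g y)%:E)%E.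
Proof.
move=> mg; have mo := measurable_outside r.
rewrite (int_indic (fun y => g (- y)) mo) (int_indic g mo).
have mf : measurable_fun setT (fun y : V => (g y * \1_(outside r) y)%:E).
  by apply/measurable_EFinP; apply: measurable_funM => //; exact: measurable_indic.
rewrite -(integral_reflect mf); apply: eq_integral => y _; congr (_ * _)%:E.
by rewrite !indicE; congr (_%:R); congr (nat_of_bool _); apply/idP/idP; rewrite !inE /outside/= enormN.
Qed.

Lemma adm_refl w : growth_adm gam w -> growth_adm gam (fun z => w (- z)).
Proof.
move=> [mw [C C0 H]]; split.
  have := measurableT_comp mw (@measurable_affine_rV R n (-1) 0).
  by apply: eq_measurable_fun => y _ /=; rewrite scaleN1r addr0.
by exists C => // z; apply: le_trans (H _) _; rewrite normrN.
Qed.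

Lemma trunc_measurable w x : growth_adm gam w ->
  measurable_fun setT ((fun y => (w x - w (x + y)) * k y) : V -> measurableTypeR R).
Proof.
move=> [mw _]; apply: measurable_funM; last exact: (sk_meas Hk).
apply: measurable_funB; first exact: measurable_cst.
have := measurable_shift x mw.
by apply: eq_measurable_fun => y _; rewrite addrC.
Qed.

(** The reflection [z -> w (2 x - z)], produced as an admissible function, so that the facts on
    truncated operators carry over to second differences. *)
Lemma trunc_refl w x : growth_adm gam w ->
  exists2 w', growth_adm gam w' & (w' x = w x) /\ forall y, w' (x + y) = w (x - y).
Proof.
move=> h; exists (fun z => w (- (z + (- (x + x))))).
  exact: (adm_shift _ (adm_refl h)).
by split=> [|y]; congr (w _); rewrite opprB ?addrK// opprD addrACA subrr add0r.
Qed.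

Lemma trunc_op_sym r w x : 0 < r -> growth_adm gam w ->
  trunc_op k r w x = 2^-1 * \int[mu]_(y in outside r) ((2 * w x - w (x + y) - w (x - y)) * k y).
Proof.
move=> r0 h; have mo := measurable_outside r.
have [w' hw' [w'x w'y]] := trunc_refl x h.
have E : trunc_op k r w x = trunc_op k r w' x.
  rewrite /trunc_op /Rintegral -(int_outside_refl r (trunc_measurable x h)).
  by congr fine; apply: eq_integral => y _; rewrite (sk_sym Hk) w'x w'y.
have -> : trunc_op k r w x = 2^-1 * (trunc_op k r w x + trunc_op k r w x) by field.
rewrite {2}E /trunc_op -RintegralD//; last 2 first.
- exact: trunc_integrable.
- exact: trunc_integrable.
by congr (_ * _); apply: eq_Rintegral => y _; rewrite w'x w'y; ring.
Qed.

Lemma second_diff_integrable r w x : 0 < r -> growth_adm gam w ->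
  mu.-integrable (outside r) (EFin \o (fun y => (2 * w x - w (x + y) - w (x - y)) * k y)).
Proof.
move=> r0 h; have mo := measurable_outside r.
have [w' hw' [w'x w'y]] := trunc_refl x h.
have := integrableD mo (trunc_integrable x r0 h) (trunc_integrable x r0 hw').
apply: eq_integrable => // y _ /=; rewrite -EFinD w'x w'y; congr EFin; ring.
Qed.

(* Only an upper bound on second differences is needed, not smoothness. *)
Lemma Lle_semiconcave w x (G : V -> R) (A : R) : growth_adm gam w ->
  measurable_fun setT (G : V -> measurableTypeR R) -> (forall y, 0 <= G y) ->
  (forall y, w (x + y) + w (x - y) - 2 * w x <= G y) ->
  (\int[mu]_y (G y * k y)%:E <= A%:E)%E -> Lle k (fun z => - w z) x (2^-1 * A).
Proof.
move=> h mG G0 HG HA e e0; exists 1 => // r r0 _.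
have mo := measurable_outside r.
have hN := adm_opp h.
have mGk : measurable_fun setT (fun y : V => (G y * k y)%:E).
  by apply/measurable_EFinP; apply: measurable_funM => //; exact: (sk_meas Hk).
have Gk0 y : (0 <= (G y * k y)%:E)%E by rewrite lee_fin mulr_ge0// kernel_nneg.
rewrite trunc_op_sym// (@le_trans _ _ (2^-1 * A))//; last by rewrite lerDl ltW.
rewrite ler_wpM2l ?invr_ge0// -lee_fin.
have intG : mu.-integrable (outside r) (fun y => (G y * k y)%:E).
  apply/integrableP; split; first exact: measurable_funTS.
  apply: (@le_lt_trans _ _ A%:E); last by rewrite ltry.
  apply: le_trans HA; under eq_integral do rewrite gee0_abs//.
  exact: ge0_subset_integral.
apply: le_trans HA.
apply: (@le_trans _ _ (\int[mu]_(y in outside r) (G y * k y)%:E)%E); last exact: ge0_subset_integral.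
have fi := integrable_fin_num mo intG.
rewrite -(fineK fi) lee_fin -/(Rintegral _ _ _); apply: le_Rintegral => //.
  exact: (second_diff_integrable x r0 hN).
move=> y _; apply: ler_wpM2r; first exact: kernel_nneg.
by have := HG y; lra.
Qed.

Lemma outside_cover : [set y : V | y != 0] = \bigcup_N outside N.+1%:R^-1.
Proof.
apply/seteqP; split=> y /=; last first.
  move=> [N _ /=]; rewrite /outside/=; case: eqVneq => // ->.
  by rewrite /enorm /edot big1 ?sqrtr0 ?ltr0_norm// => [|i _]; rewrite ?mxE ?mul0r// invr_lt0 ltrn0.
move=> /enorm_gt0 y0; have /(@ltr_add_invr R 0)[N] := y0; rewrite add0r => HN.
by exists N.
Qed.

(** At a maximum the integrands are nonnegative, so the truncated integrals increase as the radius
    decreases. A bound on their upper limit therefore bounds each of them, and monotone convergence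
    gives the full integral. Every contact argument below ends here. *)
Lemma touching w x a : growth_adm gam w -> (forall y, w (x + y) <= w x) -> Lle k w x a ->
  (\int[mu]_y ((w x - w (x + y)) * k y)%:E <= a%:E)%E.
Proof.
move=> h hmax L.
have mf : measurable_fun setT (fun y => ((w x - w (x + y)) * k y)%:E).
  by apply/measurable_EFinP; exact: trunc_measurable.
have f0 y : (0 <= ((w x - w (x + y)) * k y)%:E)%E.
  by rewrite lee_fin mulr_ge0 ?kernel_nneg// subr_ge0.
have -> : (\int[mu]_y ((w x - w (x + y)) * k y)%:E =
   \int[mu]_(y in \bigcup_N outside N.+1%:R^-1) ((w x - w (x + y)) * k y)%:E)%E.
  rewrite [RHS]integral_mkcond; apply: eq_integral => y _.
  rewrite patchE -outside_cover; case: ifPn => //; rewrite notin_setE/= => /negP.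
  by rewrite negbK => /eqP ->; rewrite (sk_zero Hk) mulr0.
have Hr r : 0 < r -> (\int[mu]_(y in outside r) ((w x - w (x + y)) * k y)%:E <= a%:E)%E.
  move=> r0; apply/lee_addgt0Pr => e e0.
  have [r1 r10 H1] := L e e0.
  pose r' := Num.min r (r1 / 2).
  have r'0 : 0 < r' by rewrite lt_min r0 divr_gt0.
  have r'1 : r' < r1 by rewrite gt_min; apply/orP; right; lra.
  apply: (@le_trans _ _ (\int[mu]_(y in outside r') ((w x - w (x + y)) * k y)%:E)%E).
    apply: ge0_subset_integral => //; try exact: measurable_outside.
      exact: measurable_funTS.
    by move=> y; rewrite /outside/=; apply: le_lt_trans; rewrite ge_min lexx.
  have := H1 _ r'0 r'1; rewrite -lee_fin EFinD /trunc_op /Rintegral fineK//.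
  exact: (integrable_fin_num (measurable_outside _) (trunc_integrable x r'0 h)).
apply: exhaust_le => //.
- move=> i j ij y; rewrite /outside/=; apply: le_lt_trans.
  by rewrite lef_pV2 ?posrE// ler_nat.
- by move=> N; exact: measurable_outside.
- by move=> N; apply: Hr; rewrite invr_gt0.
Qed.

End Fixed.
End Kernel.

Section Compactness.
Context {R : realType}.

Lemma cont_powR_pos (T : topologicalType) (f : T -> R) (q : R) :
  continuous f -> (forall x, 0 < f x) -> continuous (fun x => f x `^ q).
Proof.
move=> cf f0.
rewrite (_ : (fun _ => _) = (fun x => expR (q * ln (f x)))); last first.
  by apply/funext => x; rewrite /powR gt_eqF.
have cl : continuous (fun x => ln (f x)).
  by move=> x; apply: (@continuous_comp T R R f (@ln R)); [exact: cf|exact: continuous_ln].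
apply: (@cont_comp R _ _ (fun x => q * ln (f x)) (@expR R)); last exact: continuous_expR.
by apply: cont_mul => //; exact: cont_cst.
Qed.

Lemma cont_closed_le (T : topologicalType) (f : T -> R) (a : R) :
  continuous f -> closed [set x | f x <= a].
Proof. by move=> cf; apply: (preimage_closed (D := [set x | x <= a])) => //; exact: closed_le. Qed.

Lemma cont_closed_ge (T : topologicalType) (f : T -> R) (a : R) :
  continuous f -> closed [set x | a <= f x].
Proof.
move=> cf; rewrite (_ : mkset _ = [set x | - f x <= - a]); last first.
  by apply/seteqP; split=> x /=; rewrite lerN2.
by apply: cont_closed_le; exact: cont_opp.
Qed.

Lemma cont_open_lt (T : topologicalType) (f : T -> R) (a : R) :
  continuous f -> open [set x | a < f x].
Proof.
move=> cf; rewrite -[X in open X]setCK openC (_ : ~` _ = [set x | f x <= a]); last first.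
  by apply/seteqP; split=> x /=; [move=> /negP; rewrite -leNgt|rewrite leNgt => /negP].
exact: cont_closed_le.
Qed.

Lemma max_on_compact (T : topologicalType) (f : T -> R) (A : set T) :
  compact A -> A !=set0 -> continuous f -> exists2 c, A c & forall t, A t -> f t <= f c.
Proof.
move=> cA A0 cf; have [c cA' H] := compact_EVT_max A0 cA (continuous_subspaceT cf).
by exists c; [rewrite inE in cA'|move=> t At; apply: H; rewrite inE].
Qed.

Lemma compact_norm_le n (c : 'rV[R]_n) (r : R) : compact [set x : 'rV[R]_n | `|x - c| <= r].
Proof.
apply: bounded_closed_compact; last first.
  apply: cont_closed_le; apply: (@cont_comp R _ _ (fun x : 'rV[R]_n => x - c) (fun x => `|x|)).
    exact: cont_shift.
  exact: cont_norm.
exists (r + `|c|); split; first by rewrite num_real.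
move=> M rM x /= xr; apply: ltW; apply: le_lt_trans rM.
by rewrite -[x](subrK c); apply: le_trans (ler_normD _ _) _; rewrite lerD2r.
Qed.

End Compactness.

Section PowerInequalities.
Context {R : realType}.

(** Concavity of [t^q], from Young's inequality with exponents [1 / q] and [1 / (1 - q)] when
    [tau = 1], and by scaling in general. *)
Lemma powR_tangent (q t tau : R) : 0 < q -> q < 1 -> 0 <= t -> 0 < tau ->
  t `^ q <= tau `^ q + q * tau `^ (q - 1) * (t - tau).
Proof.
move=> q0 q1 t0 tau0.
have key (a : R) : 0 <= a -> a `^ q <= 1 + q * (a - 1).
  move=> a0; have q1' : 0 < (1 - q)^-1 by rewrite invr_gt0 subr_gt0.
  have := @conjugate_powR R (a `^ q) 1 q^-1 (1 - q)^-1.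
  rewrite powR_ge0 ler01 invr_gt0 q0 q1' !invrK mulr1 powR_one mul1r -powRrM mulfV ?gt_eqF//.
  rewrite powRr1// => H; have := H isT isT isT isT _; rewrite addrC subrK => /(_ erefl).
  by lra.
have := key (t / tau) (divr_ge0 t0 (ltW tau0)).
move=> /(ler_wpM2l (powR_ge0 tau q)).
rewrite -powRM ?divr_ge0 ?(ltW tau0)// mulrC divfK ?gt_eqF// => /le_trans; apply.
rewrite mulrDr mulr1 lerD2l (powR_add _ _ tau0) -[-1 as X in _ * tau `^ X]/(- 1) powRN powRr1 ?(ltW tau0)//.
rewrite le_eqVlt; apply/orP; left; apply/eqP; field.
by rewrite gt_eqF.
Qed.

End PowerInequalities.

(** * Integral estimates for kernels *)

Section KernelBounds.
Context {R : realType} {n : nat}.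
Local Notation mu := (@lebn R n).
Local Notation V := 'rV[R]_n.

(** The model majorant for second differences: quadratic at small distance, of growth [gam] at large
    distance. Both ends are integrable against the kernel when [gam < 2 * s < 2]. *)
Definition sdbound (gam : R) (y : V) : R := if `|y| <= 1 then `|y| ^+ 2 else `|y| `^ gam.

Lemma sdbound_ge0 gam y : 0 <= sdbound gam y.
Proof. by rewrite /sdbound; case: ifP => _; rewrite ?exprn_ge0 ?powR_ge0. Qed.

Lemma measurable_sdbound gam : measurable_fun setT (sdbound gam : V -> measurableTypeR R).
Proof.
apply: measurable_fun_ifT.
- apply: (measurable_fun_bool true); rewrite setTI.
  rewrite (_ : _ @^-1` _ = [set y : V | `|y| <= 1]) //; exact: measurable_norm_le.
- apply: continuous_measurable_rV.
  by apply: (@cont_mul _ _ (fun x : V => `|x|) (fun x : V => `|x|)); exact: cont_norm.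
- exact: measurable_pw.
Qed.

Lemma min_le_sdbound gam (y : V) : 0 < gam -> Num.min (`|y| ^+ 2) 1 <= sdbound gam y.
Proof.
move=> g0; rewrite /sdbound; case: ifPn => [_|]; first by rewrite ge_min lexx.
rewrite -ltNge => y1; rewrite ge_min; apply/orP; right.
by rewrite -[X in X <= _](powR_one gam) powR_le ?ltW.
Qed.

Lemma sdbound_integral (s gam : R) : 0 < s -> s < 1 -> 0 < gam -> gam < 2 * s ->
  (\int[mu]_y (sdbound gam y * `|y| `^ (- (n%:R + 2 * s)))%:E < +oo)%E.
Proof.
move=> s0 s1 g0 gs; set p := n%:R + 2 * s.
pose A := [set y : V | 0 < `|y| /\ `|y| <= 1]; pose B := [set y : V | 1 < `|y|].
have mB : measurable B by exact: measurable_norm_gt.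
have mA : measurable A by apply: measurableI; [exact: measurable_norm_gt|exact: measurable_norm_le].
have mP q : measurable_fun setT (fun y : V => `|y| `^ q * \1_B y : measurableTypeR R).
  by apply: measurable_funM; [exact: measurable_pw|exact: measurable_indic].
have mPA q : measurable_fun setT (fun y : V => `|y| `^ q * \1_A y : measurableTypeR R).
  by apply: measurable_funM; [exact: measurable_pw|exact: measurable_indic].
have P0 q (C : set V) (y : V) : 0 <= `|y| `^ q * \1_C y by rewrite mulr_ge0 ?powR_ge0.
apply: (@le_lt_trans _ _ (\int[mu]_y ((`|y| `^ (2 - p) * \1_A y)%:E + (`|y| `^ (gam - p) * \1_B y)%:E))%E).
  apply: ge0_le_integral => //.
  - by move=> y _; rewrite lee_fin mulr_ge0 ?sdbound_ge0 ?powR_ge0.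
  - apply/measurable_EFinP; apply: measurable_funM; first exact: measurable_sdbound.
    exact: measurable_pw.
  - by apply: emeasurable_funD; apply/measurable_EFinP; [exact: mPA|exact: mP].
  - move=> y _; rewrite -EFinD lee_fin /sdbound; case: ifPn => y1.
      have [y0|y0] := eqVneq `|y| 0.
        by rewrite y0 expr0n/= mul0r addr_ge0.
      have yp : 0 < `|y| by rewrite lt_def y0 normr_ge0.
      rewrite -powR2// -powR_add// indicE mem_set ?mulr1; last by split.
      by rewrite lerDl.
    rewrite -ltNge in y1; rewrite -powR_add ?(lt_trans _ y1)// [\1_B y]indicE mem_set ?mulr1//.
    by rewrite lerDr.
rewrite ge0_integralD//; last 2 first.
- by apply/measurable_EFinP; exact: mPA.
- by apply/measurable_EFinP; exact: mP.
rewrite -!int_indic//; apply: lte_add_pinfty.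
  by apply: powR_near_integral; rewrite /p; lra.
by apply: powR_far_integral; rewrite /p; lra.
Qed.

Lemma kernel_sdbound (s gam m : R) : 0 < s -> s < 1 -> 0 < gam -> gam < 2 * s -> 0 < m ->
  exists2 C : R, 0 < C & forall l (k : V -> R), kernel_setting s gam l m k ->
    (\int[mu]_y (sdbound gam y * k y)%:E <= C%:E)%E.
Proof.
move=> s0 s1 g0 gs m0; set p := n%:R + 2 * s.
have := sdbound_integral s0 s1 g0 gs; rewrite -/p; set I := integral _ _ _ => HI.
have I0 : (0 <= I)%E by apply: integral_ge0 => y _; rewrite lee_fin mulr_ge0 ?sdbound_ge0 ?powR_ge0.
have If : I \is a fin_num by rewrite ge0_fin_numE.
exists (m * fine I + 1).
  by rewrite ltr_wpDl// mulr_ge0 ?fine_ge0// ltW.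
move=> l k HK; apply: (@le_trans _ _ (m%:E * I)%E); last first.
  by rewrite -(fineK If) -EFinM lee_fin lerDl.
rewrite -ge0_integralZl//; last 3 first.
- apply/measurable_EFinP; apply: measurable_funM; first exact: measurable_sdbound.
  exact: measurable_pw.
- by move=> y _; rewrite lee_fin mulr_ge0 ?sdbound_ge0 ?powR_ge0.
- by rewrite lee_fin ltW.
apply: ge0_le_integral => //.
- by move=> y _; rewrite lee_fin mulr_ge0 ?sdbound_ge0 ?(kernel_nneg HK).
- apply/measurable_EFinP; apply: measurable_funM; first exact: measurable_sdbound.
  exact: (sk_meas (ks_kernel HK)).
- apply: measurable_funeM; apply/measurable_EFinP; apply: measurable_funM; first exact: measurable_sdbound.
  exact: measurable_pw.
- move=> y _; rewrite -EFinM lee_fin mulrCA ler_wpM2l ?sdbound_ge0//.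
  exact: (kernel_le HK).
Qed.

(** Rescaling [y] by [d] reduces the claim to [d = 1] and produces the factor [d^(- 2 s)], the size
    of [L] on a bump of width [d]. *)
Lemma kernel_min_bound (s gam m : R) : 0 < s -> s < 1 -> 0 < gam -> gam < 2 * s -> 0 < m ->
  exists2 C : R, 0 < C & forall l (k : V -> R) (d : R), kernel_setting s gam l m k -> 0 < d ->
    (\int[mu]_y (Num.min (`|y| ^+ 2 / d ^+ 2) 1 * k y)%:E <= (C * d `^ (- (2 * s)))%:E)%E.
Proof.
move=> s0 s1 g0 gs m0; set p := n%:R + 2 * s.
pose F (y : V) := Num.min (`|y| ^+ 2) 1 * `|y| `^ (- p).
have mmin : measurable_fun setT ((fun y : V => Num.min (`|y| ^+ 2) 1) : V -> measurableTypeR R).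
  apply: continuous_measurable_rV; apply: cont_min; last exact: cont_cst.
  by apply: (@cont_mul _ _ (fun x : V => `|x|) (fun x : V => `|x|)); exact: cont_norm.
have mF : measurable_fun setT (fun y : V => (F y)%:E).
  by apply/measurable_EFinP; apply: measurable_funM => //; exact: measurable_pw.
have min0 (a : R) : 0 <= a -> 0 <= Num.min a 1 by move=> a0; rewrite le_min a0 ler01.
have F0 y : (0 <= (F y)%:E)%E.
  by rewrite lee_fin mulr_ge0 ?powR_ge0// min0// exprn_ge0.
pose I := (\int[mu]_y (F y)%:E)%E.
have I0 : (0 <= I)%E by apply: integral_ge0.
have If : I \is a fin_num.
  rewrite ge0_fin_numE//; apply: le_lt_trans (sdbound_integral s0 s1 g0 gs).
  apply: ge0_le_integral => //.
    apply/measurable_EFinP; apply: measurable_funM; first exact: measurable_sdbound.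
    exact: measurable_pw.
  by move=> y _; rewrite lee_fin ler_wpM2r ?powR_ge0// min_le_sdbound.
exists (m * fine I + 1).
  by rewrite ltr_wpDl// mulr_ge0 ?fine_ge0// ltW.
move=> l k d HK d0.
have mk := sk_meas (ks_kernel HK).
apply: (@le_trans _ _ (\int[mu]_y ((m * d `^ (- p))%:E * (F (d^-1 *: y))%:E))%E).
  apply: ge0_le_integral => //.
  - by move=> y _; rewrite lee_fin mulr_ge0 ?(kernel_nneg HK)// min0// divr_ge0 ?exprn_ge0// ltW.
  - apply/measurable_EFinP; apply: measurable_funM => //.
    apply: continuous_measurable_rV; apply: cont_min; last exact: cont_cst.
    apply: cont_mul; last exact: cont_cst.
    by apply: (@cont_mul _ _ (fun x : V => `|x|) (fun x : V => `|x|)); exact: cont_norm.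
  - apply: measurable_funeM; have := measurableT_comp mF (@measurable_affine_rV R n d^-1 0).
    by apply: eq_measurable_fun => y _ /=; rewrite addr0.
  - move=> y _; rewrite -EFinM lee_fin /F normrZ gtr0_norm ?invr_gt0//.
    rewrite exprMn exprVn [_^-1 * _]mulrC mulrCA.
    rewrite ler_wpM2l//; first by rewrite min0// divr_ge0 ?exprn_ge0// ltW.
    apply: le_trans (kernel_le HK y) _; rewrite -mulrA ler_wpM2l ?(ltW m0)//.
    by rewrite -powRM ?mulr_ge0 ?invr_ge0 ?(ltW d0)// mulrA mulfV ?gt_eqF// mul1r.
rewrite ge0_integralZl//; last 2 first.
- have := measurableT_comp mF (@measurable_affine_rV R n d^-1 0).
  by apply: eq_measurable_fun => y _ /=; rewrite addr0.
- by rewrite lee_fin mulr_ge0 ?powR_ge0// ltW.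
rewrite (ge0_integral_scale _ mF F0) ?invr_gt0// invrK -/I -(fineK If) -!EFinM lee_fin.
rewrite [X in X <= _](_ : _ = m * fine I * d `^ (- (2 * s))).
  by rewrite ler_wpM2r ?powR_ge0// lerDl.
have -> : d `^ (- (2 * s)) = d `^ (- p) * d ^+ n.
  by rewrite -powR_mulrn ?(ltW d0)// -powR_add//; congr (_ `^ _); rewrite /p; ring.
ring.
Qed.

(** On the box of radius [r] the kernel is at least [l * r^(- n - 2 s)], which turns [touching] into
    an integral bound on the distance to the maximal value: in measure, the function is nearly
    maximal on the box. *)
Lemma touching_ball (s gam l m : R) (k : V -> R) w x a (r : R) :
  kernel_setting s gam l m k -> growth_adm gam w -> (forall y, w (x + y) <= w x) ->
  Lle k w x a -> 0 < r ->
  (\int[mu]_(y in [set y | (`|y| <= r)%R]) (w x - w (x + y))%:E <= (a * r `^ (n%:R + 2 * s) / l)%:E)%E.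
Proof.
move=> HK h hmax L r0; set p := n%:R + 2 * s.
have l0 := ks_l0 HK; have s0 := ks_s0 HK.
have p0 : 0 <= p by rewrite addr_ge0// mulr_ge0// ltW.
have mE : measurable [set y : V | `|y| <= r] by exact: measurable_norm_le.
have mf : measurable_fun setT ((fun y => w x - w (x + y)) : V -> measurableTypeR R).
  apply: measurable_funB; first exact: measurable_cst.
  have := measurable_shift x (adm_measurable h).
  by apply: eq_measurable_fun => y _; rewrite addrC.
have mfi : measurable_fun setT (fun y => ((w x - w (x + y)) * \1_[set y : V | `|y| <= r] y)%:E).
  by apply/measurable_EFinP; apply: measurable_funM => //; exact: measurable_indic.
have T := touching HK h hmax L.
have H : ((l * r `^ (- p))%:E * \int[mu]_(y in [set y | (`|y| <= r)%R]) (w x - w (x + y))%:E <= a%:E)%E.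
  apply: le_trans T; rewrite (int_indic (fun y => w x - w (x + y)) mE) -ge0_integralZl//; last 2 first.
  - by move=> y _; rewrite lee_fin mulr_ge0 // subr_ge0.
  - by rewrite lee_fin mulr_ge0 ?powR_ge0// ltW.
  apply: ge0_le_integral => //.
  - by move=> y _; rewrite mule_ge0 ?lee_fin// mulr_ge0 ?powR_ge0 ?(ltW l0)// subr_ge0.
  - exact: measurable_funeM.
  - by apply/measurable_EFinP; exact: (trunc_measurable HK).
  - move=> y _; rewrite -EFinM lee_fin.
    have [->|y0] := eqVneq y 0; first by rewrite addr0 subrr !mul0r mulr0.
    rewrite mulrCA ler_wpM2l ?subr_ge0//.
    rewrite indicE; case: (boolP (y \in _)) => [|_]; last by rewrite mulr0 (kernel_nneg HK).
    rewrite inE/= => yr; rewrite mulr1.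
    apply: le_trans (sk_lower (ks_kernel HK) y0); rewrite ler_wpM2l ?(ltW l0)//.
    by apply: powR_anti => //; rewrite ?oppr_le0// normr_gt0.
have c0 : 0 < l * r `^ (- p) by rewrite mulr_gt0// powR_gt0.
rewrite (_ : a * r `^ p / l = (l * r `^ (- p))^-1 * a); last first.
  by rewrite powRN; field; rewrite gt_eqF ?powR_gt0// gt_eqF.
by rewrite EFinM lee_pdivlMl.
Qed.

End KernelBounds.

(** * The growth weight and second differences *)

Section Weight.
Context {R : realType} {n : nat}.
Local Notation V := 'rV[R]_n.
Implicit Types x y h : V.

Definition sdiff (U : V -> R) (h x : V) : R := U (x + h) + U (x - h) - 2 * U x.

(** Smooth and comparable to [(1 + |x|)^gam]; smoothness is the reason for the Euclidean square in
    place of the sup norm. *)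
Definition weight (gam : R) (x : V) : R := (1 + edot x x) `^ (gam / 2).

Lemma adm_of_cont (gam : R) (w : V -> R) (C : R) : continuous w ->
  (forall x, `|w x| <= C * (1 + `|x|) `^ gam) -> growth_adm gam w.
Proof.
move=> cw H; split; first exact: continuous_measurable_rV.
exists C => //; have := H 0; rewrite normr0 addr0 powR_one mulr1.
by apply: le_trans.
Qed.

Variable gam : R.
Hypotheses (gam_gt0 : 0 < gam) (gam_lt2 : gam < 2).

Let q : R := gam / 2.
Let q0 : 0 < q. Proof. by rewrite divr_gt0. Qed.
Let q1 : q < 1. Proof. by rewrite /q ltr_pdivrMr// mul1r. Qed.

Lemma weight_base_gt0 x : 0 < 1 + edot x x.
Proof. by rewrite ltr_wpDr// edot_ge0. Qed.

Lemma weight_ge1 x : 1 <= weight gam x.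
Proof.
rewrite -[X in X <= _](powR_one q); apply: powR_le; [exact: ltW|by []|].
by rewrite lerDl edot_ge0.
Qed.

Lemma cont_weight : continuous (weight gam : V -> R).
Proof.
apply: cont_powR_pos => [|x]; last exact: weight_base_gt0.
by apply: cont_add; [exact: cont_cst|exact: cont_edot].
Qed.

Lemma edot_sum_le x y : edot (x + y) (x + y) <= 2 * edot x x + 2 * edot y y.
Proof.
have := edot_ge0 (x - y); rewrite !(edotDl, edotDr, edotNl, edotNr) (edotC y x); lra.
Qed.

Lemma edot_parallelogram x y :
  edot (x + y) (x + y) + edot (x - y) (x - y) = 2 * edot x x + 2 * edot y y.
Proof. by rewrite !(edotDl, edotDr, edotNl, edotNr) (edotC y x); ring. Qed.

Lemma edot_le_growth x : 1 + edot x x <= n.+1%:R * (1 + `|x|) ^+ 2.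
Proof.
have h1 := edot_le_norm_sq x; have h2 := normr_ge0 x.
have n0 : 0 <= n%:R :> R by [].
rewrite -natr1; apply: (@le_trans _ _ (1 + n%:R * `|x| ^+ 2)); first by rewrite lerD2l.
have h3 : `|x| ^+ 2 <= (1 + `|x|) ^+ 2 by rewrite ler_sqr ?nnegrE ?addr_ge0// lerDr.
have h4 : 1 <= (1 + `|x|) ^+ 2 by rewrite expr2; have := mulr_ge0 h2 h2; lra.
by rewrite mulrDl mul1r addrC lerD// ler_wpM2l.
Qed.

Lemma weight_le_growth x : weight gam x <= n.+1%:R * (1 + `|x|) `^ gam.
Proof.
have b0 : 0 <= 1 + `|x| by rewrite addr_ge0.
apply: (@le_trans _ _ ((n.+1%:R * (1 + `|x|) ^+ 2) `^ q)).
  by apply: powR_le; [exact: ltW|exact/ltW/weight_base_gt0|exact: edot_le_growth].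
rewrite powRM ?exprn_ge0//; apply: ler_pM; rewrite ?powR_ge0//.
  rewrite -[leRHS]powRr1//; apply: ler_powR; first by rewrite ler1n.
  exact: ltW.
by rewrite -powR2// -powRrM /q mulrCA mulfV// mulr1.
Qed.

Lemma growth_le_weight x : (1 + `|x|) `^ gam <= 2 * weight gam x.
Proof.
have b0 : 0 <= 1 + `|x| by rewrite addr_ge0.
have -> : (1 + `|x|) `^ gam = ((1 + `|x|) ^+ 2) `^ q.
  by rewrite -powR2// -powRrM /q mulrCA mulfV// mulr1.
apply: (@le_trans _ _ ((2 * (1 + edot x x)) `^ q)).
  apply: powR_le; [exact: ltW|exact: exprn_ge0|].
  have := norm_sq_le_edot x; have := sqr_ge0 (1 - `|x|).
  rewrite !expr2; lra.
rewrite powRM//; last exact/ltW/weight_base_gt0.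
rewrite ler_wpM2r ?powR_ge0// -[leRHS]powRr1//; apply: ler_powR; first by lra.
exact: ltW.
Qed.

Lemma adm_weight (g : R) : gam <= g -> growth_adm g (weight gam : V -> R).
Proof.
move=> gg; apply: (@adm_of_cont g _ n.+1%:R); first exact: cont_weight.
move=> x; rewrite ger0_norm ?powR_ge0//; apply: le_trans (weight_le_growth x) _.
by rewrite ler_wpM2l//; apply: ler_powR => //; rewrite lerDl.
Qed.

(** For small [y], concavity of [t^(gam / 2)] in [t = 1 + |x|^2] and the parallelogram identity; for
    large [y], plain growth. The bound is proportional to the weight at [x] itself, so that it can
    be absorbed at a contact point. *)
Lemma weight_sdiff x y :
  weight gam (x + y) + weight gam (x - y) - 2 * weight gam x
    <= 4 * n.+1%:R * weight gam x * sdbound gam y.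
Proof.
have w1 := weight_ge1 x; have n1 : 1 <= n.+1%:R :> R by rewrite ler1n.
rewrite /sdbound; case: ifPn => y1.
  have t1 := powR_tangent q0 q1 (ltW (weight_base_gt0 (x + y))) (weight_base_gt0 x).
  have t2 := powR_tangent q0 q1 (ltW (weight_base_gt0 (x - y))) (weight_base_gt0 x).
  set c := q * (1 + edot x x) `^ (q - 1) in t1 t2.
  have c0 : 0 <= c by rewrite mulr_ge0 ?powR_ge0// ltW.
  have c1 : c <= 1.
    rewrite /c -[leRHS]mulr1; apply: ler_pM; rewrite ?powR_ge0// ?(ltW q0) ?(ltW q1)//.
    rewrite -[leRHS](powR_one (q - 1)); apply: powR_anti => //; first by rewrite subr_le0 ltW.
    by rewrite lerDl edot_ge0.
  have P := edot_parallelogram x y.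
  apply: (@le_trans _ _ (c * (2 * edot y y))).
    rewrite /weight -/q; move: t1 t2.
    set a1 := _ `^ q; set a2 := (1 + edot (x - y) _) `^ q; set a3 := _ `^ q => t1 t2.
    have -> : c * (2 * edot y y) = c * (1 + edot (x + y) (x + y) - (1 + edot x x)) + c * (1 + edot (x - y) (x - y) - (1 + edot x x)).
      by rewrite -mulrDr; congr (_ * _); lra.
    lra.
  apply: (@le_trans _ _ (2 * edot y y)).
    by rewrite ler_piMl// mulr_ge0// edot_ge0.
  apply: (@le_trans _ _ (2 * (n.+1%:R * `|y| ^+ 2))).
    rewrite ler_wpM2l//; apply: le_trans (edot_le_norm_sq y) _.
    by rewrite ler_wpM2r ?exprn_ge0// ler_nat.
  have Y0 : 0 <= n.+1%:R * `|y| ^+ 2 by rewrite mulr_ge0// exprn_ge0.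
  have := mulr_ge0 Y0 (ltW (lt_le_trans ltr01 w1)).
  have : n.+1%:R * `|y| ^+ 2 <= n.+1%:R * `|y| ^+ 2 * weight gam x by rewrite ler_peMr.
  have -> : 4 * n.+1%:R * weight gam x * `|y| ^+ 2 = 4 * (n.+1%:R * `|y| ^+ 2 * weight gam x) by ring.
  lra.
rewrite -ltNge in y1.
have far z : edot z z = edot y y -> weight gam (x + z) <= 2 * n.+1%:R * weight gam x * `|y| `^ gam.
  move=> zy; apply: (@le_trans _ _ ((2 * (1 + edot x x) * (n.+1%:R * `|y| ^+ 2)) `^ q)).
    apply: powR_le; [exact: ltW|exact/ltW/weight_base_gt0|].
    apply: (@le_trans _ _ (2 * (1 + edot x x) * (1 + edot y y))).
      have := edot_sum_le x z; rewrite zy; have := mulr_ge0 (edot_ge0 x) (edot_ge0 y).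
      have := edot_ge0 y; have := edot_ge0 x; lra.
    rewrite ler_wpM2l ?mulr_ge0//; first exact/ltW/weight_base_gt0.
    rewrite -natr1 mulrDl mul1r addrC lerD ?edot_le_norm_sq//.
    by rewrite exprn_ege1// ltW.
  have X0 := ltW (weight_base_gt0 x).
  rewrite !powRM ?mulr_ge0 ?exprn_ge0//.
  have -> : `|y| `^ q * `|y| `^ q = `|y| `^ gam.
    by rewrite -powR_add ?(lt_trans ltr01 y1)//; congr (_ `^ _); rewrite /q; field.
  rewrite mulrA ler_wpM2r ?powR_ge0// -[leRHS]mulrA [n.+1%:R * _]mulrC mulrA.
  apply: ler_pM; rewrite ?mulr_ge0 ?powR_ge0//.
    rewrite ler_wpM2r ?powR_ge0// -[leRHS]powRr1//; apply: ler_powR; first by lra.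
    exact: ltW.
  rewrite -[leRHS]powRr1//; apply: ler_powR => //; exact: ltW.
have f1 := far y erefl.
have f2 : weight gam (x - y) <= 2 * n.+1%:R * weight gam x * `|y| `^ gam.
  by apply: far; rewrite edotNl edotNr opprK.
have -> : 4 * n.+1%:R * weight gam x * `|y| `^ gam = 2 * n.+1%:R * weight gam x * `|y| `^ gam + 2 * n.+1%:R * weight gam x * `|y| `^ gam by ring.
lra.
Qed.

Lemma weight_near x d (rho : R) : 0 < rho -> `|d| <= rho ->
  weight gam (x + d) <= (1 + n.+1%:R * rho) ^+ 2 * weight gam x.
Proof.
move=> rho0 dr; set e := n.+1%:R * rho.
have e0 : 0 < e by rewrite mulr_gt0.
have b1 : 1 <= (1 + e) ^+ 2 by rewrite exprn_ege1// lerDl ltW.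
apply: (@le_trans _ _ (((1 + e) ^+ 2 * (1 + edot x x)) `^ q)).
  apply: powR_le; [exact: ltW|exact/ltW/weight_base_gt0|].
  have Nd : edot d d <= e ^+ 2.
    apply: le_trans (edot_le_norm_sq d) _; rewrite /e exprMn; apply: ler_pM => //.
      by rewrite -natrX ler_nat; apply: (leq_trans (leqnSn n)); rewrite -mulnn leq_pmulr.
    by rewrite ler_sqr ?nnegrE// ltW.
  (* Expanding this square, with [edot d d <= e^2], bounds the cross term [2 x . d] by
     [e |x|^2 + e]. *)
  have A := edot_ge0 (e *: x - d).
  rewrite !(edotDl, edotDr, edotNl, edotNr, edotZl, edotZr) (edotC d x) in A.
  rewrite !(edotDl, edotDr) (edotC d x).
  have B : 2 * edot x d <= e * edot x x + e.
    rewrite -(ler_pM2l e0); move: Nd; rewrite expr2; lra.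
  move: Nd; rewrite !expr2; have := mulr_ge0 (mulr_ge0 (ltW e0) (ltW e0)) (edot_ge0 x).
  have := mulr_ge0 (ltW e0) (edot_ge0 x); lra.
rewrite powRM ?exprn_ge0 ?(ltW (weight_base_gt0 x))// ?addr_ge0 ?(ltW e0)//.
rewrite ler_wpM2r ?powR_ge0// -[leRHS]powRr1 ?(le_trans ler01)//.
by apply: ler_powR => //; exact: ltW.
Qed.

End Weight.

Section SecondDifferences.
Context {R : realType} {n : nat}.
Local Notation V := 'rV[R]_n.
Implicit Types (x y h : V) (U : V -> R).

(** The gradient bound in integrated form, which passes to dilations, translates and averages. *)
Definition lip_growth (sig Q : R) U := forall x h,
  `|U (x + h) - U x| <= Q * `|h| * (1 + `|x| + `|h|) `^ sig.

(** The weights 1, 2, 1 add up to 4, whereas the model [|h|^(1 + bet)] gains only [2^(1 + bet) < 4]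
    when [h] is doubled. This surplus is the engine of [semiconvexity]. *)
Lemma sdiff_double U h z : sdiff U h (z + h) + 2 * sdiff U h z + sdiff U h (z - h) = sdiff U (2 *: h) z.
Proof.
rewrite /sdiff scaler_nat mulr2n addrK subrK opprD !addrA; ring.
Qed.

Lemma sdiff_growth sig Q U h x : 0 <= Q -> 0 <= sig -> lip_growth sig Q U ->
  `|sdiff U h x| <= 2 * Q * `|h| * ((1 + `|x|) `^ sig * (1 + `|h|) `^ sig).
Proof.
move=> Q0 s0 H; rewrite /sdiff.
have -> : U (x + h) + U (x - h) - 2 * U x = (U (x + h) - U x) + (U (x - h) - U x) by ring.
apply: le_trans (ler_normD _ _) _.
have := H x h; have := H x (- h); rewrite normrN => h1 h2.
have B : (1 + `|x| + `|h|) `^ sig <= (1 + `|x|) `^ sig * (1 + `|h|) `^ sig.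
  rewrite -powRM ?addr_ge0//; apply: powR_le; rewrite ?addr_ge0//.
  by have := mulr_ge0 (normr_ge0 x) (normr_ge0 h); lra.
have := ler_wpM2l (mulr_ge0 Q0 (normr_ge0 h)) B; lra.
Qed.

Lemma cont_sdiff U h : continuous U -> continuous (sdiff U h).
Proof.
move=> cU; apply: cont_sub; last by apply: cont_mul; [exact: cont_cst|].
by apply: cont_add; apply: cont_comp => //; exact: cont_shift.
Qed.

Lemma adm_sdiff sig gam Q U h : 0 <= Q -> 0 <= sig -> sig <= gam -> continuous U ->
  lip_growth sig Q U -> growth_adm gam (sdiff U h).
Proof.
move=> Q0 s0 sg cU H; apply: (@adm_of_cont _ _ gam _ (2 * Q * `|h| * (1 + `|h|) `^ sig)).
  exact: cont_sdiff.
move=> x; apply: le_trans (sdiff_growth h x Q0 s0 H) _.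
rewrite -[leRHS]mulrA; apply: ler_wpM2l; first by rewrite !mulr_ge0.
rewrite mulrC ler_wpM2l ?powR_ge0//; apply: ler_powR => //.
by rewrite lerDl.
Qed.

End SecondDifferences.

Section ClosedBox.
Context {R : realType} {n : nat}.
Local Notation mu := (@lebn R n).
Local Notation V := 'rV[R]_n.

Lemma lebn_closed_box (r : R) : 0 < r ->
  (((2 * r) ^+ n)%:E <= mu [set y : V | (`|y| <= r)%R])%E.
Proof.
move=> r0; rewrite -(lebn_box 0 r0); apply: le_measure; rewrite ?inE.
- exact: measurable_box.
- exact: measurable_norm_le.
- by move=> y /=; rewrite subr0 => /ltW.
Qed.

End ClosedBox.

(** * Semiconvexity *)

Lemma powR_lt_exp (R : realType) (a q1 q2 : R) : 1 < a -> q1 < q2 -> a `^ q1 < a `^ q2.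
Proof.
move=> a1 q12; have a0 : 0 < a by exact: lt_trans a1.
by rewrite /powR gt_eqF// ltr_expR ltr_pM2r// ln_gt0.
Qed.

Lemma cont_sdiff2 (R : realType) (n : nat) (U : 'rV[R]_n -> R) : continuous U ->
  continuous (fun z : 'rV[R]_n * 'rV[R]_n => sdiff U z.2 z.1).
Proof.
move=> cU.
have c1 : continuous (fun z : 'rV[R]_n * 'rV[R]_n => z.1 + z.2) by exact: add_continuous.
have c2 : continuous (fun z : 'rV[R]_n * 'rV[R]_n => z.1 - z.2) by exact: sub_continuous.
have c3 : continuous (fun z : 'rV[R]_n * 'rV[R]_n => z.1) by move=> z; exact: cvg_fst.
apply: cont_sub; last by apply: cont_mul; [exact: cont_cst|exact: (cont_comp c3 cU)].
by apply: cont_add; [exact: (cont_comp c1 cU)|exact: (cont_comp c2 cU)].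
Qed.

(** [eta] is the surplus [4 - 2^(1 + bet)], and [wx], [wz], [wp], [wm] are weights at nearby points.
    Their ratios stay within [(1 + e)^2], so a part [eta / 2] of the surplus survives. *)
Lemma quasi_constant_gap (R : realType) (eta e wx wz wp wm : R) :
  0 < eta -> eta <= 4 -> 0 < e -> e <= eta / 48 -> 0 < wx ->
  wz <= (1 + e) ^+ 2 * wx -> wx <= (1 + e) ^+ 2 * wp ->
  wx <= (1 + e) ^+ 2 * wz -> wx <= (1 + e) ^+ 2 * wm ->
  eta / 2 * wx <= wp + 2 * wz + wm - (4 - eta) * wz.
Proof.
move=> eta0 eta4 e_0 e_s wx0; set E := (1 + e) ^+ 2 => W0 W1 W3 W2.
have E1 : 1 <= E by rewrite exprn_ege1// lerDl ltW.
have E2 : E <= 1 + eta / 16.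
  have : e * e <= e * (1 / 12) by rewrite ler_wpM2l ?(ltW e_0)//; lra.
  by rewrite /E expr2; lra.
have E0 : 0 < E by exact: lt_le_trans E1.
rewrite -(ler_pM2l E0).
have q2 : E * ((4 - eta) * wz) <= E * ((4 - eta) * (E * wx)).
  by rewrite ler_wpM2l ?(ltW E0)// ler_wpM2l// subr_ge0.
have q4 : (E * (eta / 2) + E * ((4 - eta) * E)) * wx <= 4 * wx.
  rewrite ler_wpM2r ?(ltW wx0)//.
  have h1 : (4 - eta) * (E * E) <= (4 - eta) * ((1 + eta / 16) * (1 + eta / 16)).
    by rewrite ler_wpM2l ?subr_ge0//; apply: ler_pM => //; exact: ltW.
  have h2 : E * (eta / 2) <= (1 + eta / 16) * (eta / 2) by rewrite ler_wpM2r// divr_ge0// ltW.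
  have e2 : 0 <= eta * eta by rewrite mulr_ge0// ltW.
  have e3 : 0 <= eta * eta * eta by rewrite !mulr_ge0// ltW.
  have e4 : eta * eta <= eta * 4 by rewrite ler_wpM2l// ltW.
  clear -h1 h2 e2 e3 e4 eta0; lra.
by clear -q2 q4 W0 W1 W2 W3; lra.
Qed.

Section Semiconvexity.
Context {R : realType} {n : nat}.
Local Notation mu := (@lebn R n).
Local Notation V := 'rV[R]_n.
Implicit Types (x y h : V) (U : V -> R).

Lemma int_ball_shift (g : V -> R) (r : R) (a : V) : continuous g -> (forall y, 0 <= g y) ->
  `|a| <= r -> (\int[mu]_(y in [set y | (`|y| <= r)%R]) (g (y + a))%:E <=
    \int[mu]_(y in [set y | (`|y| <= 2 * r)%R]) (g y)%:E)%E.
Proof.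
move=> cg g0 ar.
have mE rr : measurable [set y : V | `|y| <= rr] by exact: measurable_norm_le.
have mg := continuous_measurable_rV cg.
rewrite (int_indic (fun y => g (y + a)) (mE r)) (int_indic g (mE (2 * r))).
have mf : measurable_fun setT (fun y => (g y * \1_[set y : V | `|y| <= 2 * r] y)%:E).
  by apply/measurable_EFinP; apply: measurable_funM => //; exact: measurable_indic.
rewrite -(integral_shift a mf); apply: ge0_le_integral => //.
- by move=> y _; rewrite lee_fin mulr_ge0.
- apply/measurable_EFinP; apply: measurable_funM; last exact: measurable_indic.
  exact: measurable_shift.
- have := measurableT_comp mf (@measurable_affine_rV R n 1 a).
  by apply: eq_measurable_fun => y _ /=; rewrite scale1r.
- move=> y _; rewrite lee_fin ler_wpM2l// !indicE.
  case: (boolP (y \in _)) => [|_]; last by rewrite ler0n.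
  rewrite inE/= => yr; rewrite mem_set//=.
  by apply: le_trans (ler_normD _ _) _; lra.
Qed.

(* At a minimum of [sdiff U h x / (|h|^(1 + bet) * weight gam x)], [touching_ball] makes [sdiff U h]
   nearly minimal on a whole ball, and this is incompatible with [sdiff_double] as [2^(1 + bet) < 4]. *)
Lemma semiconvexity (s gam l m sig bet : R) :
  0 < s -> s < 1 -> 0 < gam -> gam < 2 * s -> 0 < l -> 0 < m ->
  0 < sig -> sig < gam -> sig < bet -> bet < 1 ->
  exists2 C : R, 0 < C & forall kap : R, 0 < kap -> kap <= 1 ->
  exists L e0 : R, [/\ 0 < L, 0 < e0 &
  forall (k : V -> R), kernel_setting s gam l m k ->
  forall U (Q : R), 0 < Q -> continuous U -> lip_growth sig Q U ->
    (forall x h, kap <= `|h| -> `|h| <= 1 -> `|x| <= L -> sdiff U h x < 0 ->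
       Lge k (sdiff U h) x (- (e0 * Q))) ->
  forall x h, kap <= `|h| ->
    - (C * Q * `|h| `^ (1 + bet) * weight gam x) <= sdiff U h x].
Proof.
move=> s0 s1 g0 gs l0 m0 sig0 siggam sigbet bet1.
have gam2 : gam < 2 by lra.
have bet0 : 0 < bet by exact: lt_trans sigbet.
have n10 : 0 < n.+1%:R :> R by [].
have [C0 C00 HC0] := @kernel_sdbound R n s gam m s0 s1 g0 gs m0.
pose Cw : R := 2^-1 * (4 * n.+1%:R) * C0.
have Cw0 : 0 < Cw by rewrite /Cw !mulr_gt0.
pose eta : R := 4 - 2 `^ (1 + bet).
have eta0 : 0 < eta.
  rewrite subr_gt0; have -> : 4 = 2 `^ 2 :> R by rewrite powR2// expr2; ring.
  by apply: powR_lt_exp; [rewrite ltr1n|lra].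
have eta4 : eta <= 4 by rewrite /eta gerBl powR_ge0.
pose M : R := 4 * (1 + Cw) / l / (eta / 2).
have M0 : 0 < M by rewrite !mulr_gt0 ?invr_gt0 ?divr_gt0// addr_gt0.
(* Over distances [2 d1] the weights stay within the ratio that [quasi_constant_gap] allows. [d2]
   solves [(2 d2)^(2 s) = 1 / (2 M)], which brings the upper bound from [touching_ball] below the
   lower bound from doubling. *)
pose d1 : R := eta / (96 * n.+1%:R).
pose d2 : R := (2 * M) `^ (- (2 * s)^-1) / 2.
have d10 : 0 < d1 by rewrite divr_gt0// mulr_gt0.
have d20 : 0 < d2 by rewrite divr_gt0// powR_gt0// mulr_gt0.
pose del := Num.min (Num.min d1 d2) 1.
have del0 : 0 < del by rewrite !lt_min d10 d20 ltr01.
have del_d1 : del <= d1 by rewrite !ge_min lexx.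
have del_d2 : del <= d2 by rewrite !ge_min lexx orbT.
have del_1 : del <= 1 by rewrite ge_min lexx orbT.
pose Cd : R := 4 * ((del^-1 + 1) `^ sig * del `^ (sig - bet)).
pose C := Num.max Cd 1.
have C1 : 1 <= C by rewrite le_max lexx orbT.
have Cpos : 0 < C by exact: lt_le_trans C1.
exists C => // kap kap0 kap1.
(* Beyond [L] the gap between the exponents [gam] and [sig] makes the claim trivial for
   [kap <= |h| <= 1]. Only [L] and [e0 = kap^(1 + bet)] depend on [kap]; [C] does not. *)
pose L := (8 / (kap `^ bet)) `^ ((gam - sig)^-1).
have L0 : 0 < L by rewrite powR_gt0// divr_gt0// powR_gt0.
exists L, (kap `^ (1 + bet)); split; [exact: L0|exact: powR_gt0|].
move=> k HK U Q Q0 cU HU Hsup x h hk.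
have w1 z := @weight_ge1 R n gam g0 z.
have wpos z : 0 < weight gam (z : V) by exact: lt_le_trans (w1 z).
(* far from the unit scale the claim follows from the growth of [U] alone *)
have triv1 z a : del <= `|a| -> - (C * Q * `|a| `^ (1 + bet) * weight gam z) <= sdiff U a z.
  move=> da; have a0 : 0 < `|a| by exact: lt_le_trans da.
  have := sdiff_growth a z (ltW Q0) (ltW sig0) HU; rewrite ler_norml => /andP[+ _].
  apply: le_trans; rewrite lerN2.
  have B1 : (1 + `|z|) `^ sig <= 2 * weight gam z.
    apply: le_trans (growth_le_weight g0 gam2 z); apply: ler_powR; last exact: ltW.
    by rewrite lerDl.
  have B2 : (1 + `|a|) `^ sig <= (del^-1 + 1) `^ sig * del `^ (sig - bet) * `|a| `^ bet.
    apply: (@le_trans _ _ (((del^-1 + 1) * `|a|) `^ sig)).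
      apply: powR_le; [exact: ltW|by rewrite addr_ge0|].
      rewrite mulrDl mul1r lerD2r mulrC ler_pdivlMr// mul1r.
      exact: da.
    rewrite powRM ?addr_ge0 ?invr_ge0 ?(ltW del0)// -mulrA ler_wpM2l ?powR_ge0//.
    have -> : `|a| `^ sig = `|a| `^ (sig - bet) * `|a| `^ bet.
      by rewrite -powR_add// subrK.
    rewrite ler_wpM2r ?powR_ge0//; apply: powR_anti => //; lra.
  have B3 := ler_pM (powR_ge0 _ _) (powR_ge0 _ _) B1 B2.
  apply: (@le_trans _ _ (Cd * Q * `|a| `^ (1 + bet) * weight gam z)).
    rewrite powR_add// powRr1 ?normr_ge0// /Cd.
    have := ler_wpM2l (mulr_ge0 (mulr_ge0 (ler0n R 2) (ltW Q0)) (normr_ge0 a)) B3.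
    move=> /le_trans; apply; rewrite le_eqVlt; apply/orP; left; apply/eqP; ring.
  rewrite ler_wpM2r ?(ltW (wpos _))// ler_wpM2r ?powR_ge0// ler_wpM2r ?(ltW Q0)//.
  by rewrite /C le_max lexx.
have triv2 z a : kap <= `|a| -> `|a| <= 1 -> L <= `|z| ->
    - (C * Q * `|a| `^ (1 + bet) * weight gam z) <= sdiff U a z.
  move=> ka a1 Lz; have a0 : 0 < `|a| by exact: lt_le_trans ka.
  have := sdiff_growth a z (ltW Q0) (ltW sig0) HU; rewrite ler_norml => /andP[+ _].
  apply: le_trans; rewrite lerN2.
  have z0 : 0 < 1 + `|z| by rewrite ltr_wpDr.
  have B1 : (1 + `|z|) `^ sig <= (kap `^ bet / 8) * (2 * weight gam z).
    have -> : sig = (sig - gam) + gam by rewrite subrK.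
    rewrite powR_add//; apply: ler_pM; rewrite ?powR_ge0//; last exact: growth_le_weight.
    apply: (@le_trans _ _ (L `^ (sig - gam))).
      apply: powR_anti => //; first lra.
      by apply: le_trans Lz _; rewrite lerDr.
    rewrite /L -powRrM (_ : (gam - sig)^-1 * (sig - gam) = -1); last first.
      by field; rewrite subr_eq0 gt_eqF.
    by rewrite powR_inv1 ?divr_ge0 ?powR_ge0// invf_div.
  have B2 : (1 + `|a|) `^ sig <= 2.
    apply: (@le_trans _ _ (2 `^ sig)).
      apply: powR_le; [exact: ltW|by rewrite addr_ge0|lra].
    by rewrite -[leRHS]powRr1//; apply: ler_powR; lra.
  have B3 := ler_pM (powR_ge0 _ _) (powR_ge0 _ _) B1 B2.
  have B4 : kap `^ bet <= `|a| `^ bet by apply: powR_le => //; exact: ltW.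
  rewrite powR_add// powRr1 ?normr_ge0//.
  have := ler_wpM2l (mulr_ge0 (mulr_ge0 (ler0n R 2) (ltW Q0)) (normr_ge0 a)) B3.
  move=> /le_trans; apply.
  have K0 : 0 <= Q * `|a| * weight gam z by rewrite !mulr_ge0 ?(ltW Q0) ?(ltW (wpos _)).
  have -> : 2 * Q * `|a| * (kap `^ bet / 8 * (2 * weight gam z) * 2) = kap `^ bet * (Q * `|a| * weight gam z) by field.
  have -> : C * Q * (`|a| * `|a| `^ bet) * weight gam z = C * `|a| `^ bet * (Q * `|a| * weight gam z) by ring.
  rewrite ler_wpM2r//; apply: le_trans B4 _; rewrite ler_peMl// powR_ge0//.
have [hd|hd] := leP del `|h|; first exact: triv1.
have [xL|xL] := leP L `|x|.
  by apply: triv2 => //; apply: ltW; exact: lt_le_trans hd del_1.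
rewrite leNgt; apply/negP => bad.
(* The maximum with [kap] is inert on [A]; it makes the ratio continuous on the whole space. *)
pose rat (z : V * V) : R := - sdiff U z.2 z.1 * (Num.max kap `|z.2|) `^ (- (1 + bet)) * (weight gam z.1)^-1.
pose A : set (V * V) := ([set z : V | `|z - 0| <= L] `*` [set a : V | `|a - 0| <= del]) `&`
   [set z | kap <= `|z.2|].
have cA : compact A.
  apply: compact_closedI; first by apply: compact_setX; exact: compact_norm_le.
  apply: cont_closed_ge; apply: (@cont_comp R _ _ (fun z : V * V => z.2) (fun x => `|x|)).
    by move=> z; exact: cvg_snd.
  exact: cont_norm.
have A0 : A !=set0 by exists (x, h); rewrite /A/=; split => //; split => /=; rewrite subr0 ltW.
have crat : continuous rat.
  have cfst : continuous (fun z : V * V => z.1) by move=> z; exact: cvg_fst.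
  have csnd : continuous (fun z : V * V => z.2) by move=> z; exact: cvg_snd.
  apply: cont_mul; first apply: cont_mul.
  - by apply: cont_opp; exact: cont_sdiff2.
  - apply: cont_powR_pos => [|z]; last by rewrite lt_max kap0.
    by apply: cont_max; [exact: cont_cst|exact: (cont_comp csnd cont_norm)].
  - rewrite (_ : (fun _ => _) = (fun z : V * V => weight gam z.1 `^ (-1))); last first.
      by apply/funext => z; rewrite powR_inv1// ltW.
    by apply: cont_powR_pos => //; apply: (cont_comp cfst); exact: cont_weight.
have [[x1 h1] [[/= X1 H1] /= kh1] Hmax] := max_on_compact cA A0 crat.
rewrite !subr0 in X1 H1.
have ratE z a : kap <= `|a| -> - sdiff U a z = rat (z, a) * `|a| `^ (1 + bet) * weight gam z.
  move=> ka; rewrite /rat/=; have -> : Num.max kap `|a| = `|a| by apply/max_idPr.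
  have a0 : 0 < `|a| by exact: lt_le_trans ka.
  by rewrite powRN; field; rewrite gt_eqF//= gt_eqF ?powR_gt0.
pose N := rat (x1, h1).
have NC : C * Q < N.
  have : rat (x, h) <= N.
    by apply: Hmax; split => //; split => /=; rewrite subr0 ltW.
  apply: lt_le_trans.
  have h0 : 0 < `|h| by exact: lt_le_trans hk.
  have P0 : 0 < `|h| `^ (1 + bet) * weight gam x by apply: mulr_gt0; [exact: powR_gt0|exact: wpos].
  by rewrite -(ltr_pM2r P0) [rat _ * _]mulrA -ratE// mulrA; move: bad; clear; lra.
have CQ0 : 0 < C * Q by rewrite mulr_gt0.
have N0 : 0 < N by exact: lt_trans NC.
have glob z a : kap <= `|a| -> - sdiff U a z <= N * `|a| `^ (1 + bet) * weight gam z.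
  move=> ka.
  have F0 : 0 <= `|a| `^ (1 + bet) * weight gam z by rewrite mulr_ge0 ?powR_ge0 ?(ltW (wpos _)).
  have T : C * Q * `|a| `^ (1 + bet) * weight gam z <= N * `|a| `^ (1 + bet) * weight gam z.
    by rewrite -!(mulrA _ (_ `^ _)) ler_wpM2r// ltW.
  have [da|da] := leP del `|a|.
    by apply: le_trans T; rewrite lerNl; exact: triv1.
  have [zL|zL] := leP L `|z|.
    apply: le_trans T; rewrite lerNl; apply: triv2 => //; apply: ltW; exact: lt_le_trans da del_1.
  rewrite ratE// -!(mulrA _ (_ `^ _)) ler_wpM2r//; apply: Hmax; split => //.
  by split => /=; rewrite subr0 ltW.
have h10 : 0 < `|h1| by exact: lt_le_trans kh1.
pose Nh := N * `|h1| `^ (1 + bet).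
have Nh0 : 0 < Nh by rewrite mulr_gt0// powR_gt0.
pose g z := sdiff U h1 z + Nh * weight gam z.
have g_ge0 z : 0 <= g z by have := glob z h1 kh1; rewrite /g /Nh; clear; lra.
have gx1 : g x1 = 0 by have := ratE x1 h1 kh1; rewrite /g /Nh -/N; clear; lra.
have cg : continuous g.
  apply: cont_add; first exact: cont_sdiff.
  by apply: cont_mul; [exact: cont_cst|exact: cont_weight].
have aS : growth_adm gam (sdiff U h1) by exact: (adm_sdiff h1 (ltW Q0) (ltW sig0) (ltW siggam) cU HU).
have aW : growth_adm gam (weight gam : V -> R) by exact: adm_weight.
have Lw : Lle k (fun z => - weight gam z) x1 (Cw * weight gam x1).
  have K0 : 0 <= 4 * n.+1%:R * weight gam x1 by rewrite !mulr_ge0 ?(ltW (wpos _)).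
  have := @Lle_semiconcave R n s gam l m k HK (weight gam) x1
    (fun y => 4 * n.+1%:R * weight gam x1 * sdbound gam y) (4 * n.+1%:R * weight gam x1 * C0) aW.
  rewrite /Cw (_ : 2^-1 * (4 * n.+1%:R * weight gam x1 * C0) = 2^-1 * (4 * n.+1%:R) * C0 * weight gam x1); last by ring.
  apply.
  - by apply: measurable_funM; [exact: measurable_cst|exact: measurable_sdbound].
  - by move=> y; rewrite mulr_ge0 ?sdbound_ge0.
  - by move=> y; exact: weight_sdiff.
  - rewrite EFinM; under eq_integral do rewrite -mulrA EFinM.
    rewrite ge0_integralZl//.
    + by rewrite lee_wpmul2l ?lee_fin//; exact: (HC0 l).
    + apply/measurable_EFinP; apply: measurable_funM; first exact: measurable_sdbound.
      exact: (sk_meas (ks_kernel HK)).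
    + by move=> y _; rewrite lee_fin mulr_ge0 ?sdbound_ge0 ?(kernel_nneg HK).
have Lpsi : Lle k (fun z => - g z) x1 (Nh * weight gam x1 * (1 + Cw)).
  have sneg : sdiff U h1 x1 < 0.
    by have := mulr_gt0 Nh0 (wpos x1); move: gx1; rewrite /g; clear; lra.
  have := Hsup x1 h1 kh1 (le_trans H1 del_1) X1 sneg; rewrite /Lge opprK => LS.
  have LNw := Lle_scale HK (ltW Nh0) (adm_opp aW) Lw.
  have LT := Lle_add HK (adm_opp aS) (adm_scale Nh (adm_opp aW)) LS LNw.
  rewrite (_ : (fun z => - g z) = (fun z => - sdiff U h1 z + Nh * - weight gam z)); last first.
    by apply/funext => z; rewrite /g; ring.
  (* The error [e0 * Q] is at most [Nh], as [N > Q] and [|h1| >= kap], and the weight is at least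
     1. *)
  apply: Lle_mono LT; rewrite mulrDr mulr1 lerD//.
    apply: (@le_trans _ _ Nh); last by rewrite ler_peMr// ltW.
    rewrite /Nh mulrC; apply: ler_pM; rewrite ?powR_ge0 ?(ltW Q0)//.
      apply: le_trans (ltW NC); rewrite ler_peMl// ltW//.
    by apply: powR_le => //; [exact/ltW/addr_gt0|exact: ltW].
  by rewrite le_eqVlt; apply/orP; left; apply/eqP; ring.
have aG : growth_adm gam (fun z => - g z) by apply: adm_opp; apply: adm_add => //; exact: adm_scale.
have gmax y : - g (x1 + y) <= - g x1 by rewrite gx1 oppr0 oppr_le0.
have r20 : 0 < 2 * `|h1| by rewrite mulr_gt0.
have TB := touching_ball HK aG gmax Lpsi r20.
pose I2 := (\int[mu]_(y in [set y : V | (`|y| <= 2 * `|h1|)%R]) (g (x1 + y))%:E)%E.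
have HI2 : (I2 <= (Nh * weight gam x1 * (1 + Cw) * (2 * `|h1|) `^ (n%:R + 2 * s) / l)%:E)%E.
  apply: le_trans TB; rewrite le_eqVlt; apply/orP; left; apply/eqP.
  by apply: eq_integral => y _; rewrite gx1 oppr0 opprK add0r.
pose B : set V := [set y : V | `|y| <= `|h1|].
have mB : measurable B by exact: measurable_norm_le.
have cgx : continuous (fun y => g (x1 + y)).
  apply: (@cont_comp R _ _ (fun y : V => x1 + y) g) => //.
  by under eq_fun do rewrite addrC; exact: cont_shift.
have gx0 y : 0 <= g (x1 + y) by [].
have J a : `|a| <= `|h1| -> (\int[mu]_(y in B) (g (x1 + (y + a)))%:E <= I2)%E.
  by move=> ah; exact: (int_ball_shift cgx gx0 ah).
have mga a : measurable_fun setT (fun y : V => (g (x1 + (y + a)))%:E).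
  by apply/measurable_EFinP; apply: (measurable_shift a (continuous_measurable_rV cgx)).
(* Minimality at the doubled step bounds [sdiff U (2 h1)] below by [- 2^(1 + bet) * Nh] times the
   weight, while [sdiff_double] expands it with total weight 4; written in [g], the surplus is a
   positive lower bound. *)
have low y : B y -> eta / 2 * (Nh * weight gam x1) <=
    g (x1 + (y + h1)) + 2 * g (x1 + (y + 0)) + g (x1 + (y + - h1)).
  move=> yB; rewrite addr0 (addrA x1 y h1) (addrA x1 y (- h1)); set z := x1 + y.
  have S : - (N * `|2 *: h1| `^ (1 + bet) * weight gam z) <= sdiff U (2 *: h1) z.
    by rewrite lerNl; apply: glob; rewrite normrZ ger0_norm//; move: kh1 h10; clear; lra.
  move: S; rewrite normrZ (@ger0_norm _ 2)// powRM// -sdiff_double => S.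
  pose rho := 2 * `|h1|; pose e := n.+1%:R * rho.
  have rho0 : 0 < rho by rewrite mulr_gt0.
  have e_0 : 0 < e by rewrite mulr_gt0.
  have e_s : e <= eta / 48.
    have -> : eta / 48 = n.+1%:R * (2 * d1) by rewrite /d1; field; rewrite gt_eqF.
    by rewrite ler_pM2l// /rho; have := le_trans H1 del_d1; clear; lra.
  pose E := (1 + e) ^+ 2.
  have yr : `|y| <= `|h1| by [].
  have W0 : weight gam z <= E * weight gam x1.
    by apply: weight_near => //; rewrite /rho; move: (normr_ge0 h1) yr; clear; lra.
  have W z' : `|z' - x1| <= rho -> weight gam x1 <= E * weight gam z'.
    move=> zz; have -> : x1 = z' + (x1 - z') by rewrite addrC subrK.
    by apply: weight_near => //; rewrite distrC.
  have W1 : weight gam x1 <= E * weight gam (z + h1).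
    apply: W; rewrite /z addrC !addrA addNr add0r; by apply: le_trans (ler_normD _ _) _; rewrite /rho; move: yr; clear; lra.
  have W2 : weight gam x1 <= E * weight gam (z - h1).
    apply: W; rewrite /z addrC !addrA addNr add0r; by apply: le_trans (ler_normB _ _) _; rewrite /rho; move: yr; clear; lra.
  have W3 : weight gam x1 <= E * weight gam z.
    apply: W; rewrite /z addrC addrA addNr add0r /rho; move: (normr_ge0 h1) yr; clear; lra.
  have key : eta / 2 * weight gam x1 <=
     weight gam (z + h1) + 2 * weight gam z + weight gam (z - h1) - 2 `^ (1 + bet) * weight gam z.
    have -> : 2 `^ (1 + bet) = 4 - eta by rewrite /eta; ring.
    exact: (quasi_constant_gap eta0 eta4 e_0 e_s (wpos x1) W0 W1 W3 W2).
  have := ler_wpM2l (ltW Nh0) key.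
  have P2 : N * (2 `^ (1 + bet) * `|h1| `^ (1 + bet)) * weight gam z = Nh * (2 `^ (1 + bet) * weight gam z).
    by rewrite /Nh; ring.
  by rewrite P2 in S; rewrite /g; move: S; clear; lra.
clearbody g; clearbody Nh; clearbody N.
have cst0 : 0 <= eta / 2 * (Nh * weight gam x1) by apply: mulr_ge0; [exact: (divr_ge0 (ltW eta0))|apply/ltW/mulr_gt0].
(* The translates by [h1], 0 and [- h1] of the box of radius [|h1|] stay in the box of radius
   [2 |h1|], over which [I2] is the integral of [g]. *)
have lowI : ((eta / 2 * (Nh * weight gam x1))%:E * ((2 * `|h1|) ^+ n)%:E <= 4%:E * I2)%E.
  apply: (@le_trans _ _ (\int[mu]_(y in B) (eta / 2 * (Nh * weight gam x1))%:E)%E).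
    by rewrite integral_cst//; apply: lee_wpmul2l; [rewrite lee_fin|exact: lebn_closed_box].
  apply: (@le_trans _ _ (\int[mu]_(y in B) ((g (x1 + (y + h1)))%:E + (2%:E * (g (x1 + (y + 0)))%:E + (g (x1 + (y + - h1)))%:E)))%E).
    apply: ge0_le_integral => //.
    - apply: measurable_funTS; apply: emeasurable_funD => //; apply: emeasurable_funD => //.
      exact: measurable_funeM.
    - move=> y yB; rewrite -EFinM -!EFinD lee_fin; apply: le_trans (low y yB) _; by rewrite -addrA.
  have m2 : measurable_fun setT (fun y : V => (2%:E * (g (x1 + (y + 0)))%:E)%E) by exact: measurable_funeM.
  have n2 y : (0 <= 2%:E * (g (x1 + (y + 0)))%:E)%E by rewrite mule_ge0// lee_fin.
  rewrite ge0_integralD//; last 4 first.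
  - by move=> y _; rewrite lee_fin.
  - exact: measurable_funTS.
  - by move=> y _; rewrite adde_ge0// lee_fin.
  - by apply: measurable_funTS; apply: emeasurable_funD.
  rewrite ge0_integralD//; last 3 first.
  - exact: measurable_funTS.
  - by move=> y _; rewrite lee_fin.
  - exact: measurable_funTS.
  rewrite ge0_integralZl//; last 2 first.
  - exact: measurable_funTS.
  - by move=> y _; rewrite lee_fin.
  have -> : (4%:E * I2 = I2 + (2%:E * I2 + I2))%E.
    have -> : (4%:E = 1%:E + (2%:E + 1%:E) :> \bar R)%E by rewrite -!EFinD; congr EFin; ring.
    have I20 : (0 <= I2)%E by apply: integral_ge0 => y _; rewrite lee_fin.
    by rewrite !ge0_muleDl ?adde_ge0 ?lee_fin// !mul1e.
  apply: leeD; first exact: J.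
  apply: leeD; last by apply: J; rewrite normrN.
  by apply: lee_wpmul2l => //; apply: J; rewrite normr0.
have fin : eta / 2 * (Nh * weight gam x1) * (2 * `|h1|) ^+ n <=
   4 * (Nh * weight gam x1 * (1 + Cw) * (2 * `|h1|) `^ (n%:R + 2 * s) / l).
  rewrite -lee_fin EFinM; apply: le_trans lowI _; rewrite EFinM.
  by apply: lee_wpmul2l; rewrite ?lee_fin.
move: fin; rewrite powR_add// powR_mulrn ?(ltW r20)//.
set T := (2 * `|h1|) ^+ n; set Z := (2 * `|h1|) `^ (2 * s).
have T0 : 0 < T by rewrite exprn_gt0.
have Y0 : 0 < Nh * weight gam x1 * T by apply: mulr_gt0 T0; exact: mulr_gt0.
move=> fin.
have : eta / 2 <= 4 * (1 + Cw) / l * Z.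
  rewrite -(ler_pM2l Y0).
  have -> : Nh * weight gam x1 * T * (eta / 2) = eta / 2 * (Nh * weight gam x1) * T by ring.
  by apply: le_trans fin _; rewrite le_eqVlt; apply/orP; left; apply/eqP; ring.
have Z2 : Z <= (2 * M)^-1.
  apply: (@le_trans _ _ ((2 * d2) `^ (2 * s))).
    apply: powR_le; [lra|by rewrite ltW|].
    by rewrite ler_pM2l//; exact: le_trans H1 del_d2.
  rewrite /d2 mulrC divfK// -powRrM mulNr mulVf ?gt_eqF ?mulr_gt0//.
  by rewrite powR_inv1// ltW// mulr_gt0.
have K0 : 0 < 4 * (1 + Cw) / l by rewrite !mulr_gt0 ?invr_gt0 ?addr_gt0.
have : 4 * (1 + Cw) / l * Z <= 4 * (1 + Cw) / l * (2 * M)^-1 by rewrite ler_wpM2l// ltW.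
have -> : 4 * (1 + Cw) / l * (2 * M)^-1 = eta / 4.
  have i1 : eta != 0 by rewrite gt_eqF.
  have i2 : l != 0 by rewrite gt_eqF.
  have i3 : 1 + Cw != 0 by rewrite gt_eqF// addr_gt0.
  by rewrite /M; field; rewrite i1 i2 i3.
by move: eta0; clear; lra.
Qed.

End Semiconvexity.

(** * Harnack inequalities *)

Section Paraboloid.
Context {R : realType} {n : nat}.
Local Notation mu := (@lebn R n).
Local Notation V := 'rV[R]_n.
Implicit Types (x y c : V).

(** A paraboloid cut at height 1: bounded, hence admissible, and still with second differences
    bounded above, being a minimum of two such functions. *)
Definition parab (d : R) (c z : V) : R := Num.min (edot (z - c) (z - c) / d ^+ 2) 1.

Lemma parab_ge0 d c z : 0 <= parab d c z.
Proof. by rewrite /parab le_min ler01 andbT divr_ge0 ?edot_ge0// sqr_ge0. Qed.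

Lemma parab_le1 d c z : parab d c z <= 1.
Proof. by rewrite /parab ge_min lexx orbT. Qed.

Lemma parab_center d c : parab d c c = 0.
Proof.
rewrite /parab subrr [edot 0 0](_ : _ = 0) ?mul0r; last by rewrite /edot big1// => i _; rewrite mxE mul0r.
by apply/min_idPl.
Qed.

Lemma parab_far d c z : 0 < d -> d <= `|z - c| -> parab d c z = 1.
Proof.
move=> d0 dz; apply/min_idPr; rewrite ler_pdivlMr ?exprn_gt0// mul1r.
apply: le_trans (norm_sq_le_edot _); rewrite ler_sqr ?nnegrE// ltW//.
Qed.

Lemma cont_parab d c : continuous (parab d c).
Proof.
apply: cont_min; last exact: cont_cst.
apply: cont_mul; last exact: cont_cst.
apply: (@cont_comp R _ _ (fun z : V => z - c) (fun z => edot z z)); last exact: cont_edot.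
exact: cont_shift.
Qed.

Lemma adm_parab (gam : R) d c : 0 <= gam -> growth_adm gam (parab d c).
Proof.
move=> g0; apply: (@adm_of_cont _ _ gam _ 1); first exact: cont_parab.
move=> x; rewrite ger0_norm ?parab_ge0// mul1r; apply: le_trans (parab_le1 _ _ _) _.
by rewrite -[X in X <= _](powR_one gam); apply: powR_le => //; rewrite lerDl.
Qed.

Lemma parab_sdiff d c x y : 0 < d ->
  parab d c (x + y) + parab d c (x - y) - 2 * parab d c x <=
  2 * n.+1%:R * Num.min (`|y| ^+ 2 / d ^+ 2) 1.
Proof.
move=> d0; have d20 : 0 < d ^+ 2 by rewrite exprn_gt0.
have n1 : 1 <= n.+1%:R :> R by rewrite ler1n.
have a0 : 0 <= `|y| ^+ 2 / d ^+ 2 by rewrite divr_ge0 ?exprn_ge0// ltW.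
have m0 : 0 <= Num.min (`|y| ^+ 2 / d ^+ 2) 1 by rewrite le_min a0 ler01.
have p1 := parab_le1 d c (x + y); have p2 := parab_le1 d c (x - y).
have [h|h] := leP 1 (edot (x - c) (x - c) / d ^+ 2).
  have -> : parab d c x = 1 by apply/min_idPr.
  by apply: (@le_trans _ _ 0); [lra|rewrite !mulr_ge0].
have px : parab d c x = edot (x - c) (x - c) / d ^+ 2 by apply/min_idPl/ltW.
have x0 := parab_ge0 d c x.
have [ya|ya] := leP (`|y| ^+ 2 / d ^+ 2) 1; last by lra.
have q1 : parab d c (x + y) <= edot (x - c + y) (x - c + y) / d ^+ 2.
  by rewrite addrAC /parab ge_min lexx.
have q2 : parab d c (x - y) <= edot (x - c - y) (x - c - y) / d ^+ 2.
  by rewrite addrAC /parab ge_min lexx.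
rewrite px; apply: (@le_trans _ _ (2 * (edot y y / d ^+ 2))).
  have := edot_parallelogram (x - c) y; move: q1 q2; rewrite -!(mulrC (d ^+ 2)^-1).
  set I := (d ^+ 2)^-1 => q1 q2 P.
  have := congr1 ( *%R I) P; rewrite !mulrDr => E.
  lra.
rewrite -mulrA ler_pM2l// mulrA ler_pM2r ?invr_gt0//.
apply: le_trans (edot_le_norm_sq y) _.
by rewrite ler_wpM2r ?exprn_ge0// ler_nat.
Qed.

Lemma Lle_parab (s gam m : R) : 0 < s -> s < 1 -> 0 < gam -> gam < 2 * s -> 0 < m ->
  exists2 C : R, 0 < C & forall l (k : V -> R), kernel_setting s gam l m k ->
    forall (d : R) c x, 0 < d -> Lle k (fun z => - parab d c z) x (C * d `^ (- (2 * s))).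
Proof.
move=> s0 s1 g0 gs m0.
have [C1 C10 HC1] := @kernel_min_bound R n s gam m s0 s1 g0 gs m0.
have n0 : 0 < n.+1%:R :> R by [].
exists (n.+1%:R * C1); first exact: mulr_gt0.
move=> l k HK d c x d0.
have K0 : 0 <= 2 * n.+1%:R :> R by rewrite mulr_ge0.
have min0 y : 0 <= Num.min (`|y : V| ^+ 2 / d ^+ 2) 1.
  by rewrite le_min ler01 andbT divr_ge0 ?sqr_ge0// exprn_ge0.
have mmin : measurable_fun setT ((fun y : V => Num.min (`|y| ^+ 2 / d ^+ 2) 1) : V -> measurableTypeR R).
  apply: continuous_measurable_rV; apply: cont_min; last exact: cont_cst.
  apply: cont_mul; last exact: cont_cst.
  by apply: (@cont_mul _ _ (fun x : V => `|x|) (fun x : V => `|x|)); exact: cont_norm.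
have := @Lle_semiconcave R n s gam l m k HK (parab d c) x
  (fun y => 2 * n.+1%:R * Num.min (`|y| ^+ 2 / d ^+ 2) 1)
  (2 * n.+1%:R * (C1 * d `^ (- (2 * s)))) (adm_parab d c (ltW g0)).
rewrite (_ : 2^-1 * (2 * n.+1%:R * (C1 * d `^ (- (2 * s)))) = n.+1%:R * C1 * d `^ (- (2 * s))); last by field.
apply.
- by apply: measurable_funM => //; exact: measurable_cst.
- by move=> y; rewrite mulr_ge0.
- by move=> y; exact: parab_sdiff.
- rewrite EFinM; under eq_integral do rewrite -(mulrA (2 * n.+1%:R)) EFinM.
  rewrite ge0_integralZl//.
  + by rewrite lee_wpmul2l ?lee_fin//; exact: (HC1 l).
  + apply/measurable_EFinP; apply: measurable_funM => //.
    exact: (sk_meas (ks_kernel HK)).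
  + by move=> y _; rewrite lee_fin mulr_ge0 ?(kernel_nneg HK).
Qed.

End Paraboloid.

(** * Tails, local bounds and the boundary Harnack inequality *)

Section BoundaryHarnack.
Context {R : realType} {n : nat}.
Local Notation mu := (@lebn R n).
Local Notation V := 'rV[R]_n.
Implicit Types (x y c : V) (b f w : V -> R).

(** The mass of [w] in the profile of the kernel centred at [c], including the part near [c]. Upper
    and lower bounds are both stated in this quantity, so that they can be chained. *)
Definition tailI (s : R) (c : V) (w : V -> R) : \bar R :=
  (\int[mu]_y (w y * (1 + `|y - c|) `^ (- (n%:R + 2 * s)))%:E)%E.

Lemma cont_tailw (q : R) c : continuous (fun y : V => (1 + `|y - c|) `^ q).
Proof.
apply: cont_powR_pos => [|y]; last by rewrite ltr_wpDr.
apply: cont_add; first exact: cont_cst.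
by apply: (@cont_comp R _ _ (fun z : V => z - c) (fun z => `|z|)); [exact: cont_shift|exact: cont_norm].
Qed.

Section Fixed.
Variables (s gam l m : R) (k : V -> R).
Hypothesis HK : kernel_setting s gam l m k.
Let s_gt0 : 0 < s. Proof. exact: (ks_s0 HK). Qed.
Let gam_gt0 : 0 < gam. Proof. exact: (ks_gam0 HK). Qed.
Let gam_lt : gam < 2 * s. Proof. exact: (ks_gam2 HK). Qed.
Let l_gt0 : 0 < l. Proof. exact: (ks_l0 HK). Qed.
Let m_gt0 : 0 < m. Proof. exact: (ks_m0 HK). Qed.
Let p := n%:R + 2 * s.
Let p_gt0 : 0 < p. Proof. by rewrite ltr_wpDl// mulr_gt0. Qed.

Lemma measurable_tailw w c : measurable_fun setT (w : V -> measurableTypeR R) ->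
  measurable_fun setT (fun y : V => (w y * (1 + `|y - c|) `^ (- p))%:E).
Proof.
move=> mw; apply/measurable_EFinP; apply: measurable_funM => //.
by apply: continuous_measurable_rV; exact: cont_tailw.
Qed.

Lemma tailI_shift x c w : measurable_fun setT (w : V -> measurableTypeR R) ->
  (\int[mu]_y (w (x + y) * (1 + `|x + y - c|) `^ (- p))%:E = tailI s c w)%E.
Proof.
move=> mw; have E := integral_shift x (measurable_tailw c mw).
by rewrite /tailI -[RHS]E; apply: eq_integral => y _; rewrite [y + x]addrC.
Qed.

Lemma tailI_ge0 c w : (forall y, 0 <= w y) -> (0 <= tailI s c w)%E.
Proof. by move=> w0; apply: integral_ge0 => y _; rewrite lee_fin mulr_ge0 ?powR_ge0. Qed.

Lemma tailI_fin c w : growth_adm gam w -> (forall y, 0 <= w y) -> tailI s c w \is a fin_num.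
Proof.
move=> [mw [C C0 HC]] w0; rewrite ge0_fin_numE ?tailI_ge0//.
pose A := [set y : V | `|y| <= 1]; pose B := [set y : V | 1 < `|y|].
have mA : measurable A by exact: measurable_norm_le.
have mB : measurable B by exact: measurable_norm_gt.
pose D := C * (1 + `|c|) `^ gam.
have D0 : 0 <= D by rewrite mulr_ge0 ?powR_ge0.
have qn : gam - p < 0.
  by rewrite /p; have : 0 <= n%:R :> R by []; move: gam_lt; lra.
have pt (y : V) : w (y + c) * (1 + `|y|) `^ (- p) <= D * (1 + `|y|) `^ (gam - p).
  rewrite powR_add ?ltr_wpDr// mulrA ler_wpM2r ?powR_ge0//.
  apply: le_trans (le_trans (ler_norm _) (HC _)) _; rewrite /D -mulrA ler_wpM2l// mulrC.
  by apply: growth_submul; exact: ltW.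
have mP : measurable_fun setT (fun y : V => (`|y| `^ (gam - p) * \1_B y)%:E).
  apply/measurable_EFinP; apply: measurable_funM; first exact: measurable_pw.
  exact: measurable_indic.
have m1A : measurable_fun setT (fun y : V => (\1_A y : R)%:E).
  by apply/(measurable_EFinP (R := R)); exact: measurable_indic.
rewrite /tailI -(integral_shift c (measurable_tailw c mw)).
apply: (@le_lt_trans _ _ (\int[mu]_y (D%:E * (\1_A y)%:E + D%:E * (`|y| `^ (gam - p) * \1_B y)%:E))%E).
  apply: ge0_le_integral => //.
  - by move=> y _; rewrite lee_fin mulr_ge0 ?powR_ge0.
  - have := measurableT_comp (measurable_tailw c mw) (@measurable_affine_rV R n 1 c).
    by apply: eq_measurable_fun => y _ /=; rewrite scale1r.
  - by apply: emeasurable_funD; apply: measurable_funeM.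
  - move=> y _; rewrite addrK -!EFinM -EFinD lee_fin; apply: le_trans (pt y) _.
    rewrite -mulrDr ler_wpM2l//.
    have [y1|y1] := leP `|y| 1.
      rewrite indicE mem_set//=; apply: ler_wpDr; first by rewrite mulr_ge0 ?powR_ge0.
      rewrite -[leRHS](powR_one (gam - p)); apply: powR_anti => //; first exact: ltW.
      by rewrite lerDl.
    rewrite [\1_B y]indicE (@mem_set _ B)//= mulr1 ler_wpDl//.
    by apply: powR_anti; [exact: ltW|exact: lt_trans y1|rewrite lerDr].
rewrite ge0_integralD//; first last.
- exact: measurable_funeM.
- by move=> y _; rewrite mule_ge0// lee_fin// mulr_ge0 ?powR_ge0.
- exact: measurable_funeM.
- by move=> y _; rewrite mule_ge0// lee_fin.
rewrite !ge0_integralZl ?lee_fin//.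
rewrite -int_indic// integral_indic// setIT.
apply: lte_add_pinfty.
  by apply: lte_mul_pinfty => //; apply: le_lt_trans (lebn_norm_le_fin ltr01) _; rewrite ltry.
apply: lte_mul_pinfty => //; apply: powR_far_integral.
by rewrite /p; move: gam_lt; lra.
Qed.

Lemma tailI_recenter c c' w (D : R) : measurable_fun setT (w : V -> measurableTypeR R) ->
  (forall y, 0 <= w y) -> `|c - c'| <= D ->
  (tailI s c w <= ((1 + D) `^ p)%:E * tailI s c' w)%E.
Proof.
move=> mw w0 cc; have D0 : 0 <= D by exact: le_trans cc.
rewrite /tailI -ge0_integralZl//; last 3 first.
- exact: measurable_tailw.
- by move=> y _; rewrite lee_fin mulr_ge0 ?powR_ge0.
- by rewrite lee_fin powR_ge0.
apply: ge0_le_integral => //.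
- by move=> y _; rewrite lee_fin mulr_ge0 ?powR_ge0.
- exact: measurable_tailw.
- by apply: measurable_funeM; exact: measurable_tailw.
- move=> y _; rewrite -EFinM lee_fin mulrCA ler_wpM2l// -/p.
  have a0 (z : V) : 0 < 1 + `|z| by rewrite ltr_wpDr.
  rewrite !powRN -ler_pdivrMl ?powR_gt0// ?ltr_wpDr// -invfM lef_pV2 ?posrE ?mulr_gt0 ?powR_gt0 ?ltr_wpDr//.
  rewrite -powRM ?addr_ge0//; apply: powR_le; [exact: ltW|by rewrite addr_ge0|].
  have -> : y - c' = (c - c') + (y - c) by rewrite [RHS]addrC addrA subrK.
  have := ler_normD (c - c') (y - c); have := mulr_ge0 D0 (normr_ge0 (y - c)); lra.
Qed.

Lemma tailI_recenter_fine c c' w (D : R) : growth_adm gam w ->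
  (forall y, 0 <= w y) -> `|c - c'| <= D ->
  fine (tailI s c w) <= (1 + D) `^ p * fine (tailI s c' w).
Proof.
move=> aw w0 cc; have := tailI_recenter (adm_measurable aw) w0 cc.
have a1 := tailI_fin c aw w0; have a2 := tailI_fin c' aw w0.
by rewrite -[X in (X <= _)%E](fineK a1) -[X in (_ <= _ * X)%E](fineK a2) -EFinM lee_fin.
Qed.

Lemma Lle_neg_nonneg w x A : growth_adm gam w -> (forall y, 0 <= w y) -> w x = 0 ->
  (\int[mu]_y (w (x + y) * k y)%:E <= A%:E)%E -> Lle k (fun z => - w z) x A.
Proof.
move=> h w0 wx HA e e0; exists 1 => // r r0 _.
have mo : measurable (outside r : set V) by exact: measurable_outside.
have E : trunc_op k r (fun z => - w z) x = \int[mu]_(y in outside r) (w (x + y) * k y).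
  by rewrite /trunc_op; apply: eq_Rintegral => y _; rewrite wx oppr0 opprK add0r.
rewrite E; apply: (@le_trans _ _ A); last by rewrite lerDl ltW.
have := integrable_fin_num mo (trunc_integrable HK x r0 (adm_opp h)).
rewrite (_ : integral _ _ _ = \int[mu]_(y in outside r) (w (x + y) * k y)%:E)%E; last first.
  by apply: eq_integral => y _; rewrite /= wx oppr0 opprK add0r.
move=> fi; rewrite -lee_fin /Rintegral fineK//; apply: le_trans HA.
apply: ge0_subset_integral => //.
- apply/measurable_EFinP; apply: measurable_funM; last exact: (sk_meas (ks_kernel HK)).
  have := measurable_shift x (adm_measurable h).
  by apply: eq_measurable_fun => y _; rewrite addrC.
- by move=> y _; rewrite lee_fin mulr_ge0// (kernel_nneg HK).
Qed.

Lemma adm_indic w (A : set V) : measurable A -> growth_adm gam w ->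
  growth_adm gam (fun z => w z * \1_A z).
Proof.
move=> mA [mw [C C0 HC]]; split.
  by apply: measurable_funM => //; exact: measurable_indic.
exists C => // x; rewrite normrM; apply: le_trans (HC x).
by rewrite ler_piMr// indicE; case: (_ \in _); rewrite ?normr1 ?normr0.
Qed.

(** Removing [w] on [far] costs a tail: at a point off [far] only the integral of [w] against the
    kernel over [far] is left, and [D] compares the kernel with the profile centred at [c]. *)
Lemma Lle_cut w (far : set V) x c (D : R) : growth_adm gam w -> (forall y, 0 <= w y) ->
  measurable far -> ~ far x -> 0 <= D ->
  (forall y, far (x + y) -> 1 + `|x + y - c| <= D * `|y|) ->
  Lle k (fun z => - (w z * \1_far z)) x (m * D `^ p * fine (tailI s c w)).
Proof.
move=> aw w0 mfar xfar D0 HD.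
have afar := adm_indic mfar aw.
have mw := adm_measurable aw.
have mtail : measurable_fun setT (fun y => (w (x + y) * (1 + `|x + y - c|) `^ (- p))%:E).
  have := measurableT_comp (measurable_tailw c mw) (@measurable_affine_rV R n 1 x).
  by apply: eq_measurable_fun => y _ /=; rewrite scale1r addrC.
apply: Lle_neg_nonneg => //.
- by move=> y; rewrite mulr_ge0.
- by rewrite indicE memNset ?mulr0.
have c0 : 0 <= m * D `^ p by rewrite mulr_ge0 ?powR_ge0// ltW// (ks_m0 HK).
rewrite EFinM fineK ?tailI_fin// -(tailI_shift x c mw) -ge0_integralZl//; last first.
  by move=> y _; rewrite lee_fin mulr_ge0 ?powR_ge0.
apply: ge0_le_integral => //.
- by move=> y _; rewrite lee_fin !mulr_ge0// (kernel_nneg HK).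
- apply/measurable_EFinP; apply: measurable_funM; last exact: (sk_meas (ks_kernel HK)).
  have := measurable_shift x (adm_measurable afar).
  by apply: eq_measurable_fun => y _; rewrite addrC.
- exact: measurable_funeM.
move=> y _; rewrite -EFinM lee_fin indicE.
case: (boolP (_ \in far)) => [|_]; last by rewrite mulr0 mul0r !mulr_ge0 ?powR_ge0// ltW// (ks_m0 HK).
rewrite inE => yfar; rewrite mulr1 mulrCA ler_wpM2l//.
have key := HD y yfar.
have y0 : 0 < `|y|.
  rewrite lt_def normr_ge0 andbT; apply/eqP => E; move: key.
  by rewrite E mulr0 leNgt ltr_wpDr.
apply: le_trans (kernel_le HK y) _; rewrite -mulrA ler_wpM2l ?(ltW (ks_m0 HK))// -/p.
have p0' : 0 <= p by rewrite addr_ge0 ?mulr_ge0 ?(ltW (ks_s0 HK)).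
have : (1 + `|x + y - c|) `^ p <= (D * `|y|) `^ p by apply: powR_le.
rewrite [X in _ <= X]powRM// => K1.
by rewrite !powRN ler_pdivlMr ?powR_gt0 ?ltr_wpDr// mulrC ler_pdivrMr ?powR_gt0.
Qed.

(** Seen from outside, the box carries a fixed mass at distance at most [D]. This makes the operator
    strictly negative there, a reserve that can absorb other errors. *)
Lemma Lle_indic_gain x z (rho D : R) : 0 < rho -> 2 * rho <= `|x - z| -> `|x - z| + rho <= D ->
  Lle k (\1_[set y : V | `|y - z| < rho]) x (- (l * D `^ (- p) * (2 * rho) ^+ n)).
Proof.
move=> rho0 xz xD e e0; exists rho => // r r0 rr.
pose B := [set y : V | `|y - z| < rho].
have mB : measurable B by exact: measurable_box.
pose B' := [set y : V | `|y - (z - x)| < rho].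
have mB' : measurable B' by exact: measurable_box.
have D0 : 0 < D by apply: lt_le_trans xD; rewrite ltr_wpDl.
have mo : measurable (outside r : set V) by exact: measurable_outside.
have BB y : (x + y \in B) = (y \in B').
  by apply/idP/idP; rewrite !inE /B /B'/= opprB addrA [y + x]addrC.
have xB : x \in B = false.
  by apply/negbTE; rewrite notin_setE /B/= => h; have := le_lt_trans xz h; move: rho0; lra.
have far y : y \in B' -> rho <= `|y| /\ `|y| <= D.
  rewrite inE /B'/= => h.
  have t1 : `|z - x| <= `|z - x - y| + `|y| by rewrite -{1}(subrK y (z - x)) ler_normD.
  have t2 : `|y| <= `|y - (z - x)| + `|z - x| by rewrite -{1}(subrK (z - x) y) ler_normD.
  rewrite (distrC (z - x) y) in t1; rewrite (distrC x z) in xz; rewrite (distrC x z) in xD.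
  by split; move: h t1 t2 xz xD; lra.
have aB : growth_adm gam (\1_B : V -> R).
  have := adm_indic mB (@adm_cst R n s gam l m k HK 1).
  by under eq_fun do rewrite mul1r.
have fi := trunc_integrable HK x r0 aB.
have xB0 : \1_B x = 0 :> R by rewrite indicE xB.
have BB1 y : \1_B (x + y) = \1_B' y :> R by rewrite !indicE BB.
have E : trunc_op k r (\1_B) x = - \int[mu]_(y in outside r) (\1_B' y * k y).
  rewrite -mulN1r -RintegralZl//; last first.
    have := integrableZl mo (-1) fi; apply: eq_integrable => // y _ /=.
    by rewrite xB0 BB1 -EFinM; congr EFin; ring.
  by apply: eq_Rintegral => y _; rewrite xB0 BB1; ring.
rewrite E; apply: (@le_trans _ _ (- (l * D `^ (- p) * (2 * rho) ^+ n))); last by rewrite lerDl ltW.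
rewrite lerN2.
have fi2 : mu.-integrable (outside r) (EFin \o (fun y => \1_B' y * k y)).
  have := integrableZl mo (-1) fi; apply: eq_integrable => // y _ /=.
  by rewrite xB0 BB1 -EFinM; congr EFin; ring.
rewrite -lee_fin /Rintegral fineK ?(integrable_fin_num mo fi2)//.
have K0 : 0 <= l * D `^ (- p) by rewrite mulr_ge0 ?powR_ge0// ltW.
apply: (@le_trans _ _ (\int[mu]_(y in B') (l * D `^ (- p))%:E)%E).
  by rewrite integral_cst// EFinM -(lebn_box (z - x) rho0).
have mBk : measurable_fun setT (fun y : V => (\1_B' y * k y)%:E).
  by apply/measurable_EFinP; apply: measurable_funM; [exact: measurable_indic|exact: (sk_meas (ks_kernel HK))].
apply: (@le_trans _ _ (\int[mu]_(y in B') (\1_B' y * k y)%:E)%E).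
  apply: ge0_le_integral => //.
  - exact: measurable_funTS.
  - move=> y By; rewrite lee_fin indicE mem_set// mul1r.
    have [y1 y2] := far y (mem_set By).
    have y0 : 0 < `|y| by exact: lt_le_trans y1.
    have yn : y != 0 by rewrite -normr_gt0.
    apply: le_trans (sk_lower (ks_kernel HK) yn); rewrite ler_wpM2l ?(ltW l_gt0)//.
    by apply: powR_anti => //; rewrite oppr_le0 ltW.
apply: ge0_subset_integral => //.
- exact: measurable_funTS.
- by move=> y _; rewrite lee_fin mulr_ge0 ?(kernel_nneg HK).
- move=> y By; rewrite /outside/=; have [y1 _] := far y (mem_set By).
  by apply: lt_le_trans (norm_le_enorm y); exact: lt_le_trans y1.
Qed.

End Fixed.

End BoundaryHarnack.

Section BoundaryHarnack.
Context {R : realType} {n : nat}.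
Local Notation mu := (@lebn R n).
Local Notation V := 'rV[R]_n.
Implicit Types (x y c : V) (b f w : V -> R).

(** Maximising [b x * (1 - |x - c|)^(n + 1)] yields a point [x0] with [b <= 2^(n + 1) * b x0] on the
    box around it whose radius [d] is half the distance to the boundary. A paraboloid of that height
    localises a contact point, and [touching_ball] shows that [b] has mass of order [b x0 * d^n]
    nearby, up to the tail. The power [n + 1] pays for the volume [d^n]. *)
Lemma sup_bound (s gam l m : R) :
  0 < s -> s < 1 -> 0 < gam -> gam < 2 * s -> 0 < l -> 0 < m ->
  exists2 C : R, 0 < C & forall (k : V -> R), kernel_setting s gam l m k ->
    forall b c, continuous b -> growth_adm gam b -> (forall x, 0 <= b x) ->
    (forall x, `|x - c| < 1 -> 0 < b x -> Lle k b x 0) ->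
    b c <= C * fine (tailI s c b).
Proof.
move=> s0 s1 g0 gs l0 m0; set p := n%:R + 2 * s.
have p0 : 0 < p by rewrite ltr_wpDl// mulr_gt0.
have [Cp Cp0 HCp] := @Lle_parab R n s gam m s0 s1 g0 gs m0.
(* [th] is so small that, over the box of radius [th * d], the paraboloid contributes at most half
   of the left-hand side. *)
pose th := Num.min 1 ((16 * Cp / l) `^ (- (2 * s)^-1)).
have A0 : 0 < 16 * Cp / l by rewrite divr_gt0// mulr_gt0.
have th0 : 0 < th by rewrite lt_min ltr01 powR_gt0.
have th1 : th <= 1 by rewrite ge_min lexx.
have thA : th `^ (2 * s) * (16 * Cp / l) <= 1.
  rewrite -ler_pdivlMr// mul1r.
  apply: (@le_trans _ _ (((16 * Cp / l) `^ (- (2 * s)^-1)) `^ (2 * s))).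
    apply: powR_le; [by rewrite mulr_ge0// ltW|exact: ltW|by rewrite /th ge_min lexx orbT].
  by rewrite -powRrM mulNr mulVf ?gt_eqF ?mulr_gt0// powR_inv1// ltW.
pose C5 := m * 5 `^ p / l + 3 `^ p.
have C50 : 0 < C5 by rewrite addr_gt0 ?divr_gt0 ?mulr_gt0 ?powR_gt0.
exists (2 * C5 / th ^+ n); first by rewrite divr_gt0 ?exprn_gt0// mulr_gt0.
move=> k HK b c cb ab b_ge0 Hb.
set tau := fine (tailI s c b).
have tau0 : 0 <= tau by rewrite fine_ge0// tailI_ge0.
have tauE : tailI s c b = tau%:E by rewrite /tau fineK// (tailI_fin HK).
have [bc|bc] := eqVneq (b c) 0.
  by rewrite bc mulr_ge0// divr_ge0 ?exprn_ge0 ?mulr_ge0 ?ltW.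
have bc0 : 0 < b c by rewrite lt_def bc b_ge0.
pose F (x : V) := b x * Num.max 0 (1 - `|x - c|) ^+ n.+1.
have cF : continuous F.
  apply: cont_mul => //.
  have cc : continuous (fun x : V => Num.max 0 (1 - `|x - c|)).
    apply: cont_max; first exact: cont_cst.
    apply: cont_sub; first exact: cont_cst.
    by apply: (@cont_comp R _ _ (fun z : V => z - c) (fun z => `|z|)); [exact: cont_shift|exact: cont_norm].
  elim: n.+1 => [|N IH]; first by under eq_fun do rewrite expr0; exact: cont_cst.
  by under eq_fun do rewrite exprS; exact: cont_mul.
have ball0 : [set x : V | `|x - c| <= 1] !=set0 by exists c; rewrite /= subrr normr0.
have [x0 /= x0B Hmax] := max_on_compact (@compact_norm_le R n c 1) ball0 cF.
have FE x : `|x - c| <= 1 -> F x = b x * (1 - `|x - c|) ^+ n.+1.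
  by move=> h; rewrite /F; congr (_ * _ ^+ _); apply/max_idPr; rewrite subr_ge0.
have Fc : F c = b c by rewrite FE subrr normr0// subr0 expr1n mulr1.
have F0 : b c <= F x0 by rewrite -Fc; apply: Hmax; rewrite /= subrr normr0.
have x0lt : `|x0 - c| < 1.
  rewrite lt_neqAle x0B andbT; apply/eqP => E; move: F0.
  by rewrite FE// E subrr expr0n/= mulr0 leNgt bc0.
have [d d0 d2] : exists2 d : R, 0 < d & 1 - `|x0 - c| = 2 * d.
  by exists ((1 - `|x0 - c|) / 2); [rewrite divr_gt0// subr_gt0|field].
have dle : d <= 2^-1 by move: d2 (normr_ge0 (x0 - c)); clear; lra.
pose b0 := b x0.
have b00 : 0 <= b0 by exact: b_ge0.
pose h := 2 ^+ n.+1 * b0.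
have bnear x : `|x - x0| <= d -> b x <= h.
  move=> xd; have t : `|x - c| <= `|x - x0| + `|x0 - c|.
    by rewrite -{1}(subrK x0 x) -addrA ler_normD.
  have dc : d <= 1 - `|x - c| by move: t xd d2; clear; lra.
  have xc : `|x - c| <= 1 by move: dc d0; clear; lra.
  have := Hmax x xc; rewrite !FE// d2 exprMn => H.
  have P0 : 0 < d ^+ n.+1 by rewrite exprn_gt0.
  rewrite -(ler_pM2r P0); apply: (@le_trans _ _ (b x * (1 - `|x - c|) ^+ n.+1)).
    rewrite ler_wpM2l//; rewrite lerXn2r ?nnegrE ?(ltW d0)//.
    by move: dc d0; clear; lra.
  by apply: le_trans H _; rewrite /h le_eqVlt; apply/orP; left; apply/eqP; rewrite /b0; ring.
have d20 : 0 < d / 2 by rewrite divr_gt0.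
pose far : set V := ~` [set z : V | `|z - x0| < d].
have mfar : measurable far by apply: measurableC; exact: measurable_box.
(* At distance [d / 2] the paraboloid has reached the height [h], so [psi] is nonpositive from there
   on and its maximum over the box of radius [d / 2] is global. The values of [b] beyond [d] are cut
   off and charged to the tail. *)
pose psi (z : V) := b z + - (b z * \1_far z) + h * - parab (d / 2) x0 z.
have h_ge0 : 0 <= h by rewrite mulr_ge0// exprn_ge0.
have psiE z : `|z - x0| < d -> psi z = b z - h * parab (d / 2) x0 z.
  move=> zd; rewrite /psi indicE memNset; last by move=> /(_ zd).
  by rewrite mulr0 oppr0 addr0 mulrN.
have psi_far z : d / 2 <= `|z - x0| -> psi z <= 0.
  move=> zd; rewrite /psi (parab_far d20 zd) mulrN1.
  have [zd2|zd2] := ltP `|z - x0| d.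
    rewrite indicE memNset; last by move=> /(_ zd2).
    by rewrite mulr0 oppr0 addr0 subr_le0; apply: bnear; exact: ltW.
  rewrite indicE mem_set; last by move=> /= h'; have := lt_le_trans h' zd2; rewrite ltxx.
  by rewrite mulr1 subrr add0r oppr_le0.
have psi0 : psi x0 = b0.
  by rewrite psiE ?subrr ?normr0// parab_center mulr0 subr0.
have b0_gt0 : 0 < b0.
  rewrite lt_def b00 andbT; apply/eqP => E; move: F0.
  by rewrite FE// -/b0 E mul0r leNgt bc0.
have cpsi' : continuous (fun z => b z - h * parab (d / 2) x0 z).
  by apply: cont_sub => //; apply: cont_mul; [exact: cont_cst|exact: cont_parab].
have ball1 : [set x : V | `|x - x0| <= d / 2] !=set0 by exists x0; rewrite /= subrr normr0 ltW.
have [x1 /= x1B Hmax1] := max_on_compact (@compact_norm_le R n x0 (d / 2)) ball1 cpsi'.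
have x1d : `|x1 - x0| < d by apply: le_lt_trans x1B _; move: d0; clear; lra.
have psi1 : b0 <= psi x1.
  have := Hmax1 x0; rewrite /= subrr normr0 (ltW d20) => /(_ isT).
  by rewrite parab_center mulr0 subr0 psiE.
have gmax y : psi (x1 + y) <= psi x1.
  have [yd|yd] := leP `|x1 + y - x0| (d / 2).
    have yd2 : `|x1 + y - x0| < d by apply: le_lt_trans yd _; move: d0; clear; lra.
    by rewrite !psiE//; exact: Hmax1.
  by apply: le_trans (psi_far _ (ltW yd)) _; apply: le_trans psi1.
have bx1 : 0 < b x1.
  apply: lt_le_trans b0_gt0 _; apply: le_trans psi1 _; rewrite psiE// gerBl.
  by rewrite mulr_ge0 ?parab_ge0.
have x1c : `|x1 - c| < 1.
  have t : `|x1 - c| <= `|x1 - x0| + `|x0 - c| by rewrite -{1}(subrK x0 x1) -addrA ler_normD.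
  by move: t x1B d2 d0; clear; lra.
have mb := adm_measurable ab.
have afar : growth_adm gam (fun z => b z * \1_far z) by exact: adm_indic.
have ap : growth_adm gam (parab (d / 2) x0) by apply: adm_parab; exact: ltW.
have mtail : measurable_fun setT (fun y => (b (x1 + y) * (1 + `|x1 + y - c|) `^ (- p))%:E).
  have := measurableT_comp (measurable_tailw s c mb) (@measurable_affine_rV R n 1 x1).
  by apply: eq_measurable_fun => y _ /=; rewrite scale1r addrC.
have tailshift : (\int[mu]_y (b (x1 + y) * (1 + `|x1 + y - c|) `^ (- p))%:E = tau%:E)%E.
  by rewrite -tauE; exact: tailI_shift.
have Lfar : Lle k (fun z => - (b z * \1_far z)) x1 (m * (5 / d) `^ p * tau).
  apply: (Lle_cut HK) => //.
    by rewrite divr_ge0// ltW.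
  move=> y; rewrite /far /= => /negP; rewrite -leNgt => yfar.
  have t1 : `|x1 + y - x0| <= `|x1 - x0| + `|y| by rewrite addrAC ler_normD.
  have t2 : `|x1 + y - c| <= `|x1 - c| + `|y| by rewrite addrAC ler_normD.
  have y1 : d / 2 <= `|y| by move: t1 yfar x1B; clear; lra.
  have e1 : 2 <= 4 / d * `|y|.
    have -> : 2 = 4 / d * (d / 2) by field; rewrite gt_eqF.
    by rewrite ler_wpM2l// divr_ge0// ltW.
  have e2 : `|y| <= d^-1 * `|y|.
    rewrite ler_peMl// -[leLHS]invr1 lef_pV2 ?posrE//; move: dle; clear; lra.
  have -> : 5 / d * `|y| = 4 / d * `|y| + d^-1 * `|y| by ring.
  by move: e1 e2 t2 x1c; clear; lra.
have Lpar := HCp l k HK (d / 2) x0 x1 d20.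
have Lb := Hb x1 x1c bx1.
have aN1 := adm_opp afar; have aN2 := adm_opp ap.
have Lpsi := Lle_add HK (adm_add ab aN1) (adm_scale h aN2) (Lle_add HK ab aN1 Lb Lfar) (Lle_scale HK h_ge0 aN2 Lpar).
rewrite add0r -/psi in Lpsi.
set a := (X in Lle _ _ _ X) in Lpsi.
have apsi : growth_adm gam psi by apply: adm_add; [exact: adm_add|exact: adm_scale].
pose r := th * d.
have r0 : 0 < r by rewrite mulr_gt0.
have rd : r <= d by rewrite /r ger_pMl.
have TB := touching_ball HK apsi gmax Lpsi r0.
pose B : set V := [set y : V | `|y| <= r].
have mB : measurable B by exact: measurable_norm_le.
have mpsi1 : measurable_fun setT (fun y => (psi x1 - psi (x1 + y))%:E).
  apply/measurable_EFinP; apply: measurable_funB; first exact: measurable_cst.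
  have := measurable_shift x1 (adm_measurable apsi).
  by apply: eq_measurable_fun => y _; rewrite addrC.
have mb1 : measurable_fun setT (fun y => (b (x1 + y))%:E).
  apply/measurable_EFinP; have := measurable_shift x1 mb.
  by apply: eq_measurable_fun => y _; rewrite addrC.
have I1 : (b0%:E * ((2 * r) ^+ n)%:E <= (a * r `^ p / l)%:E + (3 `^ p * tau)%:E)%E.
  apply: (@le_trans _ _ (\int[mu]_(y in B) b0%:E)%E).
    by rewrite integral_cst//; apply: lee_wpmul2l; [rewrite lee_fin|exact: lebn_closed_box].
  apply: (@le_trans _ _ (\int[mu]_(y in B) ((psi x1 - psi (x1 + y))%:E + (b (x1 + y))%:E))%E).
    apply: ge0_le_integral => //.
    - by apply: measurable_funTS; exact: emeasurable_funD.
    - move=> y _; rewrite -EFinD lee_fin.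
      have : psi (x1 + y) <= b (x1 + y).
        rewrite /psi mulrN; have z1 : 0 <= b (x1 + y) * \1_far (x1 + y) by rewrite mulr_ge0.
        have z2 : 0 <= h * parab (d / 2) x0 (x1 + y) by rewrite mulr_ge0 ?parab_ge0.
        by move: z1 z2; clear; lra.
      by move: psi1; clear; lra.
  rewrite ge0_integralD//; last 4 first.
  - by move=> y _; rewrite lee_fin subr_ge0.
  - exact: measurable_funTS.
  - by move=> y _; rewrite lee_fin.
  - exact: measurable_funTS.
  apply: leeD; first exact: TB.
  rewrite EFinM -tailshift -ge0_integralZl//; last by move=> y _; rewrite lee_fin mulr_ge0 ?powR_ge0.
  rewrite (int_indic (fun y => b (x1 + y)) mB); apply: ge0_le_integral => //.
  - by move=> y _; rewrite lee_fin mulr_ge0.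
  - by apply/measurable_EFinP; apply: measurable_funM; [exact/measurable_EFinP|exact: measurable_indic].
  - exact: measurable_funeM.
  - move=> y _; rewrite -EFinM lee_fin mulrCA ler_wpM2l// indicE.
    case: (boolP (_ \in B)) => [|_]; last by rewrite mulr_ge0 ?powR_ge0.
    rewrite inE /B/= => yr.
    have t2 : `|x1 + y - c| <= `|x1 - c| + `|y| by rewrite addrAC ler_normD.
    rewrite powRN ler_pdivlMr ?powR_gt0 ?ltr_wpDr// mul1r.
    apply: powR_le; [exact: ltW|by rewrite addr_ge0|].
    by move: t2 yr rd dle x1c; clear; lra.
move: I1; rewrite -EFinD -EFinM lee_fin.
have fin : b0 * (2 * r) ^+ n <= a * r `^ p / l + 3 `^ p * tau ->
   b0 * d ^+ n * 2 ^+ n <= 2 * C5 / th ^+ n * tau.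
  have rp : r `^ p = th `^ p * d `^ p by rewrite /r powRM// ltW.
  have thp : th `^ p <= 1.
    by rewrite -[leRHS](powR_one p); apply: powR_le => //; exact: ltW.
  have thn : 0 < th ^+ n by rewrite exprn_gt0.
  have dn : 0 < d ^+ n by rewrite exprn_gt0.
  have aE : a * r `^ p / l = th `^ p * (m * 5 `^ p / l) * tau + th `^ p * (h * Cp * ((d / 2) `^ (- (2 * s)) * d `^ p)) / l.
    have E5 : (5 / d) `^ p = 5 `^ p * d^-1 `^ p by rewrite powRM// invr_ge0 (ltW d0).
    rewrite rp /a E5.
    have -> : d^-1 `^ p = (d `^ p)^-1 by rewrite -powR_inv1 ?(ltW d0)// -powRrM mulN1r powRN.
    have dp : d `^ p != 0 by rewrite gt_eqF// powR_gt0.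
    have l_neq0 : l != 0 by rewrite gt_eqF.
    by field; rewrite ?dp ?l_neq0.
  have dd : (d / 2) `^ (- (2 * s)) * d `^ p = 2 `^ (2 * s) * d ^+ n.
    rewrite powRM ?invr_ge0 ?(ltW d0)//.
    have -> : 2^-1 `^ (- (2 * s)) = 2 `^ (2 * s) :> R by rewrite -powR_inv1// -powRrM mulN1r opprK.
    rewrite mulrAC mulrC; congr (_ * _); rewrite -powR_add// -powR_mulrn ?(ltW d0)//.
    by congr (_ `^ _); rewrite /p; ring.
  have two_s : 2 `^ (2 * s) <= 4 :> R.
    have -> : 4 = 2 `^ 2 :> R by rewrite powR2// expr2; ring.
    by apply: ler_powR; [rewrite ler1n|move: s1; clear; lra].
  have thpE : th `^ p = th ^+ n * th `^ (2 * s) by rewrite powR_add// powR_mulrn// ltW.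
  rewrite aE dd => H.
  have small : th `^ p * (h * Cp * (2 `^ (2 * s) * d ^+ n)) / l <= 2^-1 * (b0 * (2 * r) ^+ n).
    rewrite thpE /h exprS exprMn [r ^+ n]exprMn.
    have -> : th ^+ n * th `^ (2 * s) * (2 * 2 ^+ n * b0 * Cp * (2 `^ (2 * s) * d ^+ n)) / l =
      (b0 * (2 ^+ n * (th ^+ n * d ^+ n))) * (th `^ (2 * s) * (2 * Cp / l) * 2 `^ (2 * s)) by ring.
    have -> : 2^-1 * (b0 * (2 ^+ n * (th ^+ n * d ^+ n))) = (b0 * (2 ^+ n * (th ^+ n * d ^+ n))) * 2^-1 by ring.
    rewrite ler_wpM2l ?mulr_ge0 ?exprn_ge0 ?(ltW th0) ?(ltW d0)//.
    have X0 : 0 <= th `^ (2 * s) * (2 * Cp / l) by rewrite mulr_ge0 ?powR_ge0// divr_ge0 ?mulr_ge0 ?ltW.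
    apply: (@le_trans _ _ (th `^ (2 * s) * (2 * Cp / l) * 4)); first by rewrite ler_wpM2l.
    have -> : th `^ (2 * s) * (2 * Cp / l) * 4 = (th `^ (2 * s) * (16 * Cp / l)) * 2^-1 by field; rewrite gt_eqF.
    by rewrite ler_piMl// invr_ge0.
  have main : b0 * (2 * r) ^+ n <= 2 * C5 * tau.
    have : th `^ p * (m * 5 `^ p / l) * tau <= m * 5 `^ p / l * tau.
      by rewrite ler_wpM2r// ler_piMl// divr_ge0 ?mulr_ge0 ?powR_ge0// ltW.
    have -> : 2 * C5 * tau = 2 * (m * 5 `^ p / l * tau) + 2 * (3 `^ p * tau) by rewrite /C5; ring.
    by move: H small; clear; lra.
  have -> : b0 * d ^+ n * 2 ^+ n = b0 * (2 * r) ^+ n / th ^+ n.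
    by rewrite /r !exprMn; field; rewrite gt_eqF.
  have -> : 2 * C5 / th ^+ n * tau = 2 * C5 * tau / th ^+ n by ring.
  by rewrite ler_wpM2r// invr_ge0 ltW.
move=> /fin /(le_trans _); apply; apply: le_trans F0 _.
rewrite FE// d2 exprMn !exprS -/b0.
have -> : b0 * (2 * 2 ^+ n * (d * d ^+ n)) = (b0 * d ^+ n * 2 ^+ n) * (2 * d) by ring.
rewrite ler_piMr// ?mulr_ge0 ?exprn_ge0 ?(ltW d0)//.
by move: dle; clear; lra.
Qed.


End BoundaryHarnack.

Section BoundaryHarnack.
Context {R : realType} {n : nat}.
Local Notation mu := (@lebn R n).
Local Notation V := 'rV[R]_n.
Implicit Types (x y c : V) (b f w : V -> R).

(** Touching [f] from below near [c] by a downward paraboloid of height [f c] bounds the integral in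
    [touching] by a multiple of [f c]. The lower bound of the kernel holds at all distances, so this
    integral controls the entire tail of [f]. *)
Lemma inf_bound (s gam l m rho : R) :
  0 < s -> s < 1 -> 0 < gam -> gam < 2 * s -> 0 < l -> 0 < m -> 0 < rho -> rho <= 1 ->
  exists2 C : R, 0 < C & forall (k : V -> R), kernel_setting s gam l m k ->
    forall f c, continuous f -> growth_adm gam f -> (forall x, 0 <= f x) ->
    (forall x, `|x - c| < rho -> Lge k f x 0) ->
    fine (tailI s c f) <= C * f c.
Proof.
move=> s0 s1 g0 gs l0 m0 rho0 rho1; set p := n%:R + 2 * s.
have p0 : 0 < p by rewrite ltr_wpDl// mulr_gt0.
have [Cp Cp0 HCp] := @Lle_parab R n s gam m s0 s1 g0 gs m0.
pose A := Cp * (rho / 2) `^ (- (2 * s)).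
have A0 : 0 < A by rewrite mulr_gt0// powR_gt0// divr_gt0.
exists (A / l + 4 ^+ n); first by rewrite addr_gt0 ?exprn_gt0// divr_gt0.
move=> k HK f c cf af f0 Hf.
set t := f c; have t0 : 0 <= t by exact: f0.
have d0 : 0 < rho / 2 by rewrite divr_gt0.
pose psi z := t * - parab (rho / 2) c z + - f z.
have cpsi : continuous psi.
  apply: cont_add; last exact: cont_opp.
  by apply: cont_mul; [exact: cont_cst|apply: cont_opp; exact: cont_parab].
have ball0 : [set x : V | `|x - c| <= rho / 2] !=set0 by exists c; rewrite /= subrr normr0 ltW.
have [x0 /= x0B Hmax] := max_on_compact (@compact_norm_le R n c (rho / 2)) ball0 cpsi.
have psic : psi c = - t by rewrite /psi parab_center oppr0 mulr0 add0r.
have psi0 : - t <= psi x0 by rewrite -psic; apply: Hmax; rewrite /= subrr normr0 ltW.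
have gmax y : psi (x0 + y) <= psi x0.
  have [yd|yd] := leP `|x0 + y - c| (rho / 2); first exact: Hmax.
  apply: le_trans psi0; rewrite /psi (parab_far d0 (ltW yd)) mulrN1 gerDl oppr_le0//.
have x0r : `|x0 - c| < rho by apply: le_lt_trans x0B _; move: rho0; clear; lra.
have ap : growth_adm gam (parab (rho / 2) c) by apply: adm_parab; exact: ltW.
have aN := adm_opp ap; have afN := adm_opp af.
have apsi : growth_adm gam psi by apply: adm_add => //; exact: adm_scale.
have Lpsi : Lle k psi x0 (t * A).
  have := Lle_add HK (adm_scale t aN) afN (Lle_scale HK t0 aN (HCp l k HK (rho / 2) c x0 d0)) (Hf x0 x0r).
  by rewrite oppr0 addr0.
have TB := touching HK apsi gmax Lpsi.
have mf := adm_measurable af.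
(* Off [B] the paraboloid equals 1 and the distance to the maximum dominates [f]; on [B] it does so
   up to [t], at the cost of [t * 4^n]. *)
pose B : set V := [set y : V | `|y - (c - x0)| < 2].
have mB : measurable B by exact: measurable_box.
have mpk : measurable_fun setT (fun y => ((psi x0 - psi (x0 + y)) * k y)%:E).
  by apply/measurable_EFinP; exact: (trunc_measurable HK).
have tailf : tailI s c f = (fine (tailI s c f))%:E by rewrite fineK// (tailI_fin HK).
rewrite -lee_fin -tailf -(tailI_shift s x0 c mf).
apply: (@le_trans _ _ (\int[mu]_y (l^-1%:E * ((psi x0 - psi (x0 + y)) * k y)%:E + (t * \1_B y)%:E)%E)%E).
  apply: ge0_le_integral => //.
  - by move=> y _; rewrite lee_fin mulr_ge0 ?powR_ge0.
  - have := measurableT_comp (measurable_tailw s c mf) (@measurable_affine_rV R n 1 x0).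
    by apply: eq_measurable_fun => y _ /=; rewrite scale1r addrC.
  - apply: emeasurable_funD; first exact: measurable_funeM.
    by apply/measurable_EFinP; apply: measurable_funM => //; exact: measurable_indic.
  move=> y _; rewrite -EFinM -EFinD lee_fin.
  set w := (1 + _) `^ _.
  have w0 : 0 <= w by exact: powR_ge0.
  have w1 : w <= 1.
    rewrite /w powRN -[leRHS]invr1 lef_pV2 ?posrE ?powR_gt0 ?ltr_wpDr//.
    by rewrite -[leLHS](powR_one p); apply: powR_le; rewrite ?(ltW p0)// lerDl.
  have D0 : 0 <= psi x0 - psi (x0 + y) by rewrite subr_ge0.
  have e1 : f (x0 + y) * w <= (psi x0 - psi (x0 + y)) * w + t * \1_B y.
    have q1 := parab_ge0 (rho / 2) c (x0 + y).
    have q2 : 0 <= t * parab (rho / 2) c (x0 + y) by rewrite mulr_ge0.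
    have psiy : psi (x0 + y) = - (t * parab (rho / 2) c (x0 + y)) - f (x0 + y) by rewrite /psi mulrN.
    rewrite indicE; case: (boolP (_ \in B)) => [_|].
      rewrite mulr1; apply: (@le_trans _ _ ((psi x0 - psi (x0 + y) + t) * w)).
        by rewrite ler_wpM2r//; move: psi0 q2 psiy; clear; lra.
      by rewrite mulrDl lerD2l ler_piMr.
    rewrite notin_setE /B/= => /negP; rewrite -leNgt opprB addrA [y + x0]addrC => yB.
    rewrite mulr0 addr0 ler_wpM2r//.
    have : parab (rho / 2) c (x0 + y) = 1.
      by apply: parab_far => //; apply: le_trans yB; move: rho1; clear; lra.
    by move=> E; move: psi0 psiy; rewrite E; clear; lra.
  apply: (le_trans e1); rewrite lerD2r.
  have [->|yn] := eqVneq y 0; first by rewrite addr0 subrr !mul0r mulr0.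
  rewrite mulrCA ler_wpM2l//.
  have y0 : 0 < `|y| by rewrite normr_gt0.
  rewrite ler_pdivlMl//; apply: le_trans (sk_lower (ks_kernel HK) yn).
  rewrite ler_wpM2l ?(ltW l0)// /w -/p !powRN lef_pV2 ?posrE ?powR_gt0 ?ltr_wpDr//.
  apply: powR_le; rewrite ?(ltW p0)//.
  have E : x0 + y - c - (x0 - c) = y by rewrite opprB addrA subrK addrAC subrr add0r.
  have := ler_normB (x0 + y - c) (x0 - c); rewrite E.
  by move: x0r rho1; clear; lra.
rewrite ge0_integralD//; last 4 first.
- by move=> y _; rewrite -EFinM lee_fin !mulr_ge0 ?invr_ge0 ?(ltW l0) ?(kernel_nneg HK)// subr_ge0.
- exact: measurable_funeM.
- by move=> y _; rewrite lee_fin mulr_ge0.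
- by apply/measurable_EFinP; apply: measurable_funM => //; exact: measurable_indic.
rewrite mulrDl EFinD; apply: leeD.
  rewrite ge0_integralZl//; last 2 first.
  - by move=> y _; rewrite lee_fin !mulr_ge0 ?(kernel_nneg HK)// subr_ge0.
  - by rewrite lee_fin invr_ge0 ltW.
  apply: le_trans (lee_wpmul2l _ TB) _; first by rewrite lee_fin invr_ge0 ltW.
  by rewrite -EFinM lee_fin le_eqVlt; apply/orP; left; apply/eqP; ring.
have muB : mu B = ((2 * 2) ^+ n)%:E by exact: lebn_box.
have I : (\int[mu]_(y in B) t%:E = t%:E * mu B)%E by rewrite integral_cst.
rewrite -(int_indic (fun=> t) mB) I muB -EFinM lee_fin.
by rewrite mulrC (_ : 2 * 2 = 4 :> R)//; ring.
Qed.

(** At a violation, [b - Th * f + q * 1_B - C1 * Tb * parab], with [b] cut off far away, has a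
    positive maximum. The indicator of an interior box, paid for by the lower bound of [f] there,
    makes the operator negative at this maximum and outweighs the errors of cutting and localising,
    whereas the integral at a maximum is nonnegative. The geometry of [P] enters only through one
    interior box. *)
Lemma boundary_harnack (s gam l m rho : R) :
  0 < s -> s < 1 -> 0 < gam -> gam < 2 * s -> 0 < l -> 0 < m -> 0 < rho -> rho <= 1 ->
  exists2 C : R, 0 < C & forall (k : V -> R), kernel_setting s gam l m k ->
    forall (P : set V) f b x0,
    continuous f -> growth_adm gam f -> (forall x, 0 <= f x) ->
    continuous b -> growth_adm gam b -> (forall x, 0 <= b x) ->
    (forall x, P x -> Lge k f x 0) -> (forall x, P x -> Lle k b x 0) ->
    (forall x, ~ P x -> b x = 0) ->
    `|x0| <= 1 -> (forall z, `|z - x0| < 2 * rho -> P z) ->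
    forall x, `|x| <= 1 -> b x * fine (tailI s 0 f) <= C * fine (tailI s 0 b) * f x.
Proof.
move=> s0 s1 g0 gs l0 m0 rho0 rho1; set p := n%:R + 2 * s.
have p0 : 0 < p by rewrite ltr_wpDl// mulr_gt0.
have [Cp Cp0 HCp] := @Lle_parab R n s gam m s0 s1 g0 gs m0.
have [Cs Cs0 HCs] := @sup_bound R n s gam l m s0 s1 g0 gs l0 m0.
have [Ci Ci0 HCi] := @inf_bound s gam l m rho s0 s1 g0 gs l0 m0 rho0 rho1.
have p30 : 0 < 3 `^ p :> R by rewrite powR_gt0.
pose C1 := Cs * 3 `^ p; have C10 : 0 < C1 by rewrite mulr_gt0.
pose ci := (3 `^ p * Ci)^-1; have ci0 : 0 < ci by rewrite invr_gt0 mulr_gt0.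
(* [G] is the gain from the indicator, [A] collects the errors of cutting and localising plus 1, and
   [T] solves [ci / 2 * T = C1 + A / G]. *)
pose G := l * 3 `^ (- p) * rho ^+ n.
have G0 : 0 < G by rewrite !mulr_gt0 ?powR_gt0 ?exprn_gt0.
pose A := m * 6 `^ p + C1 * (Cp * (2^-1) `^ (- (2 * s))) + 1.
have A0 : 0 < A by rewrite !addr_gt0 ?mulr_gt0 ?powR_gt0.
pose T := 2 / ci * (C1 + A / G).
have T0 : 0 < T by rewrite mulr_gt0 ?divr_gt0// addr_gt0// divr_gt0.
exists T => // k HK P f b x0 cf af f0 cb ab b0 Hf Hb bP x01 HP x x1.
set Tf := fine (tailI s 0 f); set Tb := fine (tailI s 0 b).
have Tf0 : 0 <= Tf by rewrite fine_ge0// tailI_ge0.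
have Tb0 : 0 <= Tb by rewrite fine_ge0// tailI_ge0.
have recenter w c c' : growth_adm gam w -> (forall y, 0 <= w y) -> `|c - c'| <= 2 ->
    fine (tailI s c w) <= 3 `^ p * fine (tailI s c' w).
  move=> aw w0 cc; have := tailI_recenter_fine HK aw w0 cc.
  by rewrite (_ : 1 + 2 = 3 :> R)//; ring.
have bsup z : `|z| <= 2 -> b z <= C1 * Tb.
  move=> z2; apply: (@le_trans _ _ (Cs * fine (tailI s z b))).
    apply: (HCs k HK) => // y _ y0; apply: Hb; apply: contrapT => /bP E.
    by rewrite E ltxx in y0.
  by rewrite /C1 -mulrA ler_pM2l// recenter// subr0.
have finf z : `|z - x0| < rho -> ci * Tf <= f z.
  move=> zr; rewrite ler_pdivrMl ?mulr_gt0//.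
  apply: (@le_trans _ _ (3 `^ p * fine (tailI s z f))).
    apply: recenter => //; rewrite sub0r normrN -(subrK x0 z).
    by apply: le_trans (ler_normD _ _) _; move: zr x01 rho1; clear; lra.
  rewrite -mulrA ler_pM2l//; apply: (HCi k HK) => // y yz; apply: Hf; apply: HP.
  rewrite -(subrK z y) -addrA.
  by apply: le_lt_trans (ler_normD _ _) _; move: yz zr; clear; lra.
have [Tfz|Tfn] := eqVneq Tf 0.
  by rewrite Tfz mulr0 (mulr_ge0 (mulr_ge0 (ltW T0) Tb0) (f0 x)).
have Tfp : 0 < Tf by rewrite lt_def Tfn.
have [Tbz|Tbn] := eqVneq Tb 0.
  have : b x <= 0 by have := bsup x; rewrite Tbz mulr0; apply; move: x1; clear; lra.
  by move=> bx; rewrite Tbz mulr0 mul0r mulr_le0_ge0.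
have Tbp : 0 < Tb by rewrite lt_def Tbn.
have [Px|/bP ->] := pselect (P x); last by rewrite mul0r (mulr_ge0 (mulr_ge0 (ltW T0) Tb0) (f0 x)).
pose Th := T * Tb / Tf.
have Th0 : 0 < Th by rewrite divr_gt0// mulr_gt0.
have ThTf : Th * Tf = T * Tb by rewrite /Th mulfVK.
have bound : ci / 2 * T * Tb = (C1 + A / G) * Tb.
  by rewrite /T; field; rewrite !gt_eqF.
have AG0 : 0 < A / G by rewrite divr_gt0.
suff key : b x <= Th * f x.
  apply: le_trans (ler_wpM2r Tf0 key) _; rewrite mulrAC ThTf//.
have [xx0|xx0] := ltP `|x - x0| rho.
  have h1 := finf x xx0; have h2 : b x <= C1 * Tb by apply: bsup; move: x1; clear; lra.
  apply: (le_trans h2); apply: (@le_trans _ _ (Th * (ci * Tf))); last by rewrite ler_pM2l.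
  rewrite mulrCA ThTf.
  have : ci * (T * Tb) = 2 * ((C1 + A / G) * Tb) by rewrite -bound; field.
  have := mulr_gt0 C10 Tbp; have := mulr_gt0 AG0 Tbp.
  by move=> + + ->; clear; lra.
rewrite leNgt; apply/negP => bx.
pose far : set V := ~` [set z : V | `|z - 0| < 2].
pose B : set V := [set z : V | `|z - x0| < rho / 2].
have mfar : measurable far by apply: measurableC; exact: measurable_box.
have mB : measurable B by apply: measurable_box; rewrite divr_gt0.
(* Half of the lower bound of [Th * f] on the interior box: there [b + q <= 2 q <= Th * f], so
   adding [q * 1_B] keeps [psi] nonpositive. *)
pose q := Th * (ci * Tf / 2).
have qE : q = (C1 + A / G) * Tb.
  rewrite -bound /q; have -> : Th * (ci * Tf / 2) = ci / 2 * (Th * Tf) by ring.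
  by rewrite ThTf; ring.
have q0 : 0 < q by rewrite qE mulr_gt0// addr_gt0.
have half0 : 0 < 2^-1 :> R by rewrite invr_gt0.
pose psi z := b z + - (b z * \1_far z) + (Th * - f z + (q * \1_B z + C1 * Tb * - parab 2^-1 x z)).
(* [psi'] omits the cut-off and the indicator. It is continuous and agrees with [psi] where neither
   is active, so the maximum can be found by compactness. *)
pose psi' z := b z + Th * - f z + C1 * Tb * - parab 2^-1 x z.
have CT0 : 0 < C1 * Tb by rewrite mulr_gt0.
have cpsi' : continuous psi'.
  apply: cont_add.
    by apply: cont_add => //; apply: cont_mul; [exact: cont_cst|exact: cont_opp].
  by apply: cont_mul; [exact: cont_cst|apply: cont_opp; exact: cont_parab].
have psiE z : `|z| < 2 -> rho / 2 <= `|z - x0| -> psi z = psi' z.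
  move=> z2 zr; rewrite /psi /psi' !indicE memNset; last by rewrite /far /= subr0.
  rewrite memNset; last by rewrite /B/= => h; have := lt_le_trans h zr; rewrite ltxx.
  by rewrite !mulr0 oppr0 addr0 add0r addrA.
pose E : set V := [set z | `|z - x| <= 2^-1] `&` [set z | rho <= `|z - x0|].
have cE : compact E.
  apply: compact_closedI; first exact: compact_norm_le.
  apply: cont_closed_ge; apply: (@cont_comp R _ _ (fun z : V => z - x0) (fun z => `|z|)); [exact: cont_shift|exact: cont_norm].
have E0 : E !=set0 by exists x; split => //=; rewrite subrr normr0 ltW.
have [x2 /= [x2B x2r] Hmax] := max_on_compact cE E0 cpsi'.
rewrite /= in x2B x2r.
have x2n : `|x2| <= 3 / 2.
  rewrite -(subrK x x2); apply: le_trans (ler_normD _ _) _.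
  by move: x2B x1; clear; lra.
have rho2 : rho / 2 <= rho by move: rho0; clear; lra.
have psi2E : psi x2 = psi' x2.
  by apply: psiE; [apply: le_lt_trans x2n _; clear; lra|exact: le_trans x2r].
have psi2 : 0 < psi x2.
  rewrite psi2E; apply: lt_le_trans (Hmax x _); last by split => //=; rewrite subrr normr0 ltW.
  by rewrite /psi' parab_center oppr0 mulr0 addr0 mulrN subr_gt0.
have gmax y : psi (x2 + y) <= psi x2.
  set z := x2 + y.
  have fz : 0 <= Th * f z by rewrite mulr_ge0// ltW.
  have bz1 : 0 <= b z * \1_far z by rewrite mulr_ge0.
  have pz : 0 <= C1 * Tb * parab 2^-1 x z by rewrite mulr_ge0 ?parab_ge0// ltW.
  have [zr|zr] := ltP `|z - x0| rho.
    apply: (@le_trans _ _ 0); last exact: ltW.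
    have z2 : `|z| <= 2.
      by rewrite -(subrK x0 z); apply: le_trans (ler_normD _ _) _; move: zr x01 rho1; clear; lra.
    have h1 := bsup z z2.
    have h2 : 2 * q <= Th * f z.
      rewrite /q mulrCA ler_pM2l//; have := finf z zr; clear; lra.
    have h3 : q * \1_B z <= q by rewrite ler_piMr ?(ltW q0)// indicE; case: (_ \in _).
    have h4 : C1 * Tb <= q by rewrite qE ler_pM2r// lerDl ltW.
    rewrite /psi; move: fz bz1 pz h1 h2 h3 h4.
    rewrite !mulrN; clear; lra.
  have z2 : rho / 2 <= `|z - x0| by exact: le_trans zr.
  have [zx|zx] := leP `|z - x| 2^-1.
    rewrite psi2E psiE//; first by apply: Hmax; split.
    rewrite -(subrK x z); apply: le_lt_trans (ler_normD _ _) _.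
    by move: zx x1; clear; lra.
  apply: (@le_trans _ _ 0); last exact: ltW.
  have Bz : \1_B z = 0 :> R.
    by rewrite indicE memNset// /B/= => h; have := lt_le_trans h z2; rewrite ltxx.
  rewrite /psi (parab_far half0 (ltW zx)) Bz.
  have [zf|zf] := ltP `|z| 2.
    have h1 := bsup z (ltW zf).
    by move: fz bz1 h1; rewrite !mulrN !mulr0 mulr1; clear; lra.
  rewrite indicE mem_set; last by rewrite /far/= subr0; apply/negP; rewrite -leNgt.
  by move: fz CT0; rewrite !mulrN !mulr0 !mulr1; clear; lra.
have bx2 : 0 < b x2.
  apply: lt_le_trans psi2 _; rewrite psi2E /psi' !mulrN -addrA gerDl.
  have : 0 <= Th * f x2 by rewrite mulr_ge0// ltW.
  have : 0 <= C1 * Tb * parab 2^-1 x x2 by rewrite mulr_ge0 ?parab_ge0// ltW.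
  by clear; lra.
have Px2 : P x2 by apply: contrapT => /bP e; rewrite e ltxx in bx2.
have Lfar : Lle k (fun z => - (b z * \1_far z)) x2 (m * 6 `^ p * Tb).
  apply: (Lle_cut HK) => //.
    by rewrite /far/= subr0 => h1; apply: h1; apply: le_lt_trans x2n _; clear; lra.
  move=> y; rewrite /far /= !subr0 => /negP; rewrite -leNgt => yfar.
  have := ler_normD x2 y; move: yfar x2n; clear; lra.
have Lgain : Lle k (\1_B) x2 (- G).
  have := @Lle_indic_gain R n s gam l m k HK x2 x0 (rho / 2) 3.
  rewrite (_ : 2 * (rho / 2) = rho); last by field.
  apply => //; first by rewrite divr_gt0.
  have := ler_normB x2 x0; move: x2n x01 rho1; clear; lra.
have aN1 := adm_opp (adm_indic mfar ab).
have aNf := adm_opp af.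
have aNp : growth_adm gam (fun z => - parab 2^-1 x z) by apply: adm_opp; apply: adm_parab; exact: ltW.
have aB : growth_adm gam (\1_B : V -> R).
  have := adm_indic mB (@adm_cst R n s gam l m k HK 1).
  by under eq_fun do rewrite mul1r.
have L1 := Lle_add HK ab aN1 (Hb x2 Px2) Lfar.
have L2 := Lle_scale HK (ltW Th0) aNf (Hf x2 Px2).
have L3 := Lle_scale HK (ltW q0) aB Lgain.
have L4 := Lle_scale HK (ltW CT0) aNp (HCp l k HK 2^-1 x x2 half0).
have L34 := Lle_add HK (adm_scale q aB) (adm_scale _ aNp) L3 L4.
have a34 := adm_add (adm_scale q aB) (adm_scale (C1 * Tb) aNp).
have L234 := Lle_add HK (adm_scale Th aNf) a34 L2 L34.
have a234 := adm_add (adm_scale Th aNf) a34.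
have L := Lle_add HK (adm_add ab aN1) a234 L1 L234.
have TB := touching HK (adm_add (adm_add ab aN1) a234) gmax L.
have : (0 <= \int[mu]_y ((psi x2 - psi (x2 + y)) * k y)%:E)%E.
  by apply: integral_ge0 => y _; rewrite lee_fin mulr_ge0 ?(kernel_nneg HK)// subr_ge0.
move=> /le_trans/(_ TB); rewrite lee_fin leNgt => /negP; apply.
rewrite add0r oppr0 mulr0 add0r qE.
have -> : (C1 + A / G) * Tb * - G = - (C1 * Tb * G) - A * Tb by field; rewrite gt_eqF.
have : 0 < C1 * Tb * G by rewrite mulr_gt0.
rewrite {1}/A; have -> : (m * 6 `^ p + C1 * (Cp * 2^-1 `^ (- (2 * s))) + 1) * Tb =
  m * 6 `^ p * Tb + C1 * Tb * (Cp * 2^-1 `^ (- (2 * s))) + Tb by ring.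
by move: Tbp; clear; lra.
Qed.

End BoundaryHarnack.

(** * Growth and increment bounds from the gradient *)

Section LipschitzOnLine.
Context {R : realType}.
Local Notation leb := (@lebesgue_measure R).

(** On covers by half-open intervals the Stieltjes measure of [G] is at most [c] times Lebesgue
    measure; hence it is absolutely continuous, and Radon-Nikodym provides the density. *)
Lemma lipschitz_cumulative_density (G : R -> R) (c a b : R) : a < b -> 0 <= c ->
  {homo G : x y / x <= y} -> (forall x y, `|G x - G y| <= c * `|x - y|) ->
  (forall x, x <= a -> G x = 0) -> (forall x, b <= x -> G x = 1) ->
  exists2 f : R -> R, leb.-integrable setT (EFin \o f) &
    forall x y, x <= y -> (\int[leb]_(t in `]x, y]) (f t)%:E = (G y - G x)%:E)%E.
Proof.
move=> ab c0 Gnd Glip Ga Gb.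
have Gc : continuous G.
  move=> x; apply/cvgrPdist_le => e e0; near=> t.
  apply: le_trans (Glip _ _) _; apply: (@le_trans _ _ (c * (e / (c + 1)))).
    apply: ler_wpM2l => //; near: t.
    by apply: cvgr_dist_le; [exact: cvg_id|rewrite divr_gt0// ltr_wpDl].
  rewrite mulrCA ler_piMr ?(ltW e0)// ler_pdivrMr ?ltr_wpDl// mul1r lerDl//.
have G0 : G @ -oo --> (0 : R).
  apply/cvgrPdist_le => e e0; near=> t.
  by rewrite Ga ?subrr ?normr0 ?(ltW e0)//; near: t; exact: nbhs_ninfty_le.
have G1 : G @ +oo --> (1 : R).
  apply/cvgrPdist_le => e e0; near=> t.
  by rewrite Gb ?subrr ?normr0 ?(ltW e0)//; near: t; exact: nbhs_pinfty_ge.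
pose F : cumulativeBounded (0:R) (1:R) := HB.pack G
  (isCumulative.Build R _ R G Gnd (right_continuousW Gc)) (isCumulativeBounded.Build R 0 1 G G0 G1).
pose nu := lebesgue_stieltjes_measure F.
have ocE x y : x <= y -> nu `]x, y]%classic = (G y - G x)%:E.
  move=> xy; rewrite /nu /lebesgue_stieltjes_measure /measure_extension measurable_mu_extE/=; last exact: is_ocitv.
  by rewrite wlength_itv_bnd.
have dom : nu `<< leb.
  apply/null_content_dominatesP => A mA A0; apply/eqP; rewrite eq_le measure_ge0 andbT.
  apply/lee_addgt0Pr => e e0; rewrite add0e.
  have : (leb A < (e / (c + 1))%:E)%E by rewrite A0 lte_fin divr_gt0// ltr_wpDl.
  rewrite /lebesgue_measure /lebesgue_stieltjes_measure /measure_extension /mu_ext.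
  move=> /ereal_inf_lt[_ [B [mB AB] <-] Be].
  rewrite /nu /lebesgue_stieltjes_measure /measure_extension /mu_ext.
  apply: (@le_trans _ _ (\sum_(k <oo) wlength F (B k))%E).
    by apply: ereal_inf_lbound; exists B.
  apply: (@le_trans _ _ (\sum_(k <oo) (c%:E * wlength idfun (B k)))%E).
    apply: lee_nneseries => [i _ _|i _]; first exact: wlength_ge0.
    have /ocitvP[->|[[x y]/= xy ->]] := mB i; first by rewrite !wlength0 mule0.
    rewrite !wlength_itv_bnd ?(ltW xy)// -EFinM lee_fin.
    apply: le_trans (ler_norm _) _; apply: le_trans (Glip _ _) _.
    by rewrite ger0_norm// subr_ge0 ltW.
  rewrite nneseriesZl; last by move=> i _; exact: wlength_ge0.
  apply: (@le_trans _ _ (c%:E * (e / (c + 1))%:E)%E).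
    by apply: lee_wpmul2l; [rewrite lee_fin|exact: ltW].
  rewrite -EFinM lee_fin mulrCA ler_piMr ?(ltW e0)// ler_pdivrMr ?ltr_wpDl// mul1r lerDl//.
have [f [f0 ffin fint fE]] := radon_nikodym_sigma_finite dom.
exists (fine \o f).
  by apply: eq_integrable fint => // x _ /=; rewrite fineK.
move=> x y xy; apply: etrans (ocE _ _ xy); apply: etrans (esym (fE `]x, y]%classic (measurable_itv _))).
by apply: eq_integral => t _ /=; rewrite fineK.
Unshelve. all: by end_near. Qed.

Lemma clamp_exists (a b : R) : a < b -> exists cl : R -> R,
  [/\ forall x, a <= cl x <= b, forall x, a <= x <= b -> cl x = x,
      forall x y, x <= y -> cl x <= cl y, forall x y, `|cl x - cl y| <= `|x - y| &
      (forall x, x <= a -> cl x = a) /\ (forall x, b <= x -> cl x = b)].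
Proof.
move=> ab; exists (fun x => if x <= a then a else if b <= x then b else x).
have nd x y : x <= y -> (if x <= a then a else if b <= x then b else x) <=
    (if y <= a then a else if b <= y then b else y).
  by move=> xy; case: ifPn; case: ifPn; try case: ifPn; try case: ifPn;
    rewrite -?ltNge => *; lra.
split=> //.
- by move=> x; case: ifPn; try case: ifPn; rewrite -?ltNge => *; apply/andP; split; lra.
- move=> x /andP[h1 h2]; case: ifPn => h3; first by apply/eqP; rewrite eq_le h1 h3.
  by case: ifPn => // h4; apply/eqP; rewrite eq_le h2 h4.
- move=> x y; wlog xy : x y / x <= y.
    move=> W; have [|/ltW] := leP x y; first exact: W.
    by move=> /W; rewrite distrC [X in _ <= X]distrC.
  rewrite distrC [X in _ <= X]distrC !ger0_norm ?subr_ge0 ?nd//.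
  by case: ifPn; case: ifPn; try case: ifPn; try case: ifPn;
    rewrite -?ltNge => *; lra.
- by split=> x xa; rewrite ?xa//; case: ifPn => // xa'; have := le_trans xa xa'; rewrite leNgt ab.
Qed.

(** Adding a linear term makes [g] increasing, and clamping makes it a distribution function; its
    density is then the derivative almost everywhere. Differentiability almost everywhere is thus an
    output, which is why the bound is assumed only where the derivative exists. *)
Lemma lipschitz_incr_le (g : R -> R) (a b c M : R) : a < b -> 0 <= c ->
  (forall x y, a <= x <= b -> a <= y <= b -> `|g x - g y| <= c * `|x - y|) ->
  {ae leb, forall x, a < x < b -> derivable g x 1 -> 'D_1 g x <= M} ->
  g b - g a <= M * (b - a).
Proof.
move=> ab c0 glip gM.
have [cl [clI clid clnd cllip [cla clb]]] := @clamp_exists a b ab.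
(* The slope [c + 1] instead of [c] makes the total increment [D] strictly positive. *)
pose D := g b - g a + (c + 1) * (b - a).
have D0 : 0 < D.
  have := glip b a; rewrite !lexx !(ltW ab) => /(_ isT isT).
  rewrite (ger0_norm (_ : 0 <= b - a)) ?subr_ge0 ?(ltW ab)//.
  move=> /ler_normlP[h1 h2]; rewrite /D.
  by move: h1 h2 ab; clear; set X := c * (b - a); rewrite mulrDl mul1r -/X; lra.
pose G x := (g (cl x) - g a + (c + 1) * (cl x - a)) / D.
have Gnd : {homo G : x y / x <= y}.
  move=> x y xy; rewrite /G ler_pM2r ?invr_gt0//.
  have := glip (cl y) (cl x) (clI _) (clI _); have h := clnd _ _ xy.
  rewrite (ger0_norm (_ : 0 <= cl y - cl x)) ?subr_ge0//.
  move=> /ler_normlP[h1 h2]; move: h1 h h2; rewrite !mulrBr !mulrDl !mul1r; clear; lra.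
have Glip x y : `|G x - G y| <= ((c + (c + 1)) / D) * `|x - y|.
  rewrite /G -mulrBl normrM (@ger0_norm _ D^-1) ?invr_ge0 ?(ltW D0)// mulrAC ler_pM2r ?invr_gt0//.
  have -> : g (cl x) - g a + (c + 1) * (cl x - a) - (g (cl y) - g a + (c + 1) * (cl y - a)) =
    (g (cl x) - g (cl y)) + (c + 1) * (cl x - cl y) by ring.
  apply: le_trans (ler_normD _ _) _; rewrite [leRHS]mulrDl; apply: lerD.
    by apply: le_trans (glip _ _ (clI _) (clI _)) _; apply: ler_wpM2l.
  by rewrite normrM ger0_norm ?addr_ge0// ler_wpM2l ?addr_ge0.
have Ga x : x <= a -> G x = 0.
  by move=> xa; rewrite /G cla// !subrr mulr0 addr0 mul0r.
have Gb x : b <= x -> G x = 1.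
  by move=> xb; rewrite /G clb// divff// gt_eqF.
have C0 : 0 <= (c + (c + 1)) / D by rewrite divr_ge0 ?(ltW D0)// !addr_ge0.
have [f fint fE] := lipschitz_cumulative_density ab C0 Gnd Glip Ga Gb.
have fintS A : measurable A -> leb.-integrable A (EFin \o f) by move=> mA; exact: integrableS fint.
have locf := open_integrable_locally openT fint.
pose F (y : R) : R := \int[leb]_(t in `]a, y]) f t.
have FG y : a <= y -> F y = G y.
  by move=> ay; rewrite /F /Rintegral fE//= (Ga a (lexx a)) subr0.
pose C := (M + (c + 1)) / D.
have fC : {ae leb, forall x, a < x < b -> f x <= C}.
  have := @FTC1 R f (BRight a) (fun y => fintS _ (measurable_itv _)) locf.
  suff H (x : R) : (a < x < b -> derivable g x 1 -> 'D_1 g x <= M) ->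
      ((BRight a < BRight x)%O -> derivable F x 1 /\ derive1 F x = f x) -> a < x < b -> f x <= C.
    by move: gM; apply: (@filterS2 _ _ (ae_filter_ringOfSetsType leb)) => x; exact: H.
  move=> gx Fx /andP[ax xb].
  have [dF F'] : derivable F x 1 /\ derive1 F x = f x by apply: Fx; rewrite bnd_simp.
  pose g2 y := D * F y + (g a - (c + 1) * (y - a)).
  have nearE : \forall y \near x, g2 y = g y.
    near=> y; have ay : a <= y by apply: ltW; near: y; exact: (cvgr_gt _ (@cvg_id _ (nbhs x)) _ ax).
    have yb : y <= b by apply: ltW; near: y; exact: (cvgr_lt _ (@cvg_id _ (nbhs x)) _ xb).
    rewrite /g2 FG// /G clid ?ay//; field.
    by rewrite gt_eqF.
  have dg2 : is_derive x 1 g2 (D * f x - (c + 1)).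
    have h1 : is_derive x 1 F (f x) by apply: DeriveDef; [exact: dF|rewrite -derive1E; exact: F'].
    apply: is_derive_eq; rewrite ?scaler0 ?addr0 ?add0r ?subr0 /GRing.scale/= ?mulr1 ?mul1r//.
  have [dg2' dg2E] := dg2.
  have dg : derivable g x 1 by apply: near_eq_derivable dg2'.
  have : 'D_1 g x <= M by apply: gx => //; rewrite ax xb.
  rewrite -(near_eq_derive _ nearE) dg2E /C ler_pdivlMr// mulrC.
  by clear; lra.
have nb : {ae leb, forall x, x != b}.
  exists [set b]; split => //; first exact: lebesgue_measure_set1.
  by move=> x /= /negP; rewrite negbK => /eqP.
have : (\int[leb]_(t in `]a, b]) (f t)%:E <= \int[leb]_(t in `]a, b]) C%:E)%E.
  apply: (@le_trans _ _ (\int[leb]_(t in `]a, b]) (Num.min (f t) C)%:E)%E).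
    rewrite le_eqVlt; apply/orP; left; apply/eqP; apply: ae_eq_integral => //.
    - by have /integrableP[] := fintS `]a, b]%classic (measurable_itv _).
    - apply/measurable_EFinP; apply: measurable_minr; last exact: measurable_cst.
      by have /integrableP[/measurable_EFinP] := fintS `]a, b]%classic (measurable_itv _).
    move: fC nb; apply: (@filterS2 _ _ (ae_filter_ringOfSetsType leb)) => x fx xb /=; rewrite in_itv/= => /andP[ax xb'].
    by rewrite (min_idPl _)// fx// ax lt_neqAle xb xb'.
  have ic k : leb.-integrable `]a, b] (fun=> k%:E).
    apply/integrableP; split; first exact: measurable_cst.
    rewrite (_ : (fun _ => _) = cst `|k|%:E)// integral_cst//= lebesgue_measure_itv/=.
    by rewrite lte_fin ab -EFinB -EFinM ltry.
  have minC : leb.-integrable `]a, b] (fun t => (Num.min (f t) C)%:E).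
    have ig : leb.-integrable `]a, b] (fun t => `|(f t)%:E| + `|C|%:E)%E.
      apply: integrableD => //; first exact/integrable_abse/fintS.
    apply: le_integrable ig => //.
    - apply/measurable_EFinP; apply: measurable_minr; last exact: measurable_cst.
      by have /integrableP[/measurable_EFinP] := fintS `]a, b]%classic (measurable_itv _).
    - move=> t _ /=; rewrite lee_fin [leRHS]ger0_norm ?addr_ge0//.
      by case: (leP (f t) C) => _; rewrite ?lerDl ?lerDr.
  apply: le_integral => //.
  by move=> t _; rewrite lee_fin ge_min lexx orbT.
rewrite fE ?(ltW ab)// integral_cst//= lebesgue_measure_itv/= lte_fin ab -EFinB -EFinM lee_fin (Ga a (lexx a)) (Gb b (lexx b)) subr0.
rewrite /C mulrAC ler_pdivlMr// mul1r /D; clear; lra.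
Unshelve. all: by end_near. Qed.

End LipschitzOnLine.

Section CoordPath.
Context {R : realType} {n : nat}.
Local Notation V := 'rV[R]_n.

(** A path from [x] to [x + h] along the coordinate axes, since only partial derivatives are at
    hand. In the sup norm it stays within [|h|] of [x]. *)
Definition coord_path (x h : V) (j : nat) : V :=
  \row_k (x 0 k + (if (k < j)%N then h 0 k else 0)).

Lemma coord_path0 x h : coord_path x h 0 = x.
Proof. by apply/rowP => k; rewrite mxE ltn0 addr0. Qed.

Lemma coord_pathn x h : coord_path x h n = x + h.
Proof. by apply/rowP => k; rewrite !mxE ltn_ord. Qed.

Lemma coord_pathS x h j (jn : (j < n)%N) :
  coord_path x h j.+1 = coord_path x h j + h 0 (Ordinal jn) *: evec (Ordinal jn).
Proof.
apply/rowP => k; rewrite !mxE ltnS.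
have [->|kj] := eqVneq k (Ordinal jn).
  by rewrite /= leqnn ltnn ?eqxx mulr1 addr0.
have kj' : (k != j :> nat) by apply: contra kj => /eqP kj; apply/eqP/val_inj.
by rewrite (leq_eqVlt k) (negbTE kj') /= ?(negbTE kj) ?andbF mulr0 addr0.
Qed.

Lemma coord_path_near x h (t : R) (j : 'I_n) : 0 <= t <= 1 ->
  `|coord_path x h j + (t * h 0 j) *: evec j - x| <= `|h|.
Proof.
move=> /andP[t0 t1]; apply: rV_norm_le => // k; rewrite !mxE.
have hk := coord_le_norm h k.
have [->|kj] := eqVneq k j.
  rewrite /= ltnn ?eqxx mulr1 addr0 addrAC subrr add0r normrM ger0_norm//.
  by apply: le_trans (coord_le_norm h j); rewrite ler_piMl.
rewrite /= ?(negbTE kj) ?andbF mulr0 addr0 addrAC subrr add0r.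
by case: ifP => // _; rewrite normr0.
Qed.

End CoordPath.

Section Growth.
Context {R : realType} {n : nat}.
Local Notation mu := (@lebn R n).
Local Notation V := 'rV[R]_n.
Local Notation leb := (@lebesgue_measure R).

Lemma negligible_dense (N : set V) x (e : R) : mu.-negligible N -> 0 < e ->
  exists2 y, `|y - x| < e & ~ N y.
Proof.
move=> [A [mA A0 NA]] e0; apply: contrapT => H.
have sub : [set y | `|y - x| < e] `<=` A.
  by move=> y /= ye; apply: NA; apply: contrapT => Ny; apply: H; exists y.
have mB : measurable [set y : V | `|y - x| < e] by exact: measurable_box.
have le : (mu [set y | `|y - x| < e]%R <= mu A)%E by apply: le_measure; rewrite ?inE.
have A0' : mu A = 0%E by exact: A0.
have B0 : mu [set y | `|y - x| < e]%R = ((2 * e) ^+ n)%:E by exact: lebn_box.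
by move: le; rewrite A0' B0 lee_fin leNgt exprn_gt0// mulr_gt0.
Qed.

(** Tonelli for [(z, t) -> 1_A (z + t v)]: each section at fixed [t] is a translate of a null set,
    so almost every section at fixed [z] is null. Using all base points [z] avoids splitting off the
    direction [v]. *)
Lemma negligible_lines (N : set V) (v : V) : mu.-negligible N ->
  mu.-negligible [set z | ~ leb.-negligible [set t | N (z + t *: v)]].
Proof.
move=> [A [mA A0 NA]].
pose f (p : V * measurableTypeR R) : \bar R := (\1_A (p.1 + p.2 *: v))%:E.
have mphi : measurable_fun setT (fun p : V * measurableTypeR R => p.1 + p.2 *: v).
  apply: measurable_fun_rV => i; under eq_fun do rewrite !mxE.
  apply: measurable_funD.
    by apply: (measurableT_comp (measurable_coord i)); exact: measurable_fst.
  by apply: measurable_funM; [exact: measurable_snd|exact: measurable_cst].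
have mf : measurable_fun setT f.
  by apply/measurable_EFinP; apply: measurableT_comp mphi; exact: measurable_indic.
have f0 p : (0 <= f p)%E by rewrite lee_fin.
have FT := @fubini_tonelli _ _ _ _ R mu leb f mf f0.
have I0 : (\int[mu]_z \int[leb]_t f (z, t) = 0)%E.
  rewrite FT integral0_eq// => t _.
  have E : (fun z => f (z, t)) = (fun z => (\1_A (z + t *: v))%:E) by [].
  rewrite E (@integral_shift R n (t *: v) (fun z => (\1_A z)%:E)).
    by rewrite integral_indic// setIT.
  by apply/measurable_EFinP; exact: measurable_indic.
have mF : measurable_fun setT (fun z => \int[leb]_t f (z, t))%E by exact: measurable_fun_fubini_tonelli_F.
have : ae_eq mu setT (fun z => \int[leb]_t f (z, t))%E (cst 0%E).
  apply/ae_eq_integral_abs => //; rewrite -[RHS]I0; apply: eq_integral => z _.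
  by rewrite gee0_abs// integral_ge0.
apply: negligibleS => z /= Hz; apply: contra_not Hz => /(_ I) Hz.
have mzA : measurable ([set t | A (z + t *: v)] : set (measurableTypeR R)).
  have := mphi measurableT A mA; rewrite setTI.
  have mz : measurable_fun setT (fun t : measurableTypeR R => (z, t)) by exact: measurable_pair1.
  by move=> mp; have := mz measurableT _ mp; rewrite setTI.
exists [set t | A (z + t *: v)]; split; first exact: mzA.
- move: Hz; rewrite /f /=.
  rewrite (_ : (fun t => _) = (fun t => (\1_[set t | A (z + t *: v)] t)%:E)).
    by rewrite integral_indic ?setIT.
  by apply/funext => t; rewrite !indicE; congr (_%:R)%:E; apply/idP/idP; rewrite !inE.
- by move=> t /= /NA.
Qed.

Lemma box_segment (z w : V) (rho t x : R) : 0 < t -> 0 <= x <= t ->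
  `|z| < rho -> `|z + t *: w| < rho -> `|z + x *: w| < rho.
Proof.
move=> t0 /andP[x0 xt] zr zwr.
have -> : z + x *: w = (1 - x / t) *: z + (x / t) *: (z + t *: w).
  by rewrite scalerDr scalerA divfK ?gt_eqF// addrA -scalerDl subrK scale1r.
apply: le_lt_trans (ler_normD _ _) _; rewrite 2!normrZ.
have xt0 : 0 <= x / t by rewrite divr_ge0// ltW.
have xt1 : x / t <= 1 by rewrite ler_pdivrMr// mul1r.
rewrite (ger0_norm xt0) ger0_norm ?subr_ge0//.
have -> : rho = (1 - x / t) * rho + x / t * rho by ring.
have [x00|x00] := eqVneq x 0; first by rewrite x00 !mul0r subr0 !mul1r !addr0.
have xt2 : 0 < x / t by rewrite divr_gt0// lt_def x00.
apply: ler_ltD; last by rewrite ltr_pM2l.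
by rewrite ler_wpM2l ?subr_ge0// ltW.
Qed.

(** Almost every line in direction [v] meets the exceptional set in a null set. On such a line the
    one-dimensional bound applies to [u] and to [- u], and Lipschitz continuity carries it over to
    the given segment from a nearby one. *)
Lemma lipschitz_directional (u : V -> R) (v : V) (rho c M : R) : 0 <= c ->
  (forall x y, `|x| < rho -> `|y| < rho -> `|u x - u y| <= c * `|x - y|) ->
  {ae mu, forall z, `|z| < rho -> derivable u z v -> `|'D_v u z| <= M} ->
  forall z t, `|z| < rho -> `|z + t *: v| < rho -> `|u (z + t *: v) - u z| <= M * `|t|.
Proof.
move=> c0 ulip uM.
suff pos z t : 0 < t -> `|z| < rho -> `|z + t *: v| < rho -> `|u (z + t *: v) - u z| <= M * t.
  move=> z t zr ztr; have [t0|t0|->] := ltgtP t 0; last by rewrite scale0r addr0 subrr !normr0 mulr0.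
  - by rewrite (ltr0_norm t0); have := pos (z + t *: v) (- t); rewrite -addrA -scalerDl subrr scale0r addr0 oppr_gt0 distrC => H; exact: H.
  - by rewrite (gtr0_norm t0); exact: pos.
move=> t0 zr ztr; apply/ler_addgt0Pr => e e0.
have good z' : leb.-negligible [set x | ~ (`|z' + x *: v| < rho -> derivable u (z' + x *: v) v -> `|'D_v u (z' + x *: v)| <= M)] ->
    `|z'| < rho -> `|z' + t *: v| < rho -> `|u (z' + t *: v) - u z'| <= M * t.
  move=> Hz z'r z'tr.
  pose g x := u (z' + x *: v).
  have glip x y : 0 <= x <= t -> 0 <= y <= t -> `|g x - g y| <= (c * `|v|) * `|x - y|.
    move=> xt yt; apply: le_trans (ulip _ _ (box_segment t0 xt z'r z'tr) (box_segment t0 yt z'r z'tr)) _.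
    by rewrite opprD addrACA subrr add0r -scalerBl normrZ -mulrA [`|x - y| * _]mulrC.
  have quot x : (fun h : R => h^-1 *: ((g \o shift x) (h *: (1 : R)) - g x)) =
      (fun h => h^-1 *: ((u \o shift (z' + x *: v)) (h *: v) - u (z' + x *: v))).
    have E h : z' + (h *: (1 : R) + x) *: v = h *: v + (z' + x *: v).
      by rewrite [h *: (1 : R)]mulr1 scalerDl addrCA.
    by apply/funext => h; congr (_ *: (u _ - _)); exact: E.
  have dgu x : derivable g x 1 -> derivable u (z' + x *: v) v by rewrite /derivable quot.
  have Dgu x : 'D_1 g x = 'D_v u (z' + x *: v) by rewrite /derive quot.
  have cv : 0 <= c * `|v| by rewrite mulr_ge0.
  have aeg : {ae leb, forall x, 0 < x < t -> derivable g x 1 -> `|'D_1 g x| <= M}.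
    apply: negligibleS Hz => x /= Hx Hx'; apply: Hx => /andP[x0 xt] dg.
    rewrite Dgu; apply: Hx'; last exact: dgu.
    by apply: box_segment z'r z'tr; rewrite ?t0// !ltW.
  have h1 : g t - g 0 <= M * (t - 0).
    apply: lipschitz_incr_le t0 cv glip _; move: aeg.
    apply: (@filterS _ _ (ae_filter_ringOfSetsType leb)) => x H1 H2 H3.
    by apply: le_trans (ler_norm _) _; exact: H1.
  have h2 : (- g t) - (- g 0) <= M * (t - 0).
    apply: (@lipschitz_incr_le R (fun x => - g x) 0 t _ M t0 cv).
      by move=> x y xt yt; rewrite -opprD normrN; exact: glip.
    move: aeg.
    suff H (x : R) : (0 < x < t -> derivable g x 1 -> `|'D_1 g x| <= M) ->
       (0 < x < t -> derivable (fun x => - g x) x 1 -> 'D_1 (fun x => - g x) x <= M).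
      by apply: (@filterS _ _ (ae_filter_ringOfSetsType leb)) => x; exact: H.
    move=> H1 H2 H3; have dg : derivable g x 1.
      by have := derivableN H3; rewrite (_ : - (fun x => - g x) = g)//; apply/funext => y /=; rewrite /GRing.opp/= opprK.
    have -> : 'D_1 (fun x => - g x) x = - 'D_1 g x by exact: deriveN.
    by apply: le_trans (ler_norm _) _; rewrite normrN; exact: H1.
  rewrite /g scale0r addr0 subr0 in h1 h2.
  by apply/ler_normlP; split; move: h1 h2; clear; lra.
pose d := Num.min (rho - `|z|) (Num.min (rho - `|z + t *: v|) (e / (2 * (c + 1)))).
have c1 : 0 < c + 1 by rewrite ltr_wpDl.
have d0 : 0 < d by rewrite !lt_min !subr_gt0 zr ztr divr_gt0// mulr_gt0.
have neg := negligible_lines v uM.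
have [z' z'd Hz'] := negligible_dense z neg d0.
have [d1 d2 d3] : [/\ d <= rho - `|z|, d <= rho - `|z + t *: v| & d <= e / (2 * (c + 1))].
  by rewrite /d !ge_min !lexx !orbT.
have z'r : `|z'| < rho.
  rewrite -(subrK z z'); apply: le_lt_trans (ler_normD _ _) _; move: z'd d1; clear; lra.
have z'tr : `|z' + t *: v| < rho.
  rewrite -(subrK z z') -addrA; apply: le_lt_trans (ler_normD _ _) _; move: z'd d2; clear; lra.
have Hg := good z' (contrapT Hz') z'r z'tr.
have e1 := ulip _ _ ztr z'tr; have e2 := ulip _ _ z'r zr.
have dE : z + t *: v - (z' + t *: v) = z - z' by rewrite opprD addrACA subrr addr0.
rewrite dE distrC in e1.
have cd : c * `|z' - z| <= e / 2.
  apply: (@le_trans _ _ ((c + 1) * (e / (2 * (c + 1))))).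
    apply: ler_pM => //; first by rewrite lerDl.
    exact: le_trans (ltW z'd) d3.
  by rewrite le_eqVlt; apply/orP; left; apply/eqP; field; rewrite gt_eqF.
have -> : u (z + t *: v) - u z = - (u (z' + t *: v) - u (z + t *: v)) + (u (z' + t *: v) - u z') + (u z' - u z) by ring.
apply: le_trans (ler_normD _ _) _; apply: le_trans (lerD (ler_normD _ _) (lexx _)) _.
rewrite normrN; rewrite [`|z - z'|]distrC in e1; move: e1 e2 Hg cd; clear; lra.
Qed.

End Growth.

Lemma lip_growth_of_gradient {R : realType} {n : nat} (c sig : R) (u : 'rV[R]_n -> R) :
  0 <= c -> 0 <= sig -> Ck_holder_loc 0 1 u ->
  (forall r : R, 1 <= r ->
    (Linfty_norm (eball r) (fun x => enorm (grad u x)) <= (c * r `^ sig)%:E)%E) ->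
  exists2 Q : R, 0 < Q & lip_growth sig Q u.
Proof.
move=> c0 sig0 [_ ulip] ugrad.
have N0 : 0 < n.+1%:R :> R by [].
pose Q := n%:R * (c * n.+1%:R `^ sig).
have Q0 : 0 <= Q by rewrite !mulr_ge0 ?powR_ge0.
exists (Q + 1); first by rewrite ltr_wpDl.
move=> x h; pose rho := 1 + `|x| + `|h|.
have rho1 : 1 <= rho by rewrite /rho -addrA lerDl addr_ge0.
pose r := n.+1%:R * rho.
have r1 : 1 <= r by rewrite -[leLHS]mulr1 ler_pM// ler1n.
have r0 : 0 < r by exact: lt_le_trans r1.
have box_ball (z : 'rV[R]_n) : `|z| < rho -> eball r z.
  by move=> zr; rewrite /eball/=; apply: le_lt_trans (enorm_le_norm z) _; rewrite ltr_pM2l.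
have [C0 HC] := ulip [::] erefl r r0.
pose C := `|C0| * n.+1%:R.
have C_ge0 : 0 <= C by rewrite mulr_ge0.
have lipC z w : `|z| < rho -> `|w| < rho -> `|u z - u w| <= C * `|z - w|.
  move=> zr wr; have := HC z w (box_ball _ zr) (box_ball _ wr).
  rewrite powRr1 ?enorm_ge0//= => /le_trans; apply.
  rewrite /C -mulrA; apply: (@le_trans _ _ (`|C0| * enorm (z - w))).
    by rewrite ler_wpM2r ?enorm_ge0// ler_norm.
  by rewrite ler_wpM2l ?enorm_le_norm.
pose M := c * r `^ sig.
have aeM i : {ae lebn n, forall z, `|z| < rho -> derivable u z (evec i) -> `|'D_(evec i) u z| <= M}.
  have := ugrad r r1; rewrite /Linfty_norm unlock.
  (* The norm with exponent [+oo] is an essential supremum only when the whole space has positive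
     measure. *)
  have muT : (0 < @lebn R n setT)%E.
    have mB : measurable [set y : 'rV[R]_n | `|y - 0| < 1] by exact: measurable_box.
    have le : (lebn n [set y : 'rV[R]_n | `|y - 0| < 1]%R <= @lebn R n setT)%E by apply: le_measure; rewrite ?inE.
    have B0 : lebn n [set y : 'rV[R]_n | `|y - 0| < 1]%R = ((2 * 1) ^+ n)%:E by exact: lebn_box.
    by apply: lt_le_trans le; rewrite B0 lte_fin exprn_gt0// mulr_gt0.
  rewrite muT => /ess_sup_inf.ess_supP.
  apply: (@filterS _ _ (ae_filter_ringOfSetsType (lebn n))) => z + zr _.
  rewrite /= patchE mem_set; last exact: box_ball.
  rewrite /= lee_fin => /(le_trans _); apply.
  rewrite (ger0_norm (enorm_ge0 _)); apply: le_trans (norm_le_enorm _).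
  by have := coord_le_norm (grad u z) i; rewrite mxE.
pose y := coord_path x h.
have yr j : `|y j| < rho.
  apply: (@le_lt_trans _ _ (`|x| + `|h|)); last by rewrite /rho -addrA ltr_pwDl.
  apply: rV_norm_le; rewrite ?addr_ge0// => k; rewrite mxE.
  apply: le_trans (ler_normD _ _) _; apply: lerD; first exact: coord_le_norm.
  by case: ifP => // _; rewrite ?normr0//; exact: coord_le_norm.
have step j : (j <= n)%N -> `|u (y j) - u x| <= j%:R * (M * `|h|).
  elim: j => [_|j IH jn]; first by rewrite /y coord_path0 subrr normr0 mul0r.
  have := lipschitz_directional C_ge0 lipC (aeM (Ordinal jn)) (yr j) (t := h 0 (Ordinal jn)).
  rewrite -coord_pathS => /(_ (yr j.+1)) H1.
  have -> : u (y j.+1) - u x = (u (y j.+1) - u (y j)) + (u (y j) - u x) by ring.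
  apply: le_trans (ler_normD _ _) _; rewrite -natr1 mulrDl mul1r addrC; apply: lerD; first by apply: IH; exact: ltnW.
  apply: (le_trans H1); rewrite ler_wpM2l ?mulr_ge0 ?powR_ge0//; exact: coord_le_norm.
have := step n (leqnn n); rewrite /y coord_pathn => /le_trans; apply.
have rE : r `^ sig = n.+1%:R `^ sig * rho `^ sig.
  by rewrite /r powRM ?ler0n// (le_trans ler01).
rewrite /M rE.
have -> : n%:R * (c * (n.+1%:R `^ sig * rho `^ sig) * `|h|) = Q * `|h| * rho `^ sig by rewrite /Q; ring.
by rewrite ler_wpM2r ?powR_ge0// ler_wpM2r// lerDl.
Qed.

(** * Second differences of Holder functions *)

Section SecondDifference.
Context {R : realType} {n : nat}.
Local Notation V := 'rV[R]_n.
Implicit Types (u : V -> R) (x y z v : V).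

Lemma line_quotient u z v (t : R) :
  (fun h : R => h^-1 *: (((fun a => u (z + a *: v)) \o shift t) (h *: (1 : R)) - u (z + t *: v))) =
  (fun h => h^-1 *: ((u \o shift (z + t *: v)) (h *: v) - u (z + t *: v))).
Proof.
have E (h : R) : z + (h *: (1 : R) + t) *: v = h *: v + (z + t *: v).
  by rewrite [h *: (1 : R)]mulr1 scalerDl addrCA.
by apply/funext => h; congr (_ *: (u _ - _)); exact: E.
Qed.

Lemma line_mvt u z v (t : R) :
  (forall a, 0 <= a <= 1 -> derivable u (z + (a * t) *: v) v) ->
  exists2 a : R, 0 <= a <= 1 & u (z + t *: v) - u z = t * 'D_v u (z + (a * t) *: v).
Proof.
wlog t0 : z t / 0 < t => [W|] du.
  have [t0|t0|->] := ltgtP t 0; last 2 first.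
  - exact: W.
  - by exists 0; rewrite ?lexx ?ler01// !mul0r scale0r addr0 subrr.
  have e a : z + t *: v + (a * - t) *: v = z + ((1 - a) * t) *: v.
    by rewrite -addrA -scalerDl; congr (_ + _ *: _); ring.
  have [||a /andP[a0 a1] H] := W (z + t *: v) (- t); first by rewrite oppr_gt0.
    by move=> a /andP[a0 a1]; rewrite e; apply: du; rewrite subr_ge0 a1 gerBl.
  exists (1 - a); first by rewrite subr_ge0 a1 gerBl.
  by move: H; rewrite e -addrA -scalerDl subrr scale0r addr0 => H; rewrite -[LHS]opprB H mulNr opprK.
pose g a := u (z + a *: v).
have dg (x : R) : 0 <= x <= t -> derivable g x 1.
  move=> /andP[x0 xt]; have := du (x / t).
  rewrite divr_ge0 ?(ltW t0)// ler_pdivrMr// mul1r xt divfK ?gt_eqF// => /(_ isT).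
  by rewrite /derivable -line_quotient.
have Dg (x : R) : 'D_1 g x = 'D_v u (z + x *: v) by rewrite /derive line_quotient.
have [x /andP[]||c] := @MVT_segment R g (fun a : R => 'D_1 g a) 0 t (ltW t0).
- by rewrite !bnd_simp => x0 xt; apply/derivableP/dg; rewrite !ltW.
- by apply: derivable_within_continuous => x; rewrite in_itv/=; exact: dg.
rewrite in_itv/= => /andP[c0 ct]; rewrite Dg subr0 mulrC /g scale0r addr0 => E.
exists (c / t); last by rewrite divfK ?gt_eqF.
by rewrite divr_ge0 ?(ltW t0)// ler_pdivrMr// mul1r.
Qed.

Lemma coord_mvt u x h :
  (forall z, `|z - x| <= `|h| -> forall i, derivable u z (evec i)) ->
  exists2 xi : 'I_n -> V, (forall j, `|xi j - x| <= `|h|) &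
    u (x + h) - u x = \sum_j h 0 j * 'D_(evec j) u (xi j).
Proof.
move=> du.
have /choice[xi Hxi] (j : 'I_n) : exists xi, `|xi - x| <= `|h| /\
    u (coord_path x h j.+1) - u (coord_path x h j) = h 0 j * 'D_(evec j) u xi.
  have [|a a01 E] := @line_mvt u (coord_path x h j) (evec j) (h 0 j).
    by move=> a a01; apply: du; exact: coord_path_near.
  exists (coord_path x h j + (a * h 0 j) *: evec j); split; first exact: coord_path_near.
  rewrite -E (coord_pathS x h (ltn_ord j)) /=.
  by have -> : Ordinal (ltn_ord j) = j by exact: val_inj.
exists xi => [j|]; first by case: (Hxi j).
have /esym := telescope_sumr (fun j => u (coord_path x h j)) (leq0n n).
rewrite coord_path0 coord_pathn => ->; rewrite big_mkord.
by apply: eq_bigr => j _; case: (Hxi j).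
Qed.

Lemma lipschitz_of_partials u x (M : R) : 0 <= M ->
  (forall z, `|z - x| <= 1 -> forall i, derivable u z (evec i)) ->
  (forall z i, `|z - x| <= 1 -> `|'D_(evec i) u z| <= M) ->
  forall z, `|z - x| <= 1 -> `|u z - u x| <= n%:R * M * `|z - x|.
Proof.
move=> M0 du uM z zx; have [|xi Hxi E] := @coord_mvt u x (z - x).
  by move=> w wx; apply: du; exact: le_trans zx.
rewrite [x + _]addrC subrK in E; rewrite E; apply: le_trans (ler_norm_sum _ _ _) _.
apply: (@le_trans _ _ (\sum_(j < n) M * `|z - x|)); last first.
  by rewrite sumr_const card_ord -[leLHS]mulr_natl mulrA.
apply: ler_sum => j _; rewrite normrM mulrC; apply: ler_pM => //.
  by apply: uM; exact: le_trans (Hxi j) zx.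
exact: coord_le_norm.
Qed.

Lemma sdiff_of_partials u x (C g : R) : 0 <= C -> 0 <= g ->
  (forall z, `|z - x| <= 1 -> forall i, derivable u z (evec i)) ->
  (forall z i, `|z - x| <= 1 -> `|'D_(evec i) u z - 'D_(evec i) u x| <= C * `|z - x| `^ g) ->
  forall y, `|y| <= 1 -> `|sdiff u y x| <= 2 * (n%:R * C) * (`|y| * `|y| `^ g).
Proof.
move=> C0 g0 du uC y y1.
have half w : `|w| <= 1 -> `|u (x + w) - u x - \sum_j w 0 j * 'D_(evec j) u x| <= n%:R * C * (`|w| * `|w| `^ g).
  move=> w1; have [|xi Hxi ->] := @coord_mvt u x w.
    by move=> z zx; apply: du; exact: le_trans w1.
  rewrite -sumrB; apply: le_trans (ler_norm_sum _ _ _) _.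
  apply: (@le_trans _ _ (\sum_(j < n) C * (`|w| * `|w| `^ g))); last first.
    by rewrite sumr_const card_ord -[leLHS]mulr_natl mulrA.
  apply: ler_sum => j _; rewrite -mulrBr normrM mulrCA; apply: ler_pM => //; first exact: coord_le_norm.
  apply: le_trans (uC _ _ (le_trans (Hxi j) w1)) _; rewrite ler_wpM2l//.
  by apply: powR_le => //; exact: Hxi.
have h1 := half y y1; have h2 : `|- y| <= 1 by rewrite normrN.
have {}h2 := half (- y) h2; rewrite normrN in h2.
have sE : \sum_j (- y) 0 j * 'D_(evec j) u x = - \sum_j y 0 j * 'D_(evec j) u x.
  by rewrite -sumrN; apply: eq_bigr => j _; rewrite mxE mulNr.
rewrite sE opprK in h2.
have -> : sdiff u y x = (u (x + y) - u x - \sum_j y 0 j * 'D_(evec j) u x) +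
   (u (x - y) - u x + \sum_j y 0 j * 'D_(evec j) u x) by rewrite /sdiff; ring.
apply: le_trans (ler_normD _ _) _.
have -> : 2 * (n%:R * C) * (`|y| * `|y| `^ g) = n%:R * C * (`|y| * `|y| `^ g) + n%:R * C * (`|y| * `|y| `^ g) by ring.
exact: lerD.
Qed.

(** Integer part 0, 1 or at least 2 of [b]: the function itself is Holder, its partial derivatives
    are, or its second partial derivatives are locally bounded and the exponent 2 exceeds
    [2 * s]. *)
Lemma holder_sdiff (b s : R) u x : 0 < s -> s < 1 -> 2 * s < b -> holder_loc b u ->
  exists p C : R, [/\ 2 * s < p, 0 <= C & forall y, `|y| <= 1 -> `|sdiff u y x| <= C * `|y| `^ p].
Proof.
move=> s0 s1 sb; rewrite /holder_loc.
have b0 : 0 < b by apply: lt_trans sb; rewrite mulr_gt0.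
have /truncn_itv/andP[] := ltW b0.
set k := Num.truncn b => kb bk [cu hu].
pose r : R := n.+1%:R * (`|x| + 2).
have r0 : 0 < r by rewrite mulr_gt0// ltr_wpDl.
have inball z : `|z - x| <= 1 -> eball r z.
  move=> zx; rewrite /eball/=; apply: le_lt_trans (enorm_le_norm z) _; rewrite ltr_pM2l//.
  rewrite -(subrK x z); apply: le_lt_trans (ler_normD _ _) _; move: zx; clear; lra.
have xx : `|x - x| <= 1 by rewrite subrr normr0.
have yadd (p : R) y : 0 < p -> `|y| * `|y| `^ p = `|y| `^ (1 + p).
  move=> p0; have [->|yn] := eqVneq y 0; first by rewrite normr0 mul0r powR0// gt_eqF// addr_gt0.
  by rewrite powRD ?powRr1// normr_eq0 yn implybT.
have enormg (g : R) z w : 0 <= g -> enorm (z - w) `^ g <= n.+1%:R `^ g * `|z - w| `^ g.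
  move=> g0; rewrite -powRM//; apply: powR_le => //; [exact: enorm_ge0|exact: enorm_le_norm].
case: k kb bk cu hu => [|[|k]] kb bk cu hu.
- have [C HC] := hu [::] erefl r r0.
  rewrite subr0 in HC.
  exists b, (2 * (`|C| * n.+1%:R `^ b)); split => //.
  move=> y y1.
  have half w : `|w| <= 1 -> `|u (x + w) - u x| <= `|C| * n.+1%:R `^ b * `|w| `^ b.
    move=> w1; have := HC (x + w) x (inball _ _) (inball _ xx).
    rewrite [x + w]addrC addrK => /(_ w1) /le_trans; apply.
    rewrite -mulrA; apply: le_trans (ler_wpM2r (powR_ge0 _ _) (ler_norm C)) _.
    by rewrite ler_wpM2l//; have := enormg b (w + x) x (ltW b0); rewrite addrK.
  have h1 := half y y1; have := half (- y); rewrite normrN => /(_ y1) h2.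
  have -> : sdiff u y x = (u (x + y) - u x) + (u (x - y) - u x) by rewrite /sdiff; ring.
  apply: le_trans (ler_normD _ _) _; move: h1 h2; rewrite -!mulrA; set t := `|C| * _; clear; lra.
- have du z i : derivable u z (evec i) by have [_] := cu [::] isT z I; apply.
  have g0 : 0 <= b - 1 by rewrite subr_ge0.
  have /choice[C HC] (i : 'I_n) := hu [:: i] erefl r r0.
  pose C' := (\sum_i `|C i|) * n.+1%:R `^ (b - 1).
  have CC i : `|C i| <= \sum_i `|C i| by rewrite (bigD1 i)//= lerDl sumr_ge0.
  have C'0 : 0 <= C' by rewrite mulr_ge0 ?powR_ge0 ?sumr_ge0.
  have nC'0 : 0 <= 2 * (n%:R * C') by apply: mulr_ge0 => //; apply: mulr_ge0.
  exists b, (2 * (n%:R * C')); split => //.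
  move=> y y1; apply: le_trans (sdiff_of_partials C'0 g0 (fun z _ => du z) _ y1) _.
    move=> z i zx; apply: le_trans (HC i z x (inball _ zx) (inball _ xx)) _.
    rewrite /C' -mulrA; apply: le_trans (ler_wpM2r (powR_ge0 _ _) (le_trans (ler_norm _) (CC i))) _.
    by rewrite ler_wpM2l ?sumr_ge0//; exact: enormg.
  rewrite (ler_wpM2l nC'0)//.
  (* For [b = 1] the Holder exponent is 0 and [yadd] does not apply. *)
  have [b1|b1] := eqVneq b 1; first by rewrite b1 subrr powRr0 mulr1 powRr1.
  by rewrite yadd ?subr_gt0 ?lt_def ?b1// addrC subrK.
have du z i : derivable u z (evec i) by have [_] := cu [::] isT z I; apply.
have ddu z i j : derivable (fun x => 'D_(evec i) u x) z (evec j).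
  by have [_] := cu [:: i] isT z I; apply.
have ball0 : [set z : V | `|z - x| <= 1] !=set0 by exists x.
have /choice[M HM] (ij : 'I_n * 'I_n) : exists M, forall z, `|z - x| <= 1 ->
    `|pderivs [:: ij.1; ij.2] u z| <= M.
  have cD : continuous (fun z => `|pderivs [:: ij.1; ij.2] u z|).
    apply: (@cont_comp R _ _ _ (fun t : R => `|t|)); last exact: norm_continuous.
    by move=> z; have [] := cu [:: ij.1; ij.2] isT z I.
  have [z0 _ Hz0] := max_on_compact (@compact_norm_le R n x 1) ball0 cD.
  by exists `|pderivs [:: ij.1; ij.2] u z0| => z; exact: Hz0.
pose M' := \sum_ij `|M ij|.
have MM ij : `|M ij| <= M' by rewrite /M' (bigD1 ij)//= lerDl sumr_ge0.
have M'0 : 0 <= M' by exact: sumr_ge0.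
have C0 : 0 <= n%:R * M' by rewrite mulr_ge0.
exists 2, (2 * (n%:R * (n%:R * M'))); split => //.
- by move: s1; clear; lra.
- by rewrite !mulr_ge0.
move=> y y1; apply: le_trans (sdiff_of_partials (g := 1) C0 ler01 (fun z _ => du z) _ y1) _.
  move=> z i zx; rewrite powRr1//.
  apply: (@lipschitz_of_partials (fun x => 'D_(evec i) u x) x M' M'0 _ _ z zx) => [w _ j|w j wx]; first exact: ddu.
  by apply: le_trans (HM (j, i) w wx) _; exact: le_trans (ler_norm _) (MM _).
by rewrite yadd// ler_wpM2l// !mulr_ge0.
Qed.

End SecondDifference.

(** * From the principal value to one-sided limits *)

Section RealKernel.
Context {R : realType} {n : nat}.
Local Notation mu := (@lebn R n).
Local Notation V := 'rV[R]_n.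

Definition real_kernel (K : V -> \bar R) (y : V) : R := if y == 0 then 0 else fine (K y).

Lemma real_kernelE (s lam Lam : R) K y : kernel_class s lam Lam K -> y != 0 ->
  K y = (real_kernel K y)%:E.
Proof.
move=> HK y0; rewrite /real_kernel (negbTE y0) fineK//.
rewrite ge0_fin_numE ?(kernel_ge0 HK)//.
by apply: le_lt_trans (kernel_upper HK y0) _; rewrite ltry.
Qed.

Lemma measurable_continuous_away (f : V -> R) : (forall y, y != 0 -> {for y, continuous f}) ->
  measurable_fun setT (f : V -> measurableTypeR R).
Proof.
move=> cf; apply: (measurability _ (RGenOInfty.measurableE R)).
move=> _ [_ [a ->] <-]; rewrite setTI.
set A := _ @^-1` _.
have -> : A = (A `&` [set y | 0 < `|y|]) `|` (A `&` [set y | `|y| <= 0]).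
  rewrite -setIUr (_ : _ `|` _ = setT) ?setIT//.
  by apply/seteqP; split => // y _ /=; case: (leP `|y| 0); [right|left].
apply: measurableU.
  apply: measurable_open_rV; rewrite openE => y /= [Ay y0].
  have yn : y != 0 by rewrite -normr_gt0.
  have n1 : nbhs y A by apply: (cf y yn); apply: open_nbhs_nbhs; split => //; exact: interval_open.
  have n2 : nbhs y [set y : V | 0 < `|y|].
    apply: open_nbhs_nbhs; split => //; apply: cont_open_lt; exact: cont_norm.
  exact: filterI.
have [A0|A0] := pselect (A 0).
  rewrite (_ : A `&` _ = [set y | `|y| <= 0]); first exact: measurable_norm_le.
  apply/seteqP; split => y /=; first by case.
  by move=> y0; split => //; have /eqP -> : y == 0 by rewrite -normr_le0.
rewrite (_ : A `&` _ = set0)//; apply/seteqP; split => y //= [Ay].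
by rewrite normr_le0 => /eqP y0; rewrite y0 in Ay.
Qed.

Lemma stable_real_kernel (s lam Lam : R) K : 0 < s -> 0 < lam -> kernel_class s lam Lam K ->
  stable_kernel s (lam * n.+1%:R `^ (- (n%:R + 2 * s))) Lam (real_kernel K).
Proof.
move=> s0 lam0 HK; set p := n%:R + 2 * s.
have p0 : 0 < p by rewrite ltr_wpDl// mulr_gt0.
have pE : - n%:R - 2 * s = - p by rewrite /p opprD.
have Lam0 (y : V) : y != 0 -> 0 <= Lam.
  move=> y0; have := le_trans (kernel_lower HK y0) (kernel_upper HK y0).
  rewrite lee_fin ler_pM2r ?powR_gt0 ?enorm_gt0// => /(le_trans _); apply; exact: ltW.
split.
- have mK : measurable_fun setT ((fine \o K) : V -> measurableTypeR R).
    apply: measurable_continuous_away => y y0.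
    exact: differentiable_continuous (kernel_diff HK y0).
  have mI : measurable [set y : V | 0 < `|y|] by exact: measurable_norm_gt.
  have := measurable_funM mK (measurable_indic mI).
  apply: eq_measurable_fun => y _; rewrite /= /real_kernel indicE.
  have [->|yn] := eqVneq y 0; first by rewrite memNset ?mulr0// /= normr0 ltxx.
  by rewrite mem_set ?mulr1//= normr_gt0.
- by rewrite /real_kernel eqxx.
- by move=> y; rewrite /real_kernel oppr_eq0 -(kernel_sym HK).
- move=> y y0; rewrite -lee_fin -(real_kernelE HK y0); apply: le_trans (kernel_lower HK y0).
  rewrite lee_fin pE -mulrA ler_pM2l// -powRM//; apply: powR_anti; rewrite ?oppr_le0 ?(ltW p0)//.
    exact: enorm_gt0.
  exact: enorm_le_norm.
- move=> y y0; rewrite -lee_fin -(real_kernelE HK y0); apply: le_trans (kernel_upper HK y0) _.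
  rewrite lee_fin pE; apply: ler_wpM2l; first exact: Lam0 y0.
  apply: powR_anti; rewrite ?oppr_le0 ?(ltW p0)//.
    by rewrite normr_gt0.
  exact: norm_le_enorm.
Qed.

Lemma outside_antimono (r r' : R) : r <= r' -> @outside R n r' `<=` outside r.
Proof. by move=> rr y /=; exact: le_lt_trans. Qed.

Lemma cvg_outside (g : V -> R) : measurable_fun setT (g : V -> measurableTypeR R) ->
  (forall y, 0 <= g y) -> (\int[mu]_y (g y)%:E < +oo)%E ->
  exists l : R, (\int[mu]_(y in outside r) g y) @[r --> 0^'+] --> l.
Proof.
move=> mg g0 gfin.
have mo r := @measurable_outside R n r.
have mE : measurable_fun setT (fun y => (g y)%:E) by exact/measurable_EFinP.
have le1 r : (\int[mu]_(y in outside r) (g y)%:E <= \int[mu]_y (g y)%:E)%E.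
  by apply: ge0_subset_integral => // y _; rewrite lee_fin.
have fin r : (\int[mu]_(y in outside r) (g y)%:E)%E \is a fin_num.
  rewrite ge0_fin_numE; first exact: le_lt_trans (le1 r) gfin.
  by apply: integral_ge0 => y _; rewrite lee_fin.
have fint : (\int[mu]_y (g y)%:E)%E \is a fin_num.
  by rewrite ge0_fin_numE//; apply: integral_ge0 => y _; rewrite lee_fin.
eexists; apply: (@nonincreasing_at_right_cvgr R _ 0 (BLeft 1)); first by rewrite bnd_simp.
  move=> r r' _ _ rr; rewrite /Rintegral fine_le//.
  apply: ge0_subset_integral => //; [exact: measurable_funTS|by move=> y _; rewrite lee_fin|exact: outside_antimono].
exists (fine (\int[mu]_y (g y)%:E)) => _ [r _ <-].
by rewrite /Rintegral fine_le.
Qed.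

Section Limit.
Variables (s gam l m : R) (k : V -> R).
Hypothesis HK : kernel_setting s gam l m k.
Let p := n%:R + 2 * s.

Lemma second_diff_integrableT w x (q C : R) : growth_adm gam w -> 2 * s < q -> 0 <= C ->
  (forall y, `|y| <= 1 -> `|sdiff w y x| <= C * `|y| `^ q) ->
  (\int[mu]_y `|(2 * w x - w (x + y) - w (x - y)) * k y|%:E < +oo)%E.
Proof.
move=> aw sq C0 Hq; pose f y := (2 * w x - w (x + y) - w (x - y)) * k y.
have mw := adm_measurable aw.
have mf : measurable_fun setT (f : V -> measurableTypeR R).
  apply: measurable_funM; last exact: (sk_meas (ks_kernel HK)).
  apply: measurable_funB; first (apply: measurable_funB; first exact: measurable_cst).
    by have := measurable_shift x mw; apply: eq_measurable_fun => y _; rewrite addrC.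
  have := measurableT_comp mw (@measurable_affine_rV R n (-1) x).
  by apply: eq_measurable_fun => y _ /=; rewrite scaleN1r addrC.
have mfa : measurable_fun setT (fun y => `|f y|%:E).
  by apply/measurable_EFinP; exact: measurableT_comp.
pose A : set V := [set y | `|y| <= 1]; pose B : set V := [set y | 1 < `|y|].
have mA : measurable A by exact: measurable_norm_le.
have mB : measurable B by exact: measurable_norm_gt.
have AB : A `|` B = setT.
  by apply/seteqP; split => // y _; case: (leP `|y| 1); [left|right].
have dAB : [disjoint A & B].
  by apply/disj_setPS => y [/= h1 h2]; have := le_lt_trans h1 h2; rewrite ltxx.
have fa0 y : (0 <= `|f y|%:E)%E by rewrite lee_fin.
rewrite -AB ge0_integral_setU//; last by rewrite AB.
apply: lte_add_pinfty; last first.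
  have := second_diff_integrable HK x ltr01 aw => /integrableP[_].
  apply: le_lt_trans; apply: ge0_subset_integral => //.
  - exact: measurable_outside.
  - exact: measurable_funTS.
  - by move=> y; rewrite /B/= => /lt_le_trans; apply; exact: norm_le_enorm.
have Cm0 : 0 <= C * m by rewrite mulr_ge0// ltW// (ks_m0 HK).
pose A' : set V := [set y | (0 < `|y|) /\ (`|y| <= 1)].
have mA' : measurable A'.
  by apply: measurableI; [exact: measurable_norm_gt|exact: measurable_norm_le].
have qp : 0 < q - (p - n%:R) by move: sq; rewrite /p; lra.
have near := @powR_near_integral R n q p qp.
have mpow : measurable_fun setT (fun y : V => (`|y| `^ (q - p))%:E).
  apply/measurable_EFinP; apply: (measurableT_comp (@measurable_powR R (q - p))).
  exact: measurable_norm_rV.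
apply: (@le_lt_trans _ _ ((C * m)%:E * \int[mu]_(y in A') (`|y| `^ (q - p))%:E)%E); last first.
  have : (\int[mu]_(y in A') (`|y| `^ (q - p))%:E)%E \is a fin_num.
    by rewrite ge0_fin_numE// integral_ge0// => y _; rewrite lee_fin powR_ge0.
  by move=> /fineK <-; rewrite -EFinM ltry.
rewrite -ge0_integralZl//; last exact: measurable_funTS.
rewrite (int_indic (fun y => `|f y|) mA).
rewrite (_ : (\int[mu]_(y in A') _ = \int[mu]_y ((C * m * `|y| `^ (q - p)) * \1_A' y)%:E)%E); last first.
  by rewrite -(int_indic (fun y => C * m * `|y| `^ (q - p)) mA').
apply: ge0_le_integral => //.
- by apply/measurable_EFinP; apply: measurable_funM; [exact/measurable_EFinP|exact: measurable_indic].
- apply/measurable_EFinP; apply: measurable_funM; last exact: measurable_indic.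
  by apply: measurable_funM; [exact: measurable_cst|exact/measurable_EFinP].
move=> y _; rewrite lee_fin.
have [->|yn] := eqVneq y 0.
  by rewrite /f (sk_zero (ks_kernel HK)) mulr0 normr0 mul0r !mulr_ge0 ?powR_ge0// ltW// (ks_m0 HK).
have y0 : 0 < `|y| by rewrite normr_gt0.
have [yA|yA] := pselect (A y); last first.
  by rewrite indicE memNset// mulr0 !mulr_ge0 ?powR_ge0// ltW// (ks_m0 HK).
rewrite !indicE !mem_set// !mulr1 /f normrM (ger0_norm (kernel_nneg HK y)).
have -> : C * m * `|y| `^ (q - p) = (C * `|y| `^ q) * (m * `|y| `^ (- p)).
  by rewrite powR_add//; ring.
apply: ler_pM => //; first exact: (kernel_nneg HK).
  have -> : 2 * w x - w (x + y) - w (x - y) = - sdiff w y x by rewrite /sdiff; ring.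
  by rewrite normrN; exact: Hq.
exact: (kernel_le HK).
Qed.

(** After symmetrisation the integrand is absolutely integrable; its positive and negative parts
    give bounded monotone functions of [r], which converge. *)
Lemma trunc_op_cvg w x (q C : R) : growth_adm gam w -> 2 * s < q -> 0 <= C ->
  (forall y, `|y| <= 1 -> `|sdiff w y x| <= C * `|y| `^ q) ->
  exists L : R, trunc_op k r w x @[r --> 0^'+] --> L.
Proof.
move=> aw sq C0 Hq; pose f y := (2 * w x - w (x + y) - w (x - y)) * k y.
have mw := adm_measurable aw.
have mf : measurable_fun setT (f : V -> measurableTypeR R).
  apply: measurable_funM; last exact: (sk_meas (ks_kernel HK)).
  apply: measurable_funB; first (apply: measurable_funB; first exact: measurable_cst).
    by have := measurable_shift x mw; apply: eq_measurable_fun => y _; rewrite addrC.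
  have := measurableT_comp mw (@measurable_affine_rV R n (-1) x).
  by apply: eq_measurable_fun => y _ /=; rewrite scaleN1r addrC.
have fin := second_diff_integrableT aw sq C0 Hq; rewrite -/f in fin.
have mfa : measurable_fun setT (fun y => `|f y|%:E).
  by apply/measurable_EFinP; exact: measurableT_comp.
have part (g : V -> R) : measurable_fun setT (g : V -> measurableTypeR R) ->
    (forall y, 0 <= g y <= `|f y|) -> exists l : R, (\int[mu]_(y in outside r) g y) @[r --> 0^'+] --> l.
  move=> mg g01; apply: cvg_outside => //.
    by move=> y; case/andP: (g01 y).
  apply: le_lt_trans fin; apply: ge0_le_integral => //.
  - by move=> y _; rewrite lee_fin; case/andP: (g01 y).
  - exact/measurable_EFinP.
  - by move=> y _; rewrite lee_fin; case/andP: (g01 y).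
have [|y|P HP] := part (fun y => Num.max (f y) 0).
- by apply: measurable_maxr => //; exact: measurable_cst.
- by rewrite le_max lexx orbT ge_max ler_norm normr_ge0.
have [|y|M HM] := part (fun y => Num.max (- f y) 0).
- by apply: measurable_maxr; [exact: measurableT_comp|exact: measurable_cst].
- by rewrite le_max lexx orbT ge_max -normrN ler_norm normr_ge0.
exists (2^-1 * (P - M)).
have H : (2^-1 * (\int[mu]_(y in outside r) Num.max (f y) 0 - \int[mu]_(y in outside r) Num.max (- f y) 0)) @[r --> 0^'+]
    --> 2^-1 * (P - M).
  by apply: cvgM; [exact: cvg_cst|exact: cvgB].
apply: cvg_trans H; apply: near_eq_cvg; near=> r.
have r0 : 0 < r by near: r; exact: nbhs_right_gt.
have mo := @measurable_outside R n r.
rewrite (trunc_op_sym HK x r0 aw) -/f; congr (_ * _).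
have fi := second_diff_integrable HK x r0 aw.
have ip : mu.-integrable (outside r) (EFin \o (fun y => Num.max (f y) 0)).
  apply: le_integrable fi => //; first by apply: measurable_funTS; apply/measurable_EFinP; apply: measurable_maxr => //; exact: measurable_cst.
  by move=> y _ /=; rewrite lee_fin ger0_norm ?le_max ?lexx ?orbT// ge_max ler_norm normr_ge0.
have im : mu.-integrable (outside r) (EFin \o (fun y => Num.max (- f y) 0)).
  apply: le_integrable fi => //; first by apply: measurable_funTS; apply/measurable_EFinP; apply: measurable_maxr; [exact: measurableT_comp|exact: measurable_cst].
  by move=> y _ /=; rewrite lee_fin ger0_norm ?le_max ?lexx ?orbT// ge_max -[X in _ <= `|X|]/(f y) -normrN ler_norm normr_ge0.
rewrite -RintegralB//; apply: eq_Rintegral => y _ /=; rewrite -/(f y).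
by case: (leP (f y) 0) => h; case: (leP (- f y) 0) => h'; move: h h'; lra.
Unshelve. all: by end_near. Qed.

End Limit.

Lemma nonlocal_trunc (s gam l m lam Lam : R) K w x (r : R) : kernel_class s lam Lam K ->
  kernel_setting s gam l m (real_kernel K) -> growth_adm gam w -> 0 < r ->
  (\int[mu]_(y in [set y | (r < enorm (x - y))%R]) ((w x - w y)%:E * K (x - y)%R) =
   (trunc_op (real_kernel K) r w x)%:E)%E.
Proof.
move=> HK HS aw r0; set k := real_kernel K.
have mk := sk_meas (ks_kernel HS); have mw := adm_measurable aw.
pose S : set V := [set y | r < enorm (x - y)].
have mphi := @measurable_affine_rV R n (-1) x.
have SE : S = (fun y : V => (-1) *: y + x) @^-1` (outside r).
  by apply/seteqP; split => y /=; rewrite /S/outside/= scaleN1r addrC.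
have mS : measurable S.
  by rewrite SE; have := mphi measurableT _ (@measurable_outside R n r); rewrite setTI.
pose F y := (w x - w y) * k (x - y).
have mF : measurable_fun setT (F : V -> measurableTypeR R).
  apply: measurable_funM; first by apply: measurable_funB => //; exact: measurable_cst.
  have := measurableT_comp mk mphi.
  by apply: eq_measurable_fun => y _ /=; rewrite scaleN1r addrC.
transitivity (\int[mu]_(y in S) (F y)%:E)%E.
  apply: eq_integral => y; rewrite inE /S/= => ry.
  rewrite (real_kernelE HK) ?EFinM// -/k.
  apply: contraTneq ry => ->; rewrite -leNgt /enorm /edot big1 ?sqrtr0 ?ltW// => i _.
  by rewrite mxE mul0r.
have mG : measurable_fun setT (fun y => (F y * \1_S y)%:E).
  by apply/measurable_EFinP; apply: measurable_funM => //; exact: measurable_indic.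
have fi := integrable_fin_num (@measurable_outside R n r) (trunc_integrable HS x r0 aw).
rewrite (int_indic F mS) -(integral_shift x mG) /trunc_op /Rintegral fineK//.
rewrite (int_indic (fun y => (w x - w (x + y)) * k y) (@measurable_outside R n r)).
apply: eq_integral => y _; rewrite /F; congr (_%:E).
have e : x - (y + x) = - y by rewrite opprD addrCA subrr addr0.
have ksym z : k (- z) = k z by exact: (sk_sym (ks_kernel HS)).
rewrite e ksym [y + x]addrC; congr (_ * _).
have E2 : (x + y \in S) = (y \in outside r).
  by apply/idP/idP; rewrite !inE /S/outside/= [x + y]addrC e enormN.
by rewrite !indicE E2.
Qed.

(** The bound on second differences makes the principal value exist, so that [lim] in [nonlocal] is
    not a default value and its sign passes to the one-sided limit. *)
Lemma nonlocal_ge0_Lge (s gam l m lam Lam : R) K w x (q C : R) : kernel_class s lam Lam K ->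
  kernel_setting s gam l m (real_kernel K) -> growth_adm gam w -> 2 * s < q -> 0 <= C ->
  (forall y, `|y| <= 1 -> `|sdiff w y x| <= C * `|y| `^ q) ->
  (0 <= nonlocal K w x)%E -> Lge (real_kernel K) w x 0.
Proof.
move=> HK HS aw sq C0 Hq.
have [L HL] := trunc_op_cvg HS aw sq C0 Hq.
have -> : nonlocal K w x = L%:E.
  rewrite /nonlocal; apply: cvg_lim => //.
  have : (trunc_op (real_kernel K) r w x)%:E @[r --> 0^'+] --> L%:E.
    by apply: cvg_comp HL _; exact: cvg_id.
  apply: cvg_trans; apply: near_eq_cvg; near=> r; apply/esym/(nonlocal_trunc x HK HS aw).
  by near: r; exact: nbhs_right_gt.
rewrite lee_fin => L0 e e0.
have : \forall r \near (0:R)^'+, L - e < trunc_op (real_kernel K) r w x.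
  by apply: (cvgr_gt _ HL); rewrite gtrBl.
move=> [r0 /= r00 H]; exists r0 => // r rp rr.
have /H/(_ rp) : ball 0 r0 r by rewrite /ball/= sub0r normrN gtr0_norm.
have := trunc_opZ HS (-1) x rp aw; under eq_fun do rewrite mulN1r.
by move=> ->; move: L0; clear; lra.
Unshelve. all: by end_near. Qed.

End RealKernel.

Lemma powR_decay {R : realType} (D e a R0 : R) : 0 <= D -> 0 < e -> 0 < a ->
  exists2 r : R, R0 <= r /\ 1 <= r & D * r `^ (- a) < e.
Proof.
move=> D0 e0 a0; pose t := (D / e + 1) `^ a^-1.
have De : 0 < D / e + 1 by rewrite ltr_wpDl// divr_ge0// ltW.
have t0 : 0 < t by rewrite powR_gt0.
exists (Num.max (Num.max R0 1) t); first by rewrite !le_max !lexx !orbT.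
have tE : t `^ (- a) = (D / e + 1)^-1.
  by rewrite powRN -powRrM mulVf ?gt_eqF// powRr1// ltW.
apply: (@le_lt_trans _ _ (D * t `^ (- a))).
  rewrite ler_wpM2l//; apply: powR_anti => //; first by rewrite oppr_le0 ltW.
  by rewrite le_max lexx orbT.
rewrite tE ltr_pdivrMr// mulrDr mulrC mulr1 -mulrA mulVf ?gt_eqF// mulr1 ltrDl//.
Qed.

(** * Rescaling and convexity *)

Section Scaling.
Context {R : realType} {n : nat}.
Local Notation mu := (@lebn R n).
Local Notation V := 'rV[R]_n.

Lemma integral_scale (c : R) (F : V -> \bar R) : 0 < c -> mu.-integrable setT F ->
  (\int[mu]_y F (c *: y)%R = (c^-1 ^+ n)%:E * \int[mu]_y F y)%E.
Proof.
move=> c0 iF; have [mF _] := integrableP _ _ _ iF.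
have cn : c != 0 by rewrite gt_eqF.
rewrite integralE [in RHS]integralE.
have H g : measurable_fun setT g -> (forall x, 0 <= g x)%E ->
    (\int[mu]_x g (c *: x)%R = (c^-1 ^+ n)%:E * \int[mu]_x g x)%E.
  move=> mg g0; rewrite -{2}(gtr0_norm c0) -(ge0_integral_affine 0 cn mg g0).
  by apply: eq_integral => x _; rewrite addr0.
rewrite muleBr//; last first.
  by rewrite fin_num_adde_defl// fin_numN integrable_neg_fin_num.
congr (_ - _)%E.
  rewrite -(H (F^\+)%E)//; last exact: measurable_funepos.
  by apply: eq_integral => x _; rewrite !funeposE.
rewrite -(H (F^\-)%E)//; last exact: measurable_funeneg.
by apply: eq_integral => x _; rewrite !funenegE.
Qed.

(** The kernel of the operator as seen by [x -> w (c x)], normalised so that the bounds [l] and [m]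
    do not change; homogeneous kernels are fixed by it. *)
Definition scaled_kernel (s c : R) (k : V -> R) (y : V) : R := c `^ (n%:R + 2 * s) * k (c *: y).

Section Fixed.
Variables (s gam l m : R) (k : V -> R).
Hypothesis HK : kernel_setting s gam l m k.
Let p := n%:R + 2 * s.

Lemma trunc_op_scale (c r : R) w x : 0 < c -> 0 < r -> growth_adm gam w ->
  trunc_op (scaled_kernel s c k) r (fun z => w (c *: z)) x = c `^ (2 * s) * trunc_op k (c * r) w (c *: x).
Proof.
move=> c0 r0 aw; have cr0 : 0 < c * r by rewrite mulr_gt0.
have mo q := @measurable_outside R n q.
pose f z := c `^ p * ((w (c *: x) - w (c *: x + z)) * k z).
have i0 := trunc_integrable HK (c *: x) cr0 aw.
have fi : mu.-integrable (outside (c * r)) (EFin \o f).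
  have := integrableZl (mo _) (c `^ p) i0.
  by apply: eq_integrable => // z _; rewrite /f /= EFinM.
have -> : c `^ (2 * s) * trunc_op k (c * r) w (c *: x) = c^-1 ^+ n * \int[mu]_(z in outside (c * r)) f z.
  rewrite /f RintegralZl// mulrA; congr (_ * _).
  by rewrite /p powRD ?(gt_eqF c0) ?implybT// powR_mulrn ?(ltW c0)// exprVn mulKf// expf_neq0// gt_eqF.
have iF : mu.-integrable setT ((EFin \o f) \_ (outside (c * r))) by exact: (proj1 (integrable_mkcond _ (mo _)) fi).
rewrite /trunc_op /Rintegral integral_mkcond [in RHS]integral_mkcond.
rewrite (_ : fine _ = fine (\int[mu]_y ((EFin \o f) \_ (outside (c * r))) (c *: y)%R)); last first.
  congr fine; apply: eq_integral => y _; rewrite !patchE.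
  have -> : (c *: y \in outside (c * r)) = (y \in outside r).
    by apply/idP/idP; rewrite !inE /outside/= enormZ gtr0_norm// ltr_pM2l.
  case: ifP => // _; rewrite /f /scaled_kernel -/p /= scalerDr; congr (_%:E); ring.
rewrite integral_scale// fineM//; last by apply: integrable_fin_num.
Qed.

Lemma Lle0_scale (c : R) w x : 0 < c -> growth_adm gam w -> Lle k w (c *: x) 0 ->
  Lle (scaled_kernel s c k) (fun z => w (c *: z)) x 0.
Proof.
move=> c0 aw L e e0; have cs : 0 < c `^ (2 * s) by rewrite powR_gt0.
have [r0 r00 H] := L (e / c `^ (2 * s)) (divr_gt0 e0 cs).
exists (r0 / c); first by rewrite divr_gt0.
move=> r rp rr; rewrite trunc_op_scale// add0r mulrC -ler_pdivlMr//.
by have := H (c * r); rewrite add0r; apply; [rewrite mulr_gt0|rewrite mulrC -ltr_pdivlMr].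
Qed.

Lemma scaled_setting (c : R) : 0 < c -> kernel_setting s gam l m (scaled_kernel s c k).
Proof.
move=> c0; case: HK => s0 s1 g0 gs l0 m0 [mk kz ks kl ku].
have cp : 0 < c `^ p by rewrite powR_gt0.
have sc (y : V) : `|y| `^ (- p) = c `^ p * `|c *: y| `^ (- p).
  by rewrite normrZ (gtr0_norm c0) (powRM (- p) (ltW c0))// mulrA -powRD ?subrr ?powRr0 ?mul1r// (gt_eqF c0) implybT.
split=> //; split.
- apply: measurable_funM; first exact: measurable_cst.
  have := measurableT_comp mk (@measurable_affine_rV R n c 0).
  by apply: eq_measurable_fun => y _ /=; rewrite addr0.
- by rewrite /scaled_kernel scaler0 kz mulr0.
- by move=> y; rewrite /scaled_kernel scalerN ks.
- move=> y y0; rewrite -/p sc mulrCA ler_pM2l//; apply: kl.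
  by rewrite scaler_eq0 negb_or gt_eqF.
- move=> y y0; rewrite -/p sc mulrCA /scaled_kernel -/p ler_pM2l//; apply: ku.
  by rewrite scaler_eq0 negb_or gt_eqF.
Qed.

End Fixed.

(** The hypotheses in a form closed under dilation ([incr_solution_scale]): the kernel keeps its
    bounds and [Q] is multiplied by [c^(1 + sig)]. *)
Record incr_solution (s gam l m sig Q : R) (k u : V -> R) : Prop := {
  is_setting : kernel_setting s gam l m k ;
  is_sig0 : 0 < sig ;
  is_siggam : sig < gam ;
  is_Q0 : 0 < Q ;
  is_cont : continuous u ;
  is_ge0 : forall x, 0 <= u x ;
  is_growth : lip_growth sig Q u ;
  is_incr : forall x h, 0 < u x -> Lge k (fun z => u (z + h) - u z) x 0 }.

Lemma adm_incr (s gam l m sig Q : R) k u h : incr_solution s gam l m sig Q k u ->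
  growth_adm gam (fun z => u (z + h) - u z).
Proof.
move=> H; have sg := is_siggam H; have s0 := is_sig0 H; have Q0 := is_Q0 H.
apply: (@adm_of_cont _ _ gam _ (Q * `|h| * (1 + `|h|) `^ gam)).
  apply: cont_sub; last exact: (is_cont H).
  by apply: (@cont_comp R _ _ (fun z : V => z + h) u); [exact: cont_shift|exact: (is_cont H)].
move=> x; apply: le_trans (is_growth H x h) _; rewrite -[leRHS]mulrA ler_wpM2l ?mulr_ge0 ?(ltW Q0)//.
rewrite -powRM ?addr_ge0//; apply: (@le_trans _ _ ((1 + `|x| + `|h|) `^ gam)).
  by apply: ler_powR; [rewrite -addrA lerDl addr_ge0|exact: ltW].
apply: powR_le; [exact: ltW (lt_trans s0 sg)|by rewrite !addr_ge0|].
have := mulr_ge0 (normr_ge0 x) (normr_ge0 h); move=> h1.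
by rewrite mulrDr mulr1 mulrDl mul1r; move: h1; clear; lra.
Qed.

Lemma incr_solution_scale (s gam l m sig Q c : R) k u : 1 <= c ->
  incr_solution s gam l m sig Q k u ->
  incr_solution s gam l m sig (Q * c `^ (1 + sig)) (scaled_kernel s c k) (fun x => u (c *: x)).
Proof.
move=> c1 H; have c0 : 0 < c by apply: lt_le_trans c1.
have sig0 := is_sig0 H; have Q0 := is_Q0 H.
split.
- by apply: scaled_setting; [exact: (is_setting H)|exact: c0].
- exact: sig0.
- exact: is_siggam H.
- by rewrite mulr_gt0// powR_gt0.
- by apply: (@cont_comp R _ _ (fun z : V => c *: z) u); [exact: cont_scale|exact: (is_cont H)].
- by move=> x; exact: (is_ge0 H).
- move=> x h; rewrite scalerDr; apply: le_trans (is_growth H _ _) _.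
  rewrite !normrZ (gtr0_norm c0).
  have -> : Q * c `^ (1 + sig) * `|h| * (1 + `|x| + `|h|) `^ sig =
    Q * (c * `|h|) * (c * (1 + `|x| + `|h|)) `^ sig.
    rewrite (powRM sig (ltW c0)) ?addr_ge0// powRD ?(gt_eqF c0) ?implybT// powRr1 ?(ltW c0)//; ring.
  rewrite ler_wpM2l ?mulr_ge0 ?(ltW Q0) ?(ltW c0)//; apply: powR_le; first exact: ltW.
    by rewrite !addr_ge0// mulr_ge0// ltW.
  by rewrite !mulrDr mulr1 !lerD2r.
- move=> x h ux; have L := is_incr H (c *: h) ux.
  have := Lle0_scale (is_setting H) c0 (adm_opp (adm_incr (c *: h) H)).
  move=> /(_ x); rewrite /Lge oppr0 in L; move=> /(_ L).
  by rewrite /Lge oppr0; under eq_fun do rewrite -scalerDr.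
Qed.

Lemma incr_sdiff (s gam l m sig Q : R) k u h x : incr_solution s gam l m sig Q k u ->
  0 < u x -> Lge k (sdiff u h) x 0.
Proof.
move=> H ux; have HK := is_setting H.
have a1 := adm_opp (adm_incr h H); have a2 := adm_opp (adm_incr (- h) H).
have := Lle_add HK a1 a2 (is_incr H h ux) (is_incr H (- h) ux).
rewrite !oppr0 addr0 /Lge oppr0.
rewrite (_ : (fun z => - sdiff u h z) = (fun z => - (u (z + h) - u z) + - (u (z - h) - u z)))//.
by apply/funext => z; rewrite /sdiff; ring.
Qed.

Lemma incr_sdiff_ge0 (s gam l m sig Q : R) k u x h : sig < 1 ->
  incr_solution s gam l m sig Q k u -> 0 <= sdiff u h x.
Proof.
move=> sig1 H; have HK := is_setting H; have sig0 := is_sig0 H; have Q0 := is_Q0 H.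
have [h0|h0] := eqVneq h 0.
  by rewrite h0 /sdiff subr0 addr0 mulr_natl subrr.
(* Above [sig] the rescaled lower bound tends to 0 as the scale grows; below 1 the doubling argument
   works. *)
pose bet := (sig + 1) / 2.
have sb : sig < bet by rewrite /bet; move: sig1; clear; lra.
have b1 : bet < 1 by rewrite /bet; move: sig1; clear; lra.
have [C C0 HC] := @semiconvexity R n s gam l m sig bet (ks_s0 HK) (ks_s1 HK) (ks_gam0 HK)
  (ks_gam2 HK) (ks_l0 HK) (ks_m0 HK) sig0 (is_siggam H) sb b1.
have hp : 0 < `|h| by rewrite normr_gt0.
pose D := C * Q * `|h| `^ (1 + bet) * (n.+1%:R * (1 + `|x|) `^ gam).
have D0 : 0 <= D by rewrite !mulr_ge0 ?powR_ge0// ltW.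
rewrite leNgt; apply/negP => neg.
have e0 : 0 < - sdiff u h x by rewrite oppr_gt0.
have a0 : 0 < bet - sig by rewrite subr_gt0.
have [r [r1 r2] Hr] := powR_decay `|h| D0 e0 a0.
have r0 : 0 < r by apply: lt_le_trans r2.
have HS := incr_solution_scale r2 H.
(* [h] becomes a step of size [|h| / r] for the rescaled function. The constants [L] and [e]
   degenerate as [r] grows, but the inequality for second differences holds without error and at
   every point with [u > 0], so only [C] matters. *)
have kap0 : 0 < `|h| / r by rewrite divr_gt0.
have kap1 : `|h| / r <= 1 by rewrite ler_pdivrMr// mul1r.
have [L [e [L0 ep HL]]] := HC _ kap0 kap1.
have K0 := HL _ (is_setting HS) _ _ (is_Q0 HS) (is_cont HS) (is_growth HS).
have K Hyp := K0 Hyp (r^-1 *: x) (r^-1 *: h).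
have nE : `|r^-1 *: h| = `|h| / r by rewrite normrZ gtr0_norm ?invr_gt0// mulrC.
have sE : sdiff (fun z => u (r *: z)) (r^-1 *: h) (r^-1 *: x) = sdiff u h x.
  by rewrite /sdiff -!scalerDr -scalerBr !scalerA divff ?gt_eqF// !scale1r.
rewrite nE lexx sE in K.
have : - (C * (Q * r `^ (1 + sig)) * (`|h| / r) `^ (1 + bet) * weight gam (r^-1 *: x)) <= sdiff u h x.
  apply: K => // z w _ _ _ zneg.
  have uz : 0 < u (r *: z).
    have := is_ge0 H (r *: (z + w)); have := is_ge0 H (r *: (z - w)).
    by move: zneg; rewrite /sdiff; clear; lra.
  apply: Lle_mono (incr_sdiff w HS uz).
  by rewrite lerN2 oppr_le0 mulr_ge0 ?(ltW ep) ?(ltW (is_Q0 HS)).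
have gam0 := ks_gam0 HK.
have wle : weight gam (r^-1 *: x) <= n.+1%:R * (1 + `|x|) `^ gam.
  apply: (@le_trans _ _ (n.+1%:R * (1 + `|r^-1 *: x|) `^ gam)).
    apply: weight_le_growth => //.
    by have := ks_gam2 HK; have := ks_s1 HK; clear; lra.
  rewrite ler_wpM2l//; apply: powR_le; rewrite ?(ltW gam0) ?addr_ge0// lerD2l.
  rewrite normrZ gtr0_norm ?invr_gt0// mulrC ler_pdivrMr// ler_peMr//.
have rE : r `^ (1 + sig) * (`|h| / r) `^ (1 + bet) = `|h| `^ (1 + bet) * r `^ (- (bet - sig)).
  rewrite powRM ?invr_ge0 ?(ltW r0)// mulrCA; congr (_ * _).
  rewrite -powR_inv1 ?(ltW r0)// -powRrM -powRD ?(gt_eqF r0) ?implybT//; congr (_ `^ _); ring.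
have : C * (Q * r `^ (1 + sig)) * (`|h| / r) `^ (1 + bet) * weight gam (r^-1 *: x) <= D * r `^ (- (bet - sig)).
  have -> : C * (Q * r `^ (1 + sig)) * (`|h| / r) `^ (1 + bet) = C * Q * (r `^ (1 + sig) * (`|h| / r) `^ (1 + bet)) by ring.
  rewrite rE /D.
  have -> : C * Q * (`|h| `^ (1 + bet) * r `^ (- (bet - sig))) * weight gam (r^-1 *: x) =
    C * Q * `|h| `^ (1 + bet) * r `^ (- (bet - sig)) * weight gam (r^-1 *: x) by ring.
  have -> : C * Q * `|h| `^ (1 + bet) * (n.+1%:R * (1 + `|x|) `^ gam) * r `^ (- (bet - sig)) =
    C * Q * `|h| `^ (1 + bet) * r `^ (- (bet - sig)) * (n.+1%:R * (1 + `|x|) `^ gam) by ring.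
  by rewrite ler_wpM2l// !mulr_ge0 ?powR_ge0// ltW.
move: Hr; clear; lra.
Qed.

Lemma midconvex_line (u : V -> R) x y (t : R) : continuous u ->
  (forall z h, 0 <= sdiff u h z) -> 0 <= t <= 1 ->
  u (t *: x + (1 - t) *: y) <= t * u x + (1 - t) * u y.
Proof.
move=> cu su /andP[t0 t1]; apply/ler_addgt0Pr => e e0.
pose P (a : R) : V := a *: x + (1 - a) *: y.
(* The term [e * (a^2 - a)] is strictly convex in [a] and vanishes at both ends: at a positive,
   hence interior, maximum of [g] a second difference of [g] would be positive. *)
pose g (a : R) : R := u (P a) - (a * u x + (1 - a) * u y) + e * (a * a - a).
have cP : continuous P.
  move=> a; apply: (@continuousD R V R^o (fun a => a *: x) (fun a => (1 - a) *: y)).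
    by apply: continuousZl; exact: cvg_id.
  apply: continuousZl; apply: continuousB; [exact: cvg_cst|exact: cvg_id].
have cid : continuous (fun a : R => a) by move=> a; exact: cvg_id.
have c1 : continuous (fun a : R => 1 - a) by apply: cont_sub => //; exact: cont_cst.
have cg : continuous g.
  apply: cont_add.
    apply: cont_sub; first exact: (@cont_comp R _ _ P u).
    by apply: cont_add; apply: cont_mul => //; exact: cont_cst.
  apply: cont_mul; first exact: cont_cst.
  by apply: cont_sub => //; apply: cont_mul.
have [a0 a0I Hmax] := @EVT_max R g 0 1 ler01 (continuous_subspaceT cg).
move: a0I; rewrite in_itv/= => /andP[a00 a01].
have g0 : g 0 = 0 by rewrite /g /P scale0r subr0 scale1r add0r; ring.
have g1 : g 1 = 0 by rewrite /g /P subrr scale0r scale1r addr0; ring.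
have ga0 : g a0 <= 0.
  rewrite leNgt; apply/negP => ga0.
  have a00' : 0 < a0 by rewrite lt_def a00 andbT; apply: contraTneq ga0 => ->; rewrite g0 ltxx.
  have a01' : a0 < 1 by rewrite lt_def a01 andbT; apply: contraTneq ga0 => <-; rewrite g1 ltxx.
  pose d := Num.min a0 (1 - a0).
  have d0 : 0 < d by rewrite lt_min a00' subr_gt0.
  have [da db] : d <= a0 /\ d <= 1 - a0 by rewrite /d !ge_min !lexx orbT.
  have h1 := Hmax (a0 + d); have h2 := Hmax (a0 - d).
  rewrite !in_itv/= in h1 h2.
  have {}h1 : g (a0 + d) <= g a0 by apply: h1; apply/andP; split; move: a00 d0 db; clear; lra.
  have {}h2 : g (a0 - d) <= g a0 by apply: h2; apply/andP; split; move: a01 d0 da; clear; lra.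
  have := su (P a0) (d *: (x - y)); rewrite /sdiff.
  have -> : P a0 + d *: (x - y) = P (a0 + d).
    by rewrite /P; apply/rowP => i; rewrite !mxE; ring.
  have -> : P a0 - d *: (x - y) = P (a0 - d).
    by rewrite /P; apply/rowP => i; rewrite !mxE; ring.
  move: h1 h2; rewrite /g; have : 0 < e * (d * d) by rewrite !mulr_gt0.
  set A := u _; set B := u (P (a0 + d)); set C := u (P (a0 - d)).
  have -> : e * ((a0 + d) * (a0 + d) - (a0 + d)) = e * (a0 * a0 - a0) + (e * (d * a0) *+ 2 - e * d) + e * (d * d) by ring.
  have -> : e * ((a0 - d) * (a0 - d) - (a0 - d)) = e * (a0 * a0 - a0) - (e * (d * a0) *+ 2 - e * d) + e * (d * d) by ring.
  have -> : (a0 + d) * u x + (1 - (a0 + d)) * u y = (a0 * u x + (1 - a0) * u y) + d * (u x - u y) by ring.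
  have -> : (a0 - d) * u x + (1 - (a0 - d)) * u y = (a0 * u x + (1 - a0) * u y) - d * (u x - u y) by ring.
  by clear; lra.
have := Hmax t; rewrite in_itv/= t0 t1 => /(_ isT) /le_trans/(_ ga0).
rewrite /g -/(P t); have : e * (t - t * t) <= e.
  rewrite ler_piMr ?(ltW e0)//; have := mulr_ge0 t0 t0; move: t1; clear; lra.
have -> : e * (t - t * t) = - (e * (t * t - t)) by ring.
by clear; lra.
Qed.

Lemma midconvex_convex (u : V -> R) : continuous u -> (forall z h, 0 <= sdiff u h z) ->
  convex_function (setT : set (convex_lmodType V)) u.
Proof.
move=> cu su t x y _ _; rewrite convRE.
by apply: midconvex_line => //; rewrite ge0 le1.
Qed.

End Scaling.

(** * Reduction of the hypotheses to scale-invariant form *)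

Section Hypotheses.
Context {R : realType} {n : nat}.
Local Notation V := 'rV[R]_n.

Lemma powR_antitone_exp (a p q : R) : 0 <= a -> a <= 1 -> 0 < p -> p <= q -> a `^ q <= a `^ p.
Proof.
move=> a0 a1 p0 pq; have [->|an] := eqVneq a 0.
  by rewrite !powR0// gt_eqF// (lt_le_trans p0).
by apply: ger_powR => //; rewrite lt_def an a0 a1.
Qed.

Lemma incr_solution_of_hypotheses (s lam Lam : R) (K : V -> \bar R) (alpha : R) (u : V -> R) (eps c : R) :
  0 < s -> s < 1 -> 0 < lam -> lam <= Lam -> kernel_class s lam Lam K ->
  0 < alpha -> alpha < s -> alpha < 1 - s ->
  Ck_holder_loc 0 1 u -> 0 < eps -> holder_loc (2 * s + eps) u ->
  (forall x, 0 <= u x) -> 0 < c ->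
  (forall r : R, 1 <= r ->
    (Linfty_norm (eball r) (fun x => enorm (grad u x)) <= (c * r `^ (s + alpha))%:E)%E) ->
  (forall x h : V, 0 < u x -> h != 0 ->
    (0 <= nonlocal K (fun z => (u (z + h) - u z) / enorm h)%R x)%E) ->
  exists gam l Q : R, s < gam /\ incr_solution s gam l Lam (s + alpha) Q (real_kernel K) u.
Proof.
move=> s0 s1 lam0 lamLam HK al0 als al1 ulip eps0 uh u0 c0 ug ui.
have Lam0 : 0 < Lam by exact: lt_le_trans lamLam.
have sig0 : 0 <= s + alpha by rewrite addr_ge0// ltW.
have [Q Q0 lipQ] := lip_growth_of_gradient (ltW c0) sig0 ulip ug.
(* The midpoint of [s + alpha] and [2 * s], which are in this order as [alpha < s]. It also exceeds
   [s], so that [t_+^s] will be admissible. *)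
pose gam := (s + alpha + 2 * s) / 2.
have gsig : s + alpha < gam by rewrite /gam; move: als; clear; lra.
have g2s : gam < 2 * s by rewrite /gam; move: als; clear; lra.
have g0 : 0 < gam by apply: le_lt_trans gsig.
pose l := lam * n.+1%:R `^ (- (n%:R + 2 * s)).
have l0 : 0 < l by rewrite mulr_gt0// powR_gt0.
have cu : continuous u by move=> x; have [] := (ulip.1 [::] isT x I).
have HS : kernel_setting s gam l Lam (real_kernel K) by split => //; exact: stable_real_kernel.
exists gam, l, Q; split; first by apply: lt_trans gsig; rewrite ltrDl.
split => //; first by rewrite addr_gt0.
move=> x h ux.
have [->|hn] := eqVneq h 0.
  rewrite /Lge oppr0 (_ : (fun z => - (u (z + 0) - u z)) = (fun=> 0)); last first.
    by apply/funext => z; rewrite addr0 subrr oppr0.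
  exact: Lle_cst.
have eh := enorm_gt0 hn.
pose w z := u (z + h) - u z.
have aw : growth_adm gam w.
  apply: (@adm_of_cont _ _ gam _ (Q * `|h| * (1 + `|h|) `^ gam)).
    apply: cont_sub; last exact: cu.
    by apply: (@cont_comp R _ _ (fun z : V => z + h) u); [exact: cont_shift|exact: cu].
  move=> z; apply: le_trans (lipQ z h) _; rewrite -[leRHS]mulrA ler_wpM2l ?mulr_ge0 ?(ltW Q0)//.
  rewrite -powRM ?addr_ge0//; apply: (@le_trans _ _ ((1 + `|z| + `|h|) `^ gam)).
    by apply: ler_powR; [rewrite -addrA lerDl addr_ge0|exact: ltW].
  apply: powR_le; [exact: ltW|by rewrite !addr_ge0|].
  have := mulr_ge0 (normr_ge0 z) (normr_ge0 h); move=> h1.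
  by rewrite mulrDr mulr1 mulrDl mul1r; move: h1; clear; lra.
have sb : 2 * s < 2 * s + eps by rewrite ltrDl.
have [p1 [C1 [sp1 C10 H1]]] := holder_sdiff x s0 s1 sb uh.
have [p2 [C2 [sp2 C20 H2]]] := holder_sdiff (x + h) s0 s1 sb uh.
pose p := Num.min p1 p2.
have sp : 2 * s < p by rewrite lt_min sp1 sp2.
have p0 : 0 < p by apply: lt_trans sp; rewrite mulr_gt0.
have aW := adm_scale (enorm h)^-1 aw.
have L : Lge (real_kernel K) (fun z => (enorm h)^-1 * w z) x 0.
  apply: (@nonlocal_ge0_Lge _ _ s gam l Lam lam Lam K _ x p ((enorm h)^-1 * (C2 + C1)) HK HS aW sp).
  - by rewrite mulr_ge0 ?invr_ge0 ?(ltW eh)// addr_ge0.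
  - move=> y y1.
    have -> : sdiff (fun z => (enorm h)^-1 * w z) y x = (enorm h)^-1 * (sdiff u y (x + h) - sdiff u y x).
      by rewrite /sdiff /w (addrAC x y h) (addrAC x (- y) h); ring.
    rewrite normrM ger0_norm ?invr_ge0 ?(ltW eh)// -mulrA ler_wpM2l ?invr_ge0 ?(ltW eh)//.
    apply: le_trans (ler_normB _ _) _; rewrite mulrDl; apply: lerD.
      apply: le_trans (H2 y y1) _; rewrite ler_wpM2l//; apply: powR_antitone_exp => //.
      by rewrite ge_min lexx orbT.
    apply: le_trans (H1 y y1) _; rewrite ler_wpM2l//; apply: powR_antitone_exp => //.
    by rewrite ge_min lexx.
  - by have := ui x h ux hn; under [X in nonlocal K X]eq_fun do rewrite mulrC.
have := Lle_scale HS (ltW eh) (adm_opp aW) L.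
rewrite oppr0 mulr0 /Lge oppr0.
rewrite (_ : (fun z => enorm h * - ((enorm h)^-1 * w z)) = (fun z => - (u (z + h) - u z)))//.
by apply/funext => z; rewrite mulrN mulrA divff ?gt_eqF// mul1r.
Qed.

End Hypotheses.

(** * Directions of monotonicity *)

Section Cones.
Context {R : realType} {n : nat}.
Local Notation V := 'rV[R]_n.
Implicit Types (u : V -> R) (x y z v w : V).

Lemma scaled_real_kernel (s : R) (K : V -> \bar R) (c : R) : homogeneous_kernel s K -> 0 < c ->
  (forall y, y != 0 -> K y \is a fin_num) ->
  scaled_kernel s c (real_kernel K) = real_kernel K.
Proof.
move=> hK c0 fK; apply/funext => y; rewrite /scaled_kernel /real_kernel.
rewrite scaler_eq0 gt_eqF//=; case: eqVneq => [_|y0]; first by rewrite mulr0.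
have cy0 : c *: y != 0 by rewrite scaler_eq0 gt_eqF.
have e0 := enorm_gt0 y0.
have pE : - n%:R - 2 * s = - (n%:R + 2 * s) :> R by rewrite opprD.
rewrite (hK _ cy0) (hK _ y0) pE enormZ (gtr0_norm c0) scalerA.
have -> : (c * enorm y)^-1 * c = (enorm y)^-1 by rewrite invfM mulrAC mulVf ?mul1r// gt_eqF.
have ny : (enorm y)^-1 *: y != 0 by rewrite scaler_eq0 negb_or invr_eq0 gt_eqF.
rewrite !fineM ?fK//= powRM ?(ltW c0) ?(ltW e0)// !mulrA -powRD ?subrr ?powRr0 ?mul1r//.
by rewrite (gt_eqF c0) implybT.
Qed.

Lemma cont_limit_le (g : R -> R) (C : R) : {for 0, continuous g} ->
  (forall a, 0 < a -> a <= 1 -> g a <= C) -> g 0 <= C.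
Proof.
move=> cg H; rewrite leNgt; apply/negP => Cg.
have /nbhs_ballP[e /= e0 He] : \forall a \near (0:R), C < g a by apply: (cvgr_gt _ cg).
pose a := Num.min (e / 2) 1.
have a0 : 0 < a by rewrite lt_min ltr01 andbT divr_gt0.
have ae : a < e by rewrite gt_min ltr_pdivrMr// ltr_pMr// ltr1n.
have : C < g a by apply: He; rewrite /ball/= sub0r normrN gtr0_norm.
by rewrite ltNge H// ge_min lexx orbT.
Qed.

Lemma cont_line (x v : V) : continuous (fun a : R => x + a *: v).
Proof.
move=> a; apply: (@continuousD R V R^o (fun=> x) (fun a => a *: v)); first exact: cvg_cst.
by apply: continuousZl; exact: cvg_id.
Qed.

(** For [u] convex, nonnegative and zero at 0, these are by [mono_dirP] the opposites of the
    directions in which the ray from 0 stays in {u = 0}. *)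
Definition mono_dir u v : Prop := forall x (t : R), 0 <= t -> u x <= u (x + t *: v).

Lemma mono_dirD u v w : mono_dir u v -> mono_dir u w -> mono_dir u (v + w).
Proof.
move=> hv hw x t t0; apply: (le_trans (hv x t t0)).
by rewrite scalerDr addrA; exact: hw.
Qed.

Lemma mono_dirZ u v (c : R) : 0 <= c -> mono_dir u v -> mono_dir u (c *: v).
Proof. by move=> c0 hv x t t0; rewrite scalerA; apply: hv; rewrite mulr_ge0. Qed.

Lemma mono_dir0 u : mono_dir u 0.
Proof. by move=> x t t0; rewrite scaler0 addr0. Qed.

Lemma mono_dir_sum u (I : Type) (r : seq I) (c : I -> R) (F : I -> V) :
  (forall i, 0 <= c i) -> (forall i, mono_dir u (F i)) -> mono_dir u (\sum_(i <- r) c i *: F i).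
Proof.
move=> c0 HF; elim/big_ind: _ => [||i _]; [exact: mono_dir0|exact: mono_dirD|].
by apply: mono_dirZ.
Qed.

Section Convex.
Variable u : V -> R.
Hypotheses (cu : continuous u) (su : forall x h, 0 <= sdiff u h x).

Lemma convex_slope x v (a b : R) : 0 < a -> a <= b ->
  b * (u (x + a *: v) - u x) <= a * (u (x + b *: v) - u x).
Proof.
move=> a0 ab; have b0 : 0 < b by apply: lt_le_trans ab.
have t01 : 0 <= a / b <= 1 by rewrite divr_ge0 ?(ltW a0) ?(ltW b0)//= ler_pdivrMr// mul1r.
have := midconvex_line (x + b *: v) x cu su t01.
have -> : (a / b) *: (x + b *: v) + (1 - a / b) *: x = x + a *: v.
  apply/rowP => i; rewrite !mxE; field; rewrite gt_eqF//.
move=> /(ler_wpM2l (ltW b0)).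
have -> : b * (a / b * u (x + b *: v) + (1 - a / b) * u x) = a * u (x + b *: v) + (b - a) * u x.
  by field; rewrite gt_eqF.
by clear; lra.
Qed.

Lemma convex_backslope x v (a b : R) : 0 < a -> a <= b ->
  a * (u x - u (x - b *: v)) <= b * (u x - u (x - a *: v)).
Proof. by move=> a0 ab; have := convex_slope x (- v) a0 ab; rewrite !scalerN; lra. Qed.

Hypotheses (u0 : u 0 = 0) (u_ge0 : forall x, 0 <= u x).

(** Convexity on the segment from [z] to the remote zero [- (t / a) v]: at the fraction [a] of the
    way it passes close to [z - t v], and [a] tends to 0. *)
Lemma mono_dirP v : mono_dir u v <-> forall t, 0 <= t -> u (- (t *: v)) = 0.
Proof.
split=> [H t t0|H x t t0].
  by apply/eqP; rewrite eq_le u_ge0 andbT -u0; have := H (- (t *: v)) t t0; rewrite addNr.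
set z := x + t *: v; have xE : x = z + 0 *: (- z) - t *: v by rewrite scale0r addr0 addrK.
rewrite [leLHS](_ : _ = (fun a => u (z + a *: (- z) - t *: v)) 0); last by rewrite -xE.
apply: (@cont_limit_le (fun a => u (z + a *: (- z) - t *: v)) (u z)) => [|a a0 a1].
  apply: continuous_comp; last exact: cu.
  have c := @cont_line (z - t *: v) (- z) 0.
  by rewrite (_ : (fun a => _) = (fun a => z - t *: v + a *: - z))//; apply/funext => a; rewrite addrAC.
have := midconvex_line z (- ((t / a) *: v)) cu su (t := 1 - a).
rewrite subr_ge0 a1 gerBl (ltW a0) => /(_ isT).
have -> : 1 - (1 - a) = a by ring.
rewrite H ?divr_ge0 ?(ltW a0)// mulr0 addr0.
have -> : (1 - a) *: z + a *: - ((t / a) *: v) = z + a *: - z - t *: v.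
  by apply/rowP => i; rewrite !mxE; field; rewrite gt_eqF.
move=> /le_trans; apply; rewrite ler_piMl// gerBl ltW//.
Qed.

Lemma u_ray_mono x (a b : R) : 0 <= a -> a <= b -> u (a *: x) <= u (b *: x).
Proof.
move=> a0 ab; have [->|an] := eqVneq a 0; first by rewrite scale0r u0.
have ap : 0 < a by rewrite lt_def an.
have bp : 0 < b by apply: lt_le_trans ab.
have := convex_slope 0 x ap ab; rewrite !add0r u0 !subr0 => H.
rewrite -(ler_pM2l bp); apply: (le_trans H); by rewrite ler_wpM2r.
Qed.

Lemma mono_dir_closed v w : (forall a, 0 < a -> a <= 1 -> mono_dir u (v + a *: w)) -> mono_dir u v.
Proof.
move=> H x t t0; rewrite -lerN2.
rewrite [leLHS](_ : _ = (fun a => - u (x + t *: v + a *: (t *: w))) 0); last by rewrite scale0r addr0.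
apply: (@cont_limit_le (fun a => - u (x + t *: v + a *: (t *: w))) _) => [|a a0 a1].
  apply: continuousN; apply: continuous_comp; last exact: cu.
  exact: cont_line.
rewrite lerN2; have := H a a0 a1 x t t0.
by rewrite scalerDr addrA !scalerA [t * a]mulrC.
Qed.

End Convex.

(** A linearly independent family in [G] of maximal size is a basis, or it spans a proper subspace
    that contains [G] and has a normal vector. *)
Lemma cone_dichotomy (G : V -> Prop) :
  (exists A : 'M[R]_n, A \in unitmx /\ forall i, G (row i A)) \/
  (exists nu : V, nu != 0 /\ forall v, G v -> edot v nu = 0).
Proof.
pose P r := exists A : 'M[R]_(r, n), row_free A /\ forall i, G (row i A).
have P0 : P 0.
  by exists 0; split; [rewrite /row_free mxrank0|case].
have [[A [fA GA]]|Pn] := pselect (P n).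
  by left; exists A; split => //; rewrite -row_free_unit.
right; have [r [rn [A [fA GA]] Pr]] : exists r, [/\ (r < n)%N, P r & ~ P r.+1].
  apply: contrapT => H; apply: Pn.
  suff: forall r, (r <= n)%N -> P r by apply.
  elim=> // r IH rn; apply: contrapT => Pr; apply: H; exists r; split => //; exact/IH/ltnW.
have rA : \rank A = r by apply/eqP.
have sub v : G v -> (v <= A)%MS.
  move=> Gv; have nf : ~~ row_free (col_mx v A).
    apply/negP => fvA; apply: Pr; exists (col_mx v A); split => // i.
    case: (@split_ordP 1 r i) => j ->.
      by rewrite (@rowKu _ 1 r) row_id.
    by rewrite (@rowKd _ 1 r).
  have rk : (\rank (col_mx v A) <= r)%N.
    by rewrite -ltnS ltn_neqAle rank_leq_row andbT.
  have As : (A <= col_mx v A)%MS by rewrite -addsmxE addsmxSr.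
  have [_ E] := mxrank_leqif_sup As.
  have : (col_mx v A <= A)%MS by rewrite -E eqn_leq mxrankS//= rA.
  by rewrite col_mx_sub => /andP[].
have kn : kermx A^T != 0.
  by rewrite -mxrank_eq0 mxrank_ker mxrank_tr rA subn_eq0 -ltnNge.
exists (nz_row (kermx A^T)); split; first by rewrite nz_row_eq0.
move=> v /sub /submxP[c ->].
have /sub_kermxP H := nz_row_sub (kermx A^T).
set nu := nz_row _ in H *.
have -> : edot (c *m A) nu = (c *m A *m nu^T) 0 0 by rewrite [RHS]mxE; apply: eq_bigr => i _; rewrite [nu^T _ _]mxE.
have -> : c *m A *m nu^T = c *m (nu *m A^T)^T by rewrite trmx_mul trmxK mulmxA.
by rewrite H trmx0 mulmx0 mxE.
Qed.

(** In the basis formed by the rows of [A] their sum has all coordinates 1, and small perturbations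
    keep the coordinates nonnegative. The factor [c] moves the centre into the box of radius 1/2,
    which leaves room for a translation in [dilated_harnack]. *)
Lemma cone_ball u (A : 'M[R]_n) : A \in unitmx -> (forall i, mono_dir u (row i A)) ->
  exists w (d : R), [/\ 0 < d, d <= 1, `|w| <= 2^-1 & forall y, `|y - w| < d -> mono_dir u y].
Proof.
move=> uA HA; pose S : V := \sum_i row i A.
pose c := (2 * (`|S| + 1))^-1.
have c0 : 0 < c by rewrite invr_gt0 mulr_gt0// ltr_wpDl.
pose B := \sum_j \sum_i `|invmx A j i|.
have B0 : 0 <= B by apply: sumr_ge0 => j _; apply: sumr_ge0.
pose d := Num.min 1 (c / (B + 1)).
have B1 : 0 < B + 1 by rewrite ltr_wpDl.
exists (c *: S), d; split.
- by rewrite lt_min ltr01 divr_gt0.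
- by rewrite ge_min lexx.
- rewrite normrZ gtr0_norm// /c invfM -mulrA ler_piMr ?invr_ge0//.
  by rewrite mulrC ler_pdivrMr ?mul1r ?lerDl// ltr_wpDl.
move=> y yw; have -> : y = \sum_i (y *m invmx A) 0 i *: row i A.
  by rewrite -mulmx_sum_row -mulmxA mulVmx// mulmx1.
apply: mono_dir_sum => // i.
have SE : S = const_mx 1 *m A.
  by rewrite mulmx_sum_row; apply: eq_bigr => j _; rewrite mxE scale1r.
have -> : y *m invmx A = c *: const_mx 1 + (y - c *: S) *m invmx A.
  by rewrite mulmxBl -scalemxAl SE -mulmxA mulmxV// mulmx1 addrC subrK.
rewrite !mxE mulr1.
have : `|\sum_j (y - c *: S) 0 j * invmx A j i| <= c.
  apply: le_trans (ler_norm_sum _ _ _) _.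
  apply: (@le_trans _ _ (\sum_j d * `|invmx A j i|)).
    apply: ler_sum => j _; rewrite normrM ler_wpM2r//.
    exact: le_trans (coord_le_norm _ j) (ltW yw).
  rewrite -mulr_sumr; apply: (@le_trans _ _ (d * B)).
    rewrite ler_wpM2l//; first by rewrite le_min ler01 divr_ge0 ?ltW.
    rewrite /B exchange_big/= [leRHS](bigD1 i)//= lerDl; apply: sumr_ge0 => j _; exact: sumr_ge0.
  apply: (@le_trans _ _ (c / (B + 1) * B)); first by rewrite ler_wpM2r// /d ge_min lexx orbT.
  by rewrite mulrAC ler_pdivrMr// ler_pM2l// lerDl.
by move/ler_normlP => [h1 _]; move: h1; clear; lra.
Qed.

(** Continuity of the first derivatives makes second differences [o(t)]. In [mono_dir_dominates]
    this exchanges backward and forward increments at first order. *)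
Lemma C1_sdiff u (P : set V) x v (e : R) : open P -> Ck P 1 u -> P x -> 0 < e ->
  exists2 t0 : R, 0 < t0 & forall t, 0 < t -> t < t0 -> sdiff u (t *: v) x <= e * t.
Proof.
move=> oP cP Px e0; pose e' := e / (n.+1%:R * (`|v| + 1)) / 2.
have v1 : 0 < `|v| + 1 by rewrite ltr_wpDl.
have e'0 : 0 < e' by rewrite !divr_gt0// mulr_gt0.
have /nbhs_ballP[d1 /= d10 Hd1] : nbhs x P by apply: open_nbhs_nbhs.
have H2 (i : 'I_n) : \forall z \near x, `|'D_(evec i) u x - 'D_(evec i) u z| < e'.
  have [ci _] := cP [:: i] isT x Px.
  by move/cvgrPdist_lt : ci; apply.
have /nbhs_ballP[d2 /= d20 Hd2] : \forall z \near x, forall i : 'I_n, `|'D_(evec i) u x - 'D_(evec i) u z| < e'.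
  exact: (@filter_forall _ _ (fun i z => `|'D_(evec i) u x - 'D_(evec i) u z| < e') (nbhs x) (nbhs_filter x) H2).
pose d := Num.min d1 d2.
have d0 : 0 < d by rewrite lt_min d10.
have near z : `|z - x| < d -> P z /\ forall i : 'I_n, `|'D_(evec i) u x - 'D_(evec i) u z| < e'.
  by rewrite lt_min => /andP[z1 z2]; split; [apply: Hd1|apply: Hd2]; rewrite -ball_normE/= distrC.
exists (d / (`|v| + 1)); first by rewrite divr_gt0.
move=> t tp td; set y := t *: v.
have yd : `|y| < d.
  rewrite normrZ gtr0_norm//; apply: (@le_lt_trans _ _ (t * (`|v| + 1))); first by rewrite ler_wpM2l ?lerDl// ltW.
  by rewrite -ltr_pdivlMr.
have half w : `|w| = `|y| -> exists2 xi : 'I_n -> V, (forall j, `|xi j - x| <= `|y|) &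
    u (x + w) - u x = \sum_j w 0 j * 'D_(evec j) u (xi j).
  move=> wy; have [|xi H1 H3] := @coord_mvt R n u x w.
    move=> z zx i; have [Pz _] : P z /\ forall i : 'I_n, `|'D_(evec i) u x - 'D_(evec i) u z| < e'.
      by apply: near; apply: le_lt_trans zx _; rewrite wy.
    by have [_] := cP [::] isT z Pz; apply.
  by exists xi => // j; rewrite -wy.
have [x1 Hx1 E1] := half y erefl; have [x2 Hx2 E2] := half (- y) (normrN y).
have -> : sdiff u y x = (u (x + y) - u x) + (u (x - y) - u x) by rewrite /sdiff; ring.
rewrite E1 E2 -big_split/=.
apply: (@le_trans _ _ (\sum_(j < n) `|y| * (2 * e'))).
  apply: ler_sum => j _; rewrite [(- y) 0 j]mxE mulNr -mulrBr.
  apply: le_trans (ler_norm _) _; rewrite normrM; apply: ler_pM => //; first exact: coord_le_norm.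
  have [_ /(_ j) h1] := near _ (le_lt_trans (Hx1 j) yd).
  have [_ /(_ j) h2] := near _ (le_lt_trans (Hx2 j) yd).
  have -> : 'D_(evec j) u (x1 j) - 'D_(evec j) u (x2 j) =
    ('D_(evec j) u x - 'D_(evec j) u (x2 j)) - ('D_(evec j) u x - 'D_(evec j) u (x1 j)) by ring.
  apply: le_trans (ler_normB _ _) _; move: h1 h2; clear; lra.
rewrite sumr_const card_ord -[leLHS]mulr_natl /y normrZ gtr0_norm//.
apply: (@le_trans _ _ (n.+1%:R * (t * (`|v| + 1) * (2 * e')))).
  have h : t * `|v| * (2 * e') <= t * (`|v| + 1) * (2 * e').
    by rewrite ler_pM2r ?mulr_gt0// ler_pM2l// lerDl.
  apply: ler_pM => //; first exact: mulr_ge0 (mulr_ge0 (ltW tp) (normr_ge0 _)) (mulr_ge0 (ler0n _ _) (ltW e'0)).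
  by rewrite ler_nat.
rewrite le_eqVlt; apply/orP; left; apply/eqP; rewrite /e'; field.
by rewrite gt_eqF//= pnatr_eq0.
Qed.

End Cones.

(** * The cone has interior *)

Section Thin.
Context {R : realType} {n : nat}.
Local Notation V := 'rV[R]_n.
Implicit Types (u w : V -> R) (x y z v h : V).

(** The inequality for the increment [- h] at the point [x + h], shifted back by [h], concerns
    [u - u (. + h)] at [x]: the sign is reversed, and positivity is required at the other end. *)
Lemma Lle_incr (s gam l m sig Q : R) k u x h : incr_solution s gam l m sig Q k u ->
  0 < u (x + h) -> Lle k (fun z => u (z + h) - u z) x 0.
Proof.
move=> H uxh; have := is_incr H (- h) uxh; rewrite /Lge oppr0 => /Lle_shift.
by under eq_fun do rewrite addrK opprB.
Qed.

Lemma Lle_semiconcave_sdbound (s gam m : R) : 0 < s -> s < 1 -> 0 < gam -> gam < 2 * s -> 0 < m ->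
  exists2 C : R, 0 < C & forall l (k : V -> R), kernel_setting s gam l m k ->
    forall w x (A : R), 0 <= A -> growth_adm gam w ->
      (forall y, sdiff w y x <= A * sdbound gam y) -> Lle k (fun z => - w z) x (C * A).
Proof.
move=> s0 s1 g0 gs m0; have [C0 C00 HC0] := @kernel_sdbound R n s gam m s0 s1 g0 gs m0.
exists (2^-1 * C0); first by rewrite mulr_gt0.
move=> l k HK w x A A0 aw Hw.
rewrite -mulrA [C0 * A]mulrC; apply: (Lle_semiconcave HK aw _ _ Hw).
- by apply: measurable_funM; [exact: measurable_cst|exact: measurable_sdbound].
- by move=> y; rewrite mulr_ge0 ?sdbound_ge0.
- rewrite EFinM; under eq_integral do rewrite -mulrA EFinM.
  rewrite ge0_integralZl//.
  + by rewrite lee_wpmul2l ?lee_fin//; exact: (HC0 l).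
  + apply/measurable_EFinP; apply: measurable_funM; first exact: measurable_sdbound.
    exact: (sk_meas (ks_kernel HK)).
  + by move=> y _; rewrite lee_fin mulr_ge0 ?sdbound_ge0 ?(kernel_nneg HK).
Qed.

Lemma Lle_sum (s gam l m : R) k x (F : nat -> V -> R) (a : nat -> R) (N : nat) :
  kernel_setting s gam l m k ->
  (forall j, growth_adm gam (F j)) -> (forall j, (j < N)%N -> Lle k (F j) x (a j)) ->
  Lle k (fun z => \sum_(j < N) F j z) x (\sum_(j < N) a j) /\
  growth_adm gam (fun z => \sum_(j < N) F j z).
Proof.
move=> HK aF; elim: N => [|N IH] LF.
  rewrite big_ord0; under eq_fun do rewrite big_ord0.
  by split; [exact: Lle_cst|exact: (adm_cst HK)].
have [|L aS] := IH; first by move=> j jN; apply: LF; exact: ltnW.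
rewrite big_ord_recr/=; under eq_fun do rewrite big_ord_recr/=.
split; first by apply: (Lle_add HK) => //; exact: LF.
exact: (adm_add aS).
Qed.

(** Slopes of a convex function increase with the step, so the slope over [|h|] is at most the slope
    over a step [b] that exceeds 1, [|h|] and [|x|]. The factor 4 comes from [2^(1 + sig) <= 4]. *)
Lemma convex_lip_growth u (A sig : R) : continuous u -> (forall x h, 0 <= sdiff u h x) ->
  (forall x, 0 <= u x) -> 0 < sig -> sig < 1 -> 0 <= A ->
  (forall r : R, 1 <= r -> forall x, `|x| <= r -> u x <= A * r `^ (1 + sig)) ->
  lip_growth sig (4 * A) u.
Proof.
move=> cu su u_ge0 sig0 sig1 A0 HA.
have key x h (b : R) : h != 0 -> `|h| <= b -> 1 <= b -> `|x| <= b ->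
    u (x + h) - u x <= 4 * A * `|h| * b `^ sig.
  move=> h0 hb b1 xb; have hp : 0 < `|h| by rewrite normr_gt0.
  have b0 : 0 < b by apply: lt_le_trans b1.
  have := convex_slope cu su x (`|h|^-1 *: h) hp hb.
  rewrite scalerA divff ?gt_eqF// scale1r => H1.
  rewrite -(ler_pM2l b0); apply: (le_trans H1).
  have H2 : u (x + b *: (`|h|^-1 *: h)) <= A * (2 * b) `^ (1 + sig).
    apply: HA; first by move: b1; clear; lra.
    apply: le_trans (ler_normD _ _) _; rewrite !normrZ normfV normr_id mulVf ?gt_eqF// mulr1 gtr0_norm//.
    by move: xb; clear; lra.
  have H3 : u (x + b *: (`|h|^-1 *: h)) - u x <= A * (4 * (b * b `^ sig)).
    apply: (@le_trans _ _ (A * (2 * b) `^ (1 + sig))).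
      by have := u_ge0 x; move: H2; clear; lra.
    rewrite ler_wpM2l// powRM ?(ltW b0)// (powR_add 1 sig b0) powRr1 ?(ltW b0)//.
    rewrite ler_wpM2r ?mulr_ge0 ?powR_ge0 ?(ltW b0)//.
    have -> : 4 = 2 `^ 2 :> R by rewrite powR2// expr2; ring.
    by apply: ler_powR; [rewrite ler1n|move: sig1; clear; lra].
  apply: le_trans (ler_wpM2l (ltW hp) H3) _.
  by rewrite le_eqVlt; apply/orP; left; apply/eqP; ring.
move=> x h; have [->|h0] := eqVneq h 0.
  by rewrite addr0 subrr !normr0 mulr0 mul0r.
have nx := normr_ge0 x; have nh := normr_ge0 h.
have b1 : 1 <= 1 + `|x| + `|h| by rewrite -addrA lerDl addr_ge0.
rewrite ler_norml; apply/andP; split; last first.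
  by apply: key => //; move: nx nh; clear; lra.
rewrite lerNl opprB.
have := @key (x + h) (- h) (1 + `|x| + `|h|); rewrite addrK normrN oppr_eq0; apply => //.
  by move: nx nh; clear; lra.
by have := ler_normD x h; move: nx nh; clear; lra.
Qed.

(** If [u (t y) = 0] for all [t >= 0], then [- y] is in the cone and [y] is orthogonal to [nu]. So
    when [|y . nu| >= th] some [u (t y)] is positive; this persists nearby and at larger scales, and
    compactness makes the scale uniform. *)
Lemma thin_zero_set u nu (th L : R) : continuous u -> (forall x h, 0 <= sdiff u h x) -> u 0 = 0 ->
  (forall x, 0 <= u x) -> (forall v, mono_dir u v -> edot v nu = 0) -> 0 < th ->
  exists2 R1 : R, 1 <= R1 & forall r, R1 <= r -> forall y, `|y| <= L -> u (r *: y) = 0 -> `|edot y nu| < th.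
Proof.
move=> cu su u0 uge G th0.
pose A : set V := [set y | `|y - 0| <= L] `&` [set y | th <= `|edot y nu|].
have cA : compact A.
  apply: compact_closedI; first exact: compact_norm_le.
  apply: (@cont_closed_ge R _ (fun y : V => `|edot y nu|)).
  by move=> y; apply: (@continuous_comp _ _ _ (fun y : V => edot y nu) Num.norm); [exact: cont_edotl|exact: norm_continuous].
have /compact_near_coveringP cov := cA.
have [M [Mr HM]] : \forall r \near +oo, A `<=` (fun y => 0 < u (r *: y)).
  apply: (cov R _ (fun r y => 0 < u (r *: y))) => y [_ /= yth].
  have [t t0 ut] : exists2 t, 0 <= t & 0 < u (t *: y).
    apply: contrapT => Hn.
    have /G : mono_dir u (- y).
      apply/(mono_dirP cu su u0 uge) => t t0; rewrite scalerN opprK.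
      apply/eqP; rewrite eq_le uge andbT leNgt; apply/negP => ut; apply: Hn; by exists t.
    by rewrite edotNl => /eqP; rewrite oppr_eq0 => /eqP E; move: yth; rewrite E normr0 leNgt th0.
  exists ([set y' | 0 < u (t *: y')], [set r : R | t < r]) => /=.
    split; last by exists t; split => //; exact: num_real.
    apply: open_nbhs_nbhs; split => //.
    apply: (@cont_open_lt R _ (fun y' : V => u (t *: y'))).
    by apply: (@cont_comp R _ _ (fun z : V => t *: z) u); [exact: cont_scale|].
  by move=> [y' r] /= [h1 h2]; apply: lt_le_trans h1 _; apply: (u_ray_mono cu su u0 uge) => //; exact: ltW.
exists (Num.max 1 (M + 1)); first by rewrite le_max lexx.
move=> r; rewrite ge_max => /andP[_ Mr1] y yL ur; rewrite ltNge; apply/negP => yth.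
have Ay : A y by split => //=; rewrite subr0.
have Mlr : M < r by apply: lt_le_trans Mr1; rewrite ltrDl.
by have := HM r Mlr y Ay; rewrite ur ltxx.
Qed.

(* At a zero of [u] the increment is compared with one that ends at a point [z] where [u - Q |. - z0|^2]
   is maximal: there [u z > 0], and [u] is bounded above by a paraboloid at [z]. *)
Lemma Lle_incr_zero (s gam l m sig L : R) : 0 < s -> s < 1 -> 0 < gam -> gam < 2 * s -> 0 < m ->
  0 < sig -> sig < 1 -> sig < gam -> 0 <= L ->
  exists2 C : R, 0 < C & forall k u (Q : R), incr_solution s gam l m sig Q k u ->
    u 0 = 0 -> (exists2 z0, `|z0| <= 1 & 0 < u z0) ->
    forall y h, `|y| <= L -> `|h| <= 1 ->
      Lle k (fun z => u (z + h) - u z) y (C * Q * (u (y + h) == 0)%:R).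
Proof.
move=> s0 s1 g0 gs m0 sig0 sig1 sigg L0.
have [C0 C00 HC0] := @Lle_semiconcave_sdbound s gam m s0 s1 g0 gs m0.
(* Beyond [rho] the paraboloid [Q |x - z0|^2] exceeds the growth [2 Q |x|^(1 + sig)] of [u], so that
   [psi] has its maximum inside. *)
have [rho [rho8 rho1] Hrho] : exists2 rho : R, 8 <= rho /\ 1 <= rho & 8 * rho `^ (- (1 - sig)) < 1.
  by apply: powR_decay => //; rewrite subr_gt0.
have rho0 : 0 < rho by apply: lt_le_trans rho1.
pose D := rho + L + 1.
have D0 : 0 < D by rewrite /D; move: L0 rho0; clear; lra.
pose C1 := 2 * n.+1%:R + 4 * D * (2 * D + 2) `^ gam.
have n10 : 0 < n.+1%:R :> R by [].
have C10 : 0 < C1 by apply: addr_gt0; rewrite ?mulr_gt0// powR_gt0// addr_gt0// mulr_gt0.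
exists (C0 * C1); first exact: mulr_gt0.
move=> k u Q H u0 [z0 z01 uz0] y h yL h1.
have HK := is_setting H; have Q0 := is_Q0 H; have cu := is_cont H.
have su x' h' : 0 <= sdiff u h' x' by apply: incr_sdiff_ge0 H.
have [uyh|uyh] := eqVneq (u (y + h)) 0; last first.
  by rewrite mulr0; apply: (Lle_incr H); rewrite lt_def uyh; exact: (is_ge0 H).
rewrite mulr1; pose psi z := u z - Q * edot (z - z0) (z - z0).
have cpsi : continuous psi.
  apply: cont_sub => //; apply: cont_mul; first exact: cont_cst.
  by apply: (@cont_comp R _ _ (fun z : V => z - z0) (fun z => edot z z)); [exact: cont_shift|exact: cont_edot].
have [|z zr Hz] := @max_on_compact R _ psi [set x | `|x - 0| <= rho] (@compact_norm_le R n 0 rho) _ cpsi.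
  by exists 0; rewrite /= subrr normr0 ltW.
have far x : rho < `|x| -> psi x < psi z0.
  move=> xr; rewrite /psi subrr (_ : edot 0 0 = 0) ?mulr0 ?subr0; last first.
    by rewrite /edot big1// => i _; rewrite mxE mul0r.
  apply: le_lt_trans uz0; rewrite subr_le0.
  have xp : 0 < `|x| by apply: lt_trans xr.
  have ux : u x <= Q * (2 * `|x| * (`|x| `^ sig)).
    have := is_growth H 0 x; rewrite add0r u0 subr0 normr0 addr0 ger0_norm ?(is_ge0 H)// => /le_trans; apply.
    rewrite -!mulrA ler_wpM2l ?(ltW Q0)// mulrCA ler_wpM2l ?(ltW xp)//.
    apply: (@le_trans _ _ ((2 * `|x|) `^ sig)).
      by apply: powR_le; [exact: ltW|rewrite addr_ge0|move: xr rho1; clear; lra].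
    rewrite powRM// ler_wpM2r ?powR_ge0//.
    by rewrite -[leRHS]powRr1//; apply: ler_powR; [rewrite ler1n|exact: ltW].
  apply: (le_trans ux); rewrite ler_wpM2l ?(ltW Q0)//.
  apply: le_trans (norm_sq_le_edot _).
  have x8 : 8 * `|x| `^ sig <= `|x|.
    have h2 : `|x| `^ (- (1 - sig)) <= rho `^ (- (1 - sig)).
      by apply: powR_anti; rewrite ?oppr_le0 ?subr_ge0 ?(ltW sig1) ?(ltW xr).
    have -> : sig = - (1 - sig) + 1 by ring.
    rewrite powR_add// powRr1// mulrA ler_piMl//.
    by apply: le_trans (ltW Hrho); rewrite ler_pM2l.
  have nz : `|x| / 2 <= `|x - z0|.
    by have := lerB_dist x z0; move: z01 xr rho8; clear; lra.
  apply: (@le_trans _ _ ((`|x| / 2) ^+ 2)); last by rewrite ler_pXn2r ?nnegrE ?divr_ge0.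
  rewrite mulrAC; move: (ler_wpM2l (ltW xp) x8); rewrite expr2; clear; lra.
have psimax t : psi t <= psi z.
  have [tr|tr] := leP `|t| rho; first by apply: Hz; rewrite /= subr0.
  apply: le_trans (ltW (far t tr)) _; apply: Hz; rewrite /= subr0.
  exact: le_trans z01 rho1.
rewrite /= subr0 in zr.
have uz : 0 < u z.
  have := psimax z0; rewrite /psi subrr (_ : edot 0 0 = 0) ?mulr0 ?subr0; last first.
    by rewrite /edot big1// => i _; rewrite mxE mul0r.
  have := mulr_ge0 (ltW Q0) (edot_ge0 (z - z0)); move: uz0; clear; lra.
(* The increment at [y] is split as [(u (. + a) - u) - w]. The first part ends at [z], where
   [u > 0]. For short steps the second differences of [w] at [y] are those of [u] at [z], bounded by
   those of the paraboloid, minus those of [u] at [y + h], nonnegative by convexity. *)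
pose a := z - y; have yaz : y + a = z by rewrite addrC subrK.
pose w x := u (x + a) - u (x + h).
have aw : growth_adm gam w.
  rewrite (_ : w = fun x => (u (x + a) - u x) + - (u (x + h) - u x)); last first.
    by apply/funext => x; rewrite /w; ring.
  exact: (adm_add (adm_incr a H) (adm_opp (adm_incr h H))).
have L1 : Lle k (fun x => u (x + a) - u x) y 0 by apply: (Lle_incr H); rewrite yaz.
have L2 : Lle k (fun x => - w x) y (C0 * (C1 * Q)).
  apply: (HC0 l k HK) => //; first by rewrite mulr_ge0 ?(ltW C10) ?(ltW Q0).
  move=> x; have nx := normr_ge0 x.
  have P1 : 0 <= 2 * n.+1%:R * sdbound gam x by rewrite !mulr_ge0 ?sdbound_ge0.
  have P2 : 0 <= 4 * D * (2 * D + 2) `^ gam * sdbound gam x.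
    by rewrite !mulr_ge0 ?powR_ge0 ?sdbound_ge0 ?(ltW D0).
  rewrite /C1 mulrAC; have [x1|x1] := leP `|x| 1.
    have -> : sdiff w x y = sdiff u x z - sdiff u x (y + h).
      by rewrite /sdiff /w ![y + _ + a]addrAC yaz ![y + h + _]addrAC; ring.
    apply: (@le_trans _ _ (2 * n.+1%:R * sdbound gam x * Q)); last first.
      by rewrite ler_wpM2r ?(ltW Q0)// [leRHS]mulrDl lerDl.
    apply: (@le_trans _ _ (Q * (2 * edot x x))).
      have E := edot_parallelogram (z - z0) x.
      have p1 := psimax (z + x); have p2 := psimax (z - x); rewrite /psi in p1 p2.
      have e1 : z + x - z0 = z - z0 + x by rewrite addrAC.
      have e2 : z - x - z0 = z - z0 - x by rewrite addrAC.
      rewrite e1 in p1; rewrite e2 in p2.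
      have E' : Q * edot (z - z0 + x) (z - z0 + x) + Q * edot (z - z0 - x) (z - z0 - x) =
        2 * (Q * edot (z - z0) (z - z0)) + Q * (2 * edot x x) by rewrite -mulrDr E; ring.
      have := su (y + h) x; rewrite {2}/sdiff; move: p1 p2 E'; clear; lra.
    rewrite mulrC ler_wpM2r ?(ltW Q0)// -mulrA ler_wpM2l// /sdbound x1.
    by apply: le_trans (edot_le_norm_sq x) _; rewrite ler_wpM2r ?sqr_ge0// ler_nat.
  have x0 : 0 < `|x| by apply: lt_trans x1.
  have wb v : `|v| <= L + `|x| -> `|w v| <= Q * D * ((2 * D + 2) `^ gam * `|x| `^ gam).
    move=> vL; have ah : `|a - h| <= D.
      have := ler_normB a h; have := ler_normB z y; rewrite -/a /D; move: zr yL h1; clear; lra.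
    have -> : w v = u ((v + h) + (a - h)) - u (v + h) by rewrite addrACA subrr addr0.
    apply: le_trans (is_growth H _ _) _; rewrite -!mulrA ler_wpM2l ?(ltW Q0)//.
    have D20 : 0 <= 2 * D + 2 by move: D0; clear; lra.
    apply: ler_pM; rewrite ?powR_ge0//.
    apply: (@le_trans _ _ ((1 + `|v + h| + `|a - h|) `^ gam)).
      by apply: ler_powR; [rewrite -addrA lerDl addr_ge0|exact: ltW].
    rewrite -powRM//; apply: powR_le; rewrite ?(ltW g0) ?addr_ge0//.
    have := ler_normD v h; have : 1 * (2 * D + 1) <= `|x| * (2 * D + 1).
      by rewrite ler_wpM2r ?(ltW x1)//; move: D0; clear; lra.
    by move: ah vL h1 rho8; rewrite /D; clear; lra.
  apply: (@le_trans _ _ (4 * D * (2 * D + 2) `^ gam * sdbound gam x * Q)); last first.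
    by rewrite ler_wpM2r ?(ltW Q0)// [leRHS]mulrDl lerDr.
  have -> : sdbound gam x = `|x| `^ gam by rewrite /sdbound leNgt x1.
  have b1 := wb (y + x) (le_trans (ler_normD _ _) (lerD yL (lexx _))).
  have b2 : `|w (y - x)| <= Q * D * ((2 * D + 2) `^ gam * `|x| `^ gam).
    by apply: wb; apply: le_trans (ler_normB _ _) (lerD yL (lexx _)).
  have b3 : `|w y| <= Q * D * ((2 * D + 2) `^ gam * `|x| `^ gam).
    by apply: wb; apply: le_trans yL _; rewrite lerDl.
  have c1 := ler_norm (w (y + x)); have c2 := ler_norm (w (y - x)).
  have c3 := ler_norm (- w y); rewrite normrN in c3.
  by rewrite /sdiff; move: b1 b2 b3 c1 c2 c3; clear; lra.
have := Lle_add HK (adm_incr a H) (adm_opp aw) L1 L2.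
rewrite add0r mulrA (_ : (fun z1 => _) = (fun z1 => u (z1 + h) - u z1))//.
by apply/funext => x; rewrite /w; ring.
Qed.

Lemma sum_at_most_one (N : nat) (P : pred 'I_N) : (forall i j, P i -> P j -> i = j) ->
  \sum_(i < N) (P i)%:R <= 1 :> R.
Proof.
move=> HP; have [i Pi|P0] := pickP P; last by rewrite big1// => i _; rewrite P0.
rewrite (bigD1 i)//= Pi big1 ?addr0// => j ji.
by case Pj: (P j) => //; move: ji; rewrite (HP j i Pj Pi) eqxx.
Qed.

(* Averaging [u] over translates transversal to the thin zero set makes the contribution of that set
   negligible, so [semiconvexity] applies to minus the average. *)
Lemma thin_step (s gam l m sig Q : R) (k u : V -> R) x1 nu :
  incr_solution s gam l m sig Q k u -> sig < 1 -> (forall c, 0 < c -> scaled_kernel s c k = k) ->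
  u 0 = 0 -> 0 < u x1 -> edot nu nu = 1 -> (forall v, mono_dir u v -> edot v nu = 0) ->
  exists2 R1 : R, 1 <= R1 & forall Q0 : R, 0 < Q0 ->
    (forall r, R1 <= r -> forall x, `|x| <= r -> u x <= Q0 * r `^ (1 + sig)) ->
    forall r, R1 <= r -> forall x, `|x| <= r -> u x <= Q0 / 2 * r `^ (1 + sig).
Proof.
move=> H sig1 hk u0 ux1 nu1 G; have HK := is_setting H; have sig0 := is_sig0 H.
have cu := is_cont H; have uge := is_ge0 H.
have su x h : 0 <= sdiff u h x by apply: incr_sdiff_ge0 H.
have nuN : `|nu| <= 1.
  by apply: le_trans (norm_le_enorm _) _; rewrite /enorm nu1 sqrtr1.
pose bet := (sig + 1) / 2.
have sb : sig < bet by rewrite /bet; move: sig1; clear; lra.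
have b1 : bet < 1 by rewrite /bet; move: sig1; clear; lra.
have [C C0 HC] := @semiconvexity R n s gam l m sig bet (ks_s0 HK) (ks_s1 HK) (ks_gam0 HK)
  (ks_gam2 HK) (ks_l0 HK) (ks_m0 HK) sig0 (is_siggam H) sb b1.
(* [tau = 1 / rt] is the ratio of scales over which a factor 2 is gained: semiconvexity contributes
   one quarter of [A * tau^(1 + sig)], and the translations by at most [kap] another quarter, whence
   [144 = 4 * 36]. *)
have [rt [rt1 _] Hrt] : exists2 r : R, 1 <= r /\ 1 <= r & 8 * C * r `^ (- (bet - sig)) < 1 / 4.
  by apply: powR_decay; rewrite ?subr_gt0 ?divr_gt0 ?mulr_ge0 ?(ltW C0).
have rt0 : 0 < rt by apply: lt_le_trans rt1.
pose tau := rt^-1; have tau0 : 0 < tau by rewrite invr_gt0.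
have tau1 : tau <= 1 by rewrite invf_le1.
have Htau : 8 * C * tau `^ (1 + bet) <= 1 / 4 * tau `^ (1 + sig).
  have -> : 1 + bet = (bet - sig) + (1 + sig) by ring.
  rewrite powR_add// mulrA ler_wpM2r ?powR_ge0//; apply: ltW; apply: le_lt_trans Hrt.
  rewrite ler_pM2l ?mulr_gt0//; rewrite powRN /tau.
  by rewrite -[leLHS]mulr1 -(@powR_one R (bet - sig)) -ler_pdivlMl ?powR_gt0 ?invr_gt0// -invrM ?unitfE ?gt_eqF ?powR_gt0 ?invr_gt0// -powRM ?invr_ge0 ?(ltW rt0)// divff ?gt_eqF// !powR_one invr1.
have [kap kapE] : exists kap, kap = tau `^ (1 + sig) / 144 by eexists.
have kap0 : 0 < kap by rewrite kapE divr_gt0// powR_gt0.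
have tp1 : tau `^ (1 + sig) <= tau.
  rewrite powR_add// powRr1 ?(ltW tau0)// ler_piMr ?(ltW tau0)//.
  by rewrite -(@powR_one R sig); apply: powR_le; rewrite ?(ltW sig0) ?(ltW tau0).
have kt : kap <= tau by rewrite kapE; move: tp1 tau0; clear; lra.
have kap1 : kap <= 1 by apply: le_trans tau1.
have [L [e0 [L0 e00 HL]]] := HC kap kap0 kap1.
have [C1 C10 HC1] := @Lle_incr_zero s gam l m sig (L + 1) (ks_s0 HK) (ks_s1 HK) (ks_gam0 HK)
  (ks_gam2 HK) (ks_m0 HK) sig0 sig1 (is_siggam H) (addr_ge0 (ltW L0) ler01).
(* So many translates that the error of a single one, proportional to [C1], drops to the allowed
   [e0] in the average. *)
pose N := Num.truncn (C1 / e0); have [N1 N1E] : exists N1 : R, N1 = N.+1%:R by eexists.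
have N10 : 0 < N1 by rewrite N1E ltr0n.
have HN : C1 <= e0 * N1.
  by rewrite -ler_pdivrMl// mulrC N1E; apply: ltW; exact: truncnS_gt.
(* Half of the spacing [kap / N1] of the translates: the slab that contains the zero set meets at
   most one of them. *)
pose th := kap / (2 * N1); have th0 : 0 < th by rewrite divr_gt0// mulr_gt0.
have [R1 R11 HR1] := @thin_zero_set u nu th (L + 2) cu su u0 uge G th0.
exists (Num.max R1 `|x1|); first by rewrite le_max R11.
move=> Q0 Q00 HQ r rR x xr.
have r1 : 1 <= r by apply: le_trans rR; rewrite le_max R11.
have r0 : 0 < r by apply: lt_le_trans r1.
have [->|xn0] := eqVneq x 0.
  by rewrite u0; rewrite mulr_ge0 ?powR_ge0// divr_ge0// ltW.
pose Rr := r / tau; have rRr : r <= Rr by rewrite ler_pdivlMr// ler_piMr// ltW.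
have Rr1 : 1 <= Rr by apply: le_trans rRr.
have Rr0 : 0 < Rr by apply: lt_le_trans Rr1.
have RrR : R1 <= Rr /\ `|x1| <= Rr.
  by have := le_trans rR rRr; rewrite ge_max => /andP[].
have [A AE] : exists A, A = Q0 * Rr `^ (1 + sig) by eexists.
have A0 : 0 < A by rewrite AE mulr_gt0// powR_gt0.
pose ur z := u (Rr *: z).
have H1 := incr_solution_scale Rr1 H; rewrite hk// -/ur in H1.
have sur z h : 0 <= sdiff ur h z by apply: incr_sdiff_ge0 H1.
have lip : lip_growth sig (4 * A) ur.
  apply: convex_lip_growth; rewrite ?(ltW A0)//; [exact: (is_cont H1)|exact: (is_ge0 H1)|].
  move=> q q1 z zq; rewrite AE -mulrA -powRM ?(ltW Rr0) ?(le_trans ler01 q1)//.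
  apply: HQ; last by rewrite normrZ gtr0_norm// ler_pM2l.
  apply: (le_trans rR); apply: (le_trans rRr); by rewrite ler_peMr// ltW.
have A40 : 0 < 4 * A by rewrite mulr_gt0.
have H2 : incr_solution s gam l m sig (4 * A) k ur.
  by case: H1 => a1 a2 a3 a4 a5 a6 a7 a8; split.
have ur0 : ur 0 = 0 by rewrite /ur scaler0.
have zpos : exists2 z0 : V, `|z0| <= 1 & 0 < ur z0.
  exists (Rr^-1 *: x1); last by rewrite /ur scalerA divff ?gt_eqF// scale1r.
  by rewrite normrZ normfV (gtr0_norm Rr0) mulrC ler_pdivrMr// mul1r; case: RrR.
pose sj (j : nat) : V := (j%:R * kap / N1) *: nu.
have sjN (j : 'I_N.+1) : `|sj j| <= kap.
  have jc : 0 <= j%:R * kap / N1 by exact: (divr_ge0 (mulr_ge0 (ler0n _ _) (ltW kap0)) (ltW N10)).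
  rewrite normrZ ger0_norm//; apply: (@le_trans _ _ (j%:R * kap / N1)); first by rewrite ler_piMr.
  by rewrite ler_pdivrMr// mulrC ler_pM2l// N1E ler_nat ltnW.
(* The sign is reversed because [semiconvexity] bounds second differences from below, while those of
   the average have to be bounded from above. *)
pose U z := - (N1^-1 * \sum_(j < N.+1) ur (z + sj j)).
have iN0 : 0 < N1^-1 by rewrite invr_gt0.
have cU : continuous U.
  apply: cont_opp; apply: cont_mul; first exact: cont_cst.
  apply: cont_sum => j; apply: (@cont_comp R _ _ (fun z : V => z + sj j) ur); [exact: cont_shift|exact: (is_cont H1)].
have sU h z : - sdiff U h z = N1^-1 * \sum_(j < N.+1) sdiff ur h (z + sj j).
  rewrite /sdiff /U big_split/= big_split/= sumrN -mulr_sumr.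
  under [in LHS]eq_bigr do rewrite addrAC.
  by under [X in _ * (_ + X - _)]eq_bigr do rewrite addrAC; rewrite mulrBr mulrDr; ring.
have lipU : lip_growth sig (8 * A) U.
  move=> z h; rewrite /U -opprD normrN -mulrN -mulrDr -sumrN -big_split/= normrM gtr0_norm//.
  rewrite ler_pdivrMl//; apply: le_trans (ler_norm_sum _ _ _) _.
  apply: (@le_trans _ _ (\sum_(j < N.+1) 8 * A * `|h| * (1 + `|z| + `|h|) `^ sig)); last first.
    by rewrite sumr_const card_ord N1E [leRHS]mulr_natl.
  apply: ler_sum => j _; rewrite [z + h + _]addrAC; apply: le_trans (lip _ _) _.
  apply: (@le_trans _ _ (4 * A * `|h| * (2 * (1 + `|z| + `|h|) `^ sig))); last first.
    by rewrite le_eqVlt; apply/orP; left; apply/eqP; ring.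
  rewrite ler_wpM2l ?mulr_ge0 ?(ltW A0)//.
  have b0 : 0 <= 1 + `|z| + `|h| by rewrite !addr_ge0.
  apply: (@le_trans _ _ ((2 * (1 + `|z| + `|h|)) `^ sig)).
    apply: powR_le; rewrite ?(ltW sig0) ?addr_ge0//.
    have := ler_normD z (sj j); have := sjN j; have := normr_ge0 z; have := normr_ge0 h.
    by move: kap1; clear; lra.
  rewrite powRM// ler_wpM2r ?powR_ge0//.
  by rewrite -[leRHS]powRr1//; apply: ler_powR; [rewrite ler1n|exact: ltW].
have A80 : 0 < 8 * A by rewrite mulr_gt0.
have cond z h : kap <= `|h| -> `|h| <= 1 -> `|z| <= L -> sdiff U h z < 0 ->
    Lge k (sdiff U h) z (- (e0 * (8 * A))).
  move=> _ h1 zL _; rewrite /Lge opprK.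
  rewrite (_ : (fun v => - sdiff U h v) = (fun v => N1^-1 * \sum_(j < N.+1) sdiff ur h (v + sj j))); last first.
    by apply/funext => v; exact: sU.
  pose chi (v : V) (j : 'I_N.+1) := ur (z + sj j + v) == 0.
  have chi1 v : `|v| <= 1 -> \sum_(j < N.+1) (chi v j)%:R <= 1 :> R.
    move=> v1; apply: sum_at_most_one => i j /eqP ui /eqP uj.
    have big (j' : 'I_N.+1) : `|z + sj j' + v| <= L + 2.
      apply: le_trans (ler_normD _ _) _; have := ler_normD z (sj j'); have := sjN j'.
      by move: kap1 v1 zL; clear; lra.
    have := HR1 Rr (proj1 RrR) _ (big i) ui; have := HR1 Rr (proj1 RrR) _ (big j) uj.
    rewrite !edotDl /sj !edotZl nu1 !mulr1 !ltr_norml => /andP[h1' h2'] /andP[h3 h4].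
    have thE : 2 * th = kap / N1 by rewrite /th; field; rewrite gt_eqF.
    have d1 : i%:R * (kap / N1) < j%:R * (kap / N1) + (kap / N1) by rewrite !mulrA -thE; move: h1' h2' h3 h4; clear; lra.
    have d2 : j%:R * (kap / N1) < i%:R * (kap / N1) + (kap / N1) by rewrite !mulrA -thE; move: h1' h2' h3 h4; clear; lra.
    have kN : 0 < kap / N1 by rewrite divr_gt0.
    have cut (p q : nat) : p%:R * (kap / N1) < q%:R * (kap / N1) + kap / N1 -> (p <= q)%N.
      by rewrite -[X in _ + X]mul1r -mulrDl ltr_pM2r// natr1 ltr_nat ltnS.
    by apply/val_inj/eqP; rewrite eqn_leq !cut.
  pose a (j : nat) := C1 * (4 * A) * ((ur (z + sj j + h) == 0)%:R + (ur (z + sj j - h) == 0)%:R).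
  have aF j : growth_adm gam (fun v => sdiff ur h (v + sj j)).
    apply: (adm_shift HK); exact: (adm_sdiff h (ltW A40) (ltW sig0) (ltW (is_siggam H)) (is_cont H1) lip).
  have LF j : (j < N.+1)%N -> Lle k (fun v => sdiff ur h (v + sj j)) z (a j).
    move=> jN; have zj : `|z + sj j| <= L + 1.
      apply: le_trans (ler_normD _ _) _; have := sjN (Ordinal jN); move: kap1 zL => /=; clear; lra.
    suff LL : Lle k (sdiff ur h) (z + sj j) (a j) by move/Lle_shift: LL.
    have L1 := HC1 k ur _ H2 ur0 zpos _ h zj h1.
    have L2 := HC1 k ur _ H2 ur0 zpos _ (- h) zj; rewrite normrN in L2.
    have := Lle_add HK (adm_incr h H2) (adm_incr (- h) H2) L1 (L2 h1).
    rewrite -mulrDr (_ : (fun v => ur (v + h) - ur v + (ur (v - h) - ur v)) = sdiff ur h)//.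
    by apply/funext => v; rewrite /sdiff; ring.
  have [LS aS] := Lle_sum HK aF LF.
  apply: Lle_mono (Lle_scale HK (ltW iN0) aS LS).
  rewrite ler_pdivrMl// /a -mulr_sumr big_split/=.
  apply: (@le_trans _ _ (C1 * (4 * A) * 2)).
    rewrite ler_pM2l ?mulr_gt0//; apply: lerD; first exact: chi1.
    by apply: (chi1 (- h)); rewrite normrN.
  rewrite (_ : C1 * (4 * A) * 2 = C1 * (8 * A)); last by ring.
  by rewrite (_ : N1 * (e0 * (8 * A)) = e0 * N1 * (8 * A)) ?ler_pM2r//; ring.
pose h := (tau / `|x|) *: x; have xp : 0 < `|x| by rewrite normr_gt0.
have hN : `|h| = tau.
  by rewrite normrZ gtr0_norm ?divr_gt0// divfK// gt_eqF.
have K0 : - (C * (8 * A) * tau `^ (1 + bet) * weight gam (0 : V)) <= sdiff U h 0.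
  by rewrite -hN; apply: (HL k HK U (8 * A) A80 cU lipU cond); rewrite hN.
have w0 : weight gam (0 : V) = 1.
  by rewrite /weight /edot big1 ?addr0 ?powR_one// => i _; rewrite mxE mul0r.
rewrite w0 mulr1 in K0.
have loc (z v : V) : `|z| <= 1 -> `|v| <= kap -> `|ur (z + v) - ur z| <= 12 * A * kap.
  move=> z1 vk; apply: le_trans (lip z v) _.
  apply: (@le_trans _ _ (4 * A * kap * 3)); last by rewrite le_eqVlt; apply/orP; left; apply/eqP; ring.
  apply: ler_pM; rewrite ?mulr_ge0 ?powR_ge0 ?(ltW A0)//; first by rewrite ler_wpM2l// ltW.
  rewrite -[leRHS]powRr1//; apply: (@le_trans _ _ (3 `^ sig)); last by apply: ler_powR; [rewrite ler1n|exact: ltW].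
  by apply: powR_le; rewrite ?(ltW sig0) ?addr_ge0//; move: z1 vk kap1; clear; lra.
(* As [ur 0 = 0] and [ur >= 0], the second difference of [ur] at 0 with step [h] is at least [ur h];
   moving its centre to [sj j] costs [36 * A * kap]. *)
have urh : ur h <= A / 2 * tau `^ (1 + sig).
  have S1 : ur h <= - sdiff U h 0 + 36 * A * kap.
    rewrite sU -(ler_pM2l N10) mulrDr mulrA divff ?gt_eqF// mul1r.
    have -> : N1 * ur h = \sum_(j < N.+1) ur h by rewrite sumr_const card_ord N1E mulr_natl.
    have -> : N1 * (36 * A * kap) = \sum_(j < N.+1) (36 * A * kap) by rewrite sumr_const card_ord N1E mulr_natl.
    rewrite -big_split/=; apply: ler_sum => j _; rewrite add0r /sdiff.
    have p1 := loc h (sj j); rewrite hN in p1; have {}p1 := p1 tau1 (sjN j).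
    have p2 := loc 0 (sj j); rewrite normr0 add0r ur0 subr0 in p2; have {}p2 := p2 ler01 (sjN j).
    move: p1 p2; rewrite !ler_norml [h + _]addrC => /andP[q1 q2] /andP[q3 q4].
    by have := is_ge0 H1 (sj j - h); rewrite /= -/(ur _); move: q1 q2 q3 q4; clear; lra.
  apply: (le_trans S1).
  have S2 := ler_wpM2l (ltW A0) Htau.
  have kE : 36 * A * kap = A * (1 / 4 * tau `^ (1 + sig)) by rewrite kapE; field.
  by rewrite kE; move: S2 K0; clear; lra.
apply: (@le_trans _ _ (ur h)).
  rewrite /ur /h scalerA (_ : Rr * (tau / `|x|) = r / `|x|); last by rewrite mulrA divfK// gt_eqF.
  rewrite -[x in leLHS]scale1r; apply: (u_ray_mono cu su u0 uge) => //.
  by rewrite ler_pdivlMr// mul1r.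
apply: (le_trans urh); rewrite AE.
have -> : r = Rr * tau by rewrite divfK// gt_eqF.
by rewrite (powRM _ (ltW Rr0) (ltW tau0)) le_eqVlt; apply/orP; left; apply/eqP; move: (tau `^ _) (Rr `^ _) => a b; field.
Qed.

(** The radius [R1] of [thin_step] does not depend on the growth constant [Q0], so the halving can
    be iterated and the constant driven to 0. *)
Lemma thin_contradiction (s gam l m sig Q : R) (k u : V -> R) nu :
  incr_solution s gam l m sig Q k u -> sig < 1 -> (forall c, 0 < c -> scaled_kernel s c k = k) ->
  u 0 = 0 -> nu != 0 -> (forall v, mono_dir u v -> edot v nu = 0) -> forall x, u x = 0.
Proof.
move=> H sig1 hk u0 nu0 G x; have uge := is_ge0 H; have Qp := is_Q0 H; have sig0 := is_sig0 H.
apply/eqP; rewrite eq_le uge andbT leNgt; apply/negP => ux.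
have ep := enorm_gt0 nu0.
have nu1 : edot ((enorm nu)^-1 *: nu) ((enorm nu)^-1 *: nu) = 1.
  by rewrite edotZl edotZr -enorm_sq; field; rewrite gt_eqF.
have G' v : mono_dir u v -> edot v ((enorm nu)^-1 *: nu) = 0.
  by move=> /G E; rewrite edotZr E mulr0.
have [R1 R11 HR1] := thin_step H sig1 hk u0 ux nu1 G'.
have bound (N : nat) r : R1 <= r -> forall y, `|y| <= r -> u y <= 2 * Q / 2 ^+ N * r `^ (1 + sig).
  elim: N r => [|N IH] r rR y yr.
    have r1 : 1 <= r by apply: le_trans rR.
    have rp : 0 < r by apply: lt_le_trans r1.
    rewrite expr0 divr1; have := is_growth H 0 y; rewrite add0r u0 subr0 normr0 addr0 ger0_norm// => /le_trans; apply.
    rewrite [2 * Q]mulrC -!mulrA ler_pM2l// powR_add// powRr1 ?(ltW rp)// mulrCA.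
    apply: ler_pM; rewrite ?powR_ge0//; apply: (@le_trans _ _ ((2 * r) `^ sig)).
      by apply: powR_le; rewrite ?(ltW sig0) ?addr_ge0//; move: yr r1; clear; lra.
    rewrite powRM ?(ltW rp)// ler_wpM2r ?powR_ge0//.
    by rewrite -[leRHS]powRr1//; apply: ler_powR; [rewrite ler1n|exact: ltW].
  have -> : 2 * Q / 2 ^+ N.+1 = 2 * Q / 2 ^+ N / 2 by rewrite exprS; field; rewrite expf_neq0.
  by apply: HR1 => //; rewrite divr_gt0 ?mulr_gt0 ?exprn_gt0.
pose r := Num.max R1 `|x|.
have B N : u x <= 2 * Q / 2 ^+ N * r `^ (1 + sig) by apply: bound; rewrite /r le_max lexx ?orbT.
pose D := 2 * Q * r `^ (1 + sig).
have D0 : 0 < D by rewrite !mulr_gt0// powR_gt0// lt_max (lt_le_trans ltr01 R11).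
have HN : D / u x < (Num.truncn (D / u x)).+1%:R by exact: truncnS_gt.
have := B (Num.truncn (D / u x)).+1; rewrite mulrAC ler_pdivlMr ?exprn_gt0// -/D leNgt => /negP; apply.
rewrite -ltr_pdivrMl// mulrC; apply: (lt_le_trans HN).
by rewrite -natrX ler_nat; apply: ltnW; exact: ltn_expl.
Qed.
End Thin.

(** * The cone is a half-space *)

Section Halfspace.
Context {R : realType} {n : nat}.
Local Notation V := 'rV[R]_n.
Local Notation mu := (@lebn R n).
Implicit Types (u w f b : V -> R) (x y z v e : V).

Lemma tailI_le (s gam l m : R) (k : V -> R) c w1 w2 : kernel_setting s gam l m k ->
  growth_adm gam w1 -> growth_adm gam w2 -> (forall y, 0 <= w1 y) -> (forall y, w1 y <= w2 y) ->
  fine (tailI s c w1) <= fine (tailI s c w2).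
Proof.
move=> HK a1 a2 w10 w12; have w20 y : 0 <= w2 y by apply: le_trans (w12 y).
apply: fine_le; [exact: (tailI_fin HK)|exact: (tailI_fin HK)|].
apply: ge0_le_integral => //.
- by move=> y _; rewrite lee_fin mulr_ge0// powR_ge0.
- exact: measurable_tailw _ _ (adm_measurable a1).
- exact: measurable_tailw _ _ (adm_measurable a2).
- by move=> y _; rewrite lee_fin ler_wpM2r// powR_ge0.
Qed.

Lemma adm_dilate (gam r : R) w : 0 <= gam -> 1 <= r -> growth_adm gam w ->
  growth_adm gam (fun z => w (r *: z)).
Proof.
move=> g0 r1 [mw [C C0 Hw]]; have r0 : 0 < r by apply: lt_le_trans r1.
split.
  have := measurableT_comp mw (@measurable_affine_rV R n r 0).
  by apply: eq_measurable_fun => y _ /=; rewrite addr0.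
exists (C * r `^ gam); first by rewrite mulr_ge0// powR_ge0.
move=> x; apply: le_trans (Hw _) _; rewrite -mulrA ler_wpM2l// -powRM ?(ltW r0) ?addr_ge0//.
apply: powR_le => //.
by rewrite normrZ gtr0_norm// mulrDr mulr1 lerD2r.
Qed.

Section Fixed.
Variables (s gam l m sig Q : R) (k u : V -> R).
Hypotheses (H : incr_solution s gam l m sig Q k u) (sig1 : sig < 1)
  (hk : forall c, 0 < c -> scaled_kernel s c k = k) (u0 : u 0 = 0).
Let HK := is_setting H.
Let cu := is_cont H.
Let uge := is_ge0 H.
Let su x h : 0 <= sdiff u h x.
Proof. by apply: incr_sdiff_ge0 H. Qed.

Definition dilated_tail (r : R) w : R := fine (tailI s 0 (fun z => w (r *: z))).

Lemma dilated_tail_le (r : R) w1 w2 : 1 <= r -> growth_adm gam w1 -> growth_adm gam w2 ->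
  (forall y, 0 <= w1 y) -> (forall y, w1 y <= w2 y) -> dilated_tail r w1 <= dilated_tail r w2.
Proof.
by move=> r1 a1 a2 w10 w12; apply: (tailI_le _ HK) => //; apply: adm_dilate => //; exact: ltW (ks_gam0 HK).
Qed.

Lemma dilated_tail_ge0 (r : R) w : (forall y, 0 <= w y) -> 0 <= dilated_tail r w.
Proof. by move=> w0; rewrite fine_ge0// tailI_ge0. Qed.

Lemma cont_dilate (r : R) w : continuous w -> continuous (fun z => w (r *: z)).
Proof. by move=> cw; apply: (@cont_comp R _ _ (fun z : V => r *: z) w); [exact: cont_scale|]. Qed.

Lemma Lle_dilate (r : R) w x : 0 < r -> growth_adm gam w -> Lle k w (r *: x) 0 ->
  Lle k (fun z => w (r *: z)) x 0.
Proof. by move=> r0 aw L; have := Lle0_scale HK r0 aw L; rewrite hk. Qed.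

(** The positivity set contains [p] plus the cone, hence at scale [r] the box of radius [d] around
    [w0 + p / r]. This is the interior box for [boundary_harnack], with a constant independent of
    [r]. *)
Lemma dilated_harnack (w0 : V) (d : R) p : 0 < u p -> 0 < d -> d <= 1 -> `|w0| <= 2^-1 ->
  (forall y, `|y - w0| < d -> mono_dir u y) ->
  exists2 C : R, 0 < C & forall f b, continuous f -> growth_adm gam f -> (forall x, 0 <= f x) ->
    continuous b -> growth_adm gam b -> (forall x, 0 <= b x) ->
    (forall x, 0 < u x -> Lge k f x 0) -> (forall x, 0 < u x -> Lle k b x 0) ->
    (forall x, u x = 0 -> b x = 0) ->
    forall r, 2 * `|p| + 1 <= r -> forall x, `|x| <= r ->
      b x * dilated_tail r f <= C * dilated_tail r b * f x.
Proof.
move=> up d0 d1 w0h Gw.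
have rho0 : 0 < d / 2 by rewrite divr_gt0.
have rho1 : d / 2 <= 1 by move: d1; lra.
have [C C0 HC] := @boundary_harnack R n s gam l m (d / 2) (ks_s0 HK) (ks_s1 HK) (ks_gam0 HK)
  (ks_gam2 HK) (ks_l0 HK) (ks_m0 HK) rho0 rho1.
exists C => // f b cf af f0 cb ab b0 Lf Lb bz r rp x xr.
have r1 : 1 <= r by apply: le_trans rp; rewrite lerDr mulr_ge0.
have r0 : 0 < r by apply: lt_le_trans r1.
have g0 := ltW (ks_gam0 HK).
have := HC k HK (fun z => 0 < u (r *: z)) (fun z => f (r *: z)) (fun z => b (r *: z)) (w0 + r^-1 *: p)
  (cont_dilate cf) (adm_dilate g0 r1 af) (fun=> f0 _) (cont_dilate cb) (adm_dilate g0 r1 ab) (fun=> b0 _).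
move=> /(_ _ _ _ _ _ (r^-1 *: x)); rewrite scalerA divff ?gt_eqF// scale1r; apply.
- by move=> z uz; have := Lf _ uz; rewrite /Lge oppr0; exact: (Lle_dilate r0 (adm_opp af)).
- by move=> z uz; apply: Lle_dilate => //; exact: Lb.
- by move=> z /negP; rewrite -leNgt => uz; apply: bz; apply/eqP; rewrite eq_le uz uge.
- apply: le_trans (ler_normD _ _) _; rewrite normrZ normfV (gtr0_norm r0).
  have : r^-1 * `|p| <= 2^-1 by rewrite ler_pdivrMl//; move: rp; lra.
  by move: w0h; lra.
- move=> z zr; rewrite /= in zr *.
  have Gz : mono_dir u (z - r^-1 *: p) by apply: Gw; rewrite addrAC -addrA -opprD; move: zr; rewrite mulrC divfK// addrC.
  have := Gz p r (ltW r0); rewrite scalerBr scalerA divff ?gt_eqF// scale1r addrC subrK; exact: lt_le_trans.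
- by rewrite normrZ normfV (gtr0_norm r0) mulrC ler_pdivrMr// mul1r.
Qed.

Lemma fwd_Lge v x : 0 < u x -> Lge k (fun z => u (z + v) - u z) x 0.
Proof. by move=> ux; exact: (is_incr H). Qed.

Lemma bwd_Lle v x : 0 < u x -> Lle k (fun z => u z - u (z - v)) x 0.
Proof.
by move=> ux; have := is_incr H (- v) ux; rewrite /Lge oppr0; under eq_fun do rewrite opprB.
Qed.

Lemma adm_bwd v : growth_adm gam (fun z => u z - u (z - v)).
Proof. by have := adm_opp (adm_incr (- v) H); under eq_fun do rewrite opprB. Qed.

Lemma cont_fwd v : continuous (fun z => u (z + v) - u z).
Proof.
apply: cont_sub => //; apply: (@cont_comp R _ _ (fun z : V => z + v) u) => //; exact: cont_shift.
Qed.

Lemma cont_bwd v : continuous (fun z => u z - u (z - v)).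
Proof.
apply: cont_sub => //; apply: (@cont_comp R _ _ (fun z : V => z - v) u) => //; exact: cont_shift.
Qed.

Lemma fwd_ge0 v : mono_dir u v -> forall x, 0 <= u (x + v) - u x.
Proof. by move=> G x; rewrite subr_ge0; have := G x 1 ler01; rewrite scale1r. Qed.

Lemma bwd_ge0 v : mono_dir u v -> forall x, 0 <= u x - u (x - v).
Proof. by move=> G x; have := fwd_ge0 G (x - v); rewrite subrK. Qed.

Lemma bwd_zero v : mono_dir u v -> forall x, u x = 0 -> u x - u (x - v) = 0.
Proof.
move=> G x ux; have := bwd_ge0 G x; rewrite ux sub0r => h; apply/eqP; rewrite eq_le h andbT oppr_le0; exact: uge.
Qed.

Lemma bwd_le_fwd v x : u x - u (x - v) <= u (x + v) - u x.
Proof. by have := su x v; rewrite /sdiff; lra. Qed.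

Lemma dilated_tail_gt0 w x (r : R) : continuous w -> growth_adm gam w -> (forall y, 0 <= w y) ->
  (forall y, 0 < u y -> Lle k w y 0) -> (forall y, u y = 0 -> w y = 0) -> 0 < w x ->
  1 <= r -> 0 < dilated_tail r w.
Proof.
move=> cw aw w0 Lw wz wx r1; have r0 : 0 < r by apply: lt_le_trans r1.
have [C C0 HC] := @sup_bound R n s gam l m (ks_s0 HK) (ks_s1 HK) (ks_gam0 HK)
  (ks_gam2 HK) (ks_l0 HK) (ks_m0 HK).
have g0 := ltW (ks_gam0 HK).
have := HC k HK _ (r^-1 *: x) (cont_dilate cw) (adm_dilate g0 r1 aw) (fun=> w0 _).
rewrite /= scalerA divff ?gt_eqF// scale1r => B.
have {}B : w x <= C * fine (tailI s (r^-1 *: x) (fun z => w (r *: z))).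
  apply: B => z _ wz0; apply: Lle_dilate => //; apply: Lw.
  by rewrite lt_def uge andbT; apply/eqP => uz; move: wz0; rewrite wz ?ltxx.
rewrite lt_def dilated_tail_ge0 // andbT; apply/eqP => T0.
have := tailI_recenter_fine HK (adm_dilate g0 r1 aw) (fun=> w0 _) (lexx `|r^-1 *: x - 0|).
rewrite [X in _ * X]T0 mulr0 => F.
have := ler_wpM2l (ltW C0) F; rewrite mulr0 => F'.
by have := lt_le_trans wx (le_trans B F'); rewrite ltxx.
Qed.

Lemma increments_comparable (w0 : V) (d : R) p e v : 0 < u p -> 0 < d -> d <= 1 -> `|w0| <= 2^-1 ->
  (forall y, `|y - w0| < d -> mono_dir u y) ->
  mono_dir u e -> ~ mono_dir u (- e) -> mono_dir u v ->
  exists2 C : R, 1 <= C & forall t, 0 < t -> t <= 1 -> forall x,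
    u x - u (x - t *: v) <= C * (u (x + t *: e) - u x).
Proof.
move=> up d0 d1 w0h Gw Ge Gne Gv.
have [C C0 HC] := dilated_harnack up d0 d1 w0h Gw.
have [x1 [t1 [t10 ux1]]] : exists x1 t1, 0 <= t1 /\ u (x1 - t1 *: e) < u x1.
  apply: contrapT => Hn; apply: Gne => x t t0; rewrite leNgt; apply/negP => ux.
  by apply: Hn; exists x, t; rewrite -scalerN.
(* The strict decrease along [- e], found at the step [t1], is moved to the unit step, by
   monotonicity if [t1 <= 1] and by convexity otherwise. *)
have be1 : 0 < u x1 - u (x1 - 1 *: e).
  have [t1l|t1g] := leP t1 1.
    rewrite subr_gt0; apply: le_lt_trans ux1.
    have := Ge (x1 - 1 *: e) (1 - t1); rewrite subr_ge0 scalerBl addrA subrK; exact.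
  have := convex_backslope cu su x1 e ltr01 (ltW t1g); rewrite mul1r => h1.
  have t1p : 0 < t1 by apply: lt_trans t1g.
  by rewrite -(pmulr_rgt0 _ t1p); apply: lt_le_trans h1; rewrite subr_gt0.
pose fv1 := u (x1 + 1 *: v) - u x1.
have fv10 : 0 <= fv1 by have := fwd_ge0 Gv x1; rewrite -{1}[v]scale1r.
pose be := u x1 - u (x1 - 1 *: e).
exists (1 + C ^+ 2 * fv1 / be).
  by rewrite lerDl divr_ge0 ?mulr_ge0 ?sqr_ge0// ltW.
move=> t t0 t1' x.
have Gte := mono_dirZ (ltW t0) Ge; have Gtv := mono_dirZ (ltW t0) Gv.
pose r := Num.max (2 * `|p| + 1) (Num.max `|x| `|x1|).
have rp : 2 * `|p| + 1 <= r by rewrite le_max lexx.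
have rx : `|x| <= r by rewrite !le_max lexx orbT.
have rx1 : `|x1| <= r by rewrite !le_max lexx !orbT.
have r1 : 1 <= r by apply: le_trans rp; rewrite lerDr mulr_ge0.
have B1 := HC _ _ (@cont_fwd (t *: e)) (adm_incr _ H) (fwd_ge0 Gte) (@cont_bwd (t *: v)) (adm_bwd _)
  (bwd_ge0 Gtv) (@fwd_Lge _) (@bwd_Lle _) (bwd_zero Gtv) r rp x rx.
have B2 := HC _ _ (@cont_fwd (t *: v)) (adm_incr _ H) (fwd_ge0 Gtv) (@cont_bwd (t *: e)) (adm_bwd _)
  (bwd_ge0 Gte) (@fwd_Lge _) (@bwd_Lle _) (bwd_zero Gte) r rp x1 rx1.
have T1 := dilated_tail_le r1 (adm_bwd (t *: v)) (adm_incr (t *: v) H) (bwd_ge0 Gtv) (bwd_le_fwd (t *: v)).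
have T2 := dilated_tail_le r1 (adm_bwd (t *: e)) (adm_incr (t *: e) H) (bwd_ge0 Gte) (bwd_le_fwd (t *: e)).
have bet : t * be <= u x1 - u (x1 - t *: e).
  by have := convex_backslope cu su x1 e t0 t1'; rewrite mul1r.
have fvt : u (x1 + t *: v) - u x1 <= t * fv1.
  by have := convex_slope cu su x1 v t0 t1'; rewrite mul1r.
have T3 : 0 < dilated_tail r (fun z => u z - u (z - t *: e)).
  apply: (@dilated_tail_gt0 _ x1) => //; [exact: cont_bwd|exact: adm_bwd|exact: bwd_ge0|exact: bwd_Lle|exact: bwd_zero|].
  by apply: lt_le_trans bet; rewrite mulr_gt0.
have fe0 := fwd_ge0 Gte x; have bv0 := bwd_ge0 Gtv x.
have Tv0 : 0 <= dilated_tail r (fun z => u z - u (z - t *: v)) by exact/dilated_tail_ge0/bwd_ge0.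
move: B1 B2 T1 T2 T3 Tv0 bet fvt fe0 bv0.
move: (dilated_tail r (fun z => u z - u (z - t *: v))) => Tbv.
move: (dilated_tail r (fun z => u z - u (z - t *: e))) => Tbe.
move: (dilated_tail r (fun z => u (z + t *: v) - u z)) => Tfv.
move: (dilated_tail r (fun z => u (z + t *: e) - u z)) => Tfe.
move: (u x - u (x - t *: v)) (u (x + t *: e) - u x) => bv fe.
move: (u x1 - u (x1 - t *: e)) (u (x1 + t *: v) - u x1) => bex fvx.
move=> B1 B2 T1 T2 T3 Tv0 bet fvt fe0 bv0.
have be0 : 0 < be by [].
have TF : 0 < Tfe by apply: lt_le_trans T2.
have S1 : Tbv * (t * be) <= C * Tfe * (t * fv1).
  apply: (@le_trans _ _ (bex * Tfv)).
    rewrite mulrC; apply: ler_pM => //; exact: mulr_ge0 (ltW t0) (ltW be0).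
  apply: (le_trans B2); apply: ler_pM => //; last by rewrite ler_pM2l.
    exact: mulr_ge0 (ltW C0) (ltW T3).
  have : 0 <= bex by apply: le_trans bet; exact: mulr_ge0 (ltW t0) (ltW be0).
  move=> bex0; have Tfv0 : 0 <= Tfv by apply: le_trans T1.
  have CT : 0 < C * Tbe by exact: mulr_gt0.
  rewrite -(pmulr_rge0 _ CT); apply: le_trans B2; exact: mulr_ge0.
have S2 : Tbv * be <= C * Tfe * fv1.
  by rewrite -(ler_pM2l t0) mulrCA (mulrCA t).
have S3 : bv * be <= C ^+ 2 * fv1 * fe.
  rewrite -(ler_pM2r TF); apply: (@le_trans _ _ (C * Tbv * fe * be)).
    by rewrite mulrAC ler_pM2r.
  have := ler_wpM2l (mulr_ge0 (ltW C0) fe0) S2; rewrite expr2 => S3; lra.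
apply: (@le_trans _ _ (C ^+ 2 * fv1 / be * fe)).
  by rewrite mulrAC ler_pdivlMr.
by rewrite mulrDl mul1r lerDr.
Qed.

Lemma mono_dir_dominates (w0 : V) (d : R) p e v : Ck [set x | 0 < u x] 1 u ->
  0 < u p -> 0 < d -> d <= 1 -> `|w0| <= 2^-1 ->
  (forall y, `|y - w0| < d -> mono_dir u y) ->
  mono_dir u e -> ~ mono_dir u (- e) -> mono_dir u v ->
  exists2 C : R, 0 < C & mono_dir u (C *: e - v).
Proof.
move=> C1 up d0 d1 w0h Gw Ge Gne Gv.
have [C C1' HC] := increments_comparable up d0 d1 w0h Gw Ge Gne Gv.
have C0 : 0 < C by apply: lt_le_trans C1'.
exists C => // x t t0; have [->|tn] := eqVneq t 0; first by rewrite scale0r addr0.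
have tp : 0 < t by rewrite lt_def tn.
have [ux|ux] := leP (u x) 0; first by apply: le_trans ux (uge _).
rewrite -[leRHS]addr0; apply/ler_addgt0Pr => ep ep0.
pose ep' := ep / t; have ep'0 : 0 < ep' by rewrite divr_gt0.
have oP : open [set x : V | 0 < u x] by exact: cont_open_lt.
have [ta ta0 Ha] := C1_sdiff ((2 * C) *: e) oP C1 ux ep'0.
have [tb tb0 Hb] := C1_sdiff (2 *: v) oP C1 ux ep'0.
pose q := Num.min (Num.min ta tb) (Num.min 1 t) / 2.
have q0 : 0 < q by rewrite divr_gt0// !lt_min ta0 tb0 ltr01.
have [qa qb q1 qt] : [/\ q < ta, q < tb, 2 * q <= 1 & q <= t].
  have M : 2 * q = Num.min (Num.min ta tb) (Num.min 1 t) by rewrite /q; field.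
  have : [/\ 2 * q <= ta, 2 * q <= tb, 2 * q <= 1 & 2 * q <= t].
    by rewrite M !ge_min !lexx !orbT.
  by move=> [h1 h2 h3 h4]; split => //; move: h1 h2 h4 q0; lra.
clearbody q.
have := Ha q q0 qa; have := Hb q q0 qb; rewrite !scalerA => sb sa.
have slope := convex_slope cu su x (C *: e - v) q0 qt.
(* Midpoint convexity bounds [u (x - q (C e - v))] by the mean of [u (x + 2 q v)] and
   [u (x - 2 q C e)]. Up to the errors of [C1_sdiff] these become a backward increment along [v] and
   a forward increment along [e], which [HC] compares. *)
have key : - (ep' * q) <= u (x + q *: (C *: e - v)) - u x.
  have h1 := su x (q *: (C *: e - v)).
  have h2 := su (x - q *: (C *: e - v)) (q *: (C *: e + v)).
  have E1 : x - q *: (C *: e - v) + q *: (C *: e + v) = x + (q * 2) *: v.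
    by apply/rowP => i; rewrite !mxE; ring.
  have E2 : x - q *: (C *: e - v) - q *: (C *: e + v) = x - (q * (2 * C)) *: e.
    by apply/rowP => i; rewrite !mxE; ring.
  rewrite /sdiff E1 E2 in h2.
  have h3 := HC (2 * q) (mulr_gt0 (ltr0Sn _ 1) q0) q1 x.
  have q2 : 0 < 2 * q by rewrite mulr_gt0.
  have q2C : 2 * q <= q * (2 * C) by rewrite [2 * q]mulrC ler_pM2l// ler_peMr.
  have h4 := convex_slope cu su x e q2 q2C.
  have E3 : q * (2 * C) = 2 * q * C by ring.
  have {}h4 : C * (u (x + (2 * q) *: e) - u x) <= u (x + (q * (2 * C)) *: e) - u x.
    by rewrite -(ler_pM2l q2) mulrA -E3.
  rewrite [2 * q]mulrC in h3 h4.
  move: h1 h2 h3 h4 sa sb; rewrite /sdiff; lra.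
have h5 : t * (- (ep' * q)) <= q * (u (x + t *: (C *: e - v)) - u x).
  by apply: le_trans slope; rewrite ler_pM2l.
have h6 : t * (- (ep' * q)) = q * (- ep) by rewrite /ep'; field; rewrite gt_eqF.
by rewrite h6 ler_pM2l// in h5; rewrite addr0; move: h5; lra.
Qed.

Lemma halfspace_profile p : Ck [set x | 0 < u x] 1 u -> 0 < u p ->
  exists nu, [/\ edot nu nu = 1, mono_dir u nu & forall x, u x = u (edot x nu *: nu)].
Proof.
move=> C1 up.
have [[A [uA GA]]|[nu [nu0 Gnu]]] := cone_dichotomy (mono_dir u); last first.
  by have := thin_contradiction H sig1 hk u0 nu0 Gnu p => E; move: up; rewrite E ltxx.
have [e [d [d0 d1 eh Ge]]] := cone_ball uA GA.
have Gee : mono_dir u e by apply: Ge; rewrite subrr normr0.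
have near y : exists2 a : R, 0 < a & mono_dir u (e + a *: y).
  exists (d / (`|y| + 1) / 2); first by rewrite !divr_gt0// ltr_wpDl.
  apply: Ge; rewrite addrC addKr normrZ gtr0_norm ?divr_gt0 ?ltr_wpDl//.
  have y1 : 0 < `|y| + 1 by rewrite ltr_wpDl.
  rewrite -!mulrA gtr_pMr// mulrCA ltr_pdivrMl// ltr_pdivrMl// mulr1.
  by have := normr_ge0 y; lra.
have Gne : ~ mono_dir u (- e).
  move=> Gn; have Gp : mono_dir u p.
    have [a a0 Ga] := near p; have := mono_dirD Ga Gn; rewrite addrC addKr.
    move=> /(mono_dirZ (ltW (_ : 0 < a^-1))); rewrite invr_gt0 scalerA mulVf ?gt_eqF// scale1r; exact.
  have Gpn : mono_dir u (- p).
    have [a a0 Ga] := near (- p); have := mono_dirD Ga Gn; rewrite addrC addKr.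
    move=> /(mono_dirZ (ltW (_ : 0 < a^-1))); rewrite invr_gt0 scalerA mulVf ?gt_eqF// scale1r; exact.
  by have := Gpn p 1 ler01; rewrite scale1r subrr u0 leNgt up.
(* Modulo its lineality space the cone is the half-line spanned by [e]; the number sought is the
   least [t] with [t e - y] in the cone. *)
have decomp y : exists t : R, mono_dir u (y - t *: e) /\ mono_dir u (t *: e - y).
  pose S := [set t : R | mono_dir u (t *: e - y)].
  have Sup (t t' : R) : S t -> t <= t' -> S t'.
    move=> St tt'; have := mono_dirD St (mono_dirZ (_ : 0 <= t' - t) Gee); rewrite subr_ge0 => /(_ tt').
    by rewrite scalerBl addrAC addrCA subrr addr0.
  have S0 : S !=set0.
    have [a a0 Ga] := near (- y); exists a^-1; have := mono_dirZ (ltW (_ : 0 < a^-1)) Ga.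
    by rewrite invr_gt0 scalerDr scalerA mulVf ?gt_eqF// scale1r; apply.
  have Slb : has_lbound S.
    (* otherwise -e - y/t would lie in the closed cone for t arbitrarily large *)
    apply: contrapT => nlb; apply: Gne; apply: (@mono_dir_closed _ _ u cu _ (- y)) => a a0 a1.
    have [t St ta] : exists2 t, S t & t < - a^-1.
      apply: contrapT => Hn; apply: nlb; exists (- a^-1) => t St; rewrite leNgt; apply/negP => ta; apply: Hn; by exists t.
    have := mono_dirZ (ltW a0) (Sup _ _ St (ltW ta)).
    by rewrite scalerBr scalerA mulrN divff ?gt_eqF// scaleN1r scalerN.
  have hS : has_inf S by split.
  exists (inf S).
  have Sinf : S (inf S).
    apply: (@mono_dir_closed _ _ u cu _ e) => a a0 a1.
    have [t St ta] := inf_adherent a0 hS.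
    have := Sup t (inf S + a) St (ltW ta); by rewrite /S/= scalerDl addrAC.
  (* Otherwise [inf S * e - y] could take the role of [e] in [mono_dir_dominates] and dominate [e]
     itself; after division by [C] this lowers the infimum by [1 / C]. *)
  split => //; rewrite -opprB; apply: contrapT => Hn.
  have [C C0 HC] := mono_dir_dominates C1 up d0 d1 eh Ge Sinf Hn Gee.
  have : S (inf S - C^-1).
    have := mono_dirZ (ltW (_ : 0 < C^-1)) HC; rewrite invr_gt0 => /(_ C0).
    by rewrite scalerBr scalerA mulVf ?gt_eqF// scale1r /S/= scalerBl addrAC.
  move=> /(ge_inf Slb); rewrite leNgt => /negP; apply.
  by rewrite gtrBl invr_gt0.
pose lin y := mono_dir u y /\ mono_dir u (- y).
have linZ (c : R) y : lin y -> lin (c *: y).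
  move=> [h1 h2]; have [c0|c0] := leP 0 c.
    by split; [exact: mono_dirZ|rewrite -scalerN; exact: mono_dirZ].
  have c0' : 0 <= - c by rewrite oppr_ge0 ltW.
  split; last by rewrite -scaleNr; exact: mono_dirZ.
  by rewrite -[c]opprK scaleNr -scalerN; exact: mono_dirZ.
have linD y z : lin y -> lin z -> lin (y + z).
  by move=> [a1 a2] [b1 b2]; split; rewrite ?opprD; exact: mono_dirD.
have lin_eq y z : lin y -> u (z + y) = u z.
  move=> [h1 h2]; apply/eqP; rewrite eq_le; have := h1 z 1 ler01; have := h2 (z + y) 1 ler01.
  by rewrite !scale1r addrK => -> ->.
(* The values on the basis vectors define the linear form [x . mv] for which [x - (x . mv) e] lies
   in the lineality space. *)
have /choice[T HT] : forall i : 'I_n, exists t : R, lin (evec i - t *: e).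
  by move=> i; have [t [h1 h2]] := decomp (evec i); exists t; split; rewrite ?opprB.
pose mv : V := \row_i T i.
have linx x : lin (x - edot x mv *: e).
  have -> : x - edot x mv *: e = \sum_i x 0 i *: (evec i - T i *: e).
    under eq_bigr do rewrite scalerBr; rewrite sumrB -row_sum_delta.
    by congr (_ - _); rewrite /edot scaler_suml; apply: eq_bigr => i _; rewrite scalerA mxE.
  elim/big_ind: _ => [||i _]; [|exact: linD|exact: linZ].
  by rewrite /lin oppr0; split; exact: mono_dir0.
have prof x : u x = u (edot x mv *: e).
  by rewrite -[in LHS](subrK (edot x mv *: e) x) addrC lin_eq.
have mv0 : mv != 0.
  apply/eqP => E; have := prof p; rewrite E /edot big1 ?scale0r; last by move=> i _; rewrite mxE mulr0.
  by rewrite u0 => E'; move: up; rewrite E' ltxx.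
have ep := enorm_gt0 mv0.
exists ((enorm mv)^-1 *: mv); split.
- by rewrite edotZl edotZr -enorm_sq; field; rewrite gt_eqF.
- move=> x t t0; rewrite prof [leRHS]prof edotDl !edotZl -enorm_sq scalerDl; apply: Gee.
  by rewrite mulr_ge0// mulr_ge0 ?sqr_ge0// invr_ge0 ltW.
- move=> x; rewrite [RHS]prof !edotZl !edotZr -enorm_sq (_ : _ * _ = edot x mv) -?prof//.
  by field; rewrite gt_eqF.
Qed.

End Fixed.
End Halfspace.

(** * Powers of the distance to a half-space *)

Section QuadConst.
Context {R : realType}.

(** Subdividing [[a, b]] into [N] equal pieces leaves a total increment of order [1 / N]. *)
Lemma quadratic_increments_const (f : R -> R) (a b C : R) : a <= b -> 0 <= C ->
  (forall x y, a <= x -> x <= y -> y <= b -> `|f x - f y| <= C * (y - x) ^+ 2) -> f a = f b.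
Proof.
move=> ab C0 Hf.
have key (N : nat) : `|f a - f b| * N.+1%:R <= C * (b - a) ^+ 2.
  pose d := (b - a) / N.+1%:R; have d0 : 0 <= d by rewrite divr_ge0 ?subr_ge0.
  have dE : d * N.+1%:R = b - a by rewrite divfK// pnatr_eq0.
  have H j : (j <= N.+1)%N -> `|f a - f (a + d * j%:R)| <= j%:R * (C * d ^+ 2).
    elim: j => [|j IH] jN; first by rewrite mulr0 addr0 subrr normr0 mul0r.
    have jb : d * j.+1%:R <= b - a by rewrite -dE ler_wpM2l// ler_nat.
    have j0 : 0 <= d * j%:R by rewrite mulr_ge0.
    have jE : d * j.+1%:R = d * j%:R + d by rewrite -natr1 mulrDr mulr1.
    have h2 : `|f (a + d * j%:R) - f (a + d * j.+1%:R)| <= C * d ^+ 2.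
      have := Hf (a + d * j%:R) (a + d * j.+1%:R).
      rewrite (_ : a + d * j.+1%:R - (a + d * j%:R) = d); last by rewrite jE; ring.
      by apply; move: jb j0 d0; rewrite jE; clear; lra.
    have -> : f a - f (a + d * j.+1%:R) = (f a - f (a + d * j%:R)) + (f (a + d * j%:R) - f (a + d * j.+1%:R)) by ring.
    apply: le_trans (ler_normD _ _) _; rewrite -[in leRHS]natr1 mulrDl mul1r; apply: lerD => //.
    by apply: IH; exact: ltnW.
  have := H N.+1 (leqnn _); rewrite dE (addrC a) subrK => h.
  have N0 : 0 <= N.+1%:R :> R by [].
  apply: le_trans (ler_wpM2r N0 h) _; rewrite -dE le_eqVlt; apply/orP; left; apply/eqP; ring.
apply/eqP; rewrite -subr_eq0 -[_ == 0]normr_eq0; apply: contraT => nz.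
have p : 0 < `|f a - f b| by rewrite lt_def nz normr_ge0.
pose M := C * (b - a) ^+ 2 / `|f a - f b|.
have := key (Num.truncn M); rewrite leNgt; have := truncnS_gt M.
by rewrite {1}/M ltr_pdivrMr// [_ * `|_|]mulrC => ->.
Qed.

(* [Z] stands for [(1 - e)^s] and [A] for the tail [e^(-2s)], at two cut-offs [e]; [A * Z^2] is then
   the tail at [e / (1 - e)], the image of the cut-off under inversion of the half-line. *)
Lemma stieltjes_cell (A A' Z Z' X1 X2 : R) : 0 < Z' -> Z' <= Z -> 0 <= A' -> A' <= A ->
  (1 - Z) * (A - A') <= X1 -> X1 <= (1 - Z') * (A - A') ->
  (Z^-1 - 1) * (A * Z ^+ 2 - A' * Z' ^+ 2) <= X2 ->
  X2 <= (Z'^-1 - 1) * (A * Z ^+ 2 - A' * Z' ^+ 2) ->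
  `|X1 - X2 - ((1 - Z) ^+ 2 * A - (1 - Z') ^+ 2 * A')| <= (Z - Z') * (A - A') + (Z - Z') ^+ 2 * A / Z'.
Proof.
move=> Z'0 ZZ A'0 AA h1 h2 h3 h4; have Z0 : 0 < Z by apply: lt_le_trans ZZ.
have A0 : 0 <= A by apply: le_trans AA.
have E1 : (1 - Z') * (A - A') - (Z^-1 - 1) * (A * Z ^+ 2 - A' * Z' ^+ 2)
    - ((1 - Z) ^+ 2 * A - (1 - Z') ^+ 2 * A') = (Z - Z') * (A - A') + (Z - Z') ^+ 2 * A' / Z.
  by field; rewrite gt_eqF.
have E2 : (1 - Z) * (A - A') - (Z'^-1 - 1) * (A * Z ^+ 2 - A' * Z' ^+ 2)
    - ((1 - Z) ^+ 2 * A - (1 - Z') ^+ 2 * A') = - ((Z - Z') * (A - A') + (Z - Z') ^+ 2 * A / Z').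
  by field; rewrite gt_eqF.
have E3 : (Z - Z') ^+ 2 * A' / Z <= (Z - Z') ^+ 2 * A / Z'.
  apply: ler_pM; [exact: mulr_ge0 (sqr_ge0 _) A'0|by rewrite invr_ge0 ltW| |by rewrite lef_pV2 ?posrE].
  by rewrite ler_wpM2l// sqr_ge0.
rewrite ler_norml; move: h1 h2 h3 h4 E1 E2 E3.
move: (Z^-1) (Z'^-1) (Z^+2) (Z' ^+ 2) ((1 - Z) ^+ 2) ((1 - Z') ^+ 2) ((Z - Z') ^+ 2 * A' / Z) ((Z - Z') ^+ 2 * A / Z').
clear; move=> iZ iZ' Z2 Z'2 p p' e1 e2 h1 h2 h3 h4 E1 E2 E3.
by apply/andP; split; lra.
Qed.

(** Here [b] is a cut-off, [X] and [Z] stand for [b^s] and [(1 - b)^s], [I] and [J] for the two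
    integrals in [balance], [K] for [K0] and [M] for the integral of [x^s] beyond 1. As [b] tends to
    1, [I] and the closed form tend to [K] and [J] tends to 0, all at the rate [Z]. *)
Lemma balance_defect_bound (K b X Z I J M : R) : 0 <= K -> 2^-1 <= b -> b < 1 -> b <= X ->
  1 - b <= Z -> Z <= 1 -> 0 <= Z -> K <= I -> I <= K * (X ^+ 2)^-1 -> 0 <= J -> J <= 4 * M * Z ->
  `|I - J - (1 - Z) ^+ 2 * (K * (X ^+ 2)^-1)| <= (8 * K + 4 * M) * Z.
Proof.
move=> K0 b2 b1 bX bZ Z1 Z0 KI IA J0 JM.
have b0 : 0 < b by move: b2; clear; lra.
have X0 : 0 < X by apply: lt_le_trans bX.
have X2 : b ^+ 2 <= X ^+ 2 by rewrite lerXn2r ?nnegrE ?(ltW b0) ?(ltW X0).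
have i1 : (X ^+ 2)^-1 <= 1 + 8 * (1 - b).
  rewrite -[leLHS]mul1r ler_pdivrMr ?exprn_gt0//.
  have c0 : 0 <= 1 + 8 * (1 - b) by move: b1; clear; lra.
  apply: (@le_trans _ _ ((1 + 8 * (1 - b)) * b ^+ 2)); last by rewrite ler_wpM2l.
  have h1 : 0 <= 8 * b ^+ 2 - b - 1.
    by have := mulr_ge0 (_ : 0 <= b - 2^-1) (_ : 0 <= 8 * b + 3); rewrite expr2; move: b2; clear; nra.
  have : 0 <= (1 - b) * (8 * b ^+ 2 - b - 1) by apply: mulr_ge0 => //; move: b1; clear; lra.
  by rewrite expr2; clear; lra.
have i2 : (X ^+ 2)^-1 <= 4.
  rewrite -[leLHS]mul1r ler_pdivrMr ?exprn_gt0//; apply: (@le_trans _ _ (4 * b ^+ 2)); last by rewrite ler_pM2l.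
  by rewrite expr2; move: b2; clear; nra.
have i0 : 0 <= (X ^+ 2)^-1 by rewrite invr_ge0 sqr_ge0.
move: (X ^+ 2)^-1 i0 i1 i2 IA => iX i0 i1 i2 IA.
have h1 := mulr_ge0 K0 (_ : 0 <= 1 + 8 * (1 - b) - iX); rewrite subr_ge0 in h1; have {}h1 := h1 i1.
have h2 := mulr_ge0 K0 (_ : 0 <= 4 - iX); rewrite subr_ge0 in h2; have {}h2 := h2 i2.
have h3 := mulr_ge0 K0 (_ : 0 <= Z - (1 - b)); rewrite subr_ge0 in h3; have {}h3 := h3 bZ.
have h4 := mulr_ge0 Z0 h2.
have A0 : 0 <= K * iX by apply: mulr_ge0.
have h5 := mulr_ge0 A0 (sqr_ge0 Z).
have h6 := mulr_ge0 A0 (mulr_ge0 Z0 (_ : 0 <= 2 - Z)).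
have h7 : 0 <= 2 - Z by move: Z1; clear; lra.
have {}h6 := h6 h7.
have h8 := mulr_ge0 K0 Z0.
rewrite ler_norml !expr2; rewrite expr2 in h5.
move: h1 h2 h3 h4 A0 h5 h6 h8 KI IA J0 JM; clear => h1 h2 h3 h4 A0 h5 h6 h8 KI IA J0 JM.
by apply/andP; split; lra.
Qed.

(** [A] stands for the tail [K0 * d^(- 2 s)], [Z] for [(1 - d)^s], and [a], [b], [c] for the
    integrals of the drop beyond [d], of the rise beyond [d] and of the rise beyond
    [d / (1 - d)]. *)
Lemma cut_difference_bound (A Z a b c d : R) : 0 <= A -> 0 <= d -> 0 < Z -> 1 - d <= Z -> Z <= 1 -> 2^-1 <= Z ->
  a - c = (1 - Z) ^+ 2 * A -> b - c <= (Z^-1 - 1) * (A - A * Z ^+ 2) -> 0 <= b - c ->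
  `|a - b| <= 4 * (d ^+ 2 * A).
Proof.
move=> A0 d0 Z0 Zd Z1 Z2 E1 E2 E3.
have p2 : (1 - Z) ^+ 2 <= d ^+ 2.
  by rewrite lerXn2r ?nnegrE ?subr_ge0//; move: Zd; clear; lra.
have pA : (1 - Z) ^+ 2 * A <= d ^+ 2 * A by rewrite ler_wpM2r.
have iZ : Z^-1 <= 2 by rewrite -[leLHS]mul1r ler_pdivrMr//; move: Z2; clear; lra.
have E4 : b - c <= 4 * ((1 - Z) ^+ 2 * A).
  apply: (le_trans E2).
  have -> : (Z^-1 - 1) * (A - A * Z ^+ 2) = ((1 - Z) ^+ 2 * A) * ((1 + Z) * Z^-1) by field; rewrite gt_eqF.
  rewrite mulrC ler_wpM2r//; first exact: mulr_ge0 (sqr_ge0 _) A0.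
  apply: (@le_trans _ _ (2 * 2)); last by rewrite -natrM.
  by apply: ler_pM => //; [rewrite addr_ge0// ltW|rewrite invr_ge0 ltW|exact: (lerD (lexx 1) Z1)].
have P0 : 0 <= (1 - Z) ^+ 2 * A by rewrite mulr_ge0// sqr_ge0.
rewrite ler_norml; move: E1 E3 E4 pA P0.
by move: ((1 - Z) ^+ 2 * A) (d ^+ 2 * A); clear; move=> u v *; apply/andP; split; lra.
Qed.

Lemma measurable_above (a : R) : measurable_fun setT (fun x : R => (a < x)%R%:R : R).
Proof.
rewrite (_ : (fun _ => _) = \1_(`]a, +oo[)).
  by apply: measurable_indic; exact: measurable_itv.
by apply/funext => x; rewrite indicE; congr (_%:R); rewrite mem_setE in_itv/= andbT.
Qed.

Lemma powR_lip_ge (s a x y : R) : 0 < s -> s < 1 -> 0 < a -> a <= x -> x <= y ->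
  y `^ s - x `^ s <= s * a `^ (s - 1) * (y - x).
Proof.
move=> s0 s1 a0 ax xy; have x0 : 0 < x by apply: lt_le_trans ax.
have := powR_tangent s0 s1 (le_trans (ltW x0) xy) x0.
have : s * x `^ (s - 1) * (y - x) <= s * a `^ (s - 1) * (y - x).
  rewrite ler_wpM2r ?subr_ge0// ler_wpM2l ?(ltW s0)//; apply: powR_anti => //.
  by rewrite subr_le0 ltW.
by lra.
Qed.

Lemma powR_opp_double (s x : R) : 0 < x -> x `^ (- (2 * s)) = ((x `^ s) ^+ 2)^-1.
Proof. by move=> x0; rewrite powRN mulr2n mulrDl mul1r powR_add// expr2. Qed.

End QuadConst.

(** * Integrals against the one-dimensional marginal of the kernel *)

Section Layers.
Context {R : realType} {n : nat}.
Local Notation V := 'rV[R]_n.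
Local Notation mu := (@lebn R n).
Implicit Types (z v : V) (g : R -> R).

Variables (s gam l m : R) (k : V -> R) (nu : V).
Hypotheses (HK : kernel_setting s gam l m k)
  (hk : forall c, 0 < c -> scaled_kernel s c k = k) (sgam : s < gam) (nu1 : edot nu nu = 1).

(** Integration against the marginal of the kernel in direction [nu]. For a homogeneous kernel this
    marginal is a multiple of [|t|^(-1 - 2 s)], but it is never written down: its homogeneity is
    available as [layer_dilate]. *)
Definition layer_int g : \bar R := (\int[mu]_y (g (edot y nu) * k y)%:E)%E.

Definition layer_fun g : Prop :=
  [/\ measurable_fun setT g, (forall x, 0 <= g x) & (layer_int g < +oo)%E].

Definition psi g : R := fine (layer_int g).

Lemma measurable_edot : measurable_fun setT ((fun y : V => edot y nu) : V -> measurableTypeR R).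
Proof. by apply: continuous_measurable_rV; exact: cont_edotl. Qed.

Lemma measurable_layer g : measurable_fun setT g ->
  measurable_fun setT ((fun y : V => g (edot y nu) * k y) : V -> measurableTypeR R).
Proof.
move=> mg; apply: measurable_funM; last exact: (sk_meas (ks_kernel HK)).
exact: (measurableT_comp mg measurable_edot).
Qed.

Lemma layer_nonneg g y : (forall x, 0 <= g x) -> 0 <= g (edot y nu) * k y.
Proof. by move=> g0; rewrite mulr_ge0// (kernel_nneg HK). Qed.

Lemma layer_fin g : layer_fun g -> layer_int g = (psi g)%:E.
Proof.
move=> [mg g0 fg]; rewrite fineK// ge0_fin_numE//.
by apply: integral_ge0 => y _; rewrite lee_fin layer_nonneg.
Qed.

Lemma psi_ge0 g : (forall x, 0 <= g x) -> 0 <= psi g.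
Proof. by move=> g0; apply: fine_ge0; apply: integral_ge0 => y _; rewrite lee_fin layer_nonneg. Qed.

Lemma layer_int_le g1 g2 : measurable_fun setT g1 -> measurable_fun setT g2 -> (forall x, 0 <= g1 x) ->
  (forall x, g1 x <= g2 x) -> (layer_int g1 <= layer_int g2)%E.
Proof.
move=> m1 m2 g10 g12; apply: ge0_le_integral => //.
- by move=> y _; rewrite lee_fin layer_nonneg.
- by apply/measurable_EFinP; exact: measurable_layer.
- by apply/measurable_EFinP; exact: measurable_layer.
- by move=> y _; rewrite lee_fin ler_wpM2r// (kernel_nneg HK).
Qed.

Lemma layer_sub g1 g2 : layer_fun g2 -> measurable_fun setT g1 -> (forall x, 0 <= g1 x) ->
  (forall x, g1 x <= g2 x) -> layer_fun g1.
Proof.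
move=> [m2 g20 f2] m1 g10 g12; split => //.
by apply: le_lt_trans f2; exact: layer_int_le.
Qed.

Lemma psi_le g1 g2 : layer_fun g1 -> layer_fun g2 -> (forall x, g1 x <= g2 x) -> psi g1 <= psi g2.
Proof.
move=> L1 L2 g12; rewrite -lee_fin -!layer_fin//.
by case: L1 L2 => m1 g10 _ [m2 _ _]; exact: layer_int_le.
Qed.

Lemma layer_add g1 g2 : layer_fun g1 -> layer_fun g2 ->
  layer_fun (fun x => g1 x + g2 x) /\ psi (fun x => g1 x + g2 x) = psi g1 + psi g2.
Proof.
move=> L1 L2; have F1 := layer_fin L1; have F2 := layer_fin L2.
case: L1 L2 => m1 g10 f1 [m2 g20 f2].
have E : layer_int (fun x => g1 x + g2 x) = (layer_int g1 + layer_int g2)%E.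
  rewrite /layer_int; under eq_integral do rewrite mulrDl EFinD.
  rewrite ge0_integralD//.
  - by move=> y _; rewrite lee_fin layer_nonneg.
  - by apply/measurable_EFinP; exact: measurable_layer.
  - by move=> y _; rewrite lee_fin layer_nonneg.
  - by apply/measurable_EFinP; exact: measurable_layer.
split; last by rewrite /psi E F1 F2.
split; [exact: measurable_funD|by move=> x; rewrite addr_ge0|by rewrite E F1 F2 -EFinD ltry].
Qed.

Lemma layer_scale (c : R) g : 0 <= c -> layer_fun g ->
  layer_fun (fun x => c * g x) /\ psi (fun x => c * g x) = c * psi g.
Proof.
move=> c0 L; have F := layer_fin L; case: L => mg g0 fg.
have E : layer_int (fun x => c * g x) = (c%:E * layer_int g)%E.
  rewrite /layer_int; under eq_integral do rewrite -mulrA EFinM.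
  rewrite ge0_integralZl//.
  - by apply/measurable_EFinP; exact: measurable_layer.
  - by move=> y _; rewrite lee_fin layer_nonneg.
split; last by rewrite /psi E F.
split; [by apply: measurable_funM|by move=> x; rewrite mulr_ge0|by rewrite E F -EFinM ltry].
Qed.

Lemma layer_dilate (c : R) g : 0 < c -> layer_fun g ->
  layer_fun (fun x => g (c * x)) /\ psi (fun x => g (c * x)) = c `^ (2 * s) * psi g.
Proof.
move=> c0 L; have F := layer_fin L; case: L => mg g0 fg.
have mgc : measurable_fun setT (fun x => g (c * x)).
  by apply: (measurableT_comp mg); apply: measurable_funM.
have E : layer_int (fun x => g (c * x)) = ((c `^ (2 * s))%:E * layer_int g)%E.
  have kc y : k y = c `^ (n%:R + 2 * s) * k (c *: y) by rewrite -[in LHS](hk c0).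
  rewrite /layer_int.
  under eq_integral do rewrite kc mulrCA -edotZl EFinM.
  rewrite ge0_integralZl//; last 3 first.
  - apply/measurable_EFinP.
    have := measurableT_comp (measurable_layer mg) (@measurable_affine_rV R n c 0).
    by apply: eq_measurable_fun => y _ /=; rewrite addr0.
  - by move=> y _; rewrite lee_fin layer_nonneg.
  - by rewrite lee_fin powR_ge0.
  rewrite (ge0_integral_scale (f := fun y => (g (edot y nu) * k y)%:E) c0); last 2 first.
  - by apply/measurable_EFinP; exact: measurable_layer.
  - by move=> y; rewrite lee_fin layer_nonneg.
  rewrite muleA -EFinM; congr (_%:E * _)%E.
  rewrite powR_add// powR_mulrn ?(ltW c0)// mulrAC -exprMn divff ?gt_eqF// expr1n mul1r.
  by [].
split; last by rewrite /psi E F.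
split => //; by rewrite E F -EFinM ltry.
Qed.

Let N : R := n.+1%:R.

Lemma edot_bound y : `|edot y nu| <= N * `|y|.
Proof.
have nuN : `|nu| <= 1 by apply: le_trans (norm_le_enorm _) _; rewrite /enorm nu1 sqrtr1.
apply: le_trans (ler_norm_sum _ _ _) _.
apply: (@le_trans _ _ (\sum_(i < n) `|y|)).
  apply: ler_sum => i _; rewrite normrM -[leRHS]mulr1; apply: ler_pM => //; first exact: coord_le_norm.
  by apply: le_trans (coord_le_norm _ _) nuN.
by rewrite sumr_const card_ord -[leLHS]mulr_natl ler_wpM2r// ler_nat.
Qed.

Lemma layer_of_sdbound g (C : R) : measurable_fun setT g -> (forall x, 0 <= g x) -> 0 <= C ->
  (forall y, g (edot y nu) <= C * sdbound gam y) -> layer_fun g.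
Proof.
move=> mg g0 C0 Hg; split => //.
have [C1 _ HC1] := @kernel_sdbound R n s gam m (ks_s0 HK) (ks_s1 HK) (ks_gam0 HK) (ks_gam2 HK) (ks_m0 HK).
apply: (@le_lt_trans _ _ (\int[mu]_y (C%:E * (sdbound gam y * k y)%:E))%E).
  apply: ge0_le_integral => //.
  - by move=> y _; rewrite lee_fin layer_nonneg.
  - by apply/measurable_EFinP; exact: measurable_layer.
  - apply/measurable_EFinP; apply: measurable_funM => //; apply: measurable_funM; first exact: measurable_sdbound.
    exact: (sk_meas (ks_kernel HK)).
  - by move=> y _; rewrite -EFinM lee_fin mulrA ler_wpM2r// (kernel_nneg HK).
rewrite ge0_integralZl//.
- apply: (@le_lt_trans _ _ (C%:E * C1%:E)%E); last by rewrite -EFinM ltry.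
  by rewrite lee_wpmul2l ?lee_fin//; exact: (HC1 l).
- apply/measurable_EFinP; apply: measurable_funM; first exact: measurable_sdbound.
  exact: (sk_meas (ks_kernel HK)).
- by move=> y _; rewrite lee_fin mulr_ge0 ?sdbound_ge0// (kernel_nneg HK).
Qed.

Definition above (a : R) g (x : R) : R := (a < x)%R%:R * g x.

Lemma measurable_above_fun (a : R) g : measurable_fun setT g -> measurable_fun setT (above a g).
Proof. by move=> mg; apply: measurable_funM => //; exact: measurable_above. Qed.

Lemma above_ge0 (a : R) g : 0 <= a -> (forall x, 0 < x -> 0 <= g x) -> forall x, 0 <= above a g x.
Proof.
move=> a0 g0 x; rewrite /above; case: ltP => [ax|_]; last by rewrite mul0r.
by rewrite mul1r g0// (le_lt_trans a0).
Qed.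

Lemma layer_tail1 : layer_fun (above 1 (fun x => x `^ s)).
Proof.
have N1 : 1 <= N by rewrite ler1n.
have N0 : 0 < N by rewrite ltr0n.
have s0 := ltW (ks_s0 HK).
apply: (@layer_of_sdbound _ (N ^+ 2 * N `^ s)).
- by apply: measurable_above_fun; exact: measurable_powR.
- by apply: above_ge0 => // x _; rewrite powR_ge0.
- by rewrite mulr_ge0 ?sqr_ge0 ?powR_ge0.
move=> y; rewrite /above; case: ltP => [ty|_]; last first.
  by rewrite mul0r !mulr_ge0 ?sdbound_ge0 ?sqr_ge0 ?powR_ge0.
rewrite mul1r; have Ny : edot y nu <= N * `|y| by apply: le_trans (edot_bound y); exact: ler_norm.
have NN : 1 <= N ^+ 2 by rewrite -[1](expr1n _ 2) lerXn2r ?nnegrE// ltW.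
have tpow : edot y nu `^ s <= (N * `|y|) `^ s.
  by apply: powR_le => //; rewrite ltW// (lt_trans ltr01).
apply: (le_trans tpow); rewrite /sdbound; have [y1|y1] := leP `|y| 1.
  have y2 : 1 <= N ^+ 2 * `|y| ^+ 2.
    by rewrite -exprMn -[1](expr1n _ 2) lerXn2r ?nnegrE ?mulr_ge0// ?(ltW N0)// ltW// (lt_le_trans ty).
  rewrite mulrAC; apply: (@le_trans _ _ (1 * N `^ s)); last by rewrite ler_wpM2r ?powR_ge0.
  by rewrite mul1r; apply: powR_le => //; [rewrite mulr_ge0// ltW|rewrite ler_piMr// ltW].
rewrite powRM ?(ltW N0)//; apply: ler_pM; rewrite ?powR_ge0//.
  by rewrite -[leLHS]mul1r ler_wpM2r ?powR_ge0.
by apply: ler_powR; [exact: ltW|exact: ltW].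
Qed.

Lemma layer_near1 : layer_fun (fun x => above 0 (fun x => x ^+ 2) x * (x <= 1)%R%:R).
Proof.
have N1 : 1 <= N by rewrite ler1n.
have mle : measurable_fun setT (fun x : R => (x <= 1)%R%:R : R).
  rewrite (_ : (fun _ => _) = (fun x => 1 - (1 < x)%R%:R)).
    by apply: measurable_funB => //; exact: measurable_above.
  by apply/funext => x; case: leP => _; rewrite ?subr0 ?subrr.
apply: (@layer_of_sdbound _ (N ^+ 2)).
- apply: measurable_funM => //; apply: measurable_above_fun; exact: measurable_funX.
- by move=> x; rewrite mulr_ge0//; apply: above_ge0 => // ? _; exact: sqr_ge0.
- exact: sqr_ge0.
move=> y; rewrite /above.
have R0 : 0 <= N ^+ 2 * sdbound gam y by rewrite mulr_ge0 ?sqr_ge0 ?sdbound_ge0.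
case: ltP => [ty|_]; last by rewrite !mul0r.
have [t1|_] := leP (edot y nu) 1; last by rewrite mulr0.
rewrite mul1r mulr1 /sdbound; have [y1|y1] := leP `|y| 1.
  rewrite -exprMn lerXn2r ?nnegrE ?mulr_ge0// ?(ltW ty)//.
  by apply: le_trans (edot_bound y); exact: ler_norm.
apply: (@le_trans _ _ 1); first by rewrite -[leRHS](expr1n _ 2) lerXn2r ?nnegrE// ltW.
rewrite -[leLHS]mulr1; apply: ler_pM => //.
  by rewrite -[leLHS](expr1n _ 2) lerXn2r ?nnegrE.
by rewrite -(powRr0 `|y|); apply: ler_powR; [exact: ltW|exact: ltW (ks_gam0 HK)].
Qed.


Lemma powR_invl (a q : R) : 0 < a -> a^-1 `^ q = a `^ (- q).
Proof.
move=> a0; rewrite powRN; apply: (@mulIf _ (a `^ q)); first by rewrite gt_eqF// powR_gt0.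
by rewrite -powRM ?invr_ge0 ?(ltW a0)// !mulVf ?powR_one// gt_eqF// powR_gt0.
Qed.

Lemma layer_above (a C : R) g : 0 < a -> 0 <= C -> measurable_fun setT g ->
  (forall x, a < x -> 0 <= g x) -> (forall x, a < x -> g x <= C * x `^ s) -> layer_fun (above a g).
Proof.
move=> a0 C0 mg g0 gC.
have ia : 0 < a^-1 by rewrite invr_gt0.
have [L1 _] := layer_dilate ia layer_tail1.
have Ca : 0 <= C * a `^ s by rewrite mulr_ge0// powR_ge0.
have [L2 _] := layer_scale Ca L1.
apply: (layer_sub L2); first exact: measurable_above_fun.
  by move=> x; rewrite /above; case: ltP => ax; rewrite ?mul0r// mul1r g0.
move=> x; rewrite /above ltr_pdivlMl// mulr1; case: ltP => ax; rewrite ?mul0r ?mulr0// !mul1r.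
apply: le_trans (gC x ax) _; have x0 : 0 < x by apply: lt_trans ax.
by rewrite (powRM s (ltW ia) (ltW x0)) powR_invl// powRN mulrA mulfK ?gt_eqF// powR_gt0.
Qed.

Definition psi_above g (a : R) : R := psi (above a g).

Definition K0 : R := psi_above (fun=> 1) 1.

Lemma layer_tail (a : R) : 0 < a -> layer_fun (above a (fun=> 1)).
Proof.
move=> a0; have as0 : 0 < a `^ s by rewrite powR_gt0.
apply: (@layer_above _ (a `^ s)^-1) => //; first by rewrite invr_ge0 ltW.
move=> x ax; rewrite ler_pdivlMl// mulr1; apply: powR_le; rewrite ?(ltW (ks_s0 HK)) ?(ltW a0)//.
exact: ltW.
Qed.

Lemma K0_ge0 : 0 <= K0.
Proof. by apply: psi_ge0; apply: above_ge0. Qed.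

Lemma cut_tail (a : R) : 0 < a -> psi_above (fun=> 1) a = K0 * a `^ (- (2 * s)).
Proof.
move=> a0; have ia : 0 < a^-1 by rewrite invr_gt0.
have [_] := layer_dilate ia (layer_tail ltr01).
rewrite powR_invl// mulrC => <-; rewrite /psi_above; congr psi; apply/funext => x.
by rewrite /above ltr_pdivlMl// !mulr1.
Qed.

(** A mean value bound for Stieltjes integrals: on []a, b]] the nondecreasing [g] lies between [g a]
    and [g b]. Moving the subtracted terms to the other side leaves sums of nonnegative functions,
    which are compared pointwise. *)
Lemma cut_sandwich g (a b : R) : 0 < a -> a <= b -> layer_fun (above a g) -> layer_fun (above b g) ->
  (forall x, 0 < x -> 0 <= g x) -> (forall x y, 0 < x -> x <= y -> g x <= g y) ->
  g a * (psi_above (fun=> 1) a - psi_above (fun=> 1) b) <= psi_above g a - psi_above g b /\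
  psi_above g a - psi_above g b <= g b * (psi_above (fun=> 1) a - psi_above (fun=> 1) b).
Proof.
move=> a0 ab La Lb g0 gm; have b0 : 0 < b by apply: lt_le_trans ab.
have [Ta Ea] := layer_scale (g0 a a0) (layer_tail a0).
have [Tb Eb] := layer_scale (g0 a a0) (layer_tail b0).
have [Sa Fa] := layer_scale (g0 b b0) (layer_tail a0).
have [Sb Fb] := layer_scale (g0 b b0) (layer_tail b0).
rewrite /psi_above !mulrBr; split.
  have [L1 E1] := layer_add Ta Lb; have [L2 E2] := layer_add La Tb.
  suff : psi (fun x => g a * above a (fun=> 1) x + above b g x) <= psi (fun x => above a g x + g a * above b (fun=> 1) x).
    by rewrite E1 E2 Ea Eb; lra.
  apply: psi_le => // x; rewrite /above.
  case: (ltP a x) => ax; case: (ltP b x) => bx; rewrite ?mul0r ?mul1r ?mulr0 ?mulr1 ?addr0 ?add0r//.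
  - by rewrite addrC.
  - by apply: gm => //; exact: ltW.
  - by have := lt_le_trans bx (le_trans ax ab); rewrite ltxx.
have [L1 E1] := layer_add Sa Lb; have [L2 E2] := layer_add La Sb.
suff : psi (fun x => above a g x + g b * above b (fun=> 1) x) <= psi (fun x => g b * above a (fun=> 1) x + above b g x).
  by rewrite E1 E2 Fa Fb; lra.
apply: psi_le => // x; rewrite /above.
case: (ltP a x) => ax; case: (ltP b x) => bx; rewrite ?mul0r ?mul1r ?mulr0 ?mulr1 ?addr0 ?add0r//.
- by rewrite addrC.
- by apply: gm => //; exact: lt_trans ax.
- by have := lt_le_trans bx (le_trans ax ab); rewrite ltxx.
Qed.

(** The loss of [t_+^s] on moving left from [t = 1] by [x]; [rise_profile] is its gain on moving
    right. *)
Definition drop_profile (x : R) : R := 1 - (Num.max (1 - x) 0) `^ s.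
Definition rise_profile (x : R) : R := (1 + x) `^ s - 1.

Let s0 := ks_s0 HK.
Let s1 := ks_s1 HK.

Lemma measurable_drop : measurable_fun setT drop_profile.
Proof.
apply: measurable_funB => //; apply: (measurableT_comp (measurable_powR s)).
by apply: measurable_maxr => //; apply: measurable_funB.
Qed.

Lemma measurable_rise : measurable_fun setT rise_profile.
Proof.
apply: measurable_funB => //; apply: (measurableT_comp (measurable_powR s)).
by apply: measurable_funD.
Qed.

Lemma drop_ge0 x : 0 < x -> 0 <= drop_profile x.
Proof.
move=> x0; rewrite subr_ge0 -[leRHS](@powR_one R s); apply: powR_le; first exact: ltW.
  by rewrite le_max lexx orbT.
by rewrite ge_max ler01 andbT gerBl ltW.
Qed.

Lemma drop_le1 x : drop_profile x <= 1.
Proof. by rewrite gerBl powR_ge0. Qed.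

Lemma drop_mono x y : 0 < x -> x <= y -> drop_profile x <= drop_profile y.
Proof.
move=> x0 xy; rewrite lerB//; apply: powR_le; first exact: ltW.
  by rewrite le_max lexx orbT.
rewrite ge_max !le_max lexx orbT andbT; apply/orP; left; lra.
Qed.

Lemma rise_ge0 x : 0 < x -> 0 <= rise_profile x.
Proof.
by move=> x0; rewrite subr_ge0 -[leLHS](@powR_one R s); apply: powR_le; rewrite ?(ltW s0)// lerDl ltW.
Qed.

Lemma rise_mono x y : 0 < x -> x <= y -> rise_profile x <= rise_profile y.
Proof.
by move=> x0 xy; rewrite lerD2r; apply: powR_le; [exact: ltW|rewrite addr_ge0// ltW|rewrite lerD2l].
Qed.

Lemma layer_drop (a : R) : 0 < a -> layer_fun (above a drop_profile).
Proof.
move=> a0; apply: (layer_sub (layer_tail a0)).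
- exact: measurable_above_fun measurable_drop.
- by apply: above_ge0; [exact: ltW|exact: drop_ge0].
- by move=> x; rewrite /above ler_wpM2l// drop_le1.
Qed.

Lemma layer_rise (a : R) : 0 < a -> layer_fun (above a rise_profile).
Proof.
move=> a0; apply: (@layer_above _ ((1 + a^-1) `^ s)); rewrite ?powR_ge0//.
- exact: measurable_rise.
- by move=> x ax; apply: rise_ge0; exact: lt_trans ax.
move=> x ax; have x0 : 0 < x by apply: lt_trans ax.
have ia : 0 <= 1 + a^-1 by rewrite addr_ge0// invr_ge0 ltW.
rewrite -powRM ?(ltW x0)//; apply: (@le_trans _ _ ((1 + x) `^ s)); first by rewrite gerBl.
apply: powR_le; rewrite ?(ltW s0)//; first by rewrite addr_ge0// ltW.
by rewrite mulrDl mul1r addrC lerD2l ler_pdivlMl// mulr1 ltW.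
Qed.

Lemma drop_inside e : e <= 1 -> drop_profile e = 1 - (1 - e) `^ s.
Proof. by move=> e1; rewrite /drop_profile (max_idPl _)// subr_ge0. Qed.

Lemma rise_reflected e : 0 < e -> e < 1 -> rise_profile (e / (1 - e)) = ((1 - e) `^ s)^-1 - 1.
Proof.
move=> e0 e1; have e1' : 0 < 1 - e by rewrite subr_gt0.
rewrite /rise_profile (_ : 1 + e / (1 - e) = (1 - e)^-1); last by field; rewrite gt_eqF.
by rewrite powR_invl// powRN.
Qed.

Lemma tail_reflected e : 0 < e -> e < 1 ->
  (e / (1 - e)) `^ (- (2 * s)) = e `^ (- (2 * s)) * ((1 - e) `^ s) ^+ 2.
Proof.
move=> e0 e1; have e1' : 0 < 1 - e by rewrite subr_gt0.
have e2 : 0 < e / (1 - e) by rewrite divr_gt0.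
rewrite !powR_opp_double// powRM ?invr_ge0 ?(ltW e0) ?(ltW e1')// powR_invl// powRN.
by field; rewrite !gt_eqF// powR_gt0.
Qed.

(* Up to sign the value at [t = 1] of the operator applied to [t_+^s], computed outside the window
   [1 - e < z < 1 / (1 - e)], which is symmetric under the inversion [z -> 1 / z]. *)
Definition balance (e : R) : R := psi_above drop_profile e - psi_above rise_profile (e / (1 - e)).

Definition balance_defect (e : R) : R :=
  balance e - (1 - (1 - e) `^ s) ^+ 2 * (K0 * e `^ (- (2 * s))).

(** Between two cut-offs [cut_sandwich] encloses the increments of both integrals, the tail at the
    inverted cut-off being given by [tail_reflected]. By [stieltjes_cell] they match the increment
    of the closed form up to the square of the step, so nothing is left after summation. *)
Lemma balance_defect_const (a b : R) : 0 < a -> a <= b -> b < 1 -> balance_defect a = balance_defect b.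
Proof.
move=> a0 ab b1; have b0 : 0 < b by apply: lt_le_trans ab.
have K00 := K0_ge0.
pose LZ := s * (1 - b) `^ (s - 1).
pose X := a `^ s; have X0 : 0 < X by rewrite powR_gt0.
pose LA := 2 * K0 * (s * a `^ (s - 1)) / X ^+ 4.
pose Zb := (1 - b) `^ s; have Zb0 : 0 < Zb by rewrite powR_gt0// subr_gt0.
have LZ0 : 0 <= LZ by rewrite mulr_ge0 ?powR_ge0// ltW.
have LA0 : 0 <= LA by rewrite divr_ge0 ?exprn_ge0 ?(ltW X0)// !mulr_ge0 ?powR_ge0// ltW.
have TA x : 0 < x -> K0 * x `^ (- (2 * s)) = K0 / (x `^ s) ^+ 2 by move=> x0; rewrite powR_opp_double.
pose C := LZ * LA + LZ ^+ 2 * (K0 / X ^+ 2) / Zb.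
have KX0 : 0 <= K0 / X ^+ 2 by rewrite divr_ge0 ?sqr_ge0.
have C0 : 0 <= C by apply: addr_ge0 (mulr_ge0 LZ0 LA0) (divr_ge0 (mulr_ge0 (sqr_ge0 _) KX0) (ltW Zb0)).
apply: (quadratic_increments_const ab C0) => x y ax xy yb.
have x0 : 0 < x by apply: lt_le_trans ax.
have y0 : 0 < y by apply: lt_le_trans xy.
have y1 : y < 1 by apply: le_lt_trans b1.
have x1 : x < 1 by apply: le_lt_trans y1.
have x1' : 0 < 1 - x by rewrite subr_gt0.
have y1' : 0 < 1 - y by rewrite subr_gt0.
have b1' : 0 < 1 - b by rewrite subr_gt0.
have xyr : x / (1 - x) <= y / (1 - y).
  apply: ler_pM => //; [exact: ltW|by rewrite invr_ge0 ltW|by rewrite lef_pV2 ?posrE// lerD2l lerN2].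
have xr0 : 0 < x / (1 - x) by rewrite divr_gt0.
have yr0 : 0 < y / (1 - y) by rewrite divr_gt0.
have [D1 D2] := cut_sandwich x0 xy (layer_drop x0) (layer_drop y0) drop_ge0 drop_mono.
have [E1 E2] := cut_sandwich xr0 xyr (layer_rise xr0) (layer_rise yr0) rise_ge0 rise_mono.
rewrite !cut_tail// !drop_inside ?(ltW x1) ?(ltW y1)// in D1 D2.
rewrite !cut_tail// !tail_reflected// !rise_reflected// !(mulrA K0) in E1 E2.
have Zx0 : 0 < (1 - x) `^ s by rewrite powR_gt0.
have Zy0 : 0 < (1 - y) `^ s by rewrite powR_gt0.
have ZZ : (1 - y) `^ s <= (1 - x) `^ s.
  by apply: powR_le; rewrite ?(ltW s0) ?(ltW y1')// lerD2l lerN2.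
have Ay0 : 0 <= K0 * y `^ (- (2 * s)) by rewrite mulr_ge0 ?powR_ge0.
have AA : K0 * y `^ (- (2 * s)) <= K0 * x `^ (- (2 * s)).
  by rewrite ler_wpM2l//; apply: powR_anti => //; rewrite oppr_le0 mulr_ge0// ltW.
have := stieltjes_cell Zy0 ZZ Ay0 AA D1 D2 E1 E2.
rewrite /balance_defect /balance => cell.
rewrite [X in `|X|](_ : _ = psi_above drop_profile x - psi_above drop_profile y -
  (psi_above rise_profile (x / (1 - x)) - psi_above rise_profile (y / (1 - y))) -
  ((1 - (1 - x) `^ s) ^+ 2 * (K0 * x `^ (- (2 * s))) - (1 - (1 - y) `^ s) ^+ 2 * (K0 * y `^ (- (2 * s))))); last by ring.
apply: (le_trans cell).
have yx0 : 0 <= y - x by rewrite subr_ge0.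
have zL : (1 - x) `^ s - (1 - y) `^ s <= LZ * (y - x).
  have := @powR_lip_ge R s (1 - b) (1 - y) (1 - x) s0 s1 b1'.
  by rewrite (_ : 1 - x - (1 - y) = y - x); [apply; rewrite lerD2l lerN2|ring].
have aL : K0 * x `^ (- (2 * s)) - K0 * y `^ (- (2 * s)) <= LA * (y - x).
  rewrite !TA//; have Xx : X <= x `^ s by apply: powR_le; rewrite ?(ltW s0) ?(ltW a0).
  have xY : x `^ s <= y `^ s by apply: powR_le; rewrite ?(ltW s0) ?(ltW x0).
  have Y1 : y `^ s <= 1 by rewrite -(@powR_one R s); apply: powR_le; rewrite ?(ltW s0) ?(ltW y0) ?(ltW y1).
  have lip := @powR_lip_ge R s a x y s0 s1 a0 ax xy.
  move: (x `^ s) (y `^ s) Xx xY Y1 lip => p q Xp pq q1 lip.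
  have p0 : 0 < p by apply: lt_le_trans Xp.
  have q0 : 0 < q by apply: lt_le_trans pq.
  have -> : K0 / p ^+ 2 - K0 / q ^+ 2 = (K0 * (q + p) * (q - p)) / (p ^+ 2 * q ^+ 2).
    by field; rewrite !gt_eqF.
  have XX : X ^+ 4 <= p ^+ 2 * q ^+ 2.
    rewrite (_ : X ^+ 4 = X ^+ 2 * X ^+ 2); last by rewrite -exprD.
    by apply: ler_pM; rewrite ?sqr_ge0// lerXn2r ?nnegrE ?(ltW X0) ?(ltW p0) ?(ltW q0)// (le_trans Xp).
  apply: (@le_trans _ _ (2 * K0 * (s * a `^ (s - 1) * (y - x)) / X ^+ 4)); last first.
    by rewrite /LA le_eqVlt; apply/orP; left; apply/eqP; ring.
  apply: ler_pM.
  - by apply: mulr_ge0 (mulr_ge0 K00 (addr_ge0 (ltW q0) (ltW p0))) _; rewrite subr_ge0.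
  - by rewrite invr_ge0 mulr_ge0 ?sqr_ge0.
  - apply: ler_pM => //; first exact: mulr_ge0 K00 (addr_ge0 (ltW q0) (ltW p0)).
      by rewrite subr_ge0.
    by rewrite mulrC ler_wpM2r//; exact: (lerD q1 (le_trans pq q1)).
  - by rewrite lef_pV2 ?posrE ?exprn_gt0// mulr_gt0// exprn_gt0.
have dz0 : 0 <= (1 - x) `^ s - (1 - y) `^ s by rewrite subr_ge0.
have da0 : 0 <= K0 * x `^ (- (2 * s)) - K0 * y `^ (- (2 * s)) by rewrite subr_ge0.
have -> : C * (y - x) ^+ 2 = (LZ * (y - x)) * (LA * (y - x)) + (LZ * (y - x)) ^+ 2 * (K0 / X ^+ 2) / Zb.
  by rewrite /C; field; rewrite !gt_eqF.
apply: lerD; first exact: ler_pM.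
apply: ler_pM.
- by rewrite mulr_ge0 ?sqr_ge0// mulr_ge0 ?powR_ge0.
- by rewrite invr_ge0 ltW.
- apply: ler_pM; rewrite ?sqr_ge0//; first by rewrite mulr_ge0 ?powR_ge0.
    by rewrite lerXn2r ?nnegrE// mulr_ge0.
  rewrite TA// ler_wpM2l// lef_pV2 ?posrE ?exprn_gt0 ?powR_gt0//.
  by rewrite lerXn2r ?nnegrE ?powR_ge0 ?(ltW X0)//; apply: powR_le; rewrite ?(ltW s0) ?(ltW a0).
- by rewrite lef_pV2 ?posrE//; apply: powR_le; rewrite ?(ltW s0) ?(ltW b1')// lerD2l lerN2.
Qed.


Lemma rise_cut_le (b : R) : 1 <= b -> psi_above rise_profile b <= 2 * psi_above (fun x => x `^ s) 1 * b `^ (- s).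
Proof.
move=> b1; have b0 : 0 < b by apply: lt_le_trans b1.
have ib : 0 < b^-1 by rewrite invr_gt0.
have bs0 : 0 <= 2 * b `^ s by rewrite mulr_ge0 ?powR_ge0.
have [L1 E1] := layer_dilate ib layer_tail1.
have [L2 E2] := layer_scale bs0 L1.
have : psi_above rise_profile b <= psi (fun x => 2 * b `^ s * above 1 (fun x => x `^ s) (b^-1 * x)).
  apply: psi_le => //; first exact: layer_rise.
  move=> x; rewrite /above ltr_pdivlMl// mulr1; case: ltP => bx; rewrite ?mul0r ?mulr0// !mul1r.
  have x1 : 1 <= x by apply: le_trans (ltW bx).
  have x0 : 0 <= x by apply: le_trans x1.
  rewrite (powRM s (ltW ib) x0) powR_invl// powRN -mulrA mulVKf ?gt_eqF ?powR_gt0//.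
  apply: (@le_trans _ _ ((2 * x) `^ s)).
    apply: (@le_trans _ _ ((1 + x) `^ s)); first by rewrite gerBl.
    by apply: powR_le; rewrite ?(ltW s0) ?addr_ge0// mulr_natl mulr2n lerD2r.
  rewrite powRM// ler_wpM2r ?powR_ge0//.
  by rewrite -[leRHS]powRr1//; apply: ler_powR; [rewrite ler1n|exact: ltW].
move/le_trans; apply; rewrite E2 E1 powR_invl// (_ : - (2 * s) = - s + - s) ?powR_add//; last by ring.
rewrite /psi_above -!mulrA ler_wpM2l// mulrA -powR_add// subrr powRr0 mul1r mulrC.
by [].
Qed.

Lemma balance_defect_near1 : exists2 C : R, 0 <= C & forall b, 2^-1 <= b -> b < 1 ->
  `|balance_defect b| <= C * (1 - b) `^ s.
Proof.
have K00 := K0_ge0.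
have K10 : 0 <= psi_above (fun x => x `^ s) 1 by apply: psi_ge0; apply: above_ge0 => // x _; exact: powR_ge0.
exists (8 * K0 + 4 * psi_above (fun x => x `^ s) 1); first by rewrite addr_ge0 ?mulr_ge0.
move=> b b2 b1; have b0 : 0 < b by apply: lt_le_trans b2.
have b1' : 0 < 1 - b by rewrite subr_gt0.
have I1 : K0 <= psi_above drop_profile b.
  apply: psi_le; [exact: layer_tail|exact: layer_drop|] => x; rewrite /above.
  case: (ltP 1 x) => x1; last first.
    by rewrite mul0r; apply: (above_ge0 (ltW b0)) => //; exact: drop_ge0.
  rewrite (lt_trans b1 x1) !mul1r /drop_profile (max_idPr _); last by rewrite subr_le0 ltW.
  by rewrite powR0 ?subr0// gt_eqF.
have I2 : psi_above drop_profile b <= K0 * b `^ (- (2 * s)).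
  rewrite -cut_tail//; apply: psi_le; [exact: layer_drop|exact: layer_tail|].
  by move=> x; rewrite /above ler_wpM2l// drop_le1.
have bb1 : 1 <= b / (1 - b) by rewrite ler_pdivlMr//; lra.
have J := rise_cut_le bb1.
have J0 : 0 <= psi_above rise_profile (b / (1 - b)).
  by apply: psi_ge0; apply: above_ge0; [rewrite divr_ge0// ltW|exact: rise_ge0].
rewrite /balance_defect /balance.
have bs : b <= b `^ s.
  by rewrite -[leLHS]powRr1 ?(ltW b0)//; apply: powR_antitone_exp => //; rewrite ?ltW.
have Zb : 1 - b <= (1 - b) `^ s.
  by rewrite -[leLHS]powRr1 ?(ltW b1')//; apply: powR_antitone_exp; rewrite ?(ltW b1') ?(ltW s1)// gerBl ltW.
have Z1 : (1 - b) `^ s <= 1.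
  by rewrite -[leRHS](@powR_one R s); apply: powR_le; rewrite ?(ltW s0) ?(ltW b1')// gerBl ltW.
have Z0 : 0 <= (1 - b) `^ s by exact: powR_ge0.
have J' : psi_above rise_profile (b / (1 - b)) <= 4 * psi_above (fun x => x `^ s) 1 * (1 - b) `^ s.
  apply: (le_trans J).
  have -> : (b / (1 - b)) `^ (- s) = (1 - b) `^ s / b `^ s.
    rewrite powRN powRM ?invr_ge0 ?(ltW b0) ?(ltW b1')// powR_invl// powRN invfM invrK mulrC.
    by [].
  rewrite mulrA ler_pdivrMr ?powR_gt0//.
  have w2 : 0 <= 2 * b `^ s - 1 by rewrite subr_ge0 -ler_pdivrMl// mulr1; exact: le_trans bs.
  have := mulr_ge0 (mulr_ge0 K10 Z0) w2; lra.
have Xb1 : b `^ s <= 1 by rewrite -[leRHS](@powR_one R s); apply: powR_le; rewrite ?(ltW s0) ?(ltW b0) ?(ltW b1).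
rewrite powR_opp_double// in I2 *.
exact: (balance_defect_bound K00 b2 b1 bs Zb Z1 Z0 I1 I2 J0 J').
Qed.


(** The defect is constant in [e] and tends to 0 as [e] tends to 1. The closed form is of order
    [e^(2 - 2 s)] for small [e], which is why the operator vanishes on [t_+^s] in the limit. *)
Lemma balance_value (e : R) : 0 < e -> e < 1 ->
  balance e = (1 - (1 - e) `^ s) ^+ 2 * (K0 * e `^ (- (2 * s))).
Proof.
move=> e0 e1; apply/eqP; rewrite -subr_eq0 -/(balance_defect e).
rewrite -[_ == 0]normr_eq0; apply: contraT => nz.
have p : 0 < `|balance_defect e| by rewrite lt_def nz normr_ge0.
have [C C0 HC] := balance_defect_near1.
have [r [r1 r2] Hr] := powR_decay (Num.max 2 (1 - e)^-1) C0 p s0.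
move: r1; rewrite ge_max => /andP[r1 r3]; have r0 : 0 < r by apply: lt_le_trans r2.
have ri : 0 < r^-1 by rewrite invr_gt0.
have e1' : 0 < 1 - e by rewrite subr_gt0.
have h1 : 2^-1 <= 1 - r^-1.
  have : r^-1 <= 2^-1 by rewrite lef_pV2 ?posrE.
  by lra.
have h2 : e <= 1 - r^-1.
  have : r^-1 <= 1 - e by rewrite -[leRHS]invrK lef_pV2 ?posrE// invr_gt0.
  by lra.
have h3 : 1 - r^-1 < 1 by rewrite gtrBl.
have := HC _ h1 h3; rewrite -(balance_defect_const e0 h2 h3) opprB addrC subrK powR_invl//.
by rewrite leNgt Hr.
Qed.

(** Passing from the window symmetric under inversion to the window of half-width [d] about 1 adds
    the rise between [d] and [d / (1 - d)], again of order [d^(2 - 2 s)]. *)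
Lemma cut_difference (d : R) : 0 < d -> d <= 2^-1 ->
  `|psi_above drop_profile d - psi_above rise_profile d| <= 4 * K0 * d `^ (2 - 2 * s).
Proof.
move=> d0 d2; have K00 := K0_ge0.
have d1 : d < 1 by apply: le_lt_trans d2 _; rewrite invf_lt1// ltr1n.
have d1' : 0 < 1 - d by rewrite subr_gt0.
have r0 : 0 < d / (1 - d) by rewrite divr_gt0.
have dr : d <= d / (1 - d) by rewrite ler_pdivlMr// ler_piMr// ?(ltW d0)// gerBl ltW.
have [E1 E2] := cut_sandwich d0 dr (layer_rise d0) (layer_rise r0) rise_ge0 rise_mono.
have B := balance_value d0 d1; rewrite /balance in B.
rewrite !cut_tail// tail_reflected// rise_reflected// in E1 E2.
have Zd : 1 - d <= (1 - d) `^ s.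
  by rewrite -[leLHS]powRr1 ?(ltW d1')//; apply: powR_antitone_exp; rewrite ?(ltW d1') ?(ltW s1)// gerBl ltW.
have Z1 : (1 - d) `^ s <= 1.
  by rewrite -[leRHS](@powR_one R s); apply: powR_le; rewrite ?(ltW s0) ?(ltW d1')// gerBl ltW.
have A0 : 0 <= K0 * d `^ (- (2 * s)) by rewrite mulr_ge0 ?powR_ge0.
have Z2 : 2^-1 <= (1 - d) `^ s by apply: le_trans Zd; lra.
have Zp : 0 < (1 - d) `^ s by rewrite powR_gt0.
have dE : d `^ (2 - 2 * s) = d ^+ 2 * d `^ (- (2 * s)) by rewrite powR_add// powR2// ltW.
have L1 : 0 <= psi_above rise_profile d - psi_above rise_profile (d / (1 - d)).
  apply: le_trans E1; rewrite mulr_ge0 ?rise_ge0// subr_ge0 mulrA ler_piMr// expr2.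
  by rewrite -[leRHS]mul1r; apply: ler_pM; rewrite ?powR_ge0.
rewrite (mulrA K0) in E2.
have -> : 4 * K0 * d `^ (2 - 2 * s) = 4 * (d ^+ 2 * (K0 * d `^ (- (2 * s)))) by rewrite dE; ring.
exact: (cut_difference_bound A0 (ltW d0) Zp Zd Z1 Z2 B E2 L1).
Qed.

End Layers.

(** * The function [(x . nu)_+^s] *)

Section PositivePartPower.
Context {R : realType}.

Definition posp (s x : R) : R := (Num.max x 0) `^ s.

Lemma posp_ge0 s x : 0 <= posp s x.
Proof. exact: powR_ge0. Qed.

Lemma posp_pos s x : 0 <= x -> posp s x = x `^ s.
Proof. by move=> x0; rewrite /posp (max_idPl x0). Qed.

Lemma posp_neg s x : 0 < s -> x <= 0 -> posp s x = 0.
Proof. by move=> s0 x0; rewrite /posp (max_idPr x0) powR0// gt_eqF. Qed.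

Lemma powR_subadditive (s a b : R) : 0 < s -> s <= 1 -> 0 <= a -> 0 <= b ->
  (a + b) `^ s <= a `^ s + b `^ s.
Proof.
move=> s0 s1 a0 b0; have [ab0|abn] := eqVneq (a + b) 0.
  by rewrite ab0 powR0 ?gt_eqF// addr_ge0 ?powR_ge0.
have ab : 0 < a + b by rewrite lt_def abn addr_ge0.
have part c : 0 <= c -> c <= a + b -> c / (a + b) * (a + b) `^ s <= c `^ s.
  move=> c0 cab; have q0 : 0 <= c / (a + b) by rewrite divr_ge0// ltW.
  rewrite -{2}(divfK abn c) powRM ?(ltW ab)// ler_wpM2r ?powR_ge0//.
  by rewrite -[leLHS]powRr1//; apply: powR_antitone_exp => //; rewrite ler_pdivrMr// mul1r.
have h1 := part a a0; have h2 := part b b0.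
have -> : (a + b) `^ s = a / (a + b) * (a + b) `^ s + b / (a + b) * (a + b) `^ s.
  by rewrite -mulrDl -mulrDl divff// mul1r.
by apply: lerD; [apply: h1; rewrite lerDl|apply: h2; rewrite lerDr].
Qed.

Lemma posp_holder (s x y : R) : 0 < s -> s <= 1 -> `|posp s x - posp s y| <= `|x - y| `^ s.
Proof.
move=> s0 s1; wlog : x y / posp s y <= posp s x.
  move=> W; have [h|h] := leP (posp s y) (posp s x); first exact: W.
  by rewrite distrC [leRHS](_ : _ = `|y - x| `^ s); [apply: W; exact: ltW|rewrite distrC].
move=> h; rewrite ger0_norm ?subr_ge0// lerBlDr.
apply: le_trans (powR_subadditive s0 s1 (normr_ge0 _) (_ : 0 <= Num.max y 0)); last by rewrite le_max lexx orbT.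
apply: powR_le; [exact: ltW|by rewrite le_max lexx orbT|].
rewrite ge_max; apply/andP; split; last by rewrite addr_ge0// le_max lexx orbT.
apply: (@le_trans _ _ (`|x - y| + y)); last by rewrite lerD2l le_max lexx.
by rewrite -lerBlDr ler_norm.
Qed.

Lemma cont_posp (s : R) : 0 < s -> s <= 1 -> continuous (posp s).
Proof.
move=> s0 s1 x; apply/cvgrPdist_lt => e e0.
apply/nbhs_ballP; exists (e `^ s^-1); first by rewrite /= powR_gt0.
move=> y; rewrite /ball/= => xy; apply: le_lt_trans (posp_holder x y s0 s1) _.
have -> : e = (e `^ s^-1) `^ s by rewrite -powRrM mulVf ?gt_eqF// powRr1// ltW.
exact: powR_lt.
Qed.

End PositivePartPower.

Section HalfspacePower.
Context {R : realType} {n : nat}.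
Local Notation V := 'rV[R]_n.
Local Notation mu := (@lebn R n).
Implicit Types (z v : V) (g : R -> R).

Variables (s gam l m : R) (k : V -> R) (nu : V).
Hypotheses (HK : kernel_setting s gam l m k)
  (hk : forall c, 0 < c -> scaled_kernel s c k = k) (sgam : s < gam) (nu1 : edot nu nu = 1).

Definition halfspace_power (s : R) nu (x : V) : R := posp s (edot x nu).

Lemma layer_int_norm g : layer_fun k nu g -> (forall x, x <= 0 -> g x = 0) ->
  (\int[mu]_y (g `|edot y nu| * k y)%:E = (2 * psi k nu g)%:E)%E.
Proof.
move=> L gn; have F := layer_fin HK L; case: L => mg g0 _.
have E y : (g `|edot y nu| * k y)%:E = ((g (edot y nu) * k y)%:E + (g (edot (- y) nu) * k (- y))%:E)%E.
  rewrite -EFinD (sk_sym (ks_kernel HK)) -mulrDl; congr (_ * _)%:E.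
  rewrite edotNl; have [t0|t0] := leP 0 (edot y nu).
    by rewrite ger0_norm// [g (- _)]gn ?addr0// oppr_le0.
  by rewrite ltr0_norm// [g (edot _ _)]gn ?add0r// ltW.
have mG := measurable_layer nu HK mg.
under eq_integral do rewrite E.
rewrite ge0_integralD//; last 4 first.
- by move=> y _; rewrite lee_fin mulr_ge0// (kernel_nneg HK).
- exact/measurable_EFinP.
- by move=> y _; rewrite lee_fin mulr_ge0// (kernel_nneg HK).
- apply/measurable_EFinP; have := measurableT_comp mG (@measurable_affine_rV R n (-1) 0).
  by apply: eq_measurable_fun => y _ /=; rewrite addr0 scaleN1r.
rewrite (@integral_reflect R n (fun y => (g (edot y nu) * k y)%:E)); last exact/measurable_EFinP.
by rewrite -/(layer_int k nu g) F -EFinD; congr _%:E; ring.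
Qed.

Lemma measurable_norm_layer g : measurable_fun setT g ->
  measurable_fun setT ((fun y : V => g `|edot y nu| * k y) : V -> measurableTypeR R).
Proof.
move=> mg; apply: measurable_funM; last exact: (sk_meas (ks_kernel HK)).
apply: (measurableT_comp mg); apply: (measurableT_comp (@normr_measurable R setT)).
exact: measurable_edot.
Qed.

Definition outer (r : R) g : R := \int[mu]_(y in outside r) (g `|edot y nu| * k y).

Lemma outer_integrable (r : R) g : layer_fun k nu g -> (forall x, x <= 0 -> g x = 0) ->
  mu.-integrable (outside r) (fun y => (g `|edot y nu| * k y)%:E).
Proof.
move=> L gn; have E := layer_int_norm L gn; case: L => mg g0 _.
apply: (@integrableS _ _ _ mu setT) => //; first exact: measurable_outside.
apply/integrableP; split; first by apply/measurable_EFinP; exact: measurable_norm_layer.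
under eq_integral do rewrite gee0_abs ?lee_fin ?mulr_ge0 ?(kernel_nneg HK)//.
by rewrite E ltry.
Qed.

Lemma outer_le (r : R) g : layer_fun k nu g -> (forall x, x <= 0 -> g x = 0) -> outer r g <= 2 * psi k nu g.
Proof.
move=> L gn; have I := outer_integrable r L gn; have E := layer_int_norm L gn; case: L => mg g0 _.
rewrite -lee_fin /outer /Rintegral fineK; last exact: (integrable_fin_num (measurable_outside r) I).
rewrite -E; apply: ge0_subset_integral => //; first exact: measurable_outside.
  by apply/measurable_EFinP; exact: measurable_norm_layer.
by move=> y _; rewrite lee_fin mulr_ge0// (kernel_nneg HK).
Qed.

Lemma outer_eq (r d : R) g : layer_fun k nu g -> 0 <= d -> (forall x, x <= d -> g x = 0) ->
  (forall y : V, enorm y <= r -> `|edot y nu| <= d) -> outer r g = 2 * psi k nu g.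
Proof.
move=> L d0 gd rd; have gn x : x <= 0 -> g x = 0 by move=> x0; apply: gd; exact: le_trans d0.
have E := layer_int_norm L gn.
rewrite /outer /Rintegral (int_indic _ (measurable_outside r)).
have -> : (\int[mu]_y (g `|edot y nu| * k y * \1_(outside r) y)%:E = (2 * psi k nu g)%:E)%E; last by [].
rewrite -E; apply: eq_integral => y _; congr _%:E.
rewrite indicE; case: (boolP (y \in outside r)) => [|/negP yr]; first by rewrite mulr1.
rewrite mulr0 gd ?mul0r//; apply: rd; rewrite leNgt; apply/negP => h; apply: yr; by rewrite inE.
Qed.

Let s0 := ks_s0 HK.
Let s1 := ks_s1 HK.

Lemma profile_gap (x : R) : 0 <= x -> x <= 2^-1 ->
  0 <= drop_profile s x - rise_profile s x /\ drop_profile s x - rise_profile s x <= 2 * x ^+ 2.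
Proof.
move=> x0 x2; have x1 : x < 1 by apply: le_lt_trans x2 _; rewrite invf_lt1// ltr1n.
have a0 : 0 < 1 - x by rewrite subr_gt0.
have b0 : 0 <= 1 + x by rewrite addr_ge0.
rewrite drop_inside ?(ltW x1)// /rise_profile.
have t1 := powR_tangent s0 s1 b0 ltr01; have t2 := powR_tangent s0 s1 (ltW a0) ltr01.
rewrite !powR_one in t1 t2; split; first by lra.
have h1 : 1 - x <= (1 - x) `^ s.
  by rewrite -[leLHS]powRr1 ?(ltW a0)//; apply: powR_antitone_exp; rewrite ?(ltW a0) ?(ltW s1)// gerBl.
have h2 : 1 - x ^+ 2 <= (1 - x) `^ s * (1 + x) `^ s.
  have xx : 0 <= 1 - x ^+ 2 by rewrite subr_ge0 expr_le1// ltW.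
  rewrite -powRM ?(ltW a0)// (_ : (1 - x) * (1 + x) = 1 - x ^+ 2); last by ring.
  rewrite -[leLHS]powRr1//; apply: powR_antitone_exp; rewrite ?(ltW s1)// gerBl; exact: sqr_ge0.
have a2 : 2^-1 <= (1 - x) `^ s by apply: le_trans h1; lra.
have ap : 0 < (1 - x) `^ s by rewrite powR_gt0.
rewrite -(ler_pM2l ap).
move: ap a2 h2; move: ((1 - x) `^ s) ((1 + x) `^ s) => a b ap a2 h2.
have := sqr_ge0 (1 - a); have := mulr_ge0 (_ : 0 <= 2 * a - 1) (sqr_ge0 x).
rewrite !expr2 in h2 *; move=> h3; have {}h3 : 0 <= (2 * a - 1) * (x * x) by apply: h3; lra.
by lra.
Qed.

Lemma halfspace_power_gap (x y : V) : edot x nu = 1 ->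
  2 * halfspace_power s nu x - halfspace_power s nu (x + y) - halfspace_power s nu (x - y) =
  drop_profile s `|edot y nu| - rise_profile s `|edot y nu|.
Proof.
move=> x1; rewrite /halfspace_power !edotDl edotNl x1 [posp s 1]posp_pos// powR_one.
have key (t : R) : 0 <= t -> 2 * 1 - posp s (1 + t) - posp s (1 - t) = drop_profile s t - rise_profile s t.
  by move=> t0; rewrite posp_pos ?addr_ge0// /drop_profile /rise_profile -/(posp s (1 - t)); ring.
have [t0|t0] := leP 0 (edot y nu); first by rewrite ger0_norm// key.
rewrite ltr0_norm// -key; last by rewrite oppr_ge0 ltW.
by rewrite opprK; ring.
Qed.

Lemma cont_halfspace_power : continuous (halfspace_power s nu : V -> R).
Proof.
apply: (@cont_comp R _ _ (fun y : V => edot y nu) (posp s)); first exact: cont_edotl.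
by apply: cont_posp => //; exact: ltW.
Qed.

Lemma adm_halfspace_power : growth_adm gam (halfspace_power s nu : V -> R).
Proof.
apply: (@adm_of_cont _ _ gam _ (n.+1%:R `^ s)); first exact: cont_halfspace_power.
move=> x; rewrite ger0_norm ?posp_ge0//.
apply: (@le_trans _ _ ((n.+1%:R * (1 + `|x|)) `^ s)).
  apply: powR_le; [exact: ltW|by rewrite le_max lexx orbT|].
  rewrite ge_max; apply/andP; split; last by rewrite mulr_ge0// addr_ge0.
  apply: le_trans (ler_norm _) _; apply: le_trans (edot_bound nu1 x) _.
  by rewrite ler_wpM2l// lerDr.
rewrite powRM ?addr_ge0// ler_wpM2l ?powR_ge0//.
by apply: ler_powR; [rewrite lerDl|exact: ltW].
Qed.

(** Up to the factor 2 of [profile_gap], a majorant for the second differences of [(x . nu)_+^s] in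
    the slab [|y . nu| <= d]. *)
Definition near_layer (d x : R) : R := above 0 (fun x => x ^+ 2) x * (x <= d)%R%:R.

Lemma psi_near_layer (d : R) : 0 < d ->
  layer_fun k nu (near_layer d) /\ psi k nu (near_layer d) = psi k nu (near_layer 1) * d `^ (2 - 2 * s).
Proof.
move=> d0; have id0 : 0 < d^-1 by rewrite invr_gt0.
have [L1 E1] := layer_dilate HK hk id0 (layer_near1 HK nu1).
have [L2 E2] := layer_scale HK (sqr_ge0 d) L1.
have E : near_layer d = fun x => d ^+ 2 * (above 0 (fun x => x ^+ 2) (d^-1 * x) * (d^-1 * x <= 1)%R%:R).
  apply/funext => x; rewrite /near_layer /above pmulr_rgt0// ler_pdivrMl// mulr1 exprMn.
  by field; rewrite gt_eqF.
rewrite E; split => //; rewrite E2 E1 powR_invl// powR_add// powR2 ?(ltW d0)//.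
by rewrite /near_layer; ring.
Qed.

(** The explicit computation removes a slab, the operator a ball. With [d = (n + 1) r] the slab
    contains the ball, and the part in between contributes at most a multiple of the integral of
    [near_layer d], of order [d^(2 - 2 s)]. *)
Lemma halfspace_power_trunc (x : V) : edot x nu = 1 -> exists2 C : R, 0 <= C &
  forall r, 0 < r -> n.+1%:R * r <= 2^-1 ->
    `|trunc_op k r (halfspace_power s nu) x| <= C * (n.+1%:R * r) `^ (2 - 2 * s).
Proof.
move=> x1; exists (4 * K0 k nu + 2 * psi k nu (near_layer 1)).
  have := K0_ge0 nu HK; have := psi_ge0 nu HK (_ : forall x, 0 <= near_layer 1 x).
  move=> /(_ _); set P := psi _ _ _ => HP HK0; apply: addr_ge0; apply: mulr_ge0 => //; apply: HP => z.
  by rewrite mulr_ge0//; apply: above_ge0 => // *; exact: sqr_ge0.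
move=> r r0; set d := n.+1%:R * r => d2; have d0 : 0 < d by rewrite mulr_gt0.
have rd y : enorm y <= r -> `|edot y nu| <= d.
  move=> yr; apply: le_trans (edot_bound nu1 y) _; rewrite ler_wpM2l//.
  exact: le_trans (norm_le_enorm y) yr.
have Ld := layer_drop HK hk sgam nu1 d0; have Lr := layer_rise HK hk sgam nu1 d0.
have [Ln En] := psi_near_layer d0.
have dz g (z : R) : z <= d -> above d g z = 0 by move=> zd; rewrite /above ltNge zd mul0r.
have dz0 g (z : R) : z <= 0 -> above d g z = 0 by move=> zd; apply: dz; apply: le_trans zd (ltW d0).
have nz (z : R) : z <= 0 -> near_layer d z = 0 by move=> z0; rewrite /near_layer /above ltNge z0 !mul0r.
have Id := outer_integrable r Ld (dz0 _); have Ir := outer_integrable r Lr (dz0 _).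
have In := outer_integrable r Ln nz.
have Od := outer_eq Ld (ltW d0) (dz _) rd; have Or := outer_eq Lr (ltW d0) (dz _) rd.
have On := outer_le r Ln nz; rewrite En in On.
have mo : measurable (@outside R n r) by exact: measurable_outside.
have aq := adm_halfspace_power.
have IH := second_diff_integrable HK x r0 aq.
have CD := cut_difference HK hk sgam nu1 d0 d2.
rewrite (trunc_op_sym HK x r0 aq).
set J := \int[mu]_(y in outside r) _.
have IB := integrableB mo Id Ir.
have JL : outer r (above d (drop_profile s)) - outer r (above d (rise_profile s)) <= J.
  rewrite /outer -RintegralB//; apply: le_Rintegral => // y _.
  rewrite halfspace_power_gap// -mulrBl ler_wpM2r ?(kernel_nneg HK)//.
  rewrite /above; case: ltP => td; first by rewrite !mul1r.
  rewrite !mul0r subr0; exact: (profile_gap (normr_ge0 _) (le_trans td d2)).1.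
have JU : J <= (outer r (above d (drop_profile s)) - outer r (above d (rise_profile s))) + 2 * outer r (near_layer d).
  rewrite /outer -RintegralB// -RintegralZl// -RintegralD//; last first.
    exact: (integrableZl mo 2 In).
  apply: le_Rintegral => //.
    exact: (integrableD mo IB (integrableZl mo 2 In)).
  move=> y _.
  rewrite halfspace_power_gap// -mulrBl mulrA -mulrDl ler_wpM2r ?(kernel_nneg HK)//.
  rewrite /near_layer /above; have [td|td] := leP `|edot y nu| d; last first.
    by rewrite !mul1r !mulr0 addr0.
  rewrite mulr1 !mul0r subr0 add0r; have [h1 h2] := profile_gap (normr_ge0 _) (le_trans td d2).
  apply: (le_trans h2); have [->|tn] := eqVneq `|edot y nu| 0; first by rewrite expr0n/= !mulr0.
  by rewrite lt_def tn normr_ge0 mul1r.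
rewrite {}Od {}Or in JL JU.
move: CD JL JU On; rewrite !ler_norml mulrDl.
rewrite /psi_above; move: (psi k nu (above d (drop_profile s))) (psi k nu (above d (rise_profile s))) => a b.
move: (d `^ _) (outer _ _) (K0 _ _) (psi _ _ _) => D o K P.
by move=> /andP[h1 h2] h3 h4 h5; apply/andP; split; lra.
Qed.

(** Homogeneity of the function and of the kernel moves [x] to the level [x . nu = 1], where the
    truncated integrals tend to 0. *)
Lemma halfspace_power_harmonic (x : V) : 0 < edot x nu ->
  Lle k (halfspace_power s nu) x 0 /\ Lge k (halfspace_power s nu) x 0.
Proof.
move=> xp; have aq := adm_halfspace_power.
pose c := (edot x nu)^-1; have c0 : 0 < c by rewrite invr_gt0.
have x1 : edot (c *: x) nu = 1 by rewrite edotZl mulVf// gt_eqF.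
have [C C0 HC] := halfspace_power_trunc x1.
have base (e : R) : 0 < e -> exists2 r0 : R, 0 < r0 & forall r, 0 < r -> r < r0 ->
    `|trunc_op k r (halfspace_power s nu) (c *: x)| <= e.
  move=> e0; have ss : 0 < 2 - 2 * s by have := s1; lra.
  have [q [q1 q2] Hq] := powR_decay 2 C0 e0 ss; have q0 : 0 < q by apply: lt_le_trans q2.
  exists (q^-1 / n.+1%:R); first by rewrite divr_gt0// invr_gt0.
  move=> r r0; rewrite ltr_pdivlMr// mulrC => rq.
  have qi : q^-1 <= 2^-1 by rewrite lef_pV2 ?posrE.
  apply: le_trans (HC r r0 (ltW (lt_le_trans rq qi))) _; apply: le_trans (ltW Hq).
  rewrite ler_wpM2l// -powR_invl//; apply: powR_le; rewrite ?(ltW ss) ?(ltW rq)//.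
  by rewrite mulr_ge0// ltW.
have B1 : Lle k (halfspace_power s nu) (c *: x) 0.
  move=> e e0; have [r0 r00 H] := base e e0; exists r0 => // r rp rr; rewrite add0r.
  exact: le_trans (ler_norm _) (H r rp rr).
have B2 : Lle k (fun z => - halfspace_power s nu z) (c *: x) 0.
  move=> e e0; have [r0 r00 H] := base e e0; exists r0 => // r rp rr; rewrite add0r.
  have := trunc_opZ HK (-1) (c *: x) rp aq.
  rewrite mulN1r; under eq_fun do rewrite mulN1r; move=> ->.
  by rewrite lerNl; have := H r rp rr; rewrite ler_norml => /andP[].
have E (z : V) : halfspace_power s nu (c *: z) = c `^ s * halfspace_power s nu z.
  rewrite /halfspace_power edotZl /posp -powRM ?(ltW c0)//; last by rewrite le_max lexx orbT.
  by rewrite maxr_pMr ?(ltW c0)// mulr0.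
have ci : 0 <= c `^ (- s) by exact: powR_ge0.
have cc (z : R) : c `^ (- s) * (c `^ s * z) = z.
  by rewrite mulrA -powR_add// addrC subrr powRr0 mul1r.
split.
  have := Lle0_scale HK c0 aq B1; rewrite (hk c0); under eq_fun do rewrite E.
  move=> B; have := Lle_scale HK ci (adm_scale (c `^ s) aq) B.
  by rewrite mulr0; under eq_fun do rewrite cc.
have := Lle0_scale HK c0 (adm_opp aq) B2; rewrite (hk c0); under eq_fun do rewrite E -mulrN.
move=> B; have := Lle_scale HK ci (adm_scale (c `^ s) (adm_opp aq)) B.
by rewrite mulr0; under eq_fun do rewrite cc; rewrite /Lge oppr0.
Qed.

End HalfspacePower.

(** * Classification of the profile *)

Section OneDimensional.
Context {R : realType}.
Implicit Types (phi : R -> R).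

(** [powR_tangent] with the exponent [1 / (1 + s)], at the points [x^(1 + s)] and [y^(1 + s)]. *)
Lemma powR_convex_tangent (s x y : R) : 0 < s -> 0 <= x -> 0 < y ->
  y `^ (1 + s) + (1 + s) * y `^ s * (x - y) <= x `^ (1 + s).
Proof.
move=> s0 x0 y0; have s1 : 0 < 1 + s by rewrite addr_gt0.
have q0 : 0 < (1 + s)^-1 by rewrite invr_gt0.
have q1 : (1 + s)^-1 < 1 by rewrite invf_lt1// ltrDl.
have yp : 0 < y `^ (1 + s) by rewrite powR_gt0.
have := powR_tangent q0 q1 (powR_ge0 x (1 + s)) yp.
rewrite -!powRrM divff ?gt_eqF// !powRr1 ?(ltW y0)//.
have -> : (1 + s) * ((1 + s)^-1 - 1) = - s by field; rewrite gt_eqF.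
rewrite powRN => H.
have ys : 0 < y `^ s by rewrite powR_gt0.
have Y : y `^ (1 + s) = y * y `^ s by rewrite powR_add// powRr1// ltW.
have c0 : 0 < (1 + s) * y `^ s by rewrite mulr_gt0.
have := ler_wpM2l (ltW c0) H; rewrite mulrDr.
have -> : (1 + s) * y `^ s * ((1 + s)^-1 / y `^ s * (x `^ (1 + s) - y `^ (1 + s))) = x `^ (1 + s) - y `^ (1 + s).
  by field; rewrite !gt_eqF.
by rewrite mulrBr; clear; lra.
Qed.

Lemma power_profile (s K : R) phi : 0 < s -> s < 1 -> 0 <= K -> phi 0 = 0 ->
  (forall t h, 0 < t -> 0 < h -> K * h * t `^ s <= phi (t + h) - phi t) ->
  (forall t h, 0 < t -> 0 < h -> phi t - phi (t - h) <= K * h * t `^ s) ->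
  (forall t, 0 < t -> 0 <= phi t) ->
  forall t, 0 < t -> phi t = K / (1 + s) * t `^ (1 + s).
Proof.
move=> s0 s1 K0 phi0 lo hi pge.
have s1p : 0 < 1 + s by rewrite addr_gt0.
pose G t := K / (1 + s) * t `^ (1 + s).
have GE (t h : R) : 0 < t -> 0 < h -> K * h * t `^ s <= G (t + h) - G t /\ G (t + h) - G t <= K * h * (t + h) `^ s.
  move=> t0 h0; have th : 0 < t + h by rewrite addr_gt0.
  have h1 := powR_convex_tangent s0 (ltW th) t0; have h2 := powR_convex_tangent s0 (ltW t0) th.
  have Kp : 0 <= K / (1 + s) by rewrite divr_ge0// ltW.
  rewrite /G -mulrBr; split.
    have -> : K * h * t `^ s = K / (1 + s) * ((1 + s) * t `^ s * (t + h - t)) by field; rewrite gt_eqF.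
    by rewrite ler_wpM2l//; move: h1; clear; lra.
  have -> : K * h * (t + h) `^ s = K / (1 + s) * (- ((1 + s) * (t + h) `^ s * (t - (t + h)))) by field; rewrite gt_eqF.
  by rewrite ler_wpM2l//; move: h2; clear; lra.
pose f t := phi t - G t.
have fconst a b : 0 < a -> a <= b -> f a = f b.
  move=> a0 ab; pose C := K * (s * a `^ (s - 1)).
  have C0 : 0 <= C by rewrite !mulr_ge0 ?powR_ge0// ltW.
  apply: (quadratic_increments_const ab C0) => x y ax xy yb.
  have x0 : 0 < x by apply: lt_le_trans ax.
  have [->|nxy] := eqVneq x y; first by rewrite !subrr normr0 expr0n/= mulr0.
  have h0 : 0 < y - x by rewrite subr_gt0 lt_def eq_sym nxy.
  have y0 : 0 < y by apply: lt_le_trans xy.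
  have [g1 g2] := GE x (y - x) x0 h0; have p1 := lo x (y - x) x0 h0; have p2 := hi y (y - x) y0 h0.
  have E1 : x + (y - x) = y by ring.
  have E2 : y - (y - x) = x by ring.
  rewrite E1 in g1 g2 p1; rewrite E2 in p2.
  have lip := powR_lip_ge s0 s1 a0 ax xy.
  have := ler_wpM2l (mulr_ge0 K0 (ltW h0)) lip.
  rewrite mulrBr; have -> : K * (y - x) * (s * a `^ (s - 1) * (y - x)) = C * (y - x) ^+ 2 by rewrite /C; ring.
  rewrite /f ler_norml; move: g1 g2 p1 p2; clear => g1 g2 p1 p2 p3; apply/andP; split; lra.
have fsmall a : 0 < a -> `|f a| <= 2 * K * a * a `^ s.
  move=> a0; have := hi a a a0 a0; rewrite subrr phi0 subr0 => h1.
  have h2 := pge a a0.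
  have G0 : 0 <= G a by rewrite mulr_ge0 ?powR_ge0// divr_ge0// ltW.
  have G1 : G a <= K * a * a `^ s.
    rewrite /G powR_add// powRr1 ?(ltW a0)// [leLHS](_ : _ = K * a * a `^ s / (1 + s)); last by ring.
    rewrite ler_pdivrMr// ler_peMr ?mulr_ge0 ?powR_ge0 ?(ltW a0)//.
    by rewrite lerDl ltW.
  by rewrite /f ler_norml; move: h1 h2 G0 G1; clear => *; apply/andP; split; lra.
move=> t t0; apply/eqP; rewrite -subr_eq0 -/(G t) -/(f t) -[_ == 0]normr_eq0; apply: contraT => nz.
have p : 0 < `|f t| by rewrite lt_def nz normr_ge0.
have D0 : 0 <= 2 * K * 1 by rewrite !mulr_ge0.
have [r [r1 r2] Hr] := powR_decay t^-1 D0 p s0.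
have r0 : 0 < r by apply: lt_le_trans r2.
have ri : 0 < r^-1 by rewrite invr_gt0.
have rt : r^-1 <= t by rewrite -[leRHS]invrK lef_pV2 ?posrE// invr_gt0.
have := fsmall _ ri; rewrite (fconst _ _ ri rt) leNgt => /negP; case.
apply: le_lt_trans Hr; rewrite powR_invl// ler_wpM2r ?powR_ge0// ler_wpM2l ?mulr_ge0//.
by rewrite invf_le1.
Qed.

(* Slopes of a convex function are monotone in the step, so an improvement of the lower constant
   passes to larger steps and one of the upper constant to smaller steps; as one of the two occurs
   at every scale, the best constants must agree. *)
Lemma slope_dichotomy (s K1 R0 N : R) phi : 0 < s -> 0 <= K1 -> 0 < N ->
  (forall t h h', 0 < h' -> h' <= h -> h * (phi (t + h') - phi t) <= h' * (phi (t + h) - phi t)) ->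
  (forall t h h', 0 < h' -> h' <= h -> h' * (phi t - phi (t - h)) <= h * (phi t - phi (t - h'))) ->
  (forall t h, 0 <= h -> phi t <= phi (t + h)) ->
  (forall t h, 0 < t -> 0 < h -> phi t - phi (t - h) <= K1 * h * t `^ s) ->
  (exists2 E : R, 0 < E & forall m M : R, 0 <= m -> m < M ->
    (forall t h, 0 < t -> 0 < h -> m * h * t `^ s <= phi (t + h) - phi t) ->
    (forall t h, 0 < t -> 0 < h -> phi t - phi (t - h) <= M * h * t `^ s) ->
    forall h r, 0 < h -> R0 <= r -> 3 * h <= r ->
    (forall t, 0 < t -> t <= r / N -> (m + E * (M - m)) * h * t `^ s <= phi (t + h) - phi t) \/
    (forall t, 0 < t -> t <= r / N -> phi t - phi (t - h) <= (M - E * (M - m)) * h * t `^ s)) ->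
  exists K : R, [/\ 0 <= K,
    (forall t h, 0 < t -> 0 < h -> K * h * t `^ s <= phi (t + h) - phi t) &
    (forall t h, 0 < t -> 0 < h -> phi t - phi (t - h) <= K * h * t `^ s)].
Proof.
move=> s0 K10 N0 S1 S2 mono up [E E0 gain].
pose A (c : R) := forall t h, 0 < t -> 0 < h -> c * h * t `^ s <= phi (t + h) - phi t.
pose B (c : R) := forall t h, 0 < t -> 0 < h -> phi t - phi (t - h) <= c * h * t `^ s.
have pw (h t : R) : 0 < h -> 0 < t -> 0 < h * t `^ s by move=> h0 t0; rewrite mulr_gt0// powR_gt0.
pose SA := [set c | 0 <= c /\ A c]; pose SB := [set c | B c].
have A0 : SA 0 by split => // t h t0 h0; rewrite !mul0r subr_ge0 mono// ltW.
have ubA : ubound SA (phi (1 + 1) - phi 1).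
  by move=> c [_ /(_ 1 1 ltr01 ltr01)]; rewrite powR_one !mulr1.
have hA : has_sup SA by split; [exists 0|exists (phi (1 + 1) - phi 1)].
have lbB : lbound SB 0.
  move=> c /(_ 1 1 ltr01 ltr01); rewrite powR_one !mulr1; apply: le_trans.
  by rewrite subr_ge0 -[X in _ <= phi X](subrK 1 1) mono.
have hB : has_inf SB by split; [exists K1|exists 0].
pose m := sup SA; pose M := inf SB.
have m0 : 0 <= m by exact: (ub_le_sup (proj2 hA) A0).
have Am : A m.
  move=> t h t0 h0; rewrite -mulrA -ler_pdivlMr ?pw//; apply: (ge_sup (proj1 hA)) => c [_ Ac].
  by rewrite ler_pdivlMr ?pw// mulrA; exact: Ac.
have BM : B M.
  move=> t h t0 h0; rewrite -mulrA -ler_pdivrMr ?pw//; apply: (lb_le_inf (proj1 hB)) => c Bc.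
  by rewrite ler_pdivrMr ?pw// mulrA; exact: Bc.
have Mm : M <= m.
  rewrite leNgt; apply/negP => mM; have G := gain m M m0 mM Am BM.
  have EM : 0 < E * (M - m) by rewrite mulr_gt0// subr_gt0.
  pose A' h r := forall t, 0 < t -> t <= r / N -> (m + E * (M - m)) * h * t `^ s <= phi (t + h) - phi t.
  have A'mono h h' r r' : 0 < h' -> h' <= h -> r <= r' -> A' h' r' -> A' h r.
    move=> h'0 hh rr H t t0 tr; have h0 : 0 < h by apply: lt_le_trans hh.
    have tr' : t <= r' / N by apply: le_trans tr _; rewrite ler_pM2r ?invr_gt0.
    rewrite -(ler_pM2l h'0); apply: le_trans (S1 t h h' h'0 hh).
    have := ler_wpM2l (ltW h0) (H t t0 tr'); apply: le_trans.
    by rewrite le_eqVlt; apply/orP; left; apply/eqP; ring.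
  have [allA|] := pselect (forall h r, 0 < h -> A' h r).
    have : SA (m + E * (M - m)).
      split; first by rewrite addr_ge0// ltW.
      by move=> t h t0 h0; apply: (allA h (t * N) h0) => //; rewrite mulfK// gt_eqF.
    move=> /(ub_le_sup (proj2 hA)); rewrite -/m leNgt => /negP; apply.
    by rewrite ltrDl.
  move=> nA; have [h0 [r0 [hp nA0]]] : exists h r, 0 < h /\ ~ A' h r.
    apply: contrapT => H; apply: nA => h r hp; apply: contrapT => H'; apply: H; by exists h, r.
  have : SB (M - E * (M - m)).
    (* [h1] is below both the given step [h] and a step [h0] at which the improved lower bound
       fails. At [h1] and a large scale the first alternative would pass on to [h0]; so the second
       one holds, and it passes on to [h]. *)
    move=> t h t0 hp'; pose h1 := Num.min h h0; have h10 : 0 < h1 by rewrite lt_min hp'.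
    have h1h : h1 <= h by rewrite ge_min lexx.
    have h1h0 : h1 <= h0 by rewrite ge_min lexx orbT.
    pose r := Num.max (Num.max R0 (3 * h1)) (Num.max r0 (t * N)).
    have r01 : R0 <= r by rewrite !le_max lexx.
    have r02 : 3 * h1 <= r by rewrite !le_max lexx !orbT.
    have [HA|HB'] := G h1 r h10 r01 r02.
      exfalso; apply: nA0; apply: (A'mono _ h1 _ r) => //; by rewrite !le_max lexx !orbT.
    have tr : t <= r / N by rewrite ler_pdivlMr// !le_max lexx !orbT.
    have HB := HB' t t0 tr; rewrite -(ler_pM2l h10); apply: (le_trans (S2 t h h1 h10 h1h)).
    have := ler_wpM2l (ltW hp') HB; move/le_trans; apply.
    by rewrite le_eqVlt; apply/orP; left; apply/eqP; ring.
  move=> /(ge_inf (proj2 hB)); rewrite -/M leNgt => /negP; apply.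
  by rewrite gtrBl.
exists m; split => // t h t0 h0; apply: le_trans (BM t h t0 h0) _.
by rewrite -!mulrA ler_wpM2r// ltW// pw.
Qed.

End OneDimensional.

(** * Comparison with the half-space power at all scales *)

Section Classification.
Context {R : realType} {n : nat}.
Local Notation V := 'rV[R]_n.
Implicit Types (x y z : V).

Variables (s gam l m sig Q : R) (k u : V -> R) (nu : V).
Hypotheses (H : incr_solution s gam l m sig Q k u) (sig1 : sig < 1) (sgam : s < gam)
  (hk : forall c, 0 < c -> scaled_kernel s c k = k) (u0 : u 0 = 0)
  (nu1 : edot nu nu = 1) (Gnu : mono_dir u nu) (prof : forall x, u x = u (edot x nu *: nu))
  (upos : forall t : R, 0 < t -> 0 < u (t *: nu)).
Local Notation q := (@halfspace_power R n s nu).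
Local Notation N := (n.+1%:R : R).

Lemma profile_pos x : 0 < u x -> 0 < edot x nu.
Proof.
move=> ux; rewrite ltNge; apply/negP => t0.
have t0' : 0 <= - edot x nu by rewrite oppr_ge0.
have := Gnu (edot x nu *: nu) t0'; rewrite -prof scaleNr subrr u0.
by rewrite leNgt ux.
Qed.

Lemma profile_zero x : u x = 0 -> edot x nu <= 0.
Proof.
move=> ux; rewrite leNgt; apply/negP => t0.
by have := upos t0; rewrite -prof ux ltxx.
Qed.

Lemma halfspace_cone y : 0 <= edot y nu -> mono_dir u y.
Proof.
move=> y0 x t t0; rewrite prof [leRHS]prof edotDl edotZl scalerDl.
by apply: Gnu; rewrite mulr_ge0.
Qed.

Lemma halfspace_power_zero x : u x = 0 -> q x = 0.
Proof.
by move=> /profile_zero x0; rewrite /halfspace_power posp_neg// (ks_s0 (is_setting H)).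
Qed.

Lemma halfspace_power_ge0 x : 0 <= q x.
Proof. exact: posp_ge0. Qed.

Lemma dilated_tail_power (r : R) : 0 < r -> dilated_tail s r q = r `^ s * fine (tailI s 0 q).
Proof.
move=> r0; have HK := is_setting H; have aq := adm_halfspace_power HK sgam nu1.
rewrite /dilated_tail /tailI.
have E z : q (r *: z) = r `^ s * q z.
  rewrite /halfspace_power edotZl /posp -powRM ?(ltW r0)//; last by rewrite le_max lexx orbT.
  by rewrite maxr_pMr ?(ltW r0)// mulr0.
under eq_integral do rewrite E -mulrA EFinM.
have F : tailI s 0 q \is a fin_num by apply: (tailI_fin HK 0 aq) => y; exact: halfspace_power_ge0.
rewrite ge0_integralZl//.
- by rewrite fineM.
- exact: (measurable_tailw s 0 (adm_measurable aq)).
- by move=> y _; rewrite lee_fin mulr_ge0 ?powR_ge0// halfspace_power_ge0.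
- by rewrite lee_fin powR_ge0.
Qed.

(** The half-space lies in the cone, so the interior box of [dilated_harnack] can be the one around
    [nu / 2] of radius [1 / (2 (n + 1))]. *)
Lemma halfspace_harnack : exists2 C : R, 0 < C & forall f b, continuous f -> growth_adm gam f -> (forall x, 0 <= f x) ->
    continuous b -> growth_adm gam b -> (forall x, 0 <= b x) ->
    (forall x, 0 < u x -> Lge k f x 0) -> (forall x, 0 < u x -> Lle k b x 0) ->
    (forall x, u x = 0 -> b x = 0) ->
    forall r, 2 * `|nu| + 1 <= r -> forall x, `|x| <= r ->
      b x * dilated_tail s r f <= C * dilated_tail s r b * f x.
Proof.
have nuN : `|nu| <= 1 by apply: le_trans (norm_le_enorm _) _; rewrite /enorm nu1 sqrtr1.
have N0 : 0 < N by [].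
have N1 : 1 <= N by rewrite ler1n.
apply: (@dilated_harnack R n s gam l m sig Q k u H hk (2^-1 *: nu) ((2 * N)^-1) nu).
- by rewrite -[nu]scale1r; exact: upos.
- by rewrite invr_gt0 mulr_gt0.
- by rewrite invf_le1 ?mulr_gt0// (le_trans N1)// ler_peMl ?(ltW N0)// ler1n.
- by rewrite normrZ ger0_norm ?invr_ge0// ler_piMr ?invr_ge0.
move=> y yd; apply: halfspace_cone.
have := edot_bound nu1 (y - 2^-1 *: nu); rewrite edotDl edotNl edotZl nu1 mulr1.
have : N * `|y - 2^-1 *: nu| <= 2^-1.
  apply: (@le_trans _ _ (N * (2 * N)^-1)); first by rewrite ler_wpM2l// ltW.
  by rewrite invfM mulrCA divff ?mulr1// gt_eqF.
by move=> h1 h2; have := le_trans h2 h1; rewrite ler_norml; lra.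
Qed.

(** A large value at [r nu] forces a large tail by [sup_bound], as [F] is a subsolution deep inside;
    the boundary Harnack inequality with [q] as the subsolution then bounds [F] below by a multiple
    of [q] up to the boundary. *)
Lemma positivity_gain : exists2 E : R, 0 < E & forall F (r : R),
  continuous F -> growth_adm gam F -> (forall x, 0 <= F x) ->
  (forall x, 0 < u x -> Lge k F x 0) -> 2 * N * (2 * `|nu| + 1) <= r ->
  (forall x, r / 2 <= edot x nu -> Lle k F x 0) ->
  forall x, `|x| <= r / (2 * N) -> F (r *: nu) * q x <= E * r `^ s * F x.
Proof.
have HK := is_setting H; have aq := adm_halfspace_power HK sgam nu1.
have [C1 C10 HC1] := @sup_bound R n s gam l m (ks_s0 HK) (ks_s1 HK) (ks_gam0 HK)
  (ks_gam2 HK) (ks_l0 HK) (ks_m0 HK).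
have [C2 C20 HC2] := halfspace_harnack.
have cq := @cont_halfspace_power R n s gam l m k nu HK.
have N0 : 0 < N by [].
have N1 : 1 <= N by rewrite ler1n.
have N20 : 0 < 2 * N by rewrite mulr_gt0.
pose T1 := fine (tailI s 0 q).
have T10 : 0 <= T1 by rewrite fine_ge0// tailI_ge0// => y; exact: halfspace_power_ge0.
pose D := (1 + 2 * N) `^ (n%:R + 2 * s).
have D0 : 0 <= D by exact: powR_ge0.
exists (C1 * D * C2 * T1 + 1); first by rewrite ltr_wpDl// !mulr_ge0 ?(ltW C10) ?(ltW C20).
move=> F r cF aF F0 LF rbig LF2 x xr.
have nup : 1 <= 2 * `|nu| + 1 by rewrite lerDr mulr_ge0.
(* At scale [d] the point [r nu] becomes [2 (n + 1) nu]. Its unit box lies in [y . nu >= n + 1],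
   which is the height [r / 2] after scaling back. *)
pose d := r / (2 * N).
have dbig : 2 * `|nu| + 1 <= d by rewrite ler_pdivlMr// mulrC.
have d1 : 1 <= d by apply: le_trans dbig.
have d0 : 0 < d by apply: lt_le_trans d1.
have r0 : 0 < r by apply: lt_le_trans rbig; rewrite mulr_gt0// (lt_le_trans ltr01).
have rE : d *: ((2 * N) *: nu) = r *: nu by rewrite scalerA divfK// gt_eqF.
have B : F (r *: nu) <= C1 * (D * dilated_tail s d F).
  have := HC1 k HK _ ((2 * N) *: nu) (cont_dilate cF) (adm_dilate (ltW (ks_gam0 HK)) d1 aF) (fun=> F0 _).
  rewrite rE => B0; have {}B0 : F (r *: nu) <= C1 * fine (tailI s ((2 * N) *: nu) (fun z => F (d *: z))).
    apply: B0 => z zc _; apply: (Lle_dilate H hk d0 aF); apply: LF2.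
    have := edot_bound nu1 (z - (2 * N) *: nu); rewrite edotDl edotNl !edotZl nu1 mulr1.
    have : N * `|z - (2 * N) *: nu| <= N by rewrite ler_piMr ?(ltW N0)// ltW.
    move=> h1 h2; have := le_trans h2 h1; rewrite ler_norml => /andP[h3 _].
    have -> : r / 2 = d * N by rewrite /d; field.
    by rewrite ler_pM2l//; lra.
  apply: (le_trans B0); apply: ler_wpM2l; first exact: ltW.
  apply: (tailI_recenter_fine HK (adm_dilate (ltW (ks_gam0 HK)) d1 aF) (fun=> F0 _)).
  rewrite subr0 normrZ (gtr0_norm N20) ler_piMr ?(ltW N20)//.
  by apply: le_trans (norm_le_enorm _) _; rewrite /enorm nu1 sqrtr1.
have BH := HC2 F q cF aF F0 cq aq halfspace_power_ge0 LF
  (fun x ux => (halfspace_power_harmonic HK hk sgam nu1 (profile_pos ux)).1) halfspace_power_zero d dbig x xr.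
rewrite dilated_tail_power// -/T1 in BH.
have ds : d `^ s <= r `^ s.
  apply: powR_le; rewrite ?(ltW (ks_s0 HK)) ?(ltW d0)// ler_pdivrMr// ler_peMr ?(ltW r0)//.
  by rewrite (le_trans N1)// ler_peMl ?(ltW N0)// ler1n.
have q0 := halfspace_power_ge0 x; have Fx := F0 x.
have rs0 : 0 <= r `^ s by exact: powR_ge0.
have CD : 0 <= C1 * D by exact: mulr_ge0 (ltW C10) D0.
apply: (@le_trans _ _ (C1 * D * (q x * dilated_tail s d F))).
  have := ler_wpM2r q0 B; move/le_trans; apply; rewrite le_eqVlt; apply/orP; left; apply/eqP; ring.
apply: (@le_trans _ _ (C1 * D * (C2 * (r `^ s * T1) * F x))).
  apply: ler_wpM2l => //; apply: (le_trans BH); apply: ler_wpM2r => //; apply: ler_wpM2l; first exact: ltW.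
  exact: ler_wpM2r.
have := mulr_ge0 rs0 Fx; set e1 := r `^ s; move=> e2.
rewrite [leRHS](_ : _ = C1 * D * (C2 * (e1 * T1) * F x) + e1 * F x); last by ring.
by rewrite lerDl.
Qed.

(** [q] is used once as the supersolution above the backward increments at [t nu] and once as the
    subsolution below the forward increments at [nu]; the tails are chained as in
    [increments_comparable]. Steps larger than 1 follow from convexity. *)
Lemma profile_upper : exists2 C : R, 0 <= C & forall t h : R, 0 < t -> 0 < h ->
  u (t *: nu) - u ((t - h) *: nu) <= C * h * t `^ s.
Proof.
have HK := is_setting H; have aq := adm_halfspace_power HK sgam nu1.
have cu := is_cont H; have su x h : 0 <= sdiff u h x by apply: incr_sdiff_ge0 H.
have [C C0 HC] := halfspace_harnack.
have cq := @cont_halfspace_power R n s gam l m k nu HK.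
have Lq x (ux : 0 < u x) := halfspace_power_harmonic HK hk sgam nu1 (profile_pos ux).
pose f1 := u (nu + 1 *: nu) - u nu.
have f10 : 0 <= f1 by rewrite subr_ge0; exact: Gnu.
exists (C ^+ 2 * f1); first by rewrite mulr_ge0// sqr_ge0.
have qnu (t : R) : 0 < t -> q (t *: nu) = t `^ s.
  by move=> t0; rewrite /halfspace_power edotZl nu1 mulr1 posp_pos// ltW.
have small t h : 0 < t -> 0 < h -> h <= 1 -> u (t *: nu) - u (t *: nu - h *: nu) <= C ^+ 2 * f1 * h * t `^ s.
  move=> t0 h0 h1; have Gh := mono_dirZ (ltW h0) Gnu.
  pose r := Num.max (2 * `|nu| + 1) `|t *: nu|.
  have r1 : 2 * `|nu| + 1 <= r by rewrite le_max lexx.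
  have r2 : `|t *: nu| <= r by rewrite le_max lexx orbT.
  have r3 : `|nu| <= r by apply: le_trans r1; have := normr_ge0 nu; lra.
  have r4 : 1 <= r by apply: le_trans r1; rewrite lerDr mulr_ge0.
  have B1 := HC _ _ cq aq halfspace_power_ge0 (@cont_bwd _ _ _ _ _ _ _ _ _ _ H (h *: nu)) (adm_bwd H _) (bwd_ge0 Gh)
    (fun x ux => (Lq x ux).2) (@bwd_Lle _ _ _ _ _ _ _ _ _ _ H _) (bwd_zero H Gh) r r1 _ r2.
  have B2 := HC _ _ (@cont_fwd _ _ _ _ _ _ _ _ _ _ H (h *: nu)) (adm_incr _ H) (fwd_ge0 Gh) cq aq halfspace_power_ge0
    (@fwd_Lge _ _ _ _ _ _ _ _ _ _ H _) (fun x ux => (Lq x ux).1) halfspace_power_zero r r1 _ r3.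
  have T := dilated_tail_le H r4 (adm_bwd H (h *: nu)) (adm_incr (h *: nu) H) (bwd_ge0 Gh) (bwd_le_fwd H sig1 (h *: nu)).
  have n1 : 0 < u (1 *: nu) by exact: upos.
  have q1 : q nu = 1 by rewrite -[X in q X]scale1r qnu// powR_one.
  have Tq : 0 < dilated_tail s r q.
    apply: (@dilated_tail_gt0 _ _ _ _ _ _ _ _ _ _ H hk _ nu) => //.
    - exact: halfspace_power_ge0.
    - by move=> y uy; exact: (Lq y uy).1.
    - exact: halfspace_power_zero.
    - by rewrite q1.
  have fh : u (nu + h *: nu) - u nu <= h * f1.
    by have := convex_slope cu su nu nu h0 h1; rewrite mul1r.
  rewrite q1 mul1r in B2; rewrite qnu// in B1.
  have ts : 0 <= t `^ s by exact: powR_ge0.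
  rewrite -(ler_pM2r Tq); apply: (le_trans B1).
  move: B2 T Tq fh ts; move: (dilated_tail s r _) (dilated_tail s r _) (dilated_tail s r _) (t `^ s) (u (nu + _) - _) => b a c d e B2 T Tq fh ts.
  have Cc : 0 <= C * a by exact: mulr_ge0 (ltW C0) (ltW Tq).
  have : b <= C * a * (h * f1) by apply: (le_trans T); apply: (le_trans B2); exact: ler_wpM2l.
  move=> /(ler_wpM2l (ltW C0)) /(ler_wpM2r ts) /le_trans; apply.
  by rewrite le_eqVlt; apply/orP; left; apply/eqP; ring.
move=> t h t0 h0; rewrite scalerBl; pose h' := Num.min h 1.
have h'0 : 0 < h' by rewrite lt_min h0 ltr01.
have h'1 : h' <= 1 by rewrite ge_min lexx orbT.
have h'h : h' <= h by rewrite ge_min lexx.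
rewrite -(ler_pM2l h'0); apply: (le_trans (convex_backslope cu su _ _ h'0 h'h)).
have := ler_wpM2l (ltW h0) (small t h' t0 h'0 h'1); move/le_trans; apply.
by rewrite le_eqVlt; apply/orP; left; apply/eqP; ring.
Qed.

Lemma halfspace_classification : exists K : R, 0 <= K /\
  forall x, u x = K * Num.max (edot x nu) 0 `^ (1 + s).
Proof.
have HK := is_setting H; have aq := adm_halfspace_power HK sgam nu1.
have s0 := ks_s0 HK; have s1 := ks_s1 HK.
have cu := is_cont H; have su x h : 0 <= sdiff u h x by apply: incr_sdiff_ge0 H.
have cq := @cont_halfspace_power R n s gam l m k nu HK.
have N0 : 0 < 2 * N by rewrite mulr_gt0.
pose phi (t : R) := u (t *: nu).
have Lq x (ux : 0 < u x) := halfspace_power_harmonic HK hk sgam nu1 (profile_pos ux).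
have qE (x : V) : 0 < edot x nu -> q x = (edot x nu) `^ s.
  by move=> t0; rewrite /halfspace_power posp_pos// ltW.
have fwdE (x : V) (h : R) : u (x + h *: nu) - u x = phi (edot x nu + h) - phi (edot x nu).
  by rewrite prof [u x]prof edotDl edotZl nu1 mulr1.
have bwdE (x : V) (h : R) : u x - u (x - h *: nu) = phi (edot x nu) - phi (edot x nu - h).
  by rewrite [u (x - _)]prof [u x]prof edotDl edotNl edotZl nu1 mulr1.
have tnu (t : R) : edot (t *: nu) nu = t by rewrite edotZl nu1 mulr1.
have S1 t h h' : 0 < h' -> h' <= h -> h * (phi (t + h') - phi t) <= h' * (phi (t + h) - phi t).
  by move=> h0 hh; rewrite /phi !scalerDl; exact: convex_slope.
have S2 t h h' : 0 < h' -> h' <= h -> h' * (phi t - phi (t - h)) <= h * (phi t - phi (t - h')).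
  by move=> h0 hh; rewrite /phi !scalerBl; exact: convex_backslope.
have mono t h : 0 <= h -> phi t <= phi (t + h) by move=> h0; rewrite /phi scalerDl; exact: Gnu.
have phi_neg t : t <= 0 -> phi t = 0.
  move=> t0; apply/eqP; rewrite eq_le (is_ge0 H) andbT leNgt; apply/negP => /profile_pos.
  by rewrite tnu ltNge t0.
have [K1 K10 up] := profile_upper.
have [E E0 gain] := positivity_gain.
have nN : `|nu| <= 1 by apply: le_trans (norm_le_enorm _) _; rewrite /enorm nu1 sqrtr1.
have pos_u (x : V) : 0 < edot x nu -> 0 < u x by move=> x0; rewrite prof; exact: upos.
have [K [K0 lo hi]] : exists K : R, [/\ 0 <= K,
    (forall t h, 0 < t -> 0 < h -> K * h * t `^ s <= phi (t + h) - phi t) &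
    (forall t h, 0 < t -> 0 < h -> phi t - phi (t - h) <= K * h * t `^ s)].
  apply: (@slope_dichotomy R s K1 (2 * N * (2 * `|nu| + 1) + 1) (2 * N) phi s0 K10 N0 S1 S2 mono up).
  exists (2 * E)^-1; first by rewrite invr_gt0 mulr_gt0.
  move=> c M c0 cM lo hi h r h0 rbig hr.
  have M0 : 0 <= M by apply: le_trans (ltW cM).
  have r0 : 0 < r.
    apply: lt_le_trans rbig; rewrite ltr_wpDl// mulr_ge0 ?(ltW N0)// addr_ge0// mulr_ge0//.
  have rbig' : 2 * N * (2 * `|nu| + 1) <= r by apply: le_trans rbig; rewrite lerDl.
  (* The difference quotients are compared with the current constants. Both functions are
     nonnegative supersolutions in {u > 0}, and solutions from height [r / 2] on, where [3 * h <= r]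
     keeps the backward step inside. *)
  pose F1 x := h^-1 * (u (x + h *: nu) - u x) + (- c) * q x.
  pose F2 x := M * q x + h^-1 * - (u x - u (x - h *: nu)).
  have ih : 0 < h^-1 by rewrite invr_gt0.
  have cF1 : continuous F1.
    by apply: cont_add; apply: cont_mul; [exact: cont_cst|exact: (cont_fwd H)|exact: cont_cst|].
  have cF2 : continuous F2.
    apply: cont_add; apply: cont_mul; [exact: cont_cst| |exact: cont_cst|] => //.
    by apply: cont_opp; exact: (cont_bwd H).
  have aF1 : growth_adm gam F1 := adm_add (adm_scale _ (adm_incr _ H)) (adm_scale _ aq).
  have aF2 : growth_adm gam F2 := adm_add (adm_scale _ aq) (adm_scale _ (adm_opp (adm_bwd H _))).
  have F10 x : 0 <= F1 x.
    rewrite /F1; have [t0|t0] := ltP 0 (edot x nu).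
      rewrite fwdE qE// mulNr subr_ge0 ler_pdivlMl// mulrA [h * c]mulrC; exact: lo.
    rewrite /halfspace_power posp_neg// mulr0 addr0 mulr_ge0 ?(ltW ih)// subr_ge0; apply: Gnu; exact: ltW.
  have F20 x : 0 <= F2 x.
    rewrite /F2 mulrN subr_ge0; have [t0|t0] := ltP 0 (edot x nu).
      rewrite bwdE qE// ler_pdivrMl// mulrA [h * M]mulrC; exact: hi.
    by rewrite bwdE !phi_neg ?subrr ?mulr0 ?mulr_ge0 ?halfspace_power_ge0//; lra.
  have LF1 x : 0 < u x -> Lge k F1 x 0.
    move=> ux; have L1 := is_incr H (h *: nu) ux; rewrite /Lge oppr0 in L1 *.
    have := Lle_add HK (adm_scale h^-1 (adm_opp (adm_incr (h *: nu) H))) (adm_scale c aq)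
      (Lle_scale HK (ltW ih) (adm_opp (adm_incr (h *: nu) H)) L1) (Lle_scale HK c0 aq (Lq x ux).1).
    have EF z : h^-1 * - (u (z + h *: nu) - u z) + c * q z = - F1 z by rewrite /F1; ring.
    by rewrite !mulr0 addr0; under eq_fun do rewrite EF.
  have LF2 x : 0 < u x -> Lge k F2 x 0.
    move=> ux; have L1 := bwd_Lle H (h *: nu) ux; have L2 := (Lq x ux).2; rewrite /Lge oppr0 in L2 *.
    have := Lle_add HK (adm_scale M (adm_opp aq)) (adm_scale h^-1 (adm_bwd H (h *: nu)))
      (Lle_scale HK M0 (adm_opp aq) L2) (Lle_scale HK (ltW ih) (adm_bwd H (h *: nu)) L1).
    have EF z : M * - q z + h^-1 * (u z - u (z - h *: nu)) = - F2 z by rewrite /F2; ring.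
    by rewrite !mulr0 addr0; under eq_fun do rewrite EF.
  have UF1 x : r / 2 <= edot x nu -> Lle k F1 x 0.
    move=> xr; have x0 : 0 < edot x nu by apply: lt_le_trans xr; rewrite divr_gt0.
    have ux := pos_u x x0; have L2 := (Lq x ux).2; rewrite /Lge oppr0 in L2.
    have L1 : Lle k (fun z => u (z + h *: nu) - u z) x 0.
      by apply: (Lle_incr H); apply: pos_u; rewrite edotDl tnu addr_gt0.
    have := Lle_add HK (adm_scale h^-1 (adm_incr (h *: nu) H)) (adm_scale c (adm_opp aq))
      (Lle_scale HK (ltW ih) (adm_incr (h *: nu) H) L1) (Lle_scale HK c0 (adm_opp aq) L2).
    by rewrite !mulr0 addr0; under eq_fun do rewrite mulrN -mulNr; exact.
  have UF2 x : r / 2 <= edot x nu -> Lle k F2 x 0.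
    move=> xr; have x0 : 0 < edot x nu by apply: lt_le_trans xr; rewrite divr_gt0.
    have ux := pos_u x x0.
    have L1 : Lle k (fun z => - (u z - u (z - h *: nu))) x 0.
      under eq_fun do rewrite opprB; apply: (Lle_incr (h := - (h *: nu)) H); apply: pos_u.
      by rewrite edotDl edotNl tnu; lra.
    have := Lle_add HK (adm_scale M aq) (adm_scale h^-1 (adm_opp (adm_bwd H (h *: nu))))
      (Lle_scale HK M0 aq (Lq x ux).1) (Lle_scale HK (ltW ih) (adm_opp (adm_bwd H (h *: nu))) L1).
    by rewrite !mulr0 addr0.
  (* By convexity forward increments dominate backward ones, so the two functions add up to at least
     [(M - c) * r^s] at [r nu]. One of them is at least half of that, and [positivity_gain] improves
     the corresponding constant. *)
  have gap : (M - c) * r `^ s <= F1 (r *: nu) + F2 (r *: nu).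
    rewrite /F1 /F2 !qE tnu//; have := su (r *: nu) (h *: nu); rewrite /sdiff => sd.
    have := mulr_ge0 (ltW ih) sd; lra.
  have xt (t : R) : 0 < t -> t <= r / (2 * N) -> `|t *: nu| <= r / (2 * N).
    by move=> t0; apply: le_trans; rewrite normrZ gtr0_norm// ler_piMr// ltW.
  have rs : 0 < r `^ s by rewrite powR_gt0.
  have gainE (a f : R) : 0 <= a -> (M - c) * r `^ s / 2 * a <= E * r `^ s * f -> (2 * E)^-1 * (M - c) * a <= f.
    move=> a0 hh; rewrite -(ler_pM2l (mulr_gt0 E0 rs)); apply: le_trans hh.
    by rewrite le_eqVlt; apply/orP; left; apply/eqP; field; rewrite gt_eqF.
  have [big|big] := leP ((M - c) * r `^ s / 2) (F1 (r *: nu)).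
    left => t t0 tr; have G := gain F1 r cF1 aF1 F10 LF1 rbig' UF1 _ (xt t t0 tr).
    have ts : 0 <= t `^ s by exact: powR_ge0.
    rewrite qE tnu// in G; have := gainE _ _ ts (le_trans (ler_wpM2r ts big) G).
    rewrite /F1 fwdE qE tnu// mulNr => g; rewrite mulrAC [_ * h]mulrC -ler_pdivlMl//.
    by rewrite mulrDl; lra.
  have {}big : (M - c) * r `^ s / 2 <= F2 (r *: nu) by lra.
  right => t t0 tr; have G := gain F2 r cF2 aF2 F20 LF2 rbig' UF2 _ (xt t t0 tr).
  have ts : 0 <= t `^ s by exact: powR_ge0.
  rewrite qE tnu// in G; have := gainE _ _ ts (le_trans (ler_wpM2r ts big) G).
  rewrite /F2 bwdE qE tnu// mulrN => g; rewrite mulrAC [_ * h]mulrC -ler_pdivrMl//.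
  by rewrite mulrBl; lra.
have P := power_profile s0 s1 K0 (phi_neg 0 (lexx 0)) lo hi (fun t _ => is_ge0 H (t *: nu)).
have sp : 0 < 1 + s by rewrite addr_gt0.
exists (K / (1 + s)); split; first by rewrite divr_ge0// ltW.
move=> x; rewrite prof -/(phi _); have [t0|t0] := ltP 0 (edot x nu); first exact: P.
by rewrite phi_neg// powR0 ?mulr0// gt_eqF.
Qed.

End Classification.

Theorem theorem1p5 (R : realType) (n : nat) (n_gt0 : (0 < n)%N)
  (s : R) (s_gt0 : 0 < s) (s_lt1 : s < 1)
  (lam Lam : R) (lam_gt0 : 0 < lam) (lam_le_Lam : lam <= Lam)
  (K : 'rV[R]_n -> \bar R) (HK : kernel_class s lam Lam K)
  (alpha : R) (alpha_gt0 : 0 < alpha)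
  (alpha_lt_s : alpha < s) (alpha_lt_1s : alpha < 1 - s)
  (u0 : 'rV[R]_n -> R)
  (u0_lip : Ck_holder_loc 0 1 u0)
  (eps : R) (eps_gt0 : 0 < eps) (u0_holder : holder_loc (2 * s + eps) u0)
  (u0_ge0 : forall x, 0 <= u0 x)
  (c : R) (c_gt0 : 0 < c)
  (u0_growth : forall r : R, 1 <= r ->
    (Linfty_norm (eball r) (fun x => enorm (grad u0 x)) <=
       (c * r `^ (s + alpha))%:E)%E)
  (u0_incr : forall x h : 'rV[R]_n, 0 < u0 x -> h != 0 ->
    (0 <= nonlocal K (fun z => (u0 (z + h) - u0 z) / enorm h)%R x)%E) :
  convex_function (setT : set (convex_lmodType 'rV[R]_n)) u0 /\
  (homogeneous_kernel s K ->
   boundary [set x | 0 < u0 x] 0 ->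
   Ck [set x | 0 < u0 x] 1 u0 ->
   (forall e : 'rV[R]_n, enorm e = 1 ->
     viscosity_solution s K [set x | 0 < u0 x] (fun x => 'D_e u0 x)) ->
   exists (nu : 'rV[R]_n) (kappa : R),
     [/\ enorm nu = 1, 0 <= kappa &
         forall x, u0 x = kappa * Num.max (edot x nu) 0 `^ (1 + s)]).

Proof.
have [gam [l [Q [sgam H]]]] := incr_solution_of_hypotheses s_gt0 s_lt1 lam_gt0 lam_le_Lam HK alpha_gt0
  alpha_lt_s alpha_lt_1s u0_lip eps_gt0 u0_holder u0_ge0 c_gt0 u0_growth u0_incr.
have sig1 : s + alpha < 1 by move: alpha_lt_1s; rewrite ltrBrDl addrC.
have su x h : 0 <= sdiff u0 h x by apply: incr_sdiff_ge0 H.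
have cu := is_cont H.
split; first exact: midconvex_convex.
move=> hK [cl0 nint0] C1 _.
have oP : open [set x | 0 < u0 x] by exact: cont_open_lt.
have u00 : u0 0 = 0.
  apply/eqP; rewrite eq_le u0_ge0 andbT leNgt; apply/negP => u0p.
  by apply: nint0; move: oP => /interior_id ->.
have near0 (e : R) : 0 < e -> exists2 x, `|x| < e & 0 < u0 x.
  move=> e0; have [x [ux xe]] := cl0 _ (nbhsx_ballx 0 e e0).
  by exists x => //; move: xe; rewrite -ball_normE/= sub0r normrN.
have hk d : 0 < d -> scaled_kernel s d (real_kernel K) = real_kernel K.
  by move=> d0; apply: scaled_real_kernel => // y y0; rewrite (real_kernelE HK y0).
have [p _ up] := near0 1 ltr01.
have [nu [nu1 Gnu prof]] := halfspace_profile H sig1 hk u00 C1 up.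
(* Points with [u0 > 0] accumulate at 0, so some of them have height at most [t]; monotonicity in
   the direction [nu] then gives positivity at [t nu]. *)
have upos t : 0 < t -> 0 < u0 (t *: nu).
  move=> t0; have N0 : 0 < n.+1%:R :> R by [].
  have [x xt ux] := near0 (t / n.+1%:R) (divr_gt0 t0 N0).
  have xnu : edot x nu <= t.
    apply: le_trans (ler_norm _) _; apply: le_trans (edot_bound nu1 x) _.
    by rewrite mulrC -ler_pdivlMr// ltW.
  apply: (lt_le_trans ux); rewrite prof.
  have t' : 0 <= t - edot x nu by rewrite subr_ge0.
  by have := Gnu (edot x nu *: nu) _ t'; rewrite -scalerDl addrC subrK.
have [kappa [k0 kE]] := halfspace_classification H sig1 sgam hk u00 nu1 Gnu prof upos.
by exists nu, kappa; split => //; rewrite /enorm nu1 sqrtr1.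
Qed.
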